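(* Let $(\mathcal N,D_0)$ be an odd unbounded $p$-summable Breuer-Fredholm module (for $\mathbb C$) and let $\mathcal M_0=D_0+\mathcal N_{sa}$. Then for $D\in\mathcal M_0$ and $X\in T_D(\mathcal M_0)=\mathcal N_{sa}$, $$X\mapsto\frac1{\tilde C_{p/2}}\,\tau\big(X(1+D^2)^{-p/2}\big)$$ is an exact one-form on $\mathcal M_0$. Moreover, if $\{D_t\}_{t\in[a,b]}$ is a piecewise $C^1$ path in $\mathcal M_0$ with $D_a$ and $D_b$ unitarily equivalent, then $$sf(D_a,D_b)=\frac1{\tilde C_{p/2}}\int_a^b\tau\Big(\frac{d}{dt}(D_t)(1+D_t^2)^{-p/2}\Big)dt,$$ where $\tilde C_{p/2}=\int_{-\infty}^\infty(1+x^2)^{-p/2}dx$.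
   Context: $\mathcal N$ is a semifinite von Neumann algebra (with separable predual) with faithful normal semifinite trace $\tau$; $\mathcal N_{sa}$ is its self-adjoint part with the operator norm. A path $D_t=D_0+A_t$ in $\mathcal M_0$ is (piecewise) $C^1$ if $t\mapsto A_t\in\mathcal N_{sa}$ is (piecewise) $C^1$ in operator norm, and $\frac{d}{dt}(D_t)=A_t'$. That $(\mathcal N,D_0)$ is an odd unbounded $p$-summable Breuer-Fredholm module for $\mathbb C$ means: $D_0$ is an unbounded self-adjoint operator affiliated with $\mathcal N$ and $(1+D_0^2)^{-p/2}$ is trace-class, i.e. $\tau((1+D_0^2)^{-p/2})<\infty$ ($p$ need not be an integer). A one-form $\beta$ on $\mathcal M_0$ is exact if $\beta=df$ for some $f:\mathcal M_0\to\mathbb R$, where $df_D(X)=\frac{d}{ds}\big|_{s=0}f(D+sX)$. Spectral flow: let $\mathcal K_{\mathcal N}$ be the norm-closed two-sided ideal of $\mathcal N$ generated by the elements of finite trace and $\pi:\mathcal N\to\mathcal N/\mathcal K_{\mathcal N}$ the quotient map. If $P,Q$ are projections in $\mathcal N$ with $\|\pi(P)-\pi(Q)\|<1$, then $PQ:\operatorname{ran}Q\to\operatorname{ran}P$ is a Breuer-Fredholm operator, with real index $\operatorname{ind}(PQ)=\tau([\operatorname{ran}Q\cap\ker P])-\tau([\operatorname{ran}P\cap\ker Q])$, where $[\,\cdot\,]$ denotes the projection onto a closed subspace. For a norm-continuous path $\{F_t\}_{t\in[a,b]}$ of self-adjoint Breuer-Fredholm operators in $\mathcal N$ put $P_t=\chi_{[0,\infty)}(F_t)$;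 then $t\mapsto\pi(P_t)$ is continuous, and choosing a partition $a=t_0<\dots<t_n=b$ fine enough that $\pi(P_t)$ varies little in norm (by less than $1$) on each subinterval, one defines $sf(\{F_t\})=\sum_{i=1}^n\operatorname{ind}(P_{t_{i-1}}P_{t_i})$, which is independent of the choices. Finally, $sf(D_a,D_b)$ is the spectral flow of the path $F_t=D_t(1+D_t^2)^{-1/2}$, $t\in[a,b]$. *)

(* Defs.v *)
From HB Require Import structures.
From mathcomp Require Import all_boot all_order all_algebra complex sesquilinear.
From mathcomp Require Import all_classical all_reals all_analysis.

Set Implicit Arguments.
Unset Strict Implicit.
Unset Printing Implicit Defensive.

Import Order.TTheory GRing.Theory Num.Theory.
Import numFieldNormedType.Exports.

Local Open Scope classical_set_scope.
Local Open Scope complex_scope.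
Local Open Scope ring_scope.

(* A Hilbert space is a complete normed R[i]-module H with a form dot such that
   `|x| ^+ 2 = dot x x; dot is linear in its first argument and conjugate-linear
   in the second. Operators are plain functions H -> H with pointwise linear
   structure; the norm of H takes its values in R[i], hence the complex.Re. *)

Section BoundedOperators.
Context {R : realType} {H : completeNormedModType R[i]}.
Implicit Types (T S E u : H -> H) (N : set (H -> H)).

Definition bounded_operator T := linear T /\ continuous T.

(* Meaningful only for bounded operators. *)
Definition opnorm T : R := sup [set complex.Re `|T x| | x in [set x | `|x| <= 1]].

Definition norm_continuous (a b : R) (A : R -> H -> H) :=
  forall t, t \in `[a, b] ->
    opnorm (A s \- A t) @[s --> within `[a, b] (nbhs t)] --> (0 : R).

Variable dot : {dot H for Num.conj}.

Definition adjoint_of T S := forall x y, dot (T x) y = dot x (S y).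

Definition self_adjoint T := bounded_operator T /\ adjoint_of T T.

Definition positive_operator T := bounded_operator T /\ forall x, 0 <= dot (T x) x.

Definition le_operator S T := positive_operator (T \- S).

Definition projection E := self_adjoint E /\ E \o E = E.

Definition projection_onto (V : set H) : H -> H :=
  get [set E | projection E /\ range E = V].

Definition unitary u := [/\ bounded_operator u,
  forall x y, dot (u x) (u y) = dot x y & range u = setT].

Definition commutant N : set (H -> H) :=
  [set T | bounded_operator T /\ forall S, N S -> T \o S = S \o T].

Definition von_neumann_algebra N :=
  (forall T S, N T -> bounded_operator S -> adjoint_of T S -> N S) /\
  commutant (commutant N) = N.

Definition self_adjoint_part N : set (H -> H) := [set T | N T /\ self_adjoint T].

Definition positive_part N : set (H -> H) := [set T | N T /\ positive_operator T].

Definition square_summable (xi : nat -> H) :=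
  cvgn (series (fun n => complex.Re `|xi n| ^+ 2)).

(* The normal functionals on a von Neumann algebra are exactly the
   T |-> \sum_n <T xi_n, eta_n> with xi and eta square-summable. *)
Definition normal_functional (xi eta : nat -> H) T : R[i] :=
  limn (series (fun n => dot (T (xi n)) (eta n) : R[i]^o)).

Definition separable_predual N :=
  exists xis etas : nat -> nat -> H,
    (forall k, square_summable (xis k) /\ square_summable (etas k)) /\
    forall xi eta (e : R), square_summable xi -> square_summable eta -> 0 < e ->
      exists k, forall T, N T -> opnorm T <= 1 ->
        `|normal_functional xi eta T - normal_functional (xis k) (etas k) T| <= e%:C.

End BoundedOperators.

Section Trace.
Context {R : realType} {H : completeNormedModType R[i]}.
Variables (dot : {dot H for Num.conj}) (N : set (H -> H)).
(* Only the values of tau on positive_part dot N matter. *)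
Variable tau : (H -> H) -> \bar R.
Implicit Types (T S K P Q : H -> H).

Local Notation Npos := (positive_part dot N).

Record faithful_normal_semifinite_trace : Prop := {
  trace_ge0 : forall T, Npos T -> (0 <= tau T)%E ;
  traceD : forall S T, Npos S -> Npos T -> tau (S \+ T) = (tau S + tau T)%E ;
  traceZ : forall (c : R) T, 0 <= c -> Npos T -> tau (c%:C *: T) = (c%:E * tau T)%E ;
  trace_adjoint : forall T S, N T -> bounded_operator S -> adjoint_of dot T S ->
    tau (S \o T) = tau (T \o S) ;
  trace_faithful : forall T, Npos T -> tau T = 0%E -> T = 0 ;
  trace_normal : forall (F : set (H -> H)) T, F `<=` Npos -> F !=set0 ->
    (forall S1 S2, F S1 -> F S2 ->
       exists S, [/\ F S, le_operator dot S1 S & le_operator dot S2 S]) ->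
    Npos T -> (forall S, F S -> le_operator dot S T) ->
    (forall T', Npos T' -> (forall S, F S -> le_operator dot S T') ->
       le_operator dot T T') ->
    tau T = ereal_sup (tau @` F) ;
  trace_semifinite : forall T, Npos T -> T <> 0 ->
    exists S, [/\ Npos S, S <> 0, le_operator dot S T & (tau S < +oo)%E] }.

Definition finite_positive : set (H -> H) := [set T | Npos T /\ (tau T < +oo)%E].

(* The extension of tau to the linear span of the positive elements of finite
   trace, which is its ideal of definition. *)
Definition trace_value T (z : R[i]) := exists P1 P2 P3 P4,
  [/\ finite_positive P1 /\ finite_positive P2,
      finite_positive P3 /\ finite_positive P4,
      T = P1 \- P2 \+ 'i%C *: (P3 \- P4) &
      z = (fine (tau P1) - fine (tau P2)) +i* (fine (tau P3) - fine (tau P4))].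

Definition trace_class T := exists z, trace_value T z.

Definition trace T : R[i] := xget 0 (trace_value T).

Definition closed_ideal (I : set (H -> H)) :=
  [/\ I `<=` N, I (fun=> 0), forall S T, I S -> I T -> I (S \+ T),
      forall S T, N S -> I T -> I (S \o T) /\ I (T \o S) &
      forall T, N T -> (forall e : R, 0 < e -> exists2 S, I S & opnorm (T \- S) < e) ->
        I T].

Definition compact_ideal : set (H -> H) :=
  [set T | forall I, closed_ideal I -> trace_class `<=` I -> I T].

(* The quotient norm of the class of T modulo compact_ideal. *)
Definition calkin_norm T : R := inf [set opnorm (T \- K) | K in compact_ideal].

(* Invertible modulo compact_ideal. *)
Definition breuer_fredholm T := N T /\ exists S,
  [/\ N S, compact_ideal ((S \o T) \- id) & compact_ideal ((T \o S) \- id)].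

(* The real index of P Q : ran Q -> ran P, for projections P and Q. *)
Definition index P Q : R :=
  fine (tau (projection_onto dot (range Q `&` P @^-1` [set 0]))) -
  fine (tau (projection_onto dot (range P `&` Q @^-1` [set 0]))).

End Trace.

Section UnboundedOperators.
Context {R : realType} {H : completeNormedModType R[i]}.

(* The values of an unbounded operator outside its domain are irrelevant. *)
Record unbounded_operator := UnboundedOperator { dom : set H ; app :> H -> H }.

Implicit Types (D : unbounded_operator) (A X T F : H -> H) (N : set (H -> H)).

Definition of_bounded T := UnboundedOperator setT T.

Definition perturb D A := UnboundedOperator (dom D) (D \+ A).

Variable dot : {dot H for Num.conj}.

Definition self_adjoint_unbounded D :=
  [/\ dom D 0,
      forall (c : R[i]) x y, dom D x -> dom D y ->
        dom D (c *: x + y) /\ D (c *: x + y) = c *: D x + D y,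
      dense (dom D) &
      (* D is its own adjoint, domains included *)
      forall y z, (forall x, dom D x -> dot (D x) y = dot x z) <->
        (dom D y /\ z = D y)].

Definition affiliated N D := forall u, commutant N u -> unitary dot u ->
  forall x, dom D x -> dom D (u x) /\ D (u x) = u (D x).

Definition unitarily_equivalent N D1 D2 := exists u, [/\ N u, unitary dot u,
  forall x, dom D2 (u x) <-> dom D1 x &
  forall x, dom D1 x -> D2 (u x) = u (D1 x)].

(* D = \int lambda dE(lambda), with mu x = <E(.) x, x>; dom D consists of the x
   such that \int lambda^2 d(mu x) is finite. *)
Definition spectral_resolution D (E : set (measurableTypeR R) -> H -> H)
    (mu : H -> {finite_measure set (measurableTypeR R) -> \bar R}) :=
  [/\ forall B, measurable B -> projection dot (E B),
      E setT = id /\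
        forall B C, measurable B -> measurable C -> E (B `&` C) = E B \o E C,
      forall x B, measurable B -> mu x B = (complex.Re (dot (E B x) x))%:E,
      forall x, dom D x <-> (\int[mu x]_l ((l ^+ 2)%:E) < +oo)%E &
      forall x, dom D x -> dot (D x) x = (\int[mu x]_l l)%:C].

(* f(D) for D self-adjoint and f a bounded Borel function. *)
Definition fcalc D (f : R -> R) : H -> H :=
  get [set T | bounded_operator T /\ exists E mu, spectral_resolution D E mu /\
                 forall x, dot (T x) x = (\int[mu x]_l f l)%:C].

(* (1 + D^2)^(- p / 2) *)
Definition resolvent_power (p : R) D : H -> H :=
  fcalc D (fun l => (1 + l ^+ 2) `^ (- (p / 2))).

(* D (1 + D^2)^(- 1 / 2) *)
Definition bounded_transform D : H -> H := D \o resolvent_power 1 D.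

Definition nonneg_projection F : H -> H :=
  fcalc (of_bounded F) \1_[set l : R | 0 <= l].

Definition affine_space N D0 : set unbounded_operator :=
  [set D | exists2 A, self_adjoint_part dot N A & D = perturb D0 A].

Definition one_form N D0 (beta : unbounded_operator -> (H -> H) -> R) :=
  forall D, affine_space N D0 D ->
    (forall (c : R) X Y, self_adjoint_part dot N X -> self_adjoint_part dot N Y ->
       beta D (c%:C *: X \+ Y) = c * beta D X + beta D Y) /\
    exists M : R, forall X, self_adjoint_part dot N X -> `|beta D X| <= M * opnorm X.

Definition exact N D0 (beta : unbounded_operator -> (H -> H) -> R) :=
  exists f : unbounded_operator -> R, forall D X,
    affine_space N D0 D -> self_adjoint_part dot N X ->
    is_derive (0 : R) (1 : R) (fun s : R => f (perturb D (s%:C *: X))) (beta D X).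

Definition summable_module N (tau : (H -> H) -> \bar R) (p : R) D :=
  [/\ self_adjoint_unbounded D, affiliated N D &
      (tau (resolvent_power p D) < +oo)%E].

End UnboundedOperators.

Arguments unbounded_operator {R} H.

Section Paths.
Context {R : realType} {H : completeNormedModType R[i]}.
Implicit Types (A B : R -> H -> H) (a b t : R).

Definition op_derivative_within (J : set R) A t (B : H -> H) :=
  bounded_operator B /\
  opnorm ((s - t)^-1%:C *: (A s \- A t) \- B) @[s --> within J t^'] --> (0 : R).

Definition op_derivative A t : H -> H := get (op_derivative_within setT A t).

Definition C1_path a b A := exists B, norm_continuous a b B /\
  forall t, t \in `[a, b] -> op_derivative_within `[a, b] A t (B t).

(* In itv_partition a b s the points of the partition are those of a :: s. *)
Definition piecewise_C1_path a b A := norm_continuous a b A /\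
  exists2 s, itv_partition a b s &
    forall i, (i < size s)%N -> C1_path (nth b (a :: s) i) (nth b s i) A.

Variables (dot : {dot H for Num.conj}) (N : set (H -> H)) (tau : (H -> H) -> \bar R).

Definition spectral_flow_value a b (F : R -> H -> H) (v : R) :=
  let P t := nonneg_projection dot (F t) in
  [/\ forall t, t \in `[a, b] -> breuer_fredholm dot N tau (F t) /\ self_adjoint dot (F t),
      norm_continuous a b F &
      exists s, [/\ itv_partition a b s,
        forall i, (i < size s)%N -> forall t t',
          t \in `[nth b (a :: s) i, nth b s i] -> t' \in `[nth b (a :: s) i, nth b s i] ->
          calkin_norm dot N tau (P t \- P t') < 1 &
        v = \sum_(i < size s) index dot tau (P (nth b (a :: s) i)) (P (nth b s i))]].

(* The value does not depend on the partition. *)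
Definition spectral_flow a b (D : R -> unbounded_operator H) : R :=
  xget 0 (spectral_flow_value a b (fun t => bounded_transform dot (D t))).

End Paths.

(* \int (1 + x^2)^(- p / 2) dx. For p <= 1 this integral is infinite; then
   Ctilde p = fine +oo = 0 and (Ctilde p)^-1 = 0, i.e. 1 / oo = 0. *)
Definition Ctilde {R : realType} (p : R) : R :=
  \int[lebesgue_measure]_x ((1 + x ^+ 2) `^ (- (p / 2))).

(* (Ctilde p)^-1 * tau(X (1 + D^2)^(- p / 2)) *)
Definition summable_form {R : realType} {H : completeNormedModType R[i]}
    (dot : {dot H for Num.conj}) (N : set (H -> H)) (tau : (H -> H) -> \bar R) (p : R)
    (D : unbounded_operator H) (X : H -> H) : R :=
  (Ctilde p)^-1 * complex.Re (trace dot N tau (X \o resolvent_power dot p D)).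

(* Main.v *)
(** The bounded transform [F = D (1 + D^2)^(-1/2)] sends [D0 + N_sa] to self-adjoint
    contractions that differ from that of [D0] by an operator dominated by
    [(1 + D0^2)^(-1/4)]. For large n the one-form [tau (X (1 - F^2)^n)] is closed on such F,
    by cyclicity of the trace, hence has a potential, its integral along segments. Between
    the symmetries [2 P - 1] and [2 P' - 1] the potential grows by a constant [c_n] times the
    index of (P, P'); at unitarily equivalent end points the contributions of the segments
    from F to its sign [2 P - 1] cancel, so along the path the potential grows by [c_n sf].
    Pulled back to [D0 + N_sa], the form becomes [tau (X g_n(D))] with
    [g_n(l) = (1 + l^2)^(-n - 3/2)], and the substitution [r = (1 + F(l)) / 2] shows that
    [c_n] is the integral of [g_n]. The binomial series in [l^2 / (1 + l^2)] exhibits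
    [(1 + l^2)^(-p/2)] as an increasing limit of linear combinations of the [g_n]; a
    comparison of the spectral distributions of D and D0 makes the convergence of the forms
    uniform on bounded sets, so potentials and index formula pass to the limit. When
    [p <= 1] the integrals diverge, which forces [sf = 0]. *)
Require Import Defs.
From HB Require Import structures.
From mathcomp Require Import all_boot all_order all_algebra complex sesquilinear.
From mathcomp Require Import all_classical all_reals all_analysis.
From mathcomp Require Import measurable_realfun.
From mathcomp Require Import ring lra.
Set Implicit Arguments.
Unset Strict Implicit.
Unset Printing Implicit Defensive.
Import Order.TTheory GRing.Theory Num.Theory.
Import numFieldNormedType.Exports.
Local Open Scope classical_set_scope.
Local Open Scope complex_scope.
Local Open Scope ring_scope.

(** The trace estimates concern long products of operators none of which is trace class, and [p]
    need not be an integer. They are reduced to counting letters: a letter is an operator [T] with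
    [|T x| <= c |h x|], where [h = (1 + D0^2)^(-1/4)], and a product of [m0 >= p] letters is
    Hilbert-Schmidt. This is proved by comparing traces of spectral projections: a projection whose
    range is detected by [m] operators, each followed by a projection [F], has trace at most [m]
    times that of [F]. Taking [n >= 4 m0] guarantees that a product of [n] letters, however it is
    cut in two, has a trace class piece, as each use of cyclicity requires. The exponent [1/4] is a
    compromise: the resolvent [(1 + t^2 + D0^2)^-1] splits into one power of [h] and a factor
    [(1 + t^2)^(-3/4)] that is still integrable in [t], as the integral formula for
    [(1 + D^2)^(-1/2)] demands. The potential lives on a space of operators [F] because the
    symmetries [2 P - 1], whose segments compute the index, are not transforms of points of
    [D0 + N_sa]. *)

Notation mR := measurableTypeR.
Notation borel R := (set (measurableTypeR R)).
Notation leb := lebesgue_measure.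

Lemma mitv (R : realType) (i : interval R) : measurable ([set` i] : borel R).
exact: measurable_itv. Qed.
Lemma eqW d (T : porderType d) (x y : T) : x = y -> (x <= y)%O.
by move=> ->. Qed.

(** * Limits of real sequences *)

Section RealSequences.
Context {R : realType}.
Implicit Types (a b : nat -> R).

Lemma cvg_squeeze0 a b : (forall n, `|a n| <= b n) -> b @ \oo --> (0 : R) ->
 a @ \oo --> (0 : R).
move=> ab b0; apply/cvgrPdist_lt => e e0.
move/cvgrPdist_lt : b0 => /(_ e e0) [N _ hN]; exists N => // n Nn /=.
have := hN n Nn; rewrite /= !sub0r !normrN => /(le_lt_trans (ler_norm _)).
exact: le_lt_trans (ab n).
Qed.

Lemma cvg_distP a (l : R) : ((fun n => `|a n - l|) @ \oo --> (0 : R)) <-> (a @ \oo --> l).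
split=> [/cvgrPdist_lt h|/cvgrPdist_lt h]; apply/cvgrPdist_lt => e e0;
 have [N _ hN] := h e e0; exists N => // n Nn; have := hN n Nn => /=.
 by rewrite sub0r normrN normr_id distrC.
by rewrite sub0r normrN normr_id distrC.
Qed.

Lemma cvg_squeeze a b (l : R) : (forall n, `|a n - l| <= b n) -> b @ \oo --> (0 : R) ->
 a @ \oo --> l.
by move=> ab b0; apply/cvg_distP/(cvg_squeeze0 _ b0) => n; rewrite normr_id. Qed.

Lemma cvg_scale (c : R) a (l : R) : a @ \oo --> l -> (fun n => c * a n) @ \oo --> c * l.
by move=> h; apply: cvgM => //; exact: cvg_cst. Qed.

Arguments cvg_scale c {a l}.

Lemma cvg_scale0 (c : R) a : a @ \oo --> (0 : R) -> (fun n => c * a n) @ \oo --> (0 : R).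
by move=> h; have := cvg_scale c h; rewrite mulr0. Qed.

Arguments cvg_scale0 c {a}.

Lemma cvg_eq_lim a (l k : R) : a @ \oo --> l -> a @ \oo --> k -> l = k.
by move=> al ak; rewrite -(cvg_lim (@Rhausdorff R) al) -(cvg_lim (@Rhausdorff R) ak). Qed.
Lemma cvg_le a b (l k : R) : (forall n, a n <= b n) -> a @ \oo --> l -> b @ \oo --> k -> l <= k.
by move=> ab al bk; apply: (ler_cvg_to al bk); apply: nearW. Qed.
Lemma cvg_le_cst a (l C : R) : (forall n, a n <= C) -> a @ \oo --> l -> l <= C.
by move=> ab al; apply: (cvg_le ab al); exact: cvg_cst. Qed.
Lemma cvg_ge_cst a (l C : R) : (forall n, C <= a n) -> a @ \oo --> l -> C <= l.
by move=> ab al; apply: (cvg_le ab _ al); exact: cvg_cst. Qed.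

Lemma natSinv_small (e : R) : 0 < e -> exists N, forall n, (N <= n)%N -> n.+1%:R^-1 < e.
move=> e0; have /cvgrPdist_lt /(_ e e0) [N _ hN] := @cvg_harmonic R.
exists N => n Nn; have := hN n Nn.
by rewrite /= sub0r normrN ger0_norm ?invr_ge0// ler0n.
Qed.

End RealSequences.
Arguments cvg_scale {R} c {a l}.
Arguments cvg_scale0 {R} c {a}.

(** * Hilbert spaces through the real part of the inner product *)

Structure hilbert (R : realType) := Hilbert {
 hcar :> completeNormedModType R[i];
 hdot : {dot hcar for Num.conj};
 hdot_norm : forall x : hcar, `|x| ^+ 2 = hdot x x }.

Section Hilbert.
Context {R : realType} {E : hilbert R}.
Implicit Types (x y z : E) (c : R).

Definition nrm x : R := complex.Re `|x|.
(** Only the real part of the form is used. Together with [iv] it determines the form ([hdotE]), and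
    a real-linear map that commutes with [iv] is complex linear; estimates thus take place in an
    ordered field. *)
Definition rip x y : R := complex.Re (hdot E x y).
Definition iv x : E := 'i%C *: x.
Definition sv c x : E := c%:C *: x.

Lemma Re_add (a b : R[i]) : complex.Re (a + b) = complex.Re a + complex.Re b.
by case: a => ? ?; case: b. Qed.
Lemma Re_opp (a : R[i]) : complex.Re (- a) = - complex.Re a.
by case: a. Qed.
Lemma Re_scale c (a : R[i]) : complex.Re (c%:C * a) = c * complex.Re a.
by case: a => u v /=; rewrite mul0r subr0. Qed.
Lemma Re_conj (a : R[i]) : complex.Re (a^*)%C = complex.Re a.
by case: a. Qed.
Lemma normE x : `|x| = (nrm x)%:C.
by rewrite RRe_real// normr_real. Qed.
Lemma nrm_ge0 x : 0 <= nrm x.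
by rewrite -ler0c -normE. Qed.
Lemma nrmD x y : nrm (x + y) <= nrm x + nrm y.
by rewrite -lecR rmorphD /= -!normE ler_normD. Qed.
Lemma nrmN x : nrm (- x) = nrm x.
by rewrite /nrm normrN. Qed.
Lemma nrmB x y : nrm (x - y) <= nrm x + nrm y.
by rewrite -(nrmN y) nrmD. Qed.
Lemma nrmC x y : nrm (x - y) = nrm (y - x).
by rewrite -nrmN opprB. Qed.
Lemma nrm0 : nrm 0 = 0.
by rewrite /nrm normr0. Qed.
Lemma nrm_eq0 x : (nrm x == 0) = (x == 0).
by rewrite -[x == 0]normr_eq0 normE -(inj_eq (@complexI R)). Qed.
Lemma nrm0P x : nrm x <= 0 -> x = 0.
by move=> h; apply/eqP; rewrite -nrm_eq0 eq_le h nrm_ge0. Qed.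

Lemma nrm_iv x : nrm (iv x) = nrm x.
rewrite /nrm /iv normrZ.
by rewrite (_ : `|'i%C| = 1) ?mul1r// normc_def /= expr0n /= add0r expr1n sqrtr1.
Qed.

Lemma nrm_sv c x : nrm (sv c x) = `|c| * nrm x.
by rewrite /nrm /sv normrZ normc_def /= expr0n /= addr0 sqrtr_sqr Re_scale. Qed.
Lemma rip_nrm x : rip x x = nrm x ^+ 2.
by rewrite /rip -hdot_norm normE -rmorphXn. Qed.
Lemma hdotC x y : hdot E x y = (hdot E y x)^*%C.
by rewrite (@hermC _ false) expr0 mul1r. Qed.
Lemma ripC x y : rip x y = rip y x.
by rewrite /rip hdotC Re_conj. Qed.
Lemma ripDl x y z : rip (x + y) z = rip x z + rip y z.
by rewrite /rip linearDl Re_add. Qed.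
Lemma ripDr x y z : rip z (x + y) = rip z x + rip z y.
by rewrite ripC ripDl !(ripC z). Qed.
Lemma ripNl x z : rip (- x) z = - rip x z.
by rewrite /rip linearNl Re_opp. Qed.
Lemma ripNr x z : rip z (- x) = - rip z x.
by rewrite ripC ripNl ripC. Qed.
Lemma ripBl x y z : rip (x - y) z = rip x z - rip y z.
by rewrite ripDl ripNl. Qed.
Lemma ripBr x y z : rip z (x - y) = rip z x - rip z y.
by rewrite ripDr ripNr. Qed.
Lemma ripZl c x z : rip (sv c x) z = c * rip x z.
by rewrite /rip /sv linearZl_LR /= Re_scale. Qed.
Lemma ripZr c x z : rip z (sv c x) = c * rip z x.
by rewrite ripC ripZl ripC. Qed.
Lemma rip0l z : rip 0 z = 0.
by rewrite /rip linear0l. Qed.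
Lemma rip0r z : rip z 0 = 0.
by rewrite ripC rip0l. Qed.

Lemma hdotE x y : hdot E x y = rip x y +i* rip x (iv y).
apply/eqP; rewrite eq_complex /=; apply/andP; split => //; apply/eqP.
by rewrite /rip /iv linearZr_LR /=; case: (hdot E x y) => u v /=; ring.
Qed.

Lemma iv_iv x : iv (iv x) = - x.
rewrite /iv scalerA (_ : 'i%C * 'i%C = -1) ?scaleN1r//.
by apply/eqP; rewrite eq_complex /=; apply/andP; split; apply/eqP => /=; ring.
Qed.

Lemma ripi x y : rip (iv x) y = - rip x (iv y).
rewrite /rip /iv linearZl_LR linearZr_LR /=.
by case: (hdot E x y) => u v /=; ring.
Qed.

Lemma ivD x y : iv (x + y) = iv x + iv y.
exact: scalerDr. Qed.
Lemma ivN x : iv (- x) = - iv x.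
exact: scalerN. Qed.
Lemma svD c x y : sv c (x + y) = sv c x + sv c y.
exact: scalerDr. Qed.
Lemma svN c x : sv c (- x) = - sv c x.
exact: scalerN. Qed.
Lemma svDl c d x : sv (c + d) x = sv c x + sv d x.
by rewrite /sv rmorphD scalerDl. Qed.
Lemma svA c d x : sv c (sv d x) = sv (c * d) x.
by rewrite /sv scalerA rmorphM. Qed.
Lemma sv1 x : sv 1 x = x. exact: scale1r. Qed.
Lemma sv0 c : sv c 0 = 0. exact: scaler0. Qed.
Lemma sv0l x : sv 0 x = 0. exact: scale0r. Qed.
Lemma sv_iv c x : sv c (iv x) = iv (sv c x).
by rewrite /sv /iv !scalerA mulrC. Qed.
Lemma scaleE (a : R[i]) x : a *: x = sv (complex.Re a) x + iv (sv (complex.Im a) x).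
by rewrite /iv /sv {1}(complexE a) scalerDl scalerA. Qed.
Lemma nrm_sqD x y : nrm (x + y) ^+ 2 = nrm x ^+ 2 + nrm y ^+ 2 + 2 * rip x y.
by rewrite -!rip_nrm ripDl !ripDr (ripC y x); ring. Qed.
Lemma nrm_sqB x y : nrm (x - y) ^+ 2 = nrm x ^+ 2 + nrm y ^+ 2 - 2 * rip x y.
by rewrite nrm_sqD nrmN ripNr; ring. Qed.

(** Expanding the squared norm of [|y| x - |x| y] leaves [2 |x| |y| (|x| |y| - rip x y)]. *)
Lemma rip_le x y : rip x y <= nrm x * nrm y.
have [->|x0] := eqVneq x 0; first by rewrite rip0l nrm0 mul0r.
have [->|y0] := eqVneq y 0; first by rewrite rip0r nrm0 mulr0.
have px : 0 < nrm x by rewrite lt_def nrm_eq0 x0 nrm_ge0.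
have py : 0 < nrm y by rewrite lt_def nrm_eq0 y0 nrm_ge0.
have := sqr_ge0 (nrm (sv (nrm y) x - sv (nrm x) y)).
rewrite nrm_sqB !nrm_sv !ger0_norm ?nrm_ge0// ripZl ripZr.
set a := nrm x in px *; set b := nrm y in py *; set r := rip x y => h.
have h2 : 0 <= a * b * (a * b - r) by nra.
by move: h2; rewrite pmulr_rge0 ?subr_ge0// mulr_gt0.
Qed.

Lemma rip_abs x y : `|rip x y| <= nrm x * nrm y.
by rewrite ler_norml rip_le andbT lerNl -ripNl -(nrmN x) rip_le. Qed.

Lemma rip_ext x y : (forall z, rip x z = rip y z) -> x = y.
move=> h; apply/eqP; rewrite -subr_eq0 -nrm_eq0 -sqrf_eq0 -rip_nrm.
by rewrite ripBl h subrr.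
Qed.

Lemma nrm_dual x C : 0 <= C -> (forall y, rip x y <= C * nrm y) -> nrm x <= C.
move=> C0 h; have [->|x0] := eqVneq x 0; first by rewrite nrm0.
have px : 0 < nrm x by rewrite lt_def nrm_eq0 x0 nrm_ge0.
by have := h x; rewrite rip_nrm expr2 ler_pM2r.
Qed.

Definition hcvg (u : nat -> E) x := (fun n => nrm (u n - x)) @ \oo --> (0 : R).

Lemma hcvgP (u : nat -> E) x :
 hcvg u x <-> forall e : R, 0 < e -> exists N, forall n, (N <= n)%N -> nrm (u n - x) < e.
split=> [/cvgrPdist_lt h e e0|h].
 have [N _ hN] := h e e0; exists N => n Nn.
 by have := hN n Nn; rewrite /= sub0r normrN ger0_norm ?nrm_ge0.
apply/cvgrPdist_lt => e e0; have [N hN] := h e e0.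
by exists N => // n Nn /=; rewrite sub0r normrN ger0_norm ?nrm_ge0// hN.
Qed.

Lemma hcvg_cst x : hcvg (fun=> x) x.
by apply/hcvgP => e e0; exists 0%N => n _; rewrite subrr nrm0. Qed.

Lemma hcvgD u v x y : hcvg u x -> hcvg v y -> hcvg (fun n => u n + v n) (x + y).
move=> ux vy; apply: (@cvg_squeeze0 _ _ (fun n => nrm (u n - x) + nrm (v n - y))).
 move=> n; rewrite ger0_norm ?nrm_ge0// (_ : _ - _ = (u n - x) + (v n - y)) ?nrmD//.
 by rewrite opprD addrACA.
by rewrite -[X in _ --> X]addr0; exact: cvgD.
Qed.

Lemma hcvg_le u v x y C : (forall n, nrm (u n - x) <= C * nrm (v n - y)) ->
 hcvg v y -> hcvg u x.
move=> h vy; apply: (cvg_squeeze0 _ (cvg_scale0 C vy)) => n.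
by rewrite ger0_norm ?nrm_ge0.
Qed.

Lemma hcvgN u x : hcvg u x -> hcvg (fun n => - u n) (- x).
by apply: (@hcvg_le _ _ _ _ 1) => n; rewrite mul1r -opprD nrmN. Qed.
Lemma hcvgB u v x y : hcvg u x -> hcvg v y -> hcvg (fun n => u n - v n) (x - y).
by move=> ux vy; apply: hcvgD => //; exact: hcvgN. Qed.

Lemma rip_cvg u x y : hcvg u x -> (fun n => rip (u n) y) @ \oo --> rip x y.
move=> ux; apply: (cvg_squeeze _ (cvg_scale0 (nrm y) ux)) => n.
by rewrite -ripBl mulrC rip_abs.
Qed.

Arguments rip_cvg {u x} y _.

Lemma nrm_cvg u x : hcvg u x -> (fun n => nrm (u n)) @ \oo --> nrm x.
move=> ux; apply: (cvg_squeeze _ ux) => n.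
rewrite ler_norml lerNl opprB !lerBlDr; apply/andP; split.
 by rewrite nrmC -{1}(subrK (u n) x) nrmD.
by rewrite -{1}(subrK x (u n)) nrmD.
Qed.

Lemma hcvg_unique u x y : hcvg u x -> hcvg u y -> x = y.
move=> ux uy; apply: rip_ext => z.
by have h1 := rip_cvg z ux; have h2 := rip_cvg z uy; apply: (@cvg_eq_lim _ _ _ _ h1 h2).
Qed.

Lemma hcvg_nrm_le u x C : hcvg u x -> (forall n, nrm (u n) <= C) -> nrm x <= C.
by move=> ux h; apply: cvg_le_cst (nrm_cvg ux).
Qed.

Lemma hcomplete u :
 (forall e : R, 0 < e -> exists N, forall n m, (N <= n)%N -> (N <= m)%N -> nrm (u n - u m) < e) ->
 exists x, hcvg u x.
move=> h; have /cvg_ex[l ul] : cvgn u.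
 apply/cauchy_cvgP/cauchy_ballP => e e0.
 have eE : e = (complex.Re e)%:C by rewrite RRe_real// gtr0_real.
 have [|N hN] := h (complex.Re e); first by rewrite -(@ltcR R) -eE.
 exists (u @` [set n | (N <= n)%N], u @` [set n | (N <= n)%N]) => /=.
  by split; exists N => // n Nn /=; exists n.
 by move=> [_ _] [/= [n Nn <-] [m Nm <-]]; rewrite -ball_normE /= normE eE ltcR hN.
exists l; apply/hcvgP => e e0.
have eC : 0 < e%:C by rewrite ltcR.
move/cvgrPdist_lt : ul => /(_ e%:C eC) [N _ hN].
by exists N => n Nn; have := hN n Nn; rewrite /= normE ltcR nrmC.
Qed.

(** The graph of [A] over [V] is a closed real subspace of the product, hence a Hilbert space for
    the graph norm. With [A = D], Riesz's theorem in it solves [y + D (D y) = v]; with [A = 0] it is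
    the theorem for a closed subspace. *)
Record graph_space (V : set E) (A : E -> E) : Prop := {
 gsp0 : V 0 ;
 gspD : forall x y, V x -> V y -> V (x + y) /\ A (x + y) = A x + A y ;
 gspZ : forall c x, V x -> V (sv c x) /\ A (sv c x) = sv c (A x) ;
 gsp_closed : forall u x z, (forall n, V (u n)) -> hcvg u x ->
  hcvg (fun n => A (u n)) z -> V x /\ A x = z }.

(* The representative minimises [(|x|^2 + |A x|^2) / 2 - l x]. *)
Lemma riesz_graph (V : set E) (A : E -> E) (l : E -> R) C : graph_space V A ->
 (forall x y, l (x + y) = l x + l y) -> (forall c x, l (sv c x) = c * l x) ->
 (forall x, `|l x| <= C * nrm x) ->
 exists2 y, V y & forall x, V x -> l x = rip x y + rip (A x) (A y).
move=> [V0 VD VZ Vc] lD lZ lC.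
have VB x y : V x -> V y -> V (x - y) /\ A (x - y) = A x - A y.
 move=> Vx Vy; have [h1 h2] := VZ (-1) y Vy.
 have e t : sv (-1) t = - t by rewrite /sv rmorphN scaleN1r.
 by have [] := VD x (sv (-1) y) Vx h1; rewrite h2 !e.
pose J x := (nrm x ^+ 2 + nrm (A x) ^+ 2) / 2 - l x.
have Jlb x : - (C ^+ 2 / 2) <= J x.
 have := lC x; rewrite ler_norml => /andP[_ h]; rewrite /J.
 have := sqr_ge0 (nrm x - C); have := sqr_ge0 (nrm (A x)); nra.
have hi : has_inf [set J x | x in V].
 by split; [exists (J 0), 0 | exists (- (C ^+ 2 / 2)) => _ [x _ <-]].
pose m := inf [set J x | x in V].
have mJ x : V x -> m <= J x by move=> Vx; apply: ge_inf; [exact: hi.2|exists x].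
have ex n : exists x, V x /\ J x < m + n.+1%:R^-1.
 have n0 : 0 < (n.+1%:R^-1 : R) by rewrite invr_gt0.
 by have [_ [x Vx <-] h] := inf_adherent n0 hi; exists x.
have [u uP] := choice ex.
have Vu n : V (u n) := (uP n).1.
(* Parallelogram law: the midpoint lies in [V] and has [J] at least [m], which makes a minimizing
   sequence Cauchy in the graph norm. *)
have Jpar x y : V x -> V y ->
  (nrm (x - y) ^+ 2 + nrm (A x - A y) ^+ 2) / 4 <= (J x - m) + (J y - m).
 move=> Vx Vy; have [h1 h2] := VD _ _ Vx Vy; have [h3 h4] := VZ 2^-1 _ h1.
 have h := mJ _ h3; rewrite {1}/J lZ lD h4 h2 !nrm_sv ger0_norm ?invr_ge0// !exprMn in h.
 rewrite !nrm_sqD in h; rewrite !nrm_sqB /J; lra.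
have Jsmall e : 0 < e -> exists N, forall n k, (N <= n)%N -> (N <= k)%N ->
  nrm (u n - u k) < e /\ nrm (A (u n) - A (u k)) < e.
 move=> e0; have e2 : 0 < e ^+ 2 / 8 by rewrite divr_gt0// exprn_gt0.
 have [N Nle] := natSinv_small e2.
 exists N => n k Nn Nk.
 have := Jpar _ _ (Vu n) (Vu k); have := (uP n).2; have := (uP k).2.
 have := Nle _ Nn; have := Nle _ Nk.
 have := sqr_ge0 (nrm (u n - u k)); have := sqr_ge0 (nrm (A (u n) - A (u k))).
 move=> h1 h2 h3 h4 h5 h6 h7.
 have [k1 k2] : nrm (u n - u k) ^+ 2 < e ^+ 2 /\ nrm (A (u n) - A (u k)) ^+ 2 < e ^+ 2.
  move: h1 h2 h3 h4 h5 h6 h7; move: (J (u n)) (J (u k)) (n.+1%:R^-1) (k.+1%:R^-1).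
  by move=> ? ? ? ? ? ? ? ? ? ? ?; split; lra.
 by split; rewrite -(@ltr_pXn2r _ 2)// ?nnegrE ?nrm_ge0 ?(ltW e0).
have [y uy] : exists y, hcvg u y.
 by apply: hcomplete => e /Jsmall [N hN]; exists N => n k Nn Nk; have [] := hN n k Nn Nk.
have [z uz] : exists z, hcvg (fun n => A (u n)) z.
 by apply: hcomplete => e /Jsmall [N hN]; exists N => n k Nn Nk; have [] := hN n k Nn Nk.
have [Vy Ay] := Vc _ _ _ Vu uy uz.
exists y => // x Vx; apply/eqP; rewrite -subr_eq0 -sqrf_eq0; apply/eqP.
have lu : (fun n => l (u n)) @ \oo --> l y.
 apply: (cvg_squeeze _ (cvg_scale0 C uy)) => n.
 rewrite (_ : l (u n) - l y = l (u n - y)) ?lC// lD.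
 by rewrite (_ : - y = sv (-1) y) ?lZ ?mulN1r// /sv rmorphN scaleN1r.
have Jy : J y <= m.
 have cJ : (fun n => J (u n)) @ \oo --> J y.
  apply: cvgB => //; apply: cvgM; last exact: cvg_cst.
  by apply: cvgD; under eq_fun do rewrite expr2; rewrite expr2; apply: cvgM;
   rewrite ?Ay; exact: nrm_cvg.
 have cm : (fun n => m + n.+1%:R^-1) @ \oo --> m.
  by rewrite -[X in _ --> X]addr0; apply: cvgD; [exact: cvg_cst|exact: cvg_harmonic].
 by apply: (cvg_le _ cJ cm) => n; exact: ltW (uP n).2.
set d := l x - _.
have hq t : 0 <= - t * d + t ^+ 2 * ((nrm x ^+ 2 + nrm (A x) ^+ 2) / 2).
 have [h3 h4] := VZ t _ Vx; have [h5 h6] := VD _ _ Vy h3.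
 have := mJ _ h5; move=> /(le_trans Jy).
 rewrite /J lD lZ h6 h4 !nrm_sqD !nrm_sv !exprMn real_normK ?num_real// !ripZr.
 by rewrite (ripC y x) (ripC (A y) (A x)) /d; lra.
have := sqr_ge0 d; rewrite le_eqVlt => /orP[/eqP<-//|d2].
pose q := (nrm x ^+ 2 + nrm (A x) ^+ 2) / 2.
have q0 : 0 <= q by rewrite divr_ge0// addr_ge0// sqr_ge0.
(* The quadratic [- t d + t^2 q] takes the value [- d^2 / (q + 1)^2] at this [t]; adding 1 covers
   [q = 0]. *)
have := hq (d / (q + 1)); rewrite -/q.
rewrite (_ : _ + _ = - (d ^+ 2 * ((q + 1)^-1 ^+ 2))); last by field; apply/eqP; lra.
by rewrite oppr_ge0 leNgt mulr_gt0// exprn_gt0// invr_gt0; lra.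
Qed.

Record subspace (V : set E) : Prop := {
 sub0 : V 0 ;
 subD : forall x y, V x -> V y -> V (x + y) ;
 subZ : forall c x, V x -> V (sv c x) ;
 sub_closed : forall u x, (forall n, V (u n)) -> hcvg u x -> V x }.

Lemma riesz_subspace (V : set E) (l : E -> R) C : subspace V ->
 (forall x y, l (x + y) = l x + l y) -> (forall c x, l (sv c x) = c * l x) ->
 (forall x, `|l x| <= C * nrm x) -> exists2 y, V y & forall x, V x -> l x = rip x y.
move=> [V0 VD VZ Vc] lD lZ lC.
have [|y Vy hy] := @riesz_graph V (fun=> 0) l C _ lD lZ lC.
 split=> // [x y Vx Vy|c x Vx|u x z Vu ux uz].
 - by split; [exact: VD|rewrite addr0].
 - by split; [exact: VZ|rewrite sv0].
 - split; first exact: Vc ux.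
  by apply: hcvg_unique uz; exact: hcvg_cst.
by exists y => // x Vx; rewrite hy// rip0l addr0.
Qed.

End Hilbert.
Arguments rip_cvg {R E u x} y _.

(** * Bounded operators: ring structure, adjoint, order *)

Section Operators.
Context {R : realType} {E : hilbert R}.

Record op := Op { opf :> E -> E; op_bounded : bounded_operator opf }.

Lemma op_ext (S T : op) : (forall x, S x = T x) -> S = T.
case: S T => [f hf] [g hg] /= h; have fg : f = g by apply/funext.
by subst g; congr Op; exact: Prop_irrelevance.
Qed.

HB.instance Definition _ := gen_eqMixin op.
HB.instance Definition _ := gen_choiceMixin op.

Implicit Types (S T : op) (x y : E) (c : R).

Lemma opD T x y : T (x + y) = T x + T y.
by have := (op_bounded T).1 1 x y; rewrite !scale1r. Qed.
Lemma op0 T : T 0 = 0.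
by have := opD T 0 0; rewrite addr0 => /eqP; rewrite -subr_eq0 opprD addrA subrr sub0r oppr_eq0 => /eqP. Qed.
Lemma opZ T (a : R[i]) x : T (a *: x) = a *: T x.
by have := (op_bounded T).1 a x 0; rewrite !addr0 op0 addr0. Qed.
Lemma opsv T c x : T (sv c x) = sv c (T x).
exact: opZ. Qed.
Lemma opiv T x : T (iv x) = iv (T x).
exact: opZ. Qed.
Lemma opN T x : T (- x) = - T x.
by rewrite -scaleN1r opZ scaleN1r. Qed.
Lemma opB T x y : T (x - y) = T x - T y.
by rewrite opD opN. Qed.

Lemma bounded_operatorP (f : E -> E) : (forall x y, f (x + y) = f x + f y) ->
 (forall c x, f (sv c x) = sv c (f x)) -> (forall x, f (iv x) = iv (f x)) ->
 forall C, (forall x, nrm (f x) <= C * nrm x) -> bounded_operator f.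
move=> fD fZ fi C fC; split.
 by move=> a x y; rewrite fD scaleE fD fi !fZ -scaleE.
have f0 : f 0 = 0 by rewrite -{1}(sv0l (0 : E)) fZ sv0l.
have fB x y : f x - f y = f (x - y).
 rewrite fD; congr (_ + _); apply/eqP.
 by rewrite eq_sym -subr_eq0 opprK -fD addNr f0.
move=> x; apply/cvgrPdist_lt => e e0.
have eE : e = (complex.Re e)%:C by rewrite RRe_real// gtr0_real.
have e0' : 0 < complex.Re e by rewrite -(@ltcR R) -eE.
have C0 : 0 < `|C| + 1 by rewrite ltr_wpDl.
near=> y; rewrite fB normE eE ltcR.
apply: (@le_lt_trans _ _ ((`|C| + 1) * nrm (x - y))).
 by apply: (le_trans (fC _)); rewrite ler_wpM2r ?nrm_ge0// (le_trans (ler_norm _))// lerDl.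
rewrite -ltr_pdivlMl//.
near: y; have h : 0 < ((`|C| + 1)^-1 * complex.Re e)%:C by rewrite ltcR mulr_gt0// invr_gt0.
have hh := @cvgr_dist_lt _ _ _ (nbhs x) _ id x (@cvg_id _ _) _ h.
by apply: filterS (hh _) => y; rewrite normE ltcR.
Unshelve. all: by end_near. Qed.

Lemma op_boundP T : exists2 C, 0 <= C & forall x, nrm (T x) <= C * nrm x.
have := (op_bounded T).2 0 => /cvgrPdist_lt /(_ 1 ltr01).
rewrite op0 => /nbhs_normP [e /= e0 he].
have eE : e = (complex.Re e)%:C by rewrite RRe_real// gtr0_real.
set d := complex.Re e in eE; have d0 : 0 < d by rewrite -(@ltcR R) -eE.
exists (2 / d); first by rewrite divr_ge0// ltW.
move=> x; have [->|x0] := eqVneq x 0; first by rewrite op0 nrm0 mulr0.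
have px : 0 < nrm x by rewrite lt_def nrm_eq0 x0 nrm_ge0.
have := he (sv (d / 2 / nrm x) x); rewrite /= !sub0r !normrN !normE eE.
rewrite (_ : 1 = 1%:C :> R[i])// !ltcR opsv !nrm_sv.
have c0 : 0 < d / 2 / nrm x by rewrite !divr_gt0.
rewrite (gtr0_norm c0) divfK ?gt_eqF// ltr_pdivrMr// ltr_pMr// ltrDl ltr01 => /(_ isT).
rewrite -ltr_pdivlMl// mulr1 invf_div => h; apply: ltW.
by move: h; rewrite invf_div mulrC.
Qed.

Definition opn T : R := opnorm T.

Let opn_hs T : has_sup [set complex.Re `|T x| | x in [set x | `|x| <= 1]].
split; first by exists (complex.Re `|T 0|), 0 => //=; rewrite normr0.
have [C C0 hC] := op_boundP T; exists C => _ [x /= x1 <-].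
apply: (le_trans (hC x)); rewrite ler_piMr//.
by move: x1; rewrite normE (_ : 1 = 1%:C :> R[i])// lecR.
Qed.

Lemma opn_ge0 T : 0 <= opn T.
apply: sup_upper_bound; first exact: opn_hs.
by exists 0; rewrite /= ?normr0 ?op0 ?normr0.
Qed.

Lemma opn_le T x : nrm (T x) <= opn T * nrm x.
have [->|x0] := eqVneq x 0; first by rewrite op0 nrm0 mulr0.
have px : 0 < nrm x by rewrite lt_def nrm_eq0 x0 nrm_ge0.
rewrite -ler_pdivrMr//; apply: sup_upper_bound; first exact: opn_hs.
exists (sv (nrm x)^-1 x) => /=.
 by rewrite normE nrm_sv ger0_norm ?invr_ge0 ?nrm_ge0// mulVf ?gt_eqF// rmorph1.
by rewrite opsv -/(nrm _) nrm_sv ger0_norm ?invr_ge0 ?nrm_ge0// mulrC.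
Qed.

Lemma opn_lub T C : 0 <= C -> (forall x, nrm (T x) <= C * nrm x) -> opn T <= C.
move=> C0 h; apply: sup_le_ub; first exact: (opn_hs T).1.
move=> _ [x /= x1 <-]; apply: (le_trans (h x)); rewrite ler_piMr//.
by move: x1; rewrite normE (_ : 1 = 1%:C :> R[i])// lecR.
Qed.

Lemma opn_lub_rip T C : 0 <= C -> (forall x y, rip (T x) y <= C * nrm x * nrm y) -> opn T <= C.
move=> C0 h; apply: opn_lub => // x; apply: nrm_dual; first by rewrite mulr_ge0 ?nrm_ge0.
by move=> y; exact: h.
Qed.

Definition op_zero : op.
apply: (@Op (fun=> 0)); apply: (@bounded_operatorP _ _ _ _ 0) => *.
- by rewrite addr0.
- by rewrite sv0.
- by rewrite /iv scaler0.
- by rewrite nrm0 mul0r.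
Defined.

Definition op_one : op.
by apply: (@Op id); apply: (@bounded_operatorP _ _ _ _ 1) => // x; rewrite mul1r. Defined.

Definition op_opp T : op.
apply: (@Op (\- T)); apply: (@bounded_operatorP _ _ _ _ (opn T)) => /=.
- by move=> x y; rewrite opD opprD.
- by move=> c x; rewrite opsv svN.
- by move=> x; rewrite opiv ivN.
- by move=> x; rewrite nrmN opn_le.
Defined.

Definition op_add S T : op.
apply: (@Op (S \+ T)); apply: (@bounded_operatorP _ _ _ _ (opn S + opn T)) => /=.
- by move=> x y; rewrite !opD addrACA.
- by move=> c x; rewrite !opsv svD.
- by move=> x; rewrite !opiv ivD.
- by move=> x; rewrite mulrDl (le_trans (nrmD _ _))// lerD ?opn_le.
Defined.

Definition op_mul S T : op.
apply: (@Op (S \o T)); apply: (@bounded_operatorP _ _ _ _ (opn S * opn T)) => /=.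
- by move=> x y; rewrite !opD.
- by move=> c x; rewrite !opsv.
- by move=> x; rewrite !opiv.
- by move=> x; rewrite (le_trans (opn_le _ _))// -mulrA ler_wpM2l ?opn_ge0 ?opn_le.
Defined.

Definition op_scale c T : op.
apply: (@Op (fun x => sv c (T x))); apply: (@bounded_operatorP _ _ _ _ (`|c| * opn T)) => /=.
- by move=> x y; rewrite !opD svD.
- by move=> d x; rewrite !opsv !svA mulrC.
- by move=> x; rewrite !opiv sv_iv.
- by move=> x; rewrite nrm_sv -mulrA ler_wpM2l ?opn_le.
Defined.

(** Operators form a module over [R] only. Multiplication by [i] is kept as a central operator of
    square -1, and complex combinations are written [S + opJ * T]. *)
Definition opJ : op.
apply: (@Op iv); apply: (@bounded_operatorP _ _ _ _ 1) => /=.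
- exact: ivD.
- by move=> c x; rewrite sv_iv.
- by [].
- by move=> x; rewrite nrm_iv mul1r.
Defined.

Lemma op_addA : associative op_add.
by move=> S T U; apply: op_ext => x /=; rewrite addrA. Qed.
Lemma op_addC : commutative op_add.
by move=> S T; apply: op_ext => x /=; rewrite addrC. Qed.
Lemma op_add0 : left_id op_zero op_add.
by move=> S; apply: op_ext => x /=; rewrite add0r. Qed.
Lemma op_addN : left_inverse op_zero op_opp op_add.
by move=> S; apply: op_ext => x /=; rewrite addNr. Qed.

HB.instance Definition _ := GRing.isZmodule.Build op op_addA op_addC op_add0 op_addN.

Lemma op_mulA : associative op_mul.
by move=> S T U; apply: op_ext. Qed.
Lemma op_mul1 : left_id op_one op_mul.
by move=> S; apply: op_ext. Qed.
Lemma op_mulr1 : right_id op_one op_mul.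
by move=> S; apply: op_ext. Qed.
Lemma op_mulDl : left_distributive op_mul op_add.
by move=> S T U; apply: op_ext. Qed.
Lemma op_mulDr : right_distributive op_mul op_add.
by move=> S T U; apply: op_ext => x /=; rewrite opD. Qed.

HB.instance Definition _ :=
 GRing.Zmodule_isPzRing.Build op op_mulA op_mul1 op_mulr1 op_mulDl op_mulDr.

Lemma op_scaleA c d T : op_scale c (op_scale d T) = op_scale (c * d) T.
by apply: op_ext => x /=; rewrite svA. Qed.
Lemma op_scale1 : left_id 1 op_scale.
by move=> T; apply: op_ext => x /=; rewrite sv1. Qed.
Lemma op_scaleDr : right_distributive op_scale +%R.
by move=> c S T; apply: op_ext => x /=; rewrite svD. Qed.
Lemma op_scaleDl T : {morph op_scale^~ T : c d / c + d}.
by move=> c d; apply: op_ext => x /=; rewrite svDl. Qed.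

HB.instance Definition _ :=
 GRing.Zmodule_isLmodule.Build R op op_scaleA op_scale1 op_scaleDr op_scaleDl.

Lemma opZAl c S T : c *: (S * T) = (c *: S) * T.
exact: op_ext. Qed.
Lemma opZAr c S T : c *: (S * T) = S * (c *: T).
by apply: op_ext => x /=; rewrite opsv. Qed.
Lemma opDE S T x : (S + T) x = S x + T x. by []. Qed.
Lemma opNE T x : (- T) x = - T x. by []. Qed.
Lemma opME S T x : (S * T) x = S (T x). by []. Qed.
Lemma opZE c T x : (c *: T) x = sv c (T x). by []. Qed.
Lemma op1E x : (1 : op) x = x. by []. Qed.
Lemma op0E x : (0 : op) x = 0. by []. Qed.
Definition opE := (opDE, opNE, opME, opZE, op1E, op0E).

Lemma op_comm_app S T : S * T = T * S -> forall x, S (T x) = T (S x).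
by move=> h x; rewrite -opME h. Qed.
Lemma opJC T : opJ * T = T * opJ.
by apply: op_ext => x; rewrite !opE /= opiv. Qed.
Lemma opJJ : opJ * opJ = -1.
by apply: op_ext => x; rewrite !opE /= iv_iv. Qed.

Lemma opn0 : opn 0 = 0.
apply/eqP; rewrite eq_le opn_ge0 andbT; apply: opn_lub => // x.
by rewrite opE nrm0 mul0r.
Qed.

Lemma opn_eq0 T : opn T <= 0 -> T = 0.
move=> h; apply: op_ext => x; apply: nrm0P; apply: (le_trans (opn_le _ _)).
by rewrite mulr_le0_ge0 ?nrm_ge0.
Qed.

Lemma opn1 : opn 1 <= 1.
by apply: opn_lub => // x; rewrite opE mul1r. Qed.

Lemma opnD S T : opn (S + T) <= opn S + opn T.
apply: opn_lub => [|x]; first by rewrite addr_ge0 ?opn_ge0.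
by rewrite opE mulrDl (le_trans (nrmD _ _))// lerD ?opn_le.
Qed.

Lemma opnN T : opn (- T) = opn T.
have h S : opn (- S) <= opn S.
 by apply: opn_lub => [|x]; rewrite ?opn_ge0// opE nrmN opn_le.
by apply/eqP; rewrite eq_le h -{1}(opprK T) h.
Qed.

Lemma opnB S T : opn (S - T) <= opn S + opn T.
by rewrite -(opnN T) opnD. Qed.

Lemma opnM S T : opn (S * T) <= opn S * opn T.
apply: opn_lub => [|x]; first by rewrite mulr_ge0 ?opn_ge0.
by rewrite opE (le_trans (opn_le _ _))// -mulrA ler_wpM2l ?opn_ge0 ?opn_le.
Qed.

Lemma opnZ c T : opn (c *: T) <= `|c| * opn T.
apply: opn_lub => [|x]; first by rewrite mulr_ge0 ?opn_ge0.
by rewrite opE nrm_sv -mulrA ler_wpM2l ?opn_le.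
Qed.

Lemma op_cvg T u x : hcvg u x -> hcvg (fun n => T (u n)) (T x).
by apply: (@hcvg_le _ _ _ _ _ _ (opn T)) => n; rewrite -opB opn_le. Qed.

Lemma mk_op (f : E -> E) C : (forall x y, f (x + y) = f x + f y) ->
 (forall c x, f (sv c x) = sv c (f x)) -> (forall x, f (iv x) = iv (f x)) ->
 (forall x, nrm (f x) <= C * nrm x) -> exists T : op, forall x, T x = f x.
by move=> h1 h2 h3 h4; exists (Op (bounded_operatorP h1 h2 h3 h4)). Qed.

Lemma riesz (l : E -> R) C : (forall x y, l (x + y) = l x + l y) ->
 (forall c x, l (sv c x) = c * l x) ->
 (forall x, `|l x| <= C * nrm x) -> exists y, forall x, l x = rip x y.
move=> h1 h2 h3; have [//|y _ hy] := @riesz_subspace _ _ setT l C _ h1 h2 h3.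
by exists y => x; exact: hy.
Qed.

(** Riesz's theorem in the second variable; the hypothesis on [iv] is what makes the resulting
    real-linear map complex linear. *)
Lemma form_op (b : E -> E -> R) C :
 (forall x y z, b (x + y) z = b x z + b y z) -> (forall c x z, b (sv c x) z = c * b x z) ->
 (forall x y z, b z (x + y) = b z x + b z y) -> (forall c x z, b z (sv c x) = c * b z x) ->
 (forall x y, b (iv x) y = - b x (iv y)) ->
 (forall x y, `|b x y| <= C * nrm x * nrm y) ->
 exists T : op, forall x y, rip (T x) y = b x y.
move=> bDl bZl bDr bZr bi bC.
have ex x : exists v, forall y, b x y = rip y v.
 by apply: (@riesz (b x) (C * nrm x)).
have [f fP] := choice ex.
have fP' x y : rip (f x) y = b x y by rewrite ripC -fP.
have [] := @mk_op f `|C|.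
- by move=> x y; apply: rip_ext => z; rewrite ripDl !fP' bDl.
- by move=> c x; apply: rip_ext => z; rewrite ripZl !fP' bZl.
- by move=> x; apply: rip_ext => z; rewrite ripi !fP' bi.
- move=> x; apply: nrm_dual => [|y]; first by rewrite mulr_ge0 ?nrm_ge0.
 rewrite fP' (le_trans (ler_norm _))// (le_trans (bC _ _))//.
 by rewrite ler_wpM2r ?nrm_ge0// ler_wpM2r ?nrm_ge0// ler_norm.
by move=> T hT; exists T => x y; rewrite hT fP'.
Qed.

Lemma adj_exists T : exists T', forall x y, rip (T' x) y = rip x (T y).
apply: (@form_op (fun x y => rip x (T y)) (opn T)).
- by move=> *; rewrite ripDl.
- by move=> *; rewrite ripZl.
- by move=> *; rewrite opD ripDr.
- by move=> *; rewrite opsv ripZr.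
- by move=> *; rewrite opiv ripi.
- move=> x y; rewrite (le_trans (rip_abs _ _))// mulrAC mulrC.
 by rewrite ler_wpM2r ?nrm_ge0// opn_le.
Qed.

Definition adj T : op := sval (cid (adj_exists T)).
Local Notation "T ^†" := (adj T) (at level 1, format "T ^†").

Lemma adjP T x y : rip (T^† x) y = rip x (T y).
by rewrite /adj; case: cid. Qed.
Lemma adjP' T x y : rip (T x) y = rip x (T^† y).
by rewrite ripC -adjP ripC. Qed.
Lemma adj_uniq T S : (forall x y, rip (T x) y = rip x (S y)) -> T^† = S.
by move=> h; apply: op_ext => x; apply: rip_ext => y; rewrite adjP ripC h ripC. Qed.
Lemma adjK T : T^†^† = T.
by apply: adj_uniq => x y; rewrite adjP. Qed.
Lemma adjD S T : (S + T)^† = S^† + T^†.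
by apply: adj_uniq => x y; rewrite !opE ripDl ripDr !adjP'. Qed.
Lemma adjN T : (- T)^† = - T^†.
by apply: adj_uniq => x y; rewrite !opE ripNl ripNr !adjP'. Qed.
Lemma adjB S T : (S - T)^† = S^† - T^†.
by rewrite adjD adjN. Qed.
Lemma adjM S T : (S * T)^† = T^† * S^†.
by apply: adj_uniq => x y; rewrite !opE !adjP'. Qed.
Lemma adjZ c T : (c *: T)^† = c *: T^†.
by apply: adj_uniq => x y; rewrite !opE ripZl ripZr !adjP'. Qed.
Lemma adj1 : 1^† = 1. exact: adj_uniq. Qed.
Lemma adj0 : 0^† = 0.
by apply: adj_uniq => x y; rewrite !opE rip0l rip0r. Qed.
Lemma adjJ : opJ^† = - opJ.
by apply: adj_uniq => x y; rewrite !opE /= ripi ripNr. Qed.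
Lemma adjX T n : (T ^+ n)^† = (T^†) ^+ n.
by elim: n => [|n IH]; rewrite ?expr0 ?adj1// exprS adjM IH -exprSr. Qed.

Lemma opn_adj T : opn (T^†) = opn T.
have h S : opn (S^†) <= opn S.
 apply: opn_lub_rip => [|x y]; first exact: opn_ge0.
 rewrite adjP (le_trans (rip_le _ _))// [leRHS]mulrAC mulrC ler_wpM2r ?nrm_ge0//.
 exact: opn_le.
by apply/eqP; rewrite eq_le h -{1}(adjK T) h.
Qed.

Definition sa T := T^† = T.

Lemma saP T : sa T <-> forall x y, rip (T x) y = rip x (T y).
by split=> [h x y|h]; [rewrite adjP' h|exact: adj_uniq]. Qed.
Lemma saD S T : sa S -> sa T -> sa (S + T).
by rewrite /sa adjD => -> ->. Qed.
Lemma saN T : sa T -> sa (- T).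
by rewrite /sa adjN => ->. Qed.
Lemma saB S T : sa S -> sa T -> sa (S - T).
by move=> *; apply: saD => //; exact: saN. Qed.
Lemma saZ c T : sa T -> sa (c *: T).
by rewrite /sa adjZ => ->. Qed.
Lemma sa1 : sa 1. exact: adj1. Qed.
Lemma sa0 : sa 0. exact: adj0. Qed.
Lemma saM S T : sa S -> sa T -> S * T = T * S -> sa (S * T).
by rewrite /sa adjM => -> -> ->. Qed.
Lemma sa_conj S T : sa T -> sa (S^† * T * S).
by rewrite /sa !adjM adjK mulrA => ->. Qed.
Lemma sa_sq T : sa (T^† * T).
by rewrite /sa adjM adjK. Qed.

Definition q T x := rip (T x) x.

Lemma polar T x y : sa T -> rip (T x) y = (q T (x + y) - q T (x - y)) / 4.
move=> /saP h; rewrite /q !opD !opN !ripDl !ripDr !ripNl !ripNr.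
by rewrite (ripC (T y) x) -h; field.
Qed.

Lemma sa_ext S T : sa S -> sa T -> (forall x, q S x = q T x) -> S = T.
by move=> hS hT h; apply: op_ext => x; apply: rip_ext => y; rewrite !polar// !h.
Qed.

Definition psd T := sa T /\ forall x, 0 <= q T x.
Definition lop S T := psd (T - S).

Lemma qD S T x : q (S + T) x = q S x + q T x. by rewrite /q opE ripDl. Qed.
Lemma qN T x : q (- T) x = - q T x. by rewrite /q opE ripNl. Qed.
Lemma qZ c T x : q (c *: T) x = c * q T x. by rewrite /q opE ripZl. Qed.
Lemma q1 x : q 1 x = nrm x ^+ 2. by rewrite /q opE rip_nrm. Qed.
Lemma q0 x : q 0 x = 0. by rewrite /q opE rip0l. Qed.
Definition qE := (qD, qN, qZ, q1, q0).

Lemma q_conj S T x : q (S^† * T * S) x = q T (S x).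
by rewrite /q !opE adjP. Qed.
Lemma q_sq T x : q (T^† * T) x = nrm (T x) ^+ 2.
by rewrite /q opE adjP rip_nrm. Qed.
Lemma psd_sq T : psd (T^† * T).
by split=> [|x]; [exact: sa_sq|rewrite q_sq sqr_ge0]. Qed.
Lemma psd_sqs T : sa T -> psd (T * T).
by move=> h; have := psd_sq T; rewrite h. Qed.
Lemma psd_conj S T : psd T -> psd (S^† * T * S).
by move=> [h1 h2]; split=> [|x]; [exact: sa_conj|rewrite q_conj]. Qed.
Lemma psdD S T : psd S -> psd T -> psd (S + T).
by move=> [? h1] [? h2]; split=> [|x]; [exact: saD|rewrite qE addr_ge0]. Qed.
Lemma psdZ c T : 0 <= c -> psd T -> psd (c *: T).
by move=> c0 [? h1]; split=> [|x]; [exact: saZ|rewrite qE mulr_ge0]. Qed.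
Lemma psd0 : psd 0. by split=> [|x]; [exact: sa0|rewrite qE]. Qed.
Lemma psd1 : psd 1. by split=> [|x]; [exact: sa1|rewrite qE sqr_ge0]. Qed.
Lemma lopP S T : sa S -> sa T -> (forall x, q S x <= q T x) -> lop S T.
by move=> hS hT h; split=> [|x]; [exact: saB|rewrite !qE subr_ge0]. Qed.
Lemma lop_q S T x : lop S T -> q S x <= q T x.
by move=> [_ /(_ x)]; rewrite !qE subr_ge0. Qed.
Lemma lop_trans S T U : lop S T -> lop T U -> lop S U.
by rewrite /lop => h1 h2; have := psdD h2 h1; rewrite addrA subrK. Qed.
Lemma lop_conj S T U : lop S T -> lop (U^† * S * U) (U^† * T * U).
by move=> h; have := psd_conj U h; rewrite mulrBr mulrBl. Qed.

Lemma q_abs T x : `|q T x| <= opn T * nrm x ^+ 2.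
by rewrite (le_trans (rip_abs _ _))// expr2 mulrA ler_wpM2r ?nrm_ge0// opn_le.
Qed.

Lemma psd_cs T x y : psd T -> rip (T x) y ^+ 2 <= q T x * q T y.
move=> [/saP h1 h2].
have hq t : 0 <= q T x + 2 * t * rip (T x) y + t ^+ 2 * q T y.
 have := h2 (x + sv t y); rewrite /q opD opsv !ripDl !ripDr !ripZl !ripZr.
 rewrite (_ : rip (T y) x = rip (T x) y); last by rewrite h1 ripC.
 by rewrite -/(q T x) -/(q T y); set a := rip _ y; set b := q T x; set c := q T y; lra.
have [y0|y0] := eqVneq (q T y) 0.
 rewrite y0 mulr0; case: (eqVneq (rip (T x) y) 0) => [->|r0]; first by rewrite expr0n.
 (* With [q T y = 0] the quadratic is affine in [t], and this [t] gives it the value -1. *)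
 have := hq (- (q T x + 1) / (2 * rip (T x) y)).
 rewrite y0 mulr0 addr0 (_ : _ + _ = -1); first by rewrite lerNr oppr0 ler10.
 by field; rewrite r0.
have py : 0 < q T y by rewrite lt_def y0 h2.
have := hq (- rip (T x) y / q T y).
rewrite (_ : _ + _ + _ = q T x - rip (T x) y ^+ 2 / q T y); last by field.
by rewrite subr_ge0 ler_pdivrMr.
Qed.

(** Polarization and the parallelogram law bound [rip (T u) v] by [C (|u|^2 + |v|^2) / 2];
    normalizing both vectors turns this into [C |u| |v|]. *)
Lemma sa_opn T C : sa T -> 0 <= C -> (forall x, `|q T x| <= C * nrm x ^+ 2) -> opn T <= C.
move=> hT C0 h; apply: opn_lub_rip => // x y.
have key u v : rip (T u) v <= C * (nrm u ^+ 2 + nrm v ^+ 2) / 2.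
 rewrite (polar _ _ hT); have := h (u + v); have := h (u - v).
 rewrite !ler_norml => /andP[h1 _] /andP[_ h2].
 by move: h1 h2; rewrite (nrm_sqB u v) (nrm_sqD u v); lra.
have [->|x0] := eqVneq x 0; first by rewrite op0 rip0l nrm0 mulr0 mul0r.
have [->|y0] := eqVneq y 0; first by rewrite rip0r nrm0 mulr0.
have px : 0 < nrm x by rewrite lt_def nrm_eq0 x0 nrm_ge0.
have py : 0 < nrm y by rewrite lt_def nrm_eq0 y0 nrm_ge0.
have := key (sv (nrm x)^-1 x) (sv (nrm y)^-1 y).
rewrite opsv ripZl ripZr !nrm_sv !ger0_norm ?invr_ge0 ?nrm_ge0// !mulVf ?gt_eqF// expr1n.
rewrite (_ : C * (1 + 1) / 2 = C); last by field.
by rewrite ler_pdivrMl// ler_pdivrMl// => /le_trans; apply; apply: eqW; ring.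
Qed.

Lemma lop_opn T C : psd T -> lop T (C *: (1 : op)) -> 0 <= C -> opn T <= C.
move=> pT h C0; apply: sa_opn => // [|x]; first exact: pT.1.
by rewrite ger0_norm ?pT.2//; have := lop_q x h; rewrite !qE.
Qed.

Lemma opn_lop T : sa T -> lop T (opn T *: (1 : op)).
move=> h; apply: lopP => // [|x]; first by apply: saZ; exact: sa1.
by rewrite !qE; apply: le_trans (q_abs T x); rewrite ler_norm.
Qed.

Lemma opn_lopN T : sa T -> lop (- (opn T *: (1 : op))) T.
move=> h; apply: lopP => // [|x]; first by apply/saN/saZ; exact: sa1.
by rewrite !qE; have := q_abs T x; rewrite ler_norml => /andP[].
Qed.

(** Cauchy-Schwarz for the form of [T] at [x] and [T x]. In [monotone_limit] it upgrades convergence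
    of quadratic forms to strong convergence. *)
Lemma nrm_sq_psd T x : psd T -> nrm (T x) ^+ 2 <= opn T * q T x.
move=> pT; have h := psd_cs x (T x) pT; rewrite rip_nrm in h.
have hq : q T (T x) <= opn T * nrm (T x) ^+ 2.
 by apply: le_trans (q_abs T _); rewrite ler_norm.
have [t0|t0] := eqVneq (nrm (T x)) 0; first by rewrite t0 expr0n mulr_ge0 ?opn_ge0 ?pT.2.
have pt : 0 < nrm (T x) ^+ 2 by rewrite exprn_gt0// lt_def t0 nrm_ge0.
rewrite -(ler_pM2r pt) -expr2 (le_trans h)// [leRHS]mulrAC [leRHS]mulrC.
by rewrite ler_wpM2l ?pT.2.
Qed.

End Operators.
Arguments op {R} E.
Notation "T ^†" := (adj T) (at level 1, format "T ^†") : ring_scope.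

(* Noncommutative identities become commutative ones on the matrix entries [rip (T x) y]. *)
Ltac opexp := rewrite ?(opE, opD, opN, opsv, op0, ripDl, ripNl, ripZl, rip0l).
Ltac opring := apply: op_ext => ?; apply: rip_ext => ?; opexp; ring.
Global Opaque adj op_add op_opp op_mul op_scale op_one op_zero.

(** * Weak and strong limits, square roots, projections *)

Section Limits.
Context {R : realType} {E : hilbert R}.
Implicit Types (S T A B P Z : op E) (u v : nat -> op E) (x y : E) (c : R).

Definition wcvg u T := forall x y, (fun n => rip (u n x) y) @ \oo --> rip (T x) y.
Definition scvg u T := forall x, hcvg (fun n => u n x) (T x).

Lemma scvg_wcvg u T : scvg u T -> wcvg u T.
by move=> h x y; apply: rip_cvg. Qed.
Lemma wcvg_q u T x : wcvg u T -> (fun n => q (u n) x) @ \oo --> q T x.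
by move=> h; exact: h. Qed.
Lemma scvg_uniq u S T : scvg u S -> scvg u T -> S = T.
by move=> h1 h2; apply: op_ext => x; exact: hcvg_unique (h1 x) (h2 x). Qed.

Lemma wcvg_uniq u S T : wcvg u S -> wcvg u T -> S = T.
move=> h1 h2; apply: op_ext => x; apply: rip_ext => y.
by have a1 := h1 x y; have a2 := h2 x y; apply: (@cvg_eq_lim _ _ _ _ a1 a2).
Qed.

Lemma scvg_cst T : scvg (fun=> T) T.
by move=> x; exact: hcvg_cst. Qed.
Lemma scvgD u v S T : scvg u S -> scvg v T -> scvg (fun n => u n + v n) (S + T).
by move=> h1 h2 x; exact: hcvgD. Qed.
Lemma scvgN u S : scvg u S -> scvg (fun n => - u n) (- S).
by move=> h1 x; exact: hcvgN. Qed.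

Lemma scvgZ c u S : scvg u S -> scvg (fun n => c *: u n) (c *: S).
move=> h x; apply: (@hcvg_le _ _ _ _ _ _ `|c|) (h x) => n.
by rewrite !opE -svN -svD nrm_sv.
Qed.

Lemma scvgM u v S T C : (forall n, opn (u n) <= C) -> scvg u S -> scvg v T ->
 scvg (fun n => u n * v n) (S * T).
move=> hC h1 h2 x.
apply: (@cvg_squeeze0 _ _ (fun n => C * nrm (v n x - T x) + nrm (u n (T x) - S (T x)))).
 move=> n; rewrite ger0_norm ?nrm_ge0// !opE.
 rewrite -(subrK (u n (T x)) (u n (v n x))) -addrA (le_trans (nrmD _ _))// lerD//.
 by rewrite -opB (le_trans (opn_le _ _))// ler_wpM2r ?nrm_ge0.
rewrite -[X in _ --> X]addr0; apply: cvgD; last exact: h1.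
by apply: cvg_scale0; exact: h2.
Qed.

Lemma scvgMl u S T : scvg u S -> scvg (fun n => T * u n) (T * S).
by apply: (@scvgM (fun=> T) u T S (opn T)) => //; exact: scvg_cst. Qed.
Lemma scvgMr u S T : scvg u S -> scvg (fun n => u n * T) (S * T).
by move=> h x; exact: h. Qed.

Lemma wcvg_sa u T : (forall n, sa (u n)) -> wcvg u T -> sa T.
move=> h1 h2; apply/saP => x y; have a1 := h2 x y; have a2 := h2 y x.
rewrite (ripC x); apply: (@cvg_eq_lim _ _ _ _ a1).
rewrite (_ : (fun n => _) = (fun n => rip (u n y) x)) //; apply/funext => n.
by have /saP -> := h1 n; rewrite ripC.
Qed.

Lemma weak_limit u C : (forall n, opn (u n) <= C) ->
 (forall x y, cvgn (fun n => rip (u n x) y)) ->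
 exists T, wcvg u T.
move=> hC hc; pose b x y := limn (fun n => rip (u n x) y).
have bP x y : (fun n => rip (u n x) y) @ \oo --> b x y by exact: hc.
have blim x y (f : nat -> R) l : (forall n, rip (u n x) y = f n) -> f @ \oo --> l -> b x y = l.
 move=> hf hl; apply: (@cvg_eq_lim _ _ _ _ (bP x y)).
 by rewrite (_ : (fun n => _) = f)//; apply/funext.
have [T hT] : exists T : op E, forall x y, rip (T x) y = b x y.
 apply: (@form_op _ _ _ C).
 - move=> x y z; apply: (blim _ _ (fun n => rip (u n x) z + rip (u n y) z)).
   by move=> n; rewrite opD ripDl.
  exact: cvgD.
 - move=> c x z; apply: (blim _ _ (fun n => c * rip (u n x) z)).
   by move=> n; rewrite opsv ripZl.
  exact: cvg_scale.
 - move=> x y z; apply: (blim _ _ (fun n => rip (u n z) x + rip (u n z) y)).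
   by move=> n; rewrite ripDr.
  exact: cvgD.
 - move=> c x z; apply: (blim _ _ (fun n => c * rip (u n z) x)).
   by move=> n; rewrite ripZr.
  exact: cvg_scale.
 - move=> x y; apply: (blim _ _ (fun n => - rip (u n x) (iv y))).
   by move=> n; rewrite opiv ripi.
  exact: cvgN.
 - move=> x y; have h n : `|rip (u n x) y| <= C * nrm x * nrm y.
   rewrite (le_trans (rip_abs _ _))// ler_wpM2r ?nrm_ge0// (le_trans (opn_le _ _))//.
   by rewrite ler_wpM2r ?nrm_ge0.
  rewrite ler_norml; apply/andP; split.
   by apply: (cvg_ge_cst _ (bP x y)) => n; have := h n; rewrite ler_norml => /andP[].
  by apply: (cvg_le_cst _ (bP x y)) => n; have := h n; rewrite ler_norml => /andP[].
by exists T => x y; rewrite hT.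
Qed.

Lemma wcvg_opn u T C : 0 <= C -> (forall n, opn (u n) <= C) -> wcvg u T -> opn T <= C.
move=> C0 hC h; apply: opn_lub_rip => // x y.
apply: (cvg_le_cst _ (h x y)) => n; rewrite (le_trans (rip_le _ _))// ler_wpM2r ?nrm_ge0//.
by rewrite (le_trans (opn_le _ _))// ler_wpM2r ?nrm_ge0.
Qed.

Lemma sa_wcvg u T : (forall n, sa (u n)) -> sa T ->
 (forall x, (fun n => q (u n) x) @ \oo --> q T x) -> wcvg u T.
move=> su sT h x y; rewrite (polar _ _ sT).
rewrite (_ : (fun n => _) = (fun n => (q (u n) (x + y) - q (u n) (x - y)) / 4)).
 by apply: cvgM; [apply: cvgB|exact: cvg_cst].
by apply/funext => n; rewrite (polar _ _ (su n)).
Qed.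

Lemma sa_weak_limit u C : (forall n, sa (u n)) -> (forall n, opn (u n) <= C) ->
 (forall x, cvgn (fun n => q (u n) x)) ->
 exists2 T, sa T & wcvg u T.
move=> su hC hc; have [|T hT] := weak_limit hC; last by exists T => //; exact: wcvg_sa hT.
move=> x y; rewrite (_ : (fun n => _) = (fun n => (q (u n) (x + y) - q (u n) (x - y)) / 4)).
 by apply: is_cvgM; [apply: is_cvgB; exact: hc|exact: is_cvg_cst].
by apply/funext => n; rewrite (polar _ _ (su n)).
Qed.

Lemma monotone_limit u C : (forall n, sa (u n)) -> (forall n, opn (u n) <= C) ->
 (forall n x, q (u n) x <= q (u n.+1) x) ->
 exists T, [/\ sa T, scvg u T & forall n, lop (u n) T].
move=> su hC hm.
have nd x : {homo (fun n => q (u n) x) : n m / (n <= m)%N >-> n <= m}.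
 by apply/nondecreasing_seqP => n.
have C0 : 0 <= C by apply: le_trans (hC 0%N); exact: opn_ge0.
have hc x : cvgn (fun n => q (u n) x).
 apply: nondecreasing_is_cvgn; first exact: nd.
 exists (C * nrm x ^+ 2) => _ [n _ <-].
 rewrite (le_trans (ler_norm _))// (le_trans (q_abs _ _))//.
 by rewrite ler_wpM2r ?sqr_ge0.
have [T sT wT] := sa_weak_limit su hC hc.
have le n : lop (u n) T.
 apply: lopP => // x; have h := nondecreasing_cvgn_le (nd x) (hc x) n.
 apply: (le_trans h); rewrite le_eqVlt; apply/orP; left; apply/eqP.
 by apply: cvg_lim => //; exact: wcvg_q.
exists T; split=> // x.
pose K := opn T + C.
have hq n : nrm (u n x - T x) ^+ 2 <= K * (q T x - q (u n) x).
 rewrite nrmC -[T x - u n x]/((T - u n) x).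
 rewrite (le_trans (nrm_sq_psd x (le n)))// !qE ler_wpM2r//.
  by have := lop_q x (le n); rewrite subr_ge0.
 by rewrite (le_trans (opnB _ _))// lerD2l.
have h0 : (fun n => K * (q T x - q (u n) x)) @ \oo --> (0 : R).
 apply: cvg_scale0; rewrite -(subrr (q T x)); apply: cvgB; first exact: cvg_cst.
 exact: wT.
apply/hcvgP => e e0; move/cvgrPdist_lt : h0 => /(_ (e ^+ 2)).
rewrite exprn_gt0// => /(_ isT) [N _ hN]; exists N => n Nn.
rewrite -(@ltr_pXn2r _ 2)// ?nnegrE ?nrm_ge0 ?(ltW e0)// (le_lt_trans (hq n))//.
have := hN n Nn; rewrite /= sub0r normrN; apply: le_lt_trans; exact: ler_norm.
Qed.

Lemma antitone_limit u C : (forall n, sa (u n)) -> (forall n, opn (u n) <= C) ->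
 (forall n x, q (u n.+1) x <= q (u n) x) ->
 exists T, [/\ sa T, scvg u T & forall n, lop T (u n)].
move=> su hC hm; have [|n|n x|T [sT cT lT]] := @monotone_limit (fun n => - u n) C.
- by move=> n; exact: saN.
- by rewrite opnN.
- by rewrite !qE lerN2.
exists (- T); split; first exact: saN.
 by move=> x; have := scvgN cT x; under eq_fun do rewrite !opE opprK.
by move=> n; have := lT n; rewrite /lop !opprK addrC.
Qed.

(** Polynomials in [A] with nonnegative coefficients. The approximants of the square root and their
    increments stay in this cone, so they commute and are positive for a reason that does not
    involve [psdM], which itself rests on square roots. *)
Inductive cone A : op E -> Prop :=
| cone_X n : cone A (A ^+ n)
| cone_D S T : cone A S -> cone A T -> cone A (S + T)
| cone_Z c S : 0 <= c -> cone A S -> cone A (c *: S).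

Lemma cone_mul A S T : cone A S -> cone A T -> cone A (S * T).
elim=> {S} [n|S S' _ h1 _ h2|c S c0 _ h] hT; last by rewrite -opZAl; apply: cone_Z => //; exact: h.
 elim: hT => {T} [m|T T' _ h1 _ h2|c T c0 _ h].
 - by rewrite -exprD; exact: cone_X.
 - by rewrite mulrDr; exact: cone_D.
 - by rewrite -opZAr; exact: cone_Z.
by rewrite mulrDl; apply: cone_D; [exact: h1|exact: h2].
Qed.

Lemma psdX A n : psd A -> psd (A ^+ n).
move=> pA; have sk k : (A ^+ k)^† = A ^+ k by rewrite adjX pA.1.
rewrite -(odd_double_half n) exprD -mul2n mulnC exprM expr2.
case: (odd n); last by rewrite expr0 mul1r; have := psd_sq (A ^+ n./2); rewrite sk.
have := psd_conj (A ^+ n./2) pA; rewrite sk expr1 -exprSr.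
by rewrite exprS -mulrA.
Qed.

Lemma cone_psd A S : psd A -> cone A S -> psd S.
move=> pA; elim=> [n|? ? _ h1 _ h2|c ? c0 _ h]; [exact: psdX|exact: psdD|exact: psdZ].
Qed.

Lemma cone_comm A S Z : cone A S -> Z * A = A * Z -> Z * S = S * Z.
move=> h zA; elim: h => [n|? ? _ h1 _ h2|c ? c0 _ h].
- by apply: commrX; exact: zA.
- by rewrite mulrDr mulrDl h1 h2.
- by rewrite -opZAr h opZAl.
Qed.

Lemma cone_self A : cone A A.
by have := cone_X A 1; rewrite expr1. Qed.
Lemma cone_commute A S T : cone A S -> cone A T -> S * T = T * S.
by move=> hS hT; apply: (cone_comm hT); apply/esym/(cone_comm hS). Qed.

Lemma scvg_comm u T Z : (forall n, Z * u n = u n * Z) -> scvg u T -> Z * T = T * Z.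
move=> h hu; have := scvgMl Z hu; have := scvgMr Z hu.
rewrite (_ : (fun n => u n * Z) = (fun n => Z * u n)); last by apply/funext => n; rewrite h.
by move=> h1 h2; exact: scvg_uniq h2 h1.
Qed.

(** With [A = 1 - S], the iteration [Y' = (A + Y^2) / 2] started at 0 increases to a solution of
    [2 L = A + L^2], that is [(1 - L)^2 = S]. *)
Lemma sqrt_contr S : psd S -> lop S 1 ->
 exists B, [/\ psd B, B * B = S & forall Z, Z * S = S * Z -> Z * B = B * Z].
move=> pS S1; pose A := 1 - S; have pA : psd A by exact: S1.
pose Y := fix Y n := if n is n'.+1 then 2^-1 *: (A + Y n' * Y n') else 0 : op E.
have cY n : cone A (Y n).
 elim: n => [|n IH] /=; first by rewrite -(scale0r A); apply: cone_Z => //; exact: cone_self.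
 by apply: cone_Z => //; apply: cone_D; [exact: cone_self|exact: cone_mul].
have dY n : cone A (Y n.+1 - Y n).
 elim: n => [|n IH].
  rewrite /= subr0 mulr0 addr0; apply: cone_Z => //; exact: cone_self.
 have -> : Y n.+2 - Y n.+1 = 2^-1 *: ((Y n.+1 - Y n) * (Y n.+1 + Y n)).
  have YY := cone_commute (cY n) (cY n.+1).
  have e1 : Y n.+2 = 2^-1 *: (A + Y n.+1 * Y n.+1) by [].
  have e0 : Y n.+1 = 2^-1 *: (A + Y n * Y n) by [].
  rewrite e1 {3}e0 mulrDr !mulrBl YY; move: (Y n.+1) (Y n) => a b; opring.
 by apply: cone_Z => //; apply: cone_mul => //; apply: cone_D.
have A1 : opn A <= 1.
 apply: lop_opn => //; rewrite scale1r /lop /A opprB addrCA subrr addr0; exact: pS.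
have nY n : opn (Y n) <= 1.
 elim: n => [|n IH] /=; first by rewrite opn0.
 rewrite (le_trans (opnZ _ _))// ger0_norm ?invr_ge0//.
 rewrite mulrC ler_pdivrMr// mul1r (le_trans (opnD _ _))// (_ : 2 = 1 + 1)// lerD//.
 by rewrite (le_trans (opnM _ _))// mulr_ile1 ?opn_ge0.
have [|n x|L [sL cL lL]] := @monotone_limit Y 1 _ nY.
- by move=> n; have [] := cone_psd pA (cY n).
- by have := (cone_psd pA (dY n)).2 x; rewrite !qE subr_ge0.
have L1 : opn L <= 1 by apply: (wcvg_opn ler01 nY); exact: scvg_wcvg.
have eL : L = 2^-1 *: (A + L * L).
 apply: (@scvg_uniq (fun n => Y n.+1)).
  move=> x; apply/hcvgP => e e0; have /hcvgP /(_ e e0) [N hN] := cL x.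
  by exists N => n Nn; apply: hN; exact: leqW.
 by apply: scvgZ; apply: scvgD; [exact: scvg_cst|exact: (@scvgM _ _ _ _ 1)].
exists (1 - L); split.
- split=> [|x]; first by apply: saB => //; exact: sa1.
 rewrite !qE subr_ge0; apply: le_trans (ler_norm _) _.
 by apply: le_trans (q_abs _ _) _; rewrite ler_piMl ?sqr_ge0.
- have e2 : A + L * L = L + L.
  by rewrite (_ : L + L = 2 *: L); [rewrite {3}eL scalerA divff ?scale1r// pnatr_eq0|opring].
 have -> : S = 1 - (L + L - L * L) by rewrite -e2 addrK /A opprB addrC subrK.
 opring.
- move=> Z ZS; rewrite mulrBr mulrBl mulr1 mul1r; congr (_ - _).
 apply: scvg_comm cL => n; apply: (cone_comm (cY n)).
 by rewrite /A mulrBr mulrBl ZS mulr1 mul1r.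
Qed.

Lemma sqrt_exists S : psd S ->
 exists B, [/\ psd B, B * B = S & forall Z, Z * S = S * Z -> Z * B = B * Z].
move=> pS; pose c := opn S + 1; have c0 : 0 < c by rewrite ltr_wpDl ?opn_ge0.
have [||B [pB BB cB]] := @sqrt_contr (c^-1 *: S).
- by apply: psdZ => //; rewrite invr_ge0 ltW.
- apply: lopP; [by apply: saZ; exact: pS.1|exact: sa1|move=> x].
 rewrite !qE ler_pdivrMl// (le_trans (ler_norm _))// (le_trans (q_abs _ _))//.
 by rewrite ler_wpM2r ?sqr_ge0// lerDl.
exists (Num.sqrt c *: B); split.
- by apply: psdZ => //; exact: sqrtr_ge0.
- by rewrite -opZAl -opZAr scalerA -expr2 sqr_sqrtr ?(ltW c0)// BB scalerA mulfV ?gt_eqF// scale1r.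
- move=> Z ZS; rewrite -opZAr -opZAl; congr (_ *: _); apply: cB.
 by rewrite -opZAr -opZAl ZS.
Qed.

(** [S * T] is the conjugate of [T] by the square root of [S], which commutes with [T]. *)
Lemma psdM S T : psd S -> psd T -> S * T = T * S -> psd (S * T).
move=> pS pT ST; have [B [pB BB cB]] := sqrt_exists pS.
rewrite -BB -mulrA -(cB T) ?ST// mulrA -{1}pB.1; exact: psd_conj.
Qed.

Definition proj P := sa P /\ P * P = P.

Lemma proj_psd P : proj P -> psd P.
by move=> [sP PP]; rewrite -PP; exact: psd_sqs. Qed.

Lemma projC P : proj P -> proj (1 - P).
move=> [sP PP]; split; first by apply: saB => //; exact: sa1.
by rewrite mulrBr mulr1 mulrBl PP mul1r subrr subr0.
Qed.

Lemma proj_q P x : proj P -> q P x = nrm (P x) ^+ 2.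
by move=> [sP PP]; rewrite -{1}PP -{1}sP q_sq. Qed.
Lemma proj_le1 P : proj P -> lop P 1.
by move=> pP; apply: proj_psd; exact: projC. Qed.

Lemma proj_opn P : proj P -> opn P <= 1.
by move=> pP; apply: lop_opn => //; [exact: proj_psd|rewrite scale1r; exact: proj_le1].
Qed.

Lemma proj_id P x : proj P -> P (P x) = P x.
by move=> [_ PP]; rewrite -opME PP. Qed.

Lemma subspace_proj (V : set E) : subspace V -> (forall x, V x -> V (iv x)) ->
 exists P, [/\ proj P, forall x, V (P x) & forall x, V x -> P x = x].
move=> sV Vi.
have ex (v : E) : exists y, V y /\ forall x, V x -> rip x v = rip x y.
 have [y Vy hy] := @riesz_subspace _ _ V (fun x => rip x v) (nrm v) sV
  (fun x y => ripDl x y v) (fun c x => ripZl c x v) (fun x => eq_ind_r (fun t => _ <= t) (rip_abs x v) (mulrC _ _)).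
 by exists y.
have [f fP] := choice ex.
have Vf x : V (f x) by have [] := fP x.
have ff x y : V y -> rip y (f x) = rip y x by move=> Vy; rewrite (fP x).2.
have uniq a b : V a -> V b -> (forall y, V y -> rip y a = rip y b) -> a = b.
 move=> Va Vb h; apply/eqP; rewrite -subr_eq0 -nrm_eq0 -sqrf_eq0 -rip_nrm ripBr h ?subrr//.
 by apply: (subD sV) => //; rewrite -scaleN1r -[-1](rmorphN1 (real_complex R)); exact: (subZ sV).
have [] := @mk_op _ _ f 1.
- by move=> x y; apply: uniq => //; [exact: (subD sV)|move=> z Vz; rewrite ripDr !ff// ripDr].
- by move=> c x; apply: uniq => //; [exact: (subZ sV)|move=> z Vz; rewrite ripZr !ff// ripZr].
- move=> x; apply: uniq => //; [exact: Vi|move=> z Vz].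
 by rewrite ff// -[LHS]opprK -ripi -[RHS]opprK -ripi ff//; exact: Vi.
- move=> x; rewrite mul1r; have [->|x0] := eqVneq (f x) 0; first by rewrite nrm0 nrm_ge0.
 have p0 : 0 < nrm (f x) by rewrite lt_def nrm_eq0 x0 nrm_ge0.
 by rewrite -(ler_pM2l p0) -expr2 -rip_nrm ff// rip_le.
move=> P hP; exists P.
have Pid x : V x -> P x = x by move=> Vx; rewrite hP; apply: uniq => // y Vy; rewrite ff.
split=> //; last by move=> x; rewrite hP.
split; last by apply: op_ext => x; rewrite opE Pid// hP.
by apply/saP => x y; rewrite !hP -(ff y (f x))// ripC (ff x)// ripC.
Qed.

(** An operator commuting with [A] preserves the kernel, and so does its adjoint because [A] is
    self-adjoint; hence it commutes with the projection. If [W * A = 0], the adjoint of [W] has its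
    range in the kernel, which gives the last clause. *)
Lemma ker_proj A : sa A ->
 exists P, [/\ proj P, A * P = 0, (forall x, A x = 0 -> P x = x),
  (forall Z, Z * A = A * Z -> Z * P = P * Z) & (forall W, W * A = 0 -> W * P = W)].
move=> sA; have [||P [pP hP hP']] := @subspace_proj [set x | A x = 0].
- split=> /=; [by rewrite op0|by move=> x y; rewrite opD => -> ->; rewrite addr0| |].
  by move=> c x; rewrite opsv => ->; rewrite sv0.
 move=> u x hu ux; apply: (@hcvg_unique _ _ (fun n => A (u n))); first exact: op_cvg.
 by rewrite (_ : (fun n => _) = (fun=> 0)); [exact: hcvg_cst|apply/funext].
- by move=> x /=; rewrite opiv => ->; rewrite /iv scaler0.
exists P; split=> //; first by apply: op_ext => x; rewrite opE hP.
- move=> Z ZA.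
 have key W : W * A = A * W -> W * P = P * (W * P).
  move=> WA; apply: op_ext => x; rewrite !opE (hP' (W (P x)))//=.
  by rewrite -[A (W _)]/((A * W) _) -WA opE hP op0.
 have k1 := key Z ZA.
 have k2 : Z^† * P = P * (Z^† * P) by apply: key; rewrite -{1}sA -adjM -ZA adjM sA.
 have := congr1 adj k2; rewrite !adjM adjK pP.1 => k3.
 by rewrite k1 k3 mulrA.
- move=> W WA; have h : P * W^† = W^†.
  by apply: op_ext => x; rewrite opE hP'//= -opME -{1}sA -adjM WA adj0.
 by have := congr1 adj h; rewrite adjM adjK pP.1.
Qed.

End Limits.

(** * Unbounded self-adjoint operators and the resolvent of the square *)

Section Unbounded.
Context {R : realType} {E : hilbert R}.
Implicit Types (S T A B P Z : op E) (x y v w : E) (c : R).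

Definition usa (D : unbounded_operator E) := self_adjoint_unbounded (hdot E) D.

Variables (D : unbounded_operator E) (sD : usa D).

Let Dlin := let: And4 _ h _ _ := sD in h.

Lemma udom0 : dom D 0. by case: sD. Qed.
Lemma udomD x y : dom D x -> dom D y -> dom D (x + y) /\ D (x + y) = D x + D y.
by move=> dx dy; have := Dlin 1 dx dy; rewrite !scale1r. Qed.

Lemma uD0 : D 0 = 0.
have [_ ] := udomD udom0 udom0; rewrite addr0 => /eqP.
by rewrite -subr_eq0 opprD addrA subrr sub0r oppr_eq0 => /eqP.
Qed.

Lemma udomZ (a : R[i]) x : dom D x -> dom D (a *: x) /\ D (a *: x) = a *: D x.
by move=> dx; have := Dlin a dx udom0; rewrite !addr0 uD0 addr0. Qed.
Lemma udomN x : dom D x -> dom D (- x) /\ D (- x) = - D x.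
by move=> /(udomZ (-1)); rewrite !scaleN1r. Qed.
Lemma udomB x y : dom D x -> dom D y -> dom D (x - y) /\ D (x - y) = D x - D y.
by move=> dx /udomN [h1 h2]; have := udomD dx h1; rewrite h2. Qed.
Lemma udomsv c x : dom D x -> dom D (sv c x) /\ D (sv c x) = sv c (D x).
exact: udomZ. Qed.
Lemma udomiv x : dom D x -> dom D (iv x) /\ D (iv x) = iv (D x).
exact: udomZ. Qed.

Lemma usym x y : dom D x -> dom D y -> rip (D x) y = rip x (D y).
move=> dx dy; case: sD => _ _ _ h; have [_ h2] := h y (D y).
by rewrite /rip; congr complex.Re; apply: h2.
Qed.

(** Testing against real parts suffices: replacing [x] by [iv x] recovers the imaginary part. *)
Lemma umax y z : (forall x, dom D x -> rip (D x) y = rip x z) -> dom D y /\ D y = z.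
move=> h; case: sD => _ _ _ hs; have [h1 _] := hs y z.
have [|h2 h3] := h1; last by [].
move=> x dx; rewrite !hdotE h//; congr (_ +i* _).
have [d1 d2] := udomiv dx.
by rewrite -[LHS]opprK -ripi -d2 h// ripi opprK.
Qed.

Lemma uclosed (u : nat -> E) x z : (forall n, dom D (u n)) -> hcvg u x ->
 hcvg (fun n => D (u n)) z -> dom D x /\ D x = z.
move=> du ux uz; apply: umax => v dv; rewrite ripC (ripC v).
apply: (@cvg_eq_lim _ (fun n => rip (u n) (D v))); first exact: rip_cvg.
rewrite (_ : (fun n => _) = (fun n => rip (D (u n)) v)); first exact: rip_cvg.
by apply/funext => n; rewrite usym.
Qed.

Lemma udense x (e : R) : 0 < e -> exists2 y, dom D y & nrm (x - y) < e.
move=> e0; case: sD => _ _ dD _.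
have ec : 0 < e%:C by rewrite ltcR.
have [] := dD (ball x e%:C); first by exists x; exact: ballxx.
 exact: ball_open.
by move=> y [+ dy]; rewrite -ball_normE /= normE ltcR => h; exists y.
Qed.

Lemma udense_eq x y : (forall v, dom D v -> rip v x = rip v y) -> x = y.
move=> h; apply/eqP; rewrite -subr_eq0; apply/eqP/nrm0P.
rewrite leNgt; apply/negP => n0.
have [v dv hv] := udense (x - y) n0.
have := nrm_sqB (x - y) v.
have -> : rip (x - y) v = 0 by rewrite ripC ripBr h// subrr.
rewrite mulr0 subr0 => e1.
have : nrm (x - y - v) ^+ 2 < nrm (x - y) ^+ 2.
 by rewrite ltr_pXn2r// nnegrE ?nrm_ge0// ltW.
by rewrite e1 gtrDl ltNge sqr_ge0.
Qed.

(** The vector [y] represents [x |-> rip x v] for the graph inner product of [D]; maximality of [D]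
    then reads [D (D y) = v - y]. *)
Lemma resolvent_ex v : exists y, [/\ dom D y, dom D (D y) & y + D (D y) = v].
have [||||y dy hy] := @riesz_graph _ _ (dom D) D (fun x => rip x v) (nrm v).
- split; [exact: udom0|exact: udomD|exact: udomsv|].
 by move=> u x z; exact: uclosed.
- by move=> x y; rewrite ripDl.
- by move=> c x; rewrite ripZl.
- by move=> x; rewrite mulrC rip_abs.
have [d1 d2] : dom D (D y) /\ D (D y) = v - y.
 by apply: umax => x dx; rewrite ripBr hy// addrAC subrr add0r.
by exists y; split=> //; rewrite d2 addrC subrK.
Qed.

Lemma resolvent_est y : dom D y -> dom D (D y) ->
 nrm y ^+ 2 + nrm (D y) ^+ 2 = rip y (y + D (D y)).
by move=> dy ddy; rewrite ripDr -!rip_nrm -[X in _ = _ + X]usym. Qed.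

Lemma resolvent_bnd y : dom D y -> dom D (D y) ->
 nrm y <= nrm (y + D (D y)) /\ nrm (D y) <= nrm (y + D (D y)).
move=> dy ddy; have h := resolvent_est dy ddy; set v := y + _ in h *.
have h2 := rip_le y v; rewrite -h in h2.
have a0 := nrm_ge0 y; have b0 := nrm_ge0 (D y); have c0 := nrm_ge0 v.
have [y0|y0] := eqVneq (nrm y) 0; first by rewrite y0 in h2 *; split=> //; nra.
have py : 0 < nrm y by rewrite lt_def y0.
have h3 : nrm y <= nrm v by rewrite -(ler_pM2l py); nra.
by split=> //; rewrite -(@ler_pXn2r _ 2)// ?nnegrE//; nra.
Qed.

Lemma resolvent_uniq y y' : dom D y -> dom D (D y) -> dom D y' -> dom D (D y') ->
 y + D (D y) = y' + D (D y') -> y = y'.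
move=> d1 d2 d3 d4 h; have [d5 e5] := udomB d1 d3; have [d6 e6] := udomB d2 d4.
have [] := @resolvent_bnd (y - y') d5; rewrite e5// e6 addrACA -opprD h subrr nrm0.
by move=> /nrm0P /eqP; rewrite subr_eq0 => /eqP.
Qed.

(** [Y] is [(1 + D^2)^-1] and [Z] is [D (1 + D^2)^-1]. This pair of commuting bounded operators
    stands for [D] in the construction of its spectral family. *)
Lemma resolvent_op : exists Y Z : op E, [/\ forall v, dom D (Y v) /\ D (Y v) = Z v,
 forall v, dom D (Z v) /\ D (Z v) = v - Y v, psd Y, sa Z & forall v, Y v = 0 -> v = 0].
have [f fP] := choice resolvent_ex.
have f1 v : dom D (f v) by have [] := fP v.
have f2 v : dom D (D (f v)) by have [] := fP v.
have f3 v : f v + D (D (f v)) = v by have [] := fP v.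
have fD x y : f (x + y) = f x + f y.
 have [d5 e5] := udomD (f1 x) (f1 y); have [d6 e6] := udomD (f2 x) (f2 y).
 by apply: resolvent_uniq => //; rewrite ?e5// f3 e6 addrACA !f3.
have fZ c x : f (sv c x) = sv c (f x).
 have [d5 e5] := udomsv c (f1 x); have [d6 e6] := udomsv c (f2 x).
 by apply: resolvent_uniq => //; rewrite ?e5// f3 e6 -svD !f3.
have fi x : f (iv x) = iv (f x).
 have [d5 e5] := udomiv (f1 x); have [d6 e6] := udomiv (f2 x).
 by apply: resolvent_uniq => //; rewrite ?e5// f3 e6 -ivD !f3.
have [] := @mk_op _ _ f 1 fD fZ fi.
 by move=> x; rewrite mul1r; have [h _] := resolvent_bnd (f1 x) (f2 x); rewrite f3 in h.
move=> Y hY.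
have [] := @mk_op _ _ (D \o f) 1.
- by move=> x y /=; rewrite fD (udomD (f1 x) (f1 y)).2.
- by move=> c x /=; rewrite fZ (udomsv c (f1 x)).2.
- by move=> x /=; rewrite fi (udomiv (f1 x)).2.
- by move=> x; rewrite mul1r; have [_ h] := resolvent_bnd (f1 x) (f2 x); rewrite f3 in h.
move=> Z hZ; exists Y, Z; split.
- by move=> v; rewrite hY hZ.
- move=> v; rewrite hZ hY /=; split; first exact: f2.
 by rewrite -{2}(f3 v) addrAC subrr add0r.
- split; first by apply/saP => x y; rewrite !hY -{2}(f3 x) -{1}(f3 y) ripDr ripDl -(usym (f1 x))// -(usym (f2 x)).
 move=> x; rewrite /q hY -{2}(f3 x) -resolvent_est//.
 by rewrite addr_ge0 ?sqr_ge0.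
- apply/saP => x y; rewrite !hZ /= -{1}(f3 y) -{2}(f3 x) ripDr ripDl; congr (_ + _).
  exact: usym.
 by apply/esym/usym.
- by move=> v; rewrite hY => h; rewrite -(f3 v) h uD0 uD0 addr0.
Qed.

Definition resY : op E := sval (cid resolvent_op).
Let resY_spec := svalP (cid resolvent_op).
Definition resZ : op E := sval (cid resY_spec).
Let resP : [/\ forall v, dom D (resY v) /\ D (resY v) = resZ v,
 forall v, dom D (resZ v) /\ D (resZ v) = v - resY v, psd resY, sa resZ &
 forall v, resY v = 0 -> v = 0] := svalP (cid resY_spec).

Lemma resYdom v : dom D (resY v) /\ D (resY v) = resZ v. by case: resP. Qed.
Lemma resZdom v : dom D (resZ v) /\ D (resZ v) = v - resY v. by case: resP. Qed.
Lemma dom_resY v : dom D (resY v). exact: (resYdom v).1. Qed.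
Lemma D_resY v : D (resY v) = resZ v. exact: (resYdom v).2. Qed.
Lemma resY_psd : psd resY. by case: resP. Qed.
Lemma resZ_sa : sa resZ. by case: resP. Qed.
Lemma resY_inj v : resY v = 0 -> v = 0. by case: resP => _ _ _ _; exact. Qed.

Lemma resY_eq y v : dom D y -> dom D (D y) -> y + D (D y) = v -> resY v = y.
move=> d1 d2 e; have [d3 e3] := resYdom v; have [d4 e4] := resZdom v.
by apply: resolvent_uniq => //; rewrite e3// e4 addrC subrK.
Qed.

Lemma resYD x : dom D x -> resY (D x) = resZ x.
move=> dx; have [d3 e3] := resYdom x; have [d4 e4] := resZdom x.
have [d5 e5] := udomB dx d3.
by apply: resY_eq => //; rewrite e4// e5 e3 addrC subrK.
Qed.

Lemma resZD x : dom D x -> resZ (D x) = x - resY x.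
by move=> dx; rewrite -(resYdom (D x)).2 resYD// (resZdom x).2.
Qed.

Lemma resYZ : resY * resZ = resZ * resY.
by apply: op_ext => v; rewrite !opE -D_resY resYD//; exact: dom_resY. Qed.

Definition ucomm Z := forall x, dom D x -> dom D (Z x) /\ D (Z x) = Z (D x).

(** Backwards, a vector of the domain is [resZ (D x) + resY x], and [Z] passes through both
    terms. *)
Lemma ucommP Z : ucomm Z <-> Z * resY = resY * Z /\ Z * resZ = resZ * Z.
split=> [h|[hY hZ] x dx].
 have hY : Z * resY = resY * Z.
  apply: op_ext => v; rewrite !opE; apply/esym.
  have [d1 e1] := resYdom v; have [d2 e2] := resZdom v.
  have [d3 e3] := h _ d1; have [d4 e4] := h _ d2.
  by apply: resY_eq => //; rewrite e3 e1// e4 e2 -opD addrC subrK.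
 split=> //; apply: op_ext => v; rewrite !opE -(D_resY (Z v)) -(op_comm_app hY) -(D_resY v).
 by have [_ ->] := h _ (dom_resY v).
have ex : x = resZ (D x) + resY x by rewrite resZD// subrK.
have eZx : Z x = resZ (Z (D x)) + resY (Z x) by rewrite {1}ex opD (op_comm_app hY) (op_comm_app hZ).
have [d1 e1] := resZdom (Z (D x)); have [d2 e2] := resYdom (Z x).
have [d3 e3] := udomD d1 d2; rewrite eZx; split=> //.
rewrite e3 e1 e2 -(op_comm_app hZ x) -(resYD dx) (op_comm_app hY).
by rewrite subrK.
Qed.

End Unbounded.
Arguments usa {R E} D.
Global Opaque resY resZ.

(** * The spectral family of an unbounded operator *)

Section SpectralFamily.
Context {R : realType} {E : hilbert R}.
Implicit Types (S T A B P Z : op E) (x y v w : E) (c : R).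

Lemma psd_anti T : psd T -> psd (- T) -> T = 0.
move=> [sT h1] [_ h2]; apply: sa_ext => [//||x]; first exact: sa0.
by apply/eqP; rewrite q0 eq_le h1 andbT -oppr_ge0 -qN.
Qed.

(** With [A = |T|], the square root of [T^2], let [P] be the projection onto the kernel of [A + T].
    There [T = - A]; since [(A - T) (A + T) = 0], the operator [A - T] lives on that kernel, and
    [T = A] on the complement. *)
Lemma spectral_proj T : sa T -> exists P, [/\ proj P, psd (- (T * P)), psd (T * (1 - P)),
 (forall x, T x = 0 -> P x = x) & (forall Z, Z * T = T * Z -> Z * P = P * Z)].
move=> sT; have [A [pA AA cA]] := sqrt_exists (psd_sqs sT).
have TA : T * A = A * T by apply: cA; rewrite mulrA.
have [P [pP KP kP cP wP]] := ker_proj (saD pA.1 sT).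
have TP : T * P = P * T by apply: cP; rewrite mulrDr mulrDl TA.
have AP : A * P = P * A by apply: cP; rewrite mulrDr mulrDl TA.
have e1 : T * P = - (A * P).
 by apply/eqP; rewrite -subr_eq0 opprK addrC -mulrDl KP.
have e2 : (A - T) * P = A - T.
 by apply: wP; rewrite mulrDr !mulrBl AA TA; opring.
have e3 : T * (1 - P) = A * (1 - P).
 apply/eqP; rewrite eq_sym -subr_eq0 -mulrBl mulrBr mulr1 e2 subrr; exact/eqP.
exists P; split=> //.
- rewrite e1 opprK; apply: psdM => //; exact: proj_psd.
- rewrite e3; apply: psdM => //; first exact/proj_psd/projC.
 by rewrite mulrBr mulrBl mulr1 mul1r AP.
- move=> x Tx; apply: kP; rewrite opE Tx addr0.
 apply: nrm0P; rewrite -(@ler_pXn2r _ 2)// ?nnegrE ?nrm_ge0//.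
 by rewrite -q_sq pA.1 AA -{1}sT q_sq Tx nrm0.
- move=> Z ZT; apply: cP; rewrite mulrDr mulrDl ZT; congr (_ + _).
 by apply: cA; rewrite mulrA ZT -mulrA ZT mulrA.
Qed.

Lemma projM P Q : proj P -> proj Q -> P * Q = Q * P -> proj (P * Q).
move=> [sP PP] [sQ QQ] PQ; split; first exact: saM.
by rewrite mulrA -[P * Q * P]mulrA -PQ mulrA PP -mulrA QQ.
Qed.

(* [T <= 0] on the range of [P] passes to sub-projections commuting with [T P]. *)
Lemma psd_sub T P Q : psd (- (T * P)) -> proj Q -> P * Q = Q -> T * Q = Q * T -> psd (- (T * Q)).
move=> h pQ PQ TQ; have := psd_conj Q h; rewrite pQ.1.
suff -> : Q * - (T * P) * Q = - (T * Q) by [].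
by rewrite mulrN mulNr -!mulrA PQ mulrA -TQ -mulrA pQ.2.
Qed.

Lemma psd_sub' T P Q : psd (T * P) -> proj Q -> P * Q = Q -> T * Q = Q * T -> psd (T * Q).
by move=> h pQ PQ TQ; have := @psd_sub (- T) P Q; rewrite !mulNr !mulrN !opprK; apply => //; rewrite TQ.
Qed.

(** The component of [x] orthogonal to the closure of the range is killed by [A], hence zero. *)
Lemma sa_inj_dense A x (e : R) : sa A -> (forall v, A v = 0 -> v = 0) -> 0 < e ->
 exists v, nrm (A v - x) < e.
move=> sA iA e0.
have [||P [pP hP hP']] := @subspace_proj _ _ [set x | forall e : R, 0 < e -> exists v, nrm (A v - x) < e].
- split=> /=.
 + by move=> d d0; exists 0; rewrite op0 subrr nrm0.
 + move=> y z hy hz d d0; have d2 : 0 < d / 2 by rewrite divr_gt0.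
  have [v1 h1] := hy _ d2; have [v2 h2] := hz _ d2; exists (v1 + v2).
  rewrite opD opprD addrACA (le_lt_trans (nrmD _ _))// [ltRHS]splitr ltrD//.
 + move=> c y hy d d0; have c0 : 0 < `|c| + 1 by rewrite ltr_wpDl.
  have [|v h] := hy (d / (`|c| + 1)); first by rewrite divr_gt0.
  exists (sv c v); rewrite opsv -svN -svD nrm_sv.
  move: h; rewrite ltr_pdivlMr// mulrC; apply: le_lt_trans.
  by rewrite ler_wpM2r ?nrm_ge0// lerDl.
 + move=> u y hu uy d d0; have d2 : 0 < d / 2 by rewrite divr_gt0.
  have /hcvgP /(_ _ d2) [N hN] := uy; have [v hv] := hu N _ d2; exists v.
  rewrite -(subrK (u N) (A v)) -addrA (le_lt_trans (nrmD _ _))// [ltRHS]splitr ltrD// hN//.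
- move=> y /= hy d d0; have [v h] := hy _ d0; exists (iv v).
 by rewrite opiv -ivN -ivD nrm_iv.
suff <- : P x = x by exact: hP.
apply/eqP; rewrite eq_sym -subr_eq0; apply/eqP/iA/rip_ext => z.
have sA' := (saP A).1 sA; have sP := (saP P).1 pP.1.
have PA : P (A z) = A z by apply: hP' => d d0; exists z; rewrite subrr nrm0.
by rewrite sA' ripBl sP PA subrr rip0l.
Qed.

Variables (D : unbounded_operator E) (sD : usa D).
Local Notation Y := (resY sD).
Local Notation W := (resZ sD).

(** This is [(D - c) (1 + D^2)^-1], a bounded operator with the sign of [D - c]. *)
Definition Tl c : op E := W - c *: Y.

Lemma Tl_sa c : sa (Tl c).
by apply: saB; [exact: resZ_sa|apply: saZ; exact: (resY_psd sD).1]. Qed.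

(** The spectral projection of [D] for []-oo, c]]. It contains the kernel of [Tl c], which is what
    makes the family right continuous. *)
Definition sfam c : op E := sval (cid (spectral_proj (Tl_sa c))).

Let sfamP c : [/\ proj (sfam c), psd (- (Tl c * sfam c)), psd (Tl c * (1 - sfam c)),
 (forall x, Tl c x = 0 -> sfam c x = x) & (forall Z, Z * Tl c = Tl c * Z -> Z * sfam c = sfam c * Z)].
by rewrite /sfam; case: cid. Qed.

Opaque sfam.

Lemma sfam_proj c : proj (sfam c). by case: (sfamP c). Qed.

Lemma sfam_comm Z c : ucomm D Z -> Z * sfam c = sfam c * Z.
move=> /(ucommP sD) [h1 h2]; case: (sfamP c) => _ _ _ _; apply.
by rewrite /Tl mulrBr mulrBl h2 -opZAr h1 opZAl.
Qed.

Lemma ucomm_resY : ucomm D Y.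
by apply/(ucommP sD); split=> //; exact: resYZ. Qed.
Lemma ucomm_resZ : ucomm D W.
by apply/(ucommP sD); split=> //; rewrite resYZ. Qed.

Lemma ucomm_sfam c : ucomm D (sfam c).
by apply/(ucommP sD); split; apply/esym/sfam_comm; [exact: ucomm_resY|exact: ucomm_resZ].
Qed.

Lemma sfamC c d : sfam c * sfam d = sfam d * sfam c.
by apply: sfam_comm; exact: ucomm_sfam. Qed.

Lemma ucommM Z Z' : ucomm D Z -> ucomm D Z' -> ucomm D (Z * Z').
move=> h1 h2 x dx; have [d1 e1] := h2 _ dx; have [d2 e2] := h1 _ d1.
by rewrite !opE e2 e1.
Qed.

Lemma ucommD Z Z' : ucomm D Z -> ucomm D Z' -> ucomm D (Z + Z').
move=> h1 h2 x dx; have [d1 e1] := h2 _ dx; have [d2 e2] := h1 _ dx.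
by have [d3 e3] := udomD sD d2 d1; rewrite !opE e3 e2 e1.
Qed.

Lemma ucommN Z : ucomm D Z -> ucomm D (- Z).
move=> h1 x dx; have [d1 e1] := h1 _ dx; have [d2 e2] := udomN sD d1.
by rewrite !opE e2 e1.
Qed.

Lemma ucomm1 : ucomm D 1. by []. Qed.
Lemma ucommB Z Z' : ucomm D Z -> ucomm D Z' -> ucomm D (Z - Z').
by move=> h1 h2; apply: ucommD => //; exact: ucommN. Qed.

Let TlC c Z : ucomm D Z -> Tl c * Z = Z * Tl c.
by move=> /(ucommP sD) [h1 h2]; rewrite /Tl mulrBr mulrBl h2 -opZAr h1 opZAl.
Qed.

(* a sub-projection on which [D <= c] resp. [D >= d] with [c < d] vanishes *)
Lemma sfam_sep c d P : c < d -> proj P -> ucomm D P ->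
 psd (- (Tl c * P)) -> psd (Tl d * P) -> P = 0.
move=> cd pP uP h1 h2.
have YP : P * Y = Y * P by have /(ucommP sD) [] := uP.
have pYP : psd (Y * P) by apply: psdM => //; [exact: resY_psd|exact: proj_psd].
have : psd (- (Y * P)).
 have := psdZ (_ : 0 <= (d - c)^-1) (psdD h1 h2).
 rewrite invr_ge0 subr_ge0 (ltW cd) => /(_ isT).
 suff -> : (d - c)^-1 *: (- (Tl c * P) + Tl d * P) = - (Y * P) by [].
 rewrite -mulNr -mulrDl (_ : - Tl c + Tl d = - ((d - c) *: Y)); last by rewrite /Tl; opring.
 by rewrite mulNr scalerN -opZAl scalerA mulVf ?scale1r// subr_eq0 gt_eqF.
move=> /(psd_anti pYP) YP0; apply: op_ext => x; apply: (@resY_inj _ _ _ sD).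
by rewrite -opME YP0.
Qed.

Lemma sfam_mono c d : c <= d -> sfam c * sfam d = sfam c.
rewrite le_eqVlt => /orP[/eqP<-|cd]; first by rewrite (sfam_proj c).2.
have [p1 h1 _ _ _] := sfamP c; have [p2 _ h2 _ _] := sfamP d.
have uP : ucomm D (sfam c * (1 - sfam d)).
 by apply: ucommM; [|apply: ucommB; [exact: ucomm1|]]; exact: ucomm_sfam.
have cc : sfam c * (1 - sfam d) = (1 - sfam d) * sfam c.
 by rewrite mulrBr mulrBl mulr1 mul1r sfamC.
have pP : proj (sfam c * (1 - sfam d)) by apply: projM => //; exact: projC.
have h : sfam c * (1 - sfam d) = 0.
 apply: (@sfam_sep c d _ cd pP uP).
  by apply: (psd_sub h1 pP _ (TlC _ uP)); rewrite mulrA p1.2.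
 by apply: (psd_sub' h2 pP _ (TlC _ uP)); rewrite cc mulrA (projC p2).2.
by move/eqP: h; rewrite mulrBr mulr1 subr_eq0 => /eqP <-.
Qed.

Lemma sfam_mono' c d : c <= d -> sfam d * sfam c = sfam c.
by move=> h; rewrite sfamC sfam_mono. Qed.

Lemma sfam_q_mono c d x : c <= d -> q (sfam c) x <= q (sfam d) x.
move=> h; rewrite -(sfam_mono h) proj_q; last by apply: projM; [exact: sfam_proj|exact: sfam_proj|exact: sfamC].
rewrite (proj_q _ (sfam_proj d)) ler_pXn2r ?nnegrE ?nrm_ge0// opE.
by apply: (le_trans (opn_le _ _)); rewrite ler_piMl ?nrm_ge0// proj_opn//; exact: sfam_proj.
Qed.

Lemma proj_lop P Q : proj P -> proj Q -> lop P Q -> P * Q = P /\ Q * P = P.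
move=> pP pQ h.
have QP : Q * P = P.
 apply: op_ext => x; rewrite opE; apply/eqP; rewrite eq_sym -subr_eq0; apply/eqP/nrm0P.
 rewrite -(@ler_pXn2r _ 2)// ?nnegrE ?nrm_ge0// expr0n /=.
 rewrite (_ : P x - Q (P x) = (1 - Q) (P x)) ?opE// -(proj_q (P x) (projC pQ)) !qE.
 have := lop_q (P x) h; rewrite (proj_q _ pP) proj_id//; lra.
by split=> //; have := congr1 adj QP; rewrite adjM pP.1 pQ.1.
Qed.

(* right continuity and the limits at both ends are instances of this principle *)
Lemma sfam_inf (u : nat -> R) : {homo u : n m / (n <= m)%N >-> m <= n} ->
 exists P, [/\ proj P, ucomm D P, scvg (fun n => sfam (u n)) P &
  (forall n, sfam (u n) * P = P)].
move=> mu; have [|n|n x|P [sP cP lP]] := @antitone_limit _ _ (fun n => sfam (u n)) 1.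
- by move=> n; have [] := sfam_proj (u n).
- exact/proj_opn/sfam_proj.
- exact/sfam_q_mono/mu.
have pP : proj P.
 split=> //; apply: (@scvg_uniq _ _ (fun n => sfam (u n))) => //.
 have := @scvgM _ _ _ _ _ _ 1 (fun n => proj_opn (sfam_proj (u n))) cP cP.
 by rewrite (_ : (fun n => _ * _) = (fun n => sfam (u n)))//; apply/funext => n; rewrite (sfam_proj _).2.
have cm Z : ucomm D Z -> Z * P = P * Z.
 by move=> h; apply: scvg_comm cP => n; exact: sfam_comm.
exists P; split=> //.
- by apply/(ucommP sD); split; apply/esym/cm; [exact: ucomm_resY|exact: ucomm_resZ].
- by move=> n; have [] := proj_lop pP (sfam_proj (u n)) (lP n).
Qed.

(** Let [G] be the excess of the limit over [sfam c]. There [D <= c + 1 / n] for all [n] and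
    [D >= c], so [Tl c] vanishes on it; but [sfam c] contains the kernel of [Tl c], whence
    [G = 0]. *)
Lemma sfam_right c : scvg (fun n => sfam (c + n.+1%:R^-1)) (sfam c).
have mono : {homo (fun n => c + n.+1%:R^-1) : n m / (n <= m)%N >-> m <= n}.
 by move=> n m nm; rewrite lerD2l lef_pV2 ?posrE// ler_nat ltnS.
have [P [pP uP cP lP]] := sfam_inf mono.
suff -> : sfam c = P by [].
have cP' : sfam c * P = P * sfam c by apply/esym/sfam_comm.
have e1 : P * sfam c = sfam c.
 apply: (@scvg_uniq _ _ (fun n => sfam (c + n.+1%:R^-1) * sfam c)); first exact: scvgMr.
 rewrite (_ : (fun n => _) = (fun=> sfam c)); first exact: scvg_cst.
 by apply/funext => n; rewrite sfam_mono'// lerDl invr_ge0.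
pose G := P - sfam c.
have eG : G = P * (1 - sfam c) by rewrite mulrBr mulr1 e1.
have pG : proj G by rewrite eG; apply: projM => //; [exact/projC/sfam_proj|rewrite mulrBr mulrBl mulr1 mul1r cP'].
have uG : ucomm D G by apply: ucommB => //; exact: ucomm_sfam.
have PG : P * G = G by rewrite eG mulrA pP.2.
have h1 : psd (- (Tl c * G)).
 split=> [|x]; first by apply/saN/saM; [exact: Tl_sa|exact: pG.1|exact: TlC].
 have hn n : 0 <= - q (Tl c * G) x + n.+1%:R^-1 * q (Y * G) x.
  have [_ h _ _ _] := sfamP (c + n.+1%:R^-1).
  have e : sfam (c + n.+1%:R^-1) * G = G by rewrite eG mulrA lP.
  have [_ /(_ x)] := psd_sub h pG e (TlC _ uG).
  by rewrite /Tl !mulrBl !qE -!opZAl !qE; move=> h0; apply: (le_trans h0); apply: eqW; ring.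
 rewrite qN; apply: (@cvg_ge_cst _ (fun n => - q (Tl c * G) x + n.+1%:R^-1 * q (Y * G) x)) => //.
 rewrite -[X in _ --> X]addr0; apply: cvgD; first exact: cvg_cst.
 rewrite -(mul0r (q (Y * G) x)); apply: cvgM; [exact: cvg_harmonic|exact: cvg_cst].
have h2 : psd (Tl c * G).
 have [p _ h _ _] := sfamP c; apply: (psd_sub' h) => //; last exact: TlC.
 rewrite eG mulrA mulrBl mul1r mulrBr cP' e1 mulr1 mulrBl.
 by rewrite mulrBr mulr1 e1 p.2 (subrr (sfam c)) subr0.
have TG := psd_anti h2 h1.
have sG : sfam c * G = G.
 apply: op_ext => x; rewrite opE; case: (sfamP c) => _ _ _ hs _; apply: hs.
 by rewrite -opME TG.
move: sG; rewrite {1}/G mulrBr cP' e1 (sfam_proj c).2 subrr => G0.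
by apply/eqP; rewrite eq_sym -subr_eq0 -/G -G0.
Qed.

(** [Y] is injective, so a projection with [Y * P = 0] vanishes. The bounds arise when [D <= - n] or
    [D >= n] on the range of [P] for all [n]: then [n Y] lies below [- W] or [W] there. *)
Let null_proj P (w : E -> R) : proj P -> ucomm D P ->
 (forall n x, 0 <= n.+1%:R^-1 * w x - q (Y * P) x) -> P = 0.
move=> pP uP hn; have YP : P * Y = Y * P by have /(ucommP sD) [] := uP.
have pYP : psd (Y * P) by apply: psdM => //; [exact: resY_psd|exact: proj_psd].
suff YP0 : Y * P = 0 by apply: op_ext => x; apply: (@resY_inj _ _ _ sD); rewrite -opME YP0.
apply: psd_anti => //; split=> [|y]; first exact/saN/pYP.1.
rewrite qN; apply: (@cvg_ge_cst _ (fun n => n.+1%:R^-1 * w y - q (Y * P) y)) => //.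
rewrite -[X in _ --> X]add0r; apply: cvgB; last exact: cvg_cst.
rewrite -(mul0r (w y)); apply: cvgM; [exact: cvg_harmonic|exact: cvg_cst].
Qed.

Lemma sfam_Ny : scvg (fun n => sfam (- n%:R)) 0.
have mono : {homo (fun n => - n%:R : R) : n m / (n <= m)%N >-> m <= n}.
 by move=> n m nm; rewrite lerN2 ler_nat.
have [P [pP uP cP lP]] := sfam_inf mono.
suff <- : P = 0 by [].
apply: (@null_proj P (fun x => - q (W * P) x)) => // n x.
have [_ h _ _ _] := sfamP (- n.+1%:R).
have [_ /(_ x)] := psd_sub h pP (lP n.+1) (TlC _ uP).
rewrite /Tl mulrBl !qE -opZAl !qE mulNr opprK opprD => h3.
by rewrite -(@pmulr_rge0 _ n.+1%:R)// mulrBr mulrA mulfV ?pnatr_eq0// mul1r.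
Qed.

Lemma sfam_y : scvg (fun n => sfam n%:R) 1.
have [|n|n x|Q [sQ cQ lQ]] := @monotone_limit _ _ (fun n => sfam n%:R) 1.
- by move=> n; have [] := sfam_proj n%:R.
- exact/proj_opn/sfam_proj.
- by apply: sfam_q_mono; rewrite ler_nat.
suff <- : Q = 1 by [].
have pQ : proj Q.
 split=> //; apply: (@scvg_uniq _ _ (fun n => sfam n%:R)) => //.
 have := @scvgM _ _ _ _ _ _ 1 (fun n => proj_opn (sfam_proj n%:R)) cQ cQ.
 by rewrite (_ : (fun n => _ * _) = (fun n => sfam n%:R))//; apply/funext => n; rewrite (sfam_proj _).2.
have cm Z : ucomm D Z -> Z * Q = Q * Z.
 by move=> h; apply: scvg_comm cQ => n; exact: sfam_comm.
pose P := 1 - Q; have pP : proj P by exact: projC.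
have uP : ucomm D P.
 apply: ucommB; first exact: ucomm1.
 by apply/(ucommP sD); split; apply/esym/cm; [exact: ucomm_resY|exact: ucomm_resZ].
have lP n : (1 - sfam n%:R) * P = P.
 have [h1 h2] := proj_lop (sfam_proj n%:R) pQ (lQ n).
 by rewrite mulrBl mul1r /P mulrBr mulr1 h1 subrr subr0.
have P0 : P = 0.
 apply: (@null_proj P (q (W * P))) => // n x; have [_ _ h _ _] := sfamP n.+1%:R.
 have [_ /(_ x)] := psd_sub' h pP (lP n.+1) (TlC _ uP).
 rewrite /Tl mulrBl !qE -opZAl !qE => h3.
 by rewrite -(@pmulr_rge0 _ n.+1%:R)// mulrBr mulrA mulfV ?pnatr_eq0// mul1r.
by apply/eqP; rewrite eq_sym -subr_eq0; apply/eqP.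
Qed.

(* on the range of the increment the operator [D] is [c] up to [d - c] *)
Lemma sfam_slice c d x g : c < d -> g = sfam d - sfam c ->
 dom D (g x) /\ nrm (D (g x) - sv c (g x)) <= (d - c) * nrm (g x).
move=> cd gE.
have [p1 _ h1 _ _] := sfamP c; have [p2 h2 _ _ _] := sfamP d.
have dc0 : 0 <= d - c by rewrite subr_ge0 ltW.
have ug : ucomm D g by rewrite gE; apply: ucommB; exact: ucomm_sfam.
have eg : g = sfam d * (1 - sfam c) by rewrite gE mulrBr mulr1 sfam_mono'// ltW.
have pg : proj g.
 rewrite eg; apply: projM => //; first exact: projC.
 by rewrite mulrBr mulrBl mulr1 mul1r sfamC.
have k1 : psd (Tl c * g).
 apply: (psd_sub' h1 pg _ (TlC _ ug)); rewrite mulrBl mul1r gE !mulrBr (sfam_mono (ltW cd)) p1.2.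
 by rewrite (subrr (sfam c)) subr0.
have k2 : psd (- (Tl d * g)).
 by apply: (psd_sub h2 pg _ (TlC _ ug)); rewrite gE !mulrBr (sfam_mono' (ltW cd)) p2.2.
have Yg : g * Y = Y * g by have /(ucommP sD) [] := ug.
have pYg : psd (Y * g) by apply: psdM => //; [exact: resY_psd|exact: proj_psd].
have TY Z : ucomm D Z -> Z * (Y * g) = (Y * g) * Z.
 move=> uZ; rewrite mulrA (_ : Z * Y = Y * Z); last by have /(ucommP sD) [] := uZ.
 have /(ucommP sD) [gY gW] := ug; rewrite -!mulrA; congr (_ * _).
 by rewrite gE mulrBr mulrBl !(sfam_comm _ uZ).
set S := Tl c * g in k1; set V := (d - c) *: (Y * g).
have SV : psd (V - S).
 suff <- : - (Tl d * g) = V - S by [].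
 by rewrite /V /S /Tl; opring.
have uT : ucomm D (Tl c).
 apply/(ucommP sD); split; rewrite /Tl mulrBr mulrBl -?opZAr -?opZAl ?resYZ//.
have cVS : S * V = V * S.
 rewrite /V -opZAr -opZAl; congr (_ *: _); apply: TY.
 exact: ucommM.
have pV : psd V by exact: psdZ.
(* From [0 <= S <= V] and commutation, [S^2 <= V^2]: the operator inequality becomes an inequality
   of norms. *)
have key : psd (V * V - S * S).
 have -> : V * V - S * S = (V - S) * (V + S) by rewrite mulrDr !mulrBl cVS addrA subrK.
 apply: psdM => //; first exact: psdD.
 by apply: commrD; apply/commr_sym/commrB => //; exact: commr_sym.
have bnd v : nrm (S v) <= nrm (V v).
 rewrite -(@ler_pXn2r _ 2)// ?nnegrE ?nrm_ge0// -!q_sq k1.1 pV.1.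
 by have := key.2 v; rewrite !qE subr_ge0.
have bnd2 v : nrm (D (g (Y v)) - sv c (g (Y v))) <= (d - c) * nrm (g (Y v)).
 have [_ ->] := ug _ (dom_resY sD v); rewrite D_resY.
 have <- : S v = g (W v) - sv c (g (Y v)) by rewrite /S TlC// opME /Tl !opE opD opN opsv.
 have e2 : V v = sv (d - c) (g (Y v)) by rewrite /V !opE (op_comm_app Yg).
 by apply: (le_trans (bnd v)); rewrite e2 nrm_sv ger0_norm.
(* The estimate is known on the range of [Y], which is dense; closedness of [D] carries it to every
   [x]. *)
have [v hv] : exists v : nat -> E, hcvg (fun n => Y (v n)) x.
 have ex n : exists v, nrm (Y v - x) < n.+1%:R^-1.
  by apply: (sa_inj_dense _ (resY_psd sD).1 (@resY_inj _ _ _ sD)); rewrite invr_gt0.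
 have [v hv] := choice ex; exists v; apply: (@cvg_squeeze0 _ _ (fun n => n.+1%:R^-1)).
  by move=> n; rewrite ger0_norm ?nrm_ge0// ltW.
 exact: cvg_harmonic.
have gv := op_cvg g hv.
have dg n : dom D (g (Y (v n))) by have [] := ug _ (dom_resY sD (v n)).
pose K := `|d - c| + `|c|.
have bD w : nrm (D (g (Y w))) <= K * nrm (Y w).
 have e : D (g (Y w)) = (D (g (Y w)) - sv c (g (Y w))) + sv c (g (Y w)) by rewrite subrK.
 rewrite e (le_trans (nrmD _ _))// mulrDl.
 have h : nrm (g (Y w)) <= nrm (Y w).
  by rewrite (le_trans (opn_le _ _))// ler_piMl ?nrm_ge0// proj_opn.
 rewrite lerD//; last by rewrite nrm_sv ler_wpM2l.
 by rewrite (le_trans (bnd2 w))// ger0_norm// ler_wpM2l.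
have [z hz] : exists z, hcvg (fun n => D (g (Y (v n)))) z.
 apply: hcomplete => e e0; have K0 : 0 < K + 1 by rewrite ltr_wpDl ?addr_ge0.
 have e2 : 0 < e / (K + 1) / 2 by rewrite !divr_gt0.
 have /hcvgP /(_ _ e2) [N hN] := hv; exists N => n m Nn Nm.
 have [_ <-] := udomB sD (dg n) (dg m); rewrite -!opB.
 rewrite (le_lt_trans (bD _))// opB.
 have h : nrm (Y (v n) - Y (v m)) < e / (K + 1).
  rewrite (_ : Y (v n) - Y (v m) = (Y (v n) - x) - (Y (v m) - x)); last by rewrite opprB addrA subrK.
  rewrite (le_lt_trans (nrmB _ _))// [ltRHS]splitr ltrD ?hN//.
 move: h; rewrite ltr_pdivlMr// mulrC; apply: le_lt_trans.
 by rewrite ler_wpM2r ?nrm_ge0// lerDl.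
have [dgx Dgx] := uclosed sD dg gv hz; split=> //.
have l1 : hcvg (fun n => D (g (Y (v n))) - sv c (g (Y (v n)))) (D (g x) - sv c (g x)).
 apply: hcvgB; first by rewrite Dgx.
 by apply: (@hcvg_le _ _ _ _ _ _ `|c|) gv => n; rewrite -svN -svD nrm_sv.
have l2 := nrm_cvg l1; have l3 := cvg_scale (d - c) (nrm_cvg gv).
by apply: (cvg_le _ l2 l3) => n; exact: bnd2.
Qed.

End SpectralFamily.

(** * From the spectral family to a projection-valued measure *)

Lemma measure_compl d (T : measurableType d) (R : realType)
 (mu : {finite_measure set T -> \bar R}) (S : set T) : measurable S ->
 mu (~` S) = (mu setT - mu S)%E.
move=> mS; have mC := measurableC mS.
have h := fin_num_measure mu S mS.
by rewrite -(setUv S) measureU ?setICr// (addeC (mu S)) addeK.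
Qed.

Lemma borel_induction (R : realType) (P : set (set R)) :
 P setT -> (forall c : R, P `]c, +oo[%classic) ->
 (forall S : borel R, measurable S -> P S -> P (~` S)) ->
 (forall F : (borel R)^nat, (forall n, measurable (F n)) -> trivIset [set: nat] F ->
  (forall n, P (F n)) -> P (\bigcup_k F k)) ->
 forall S : borel R, measurable S -> P S.
move=> PT PG PC PU S mS.
apply: (@dynkin_induction _ (mR R) (@RGenOInfty.G R : set (borel R)) P) => //.
- exact: (@RGenOInfty.measurableE R).
- move=> _ _ [a ->] [b ->]; exists (Num.max a b).
 by rewrite set_itvE set_itvE set_itvE; apply/seteqP; split=> z /=;
  rewrite gt_max => /andP.
- by move=> _ [a ->]; exact: PG.
- have : (@ocitv R).-sigma.-measurable S by exact: mS.
 by rewrite (@RGenOInfty.measurableE R).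
Qed.

Section SpectralMeasure.
Context {R : realType} {E : hilbert R} (D : unbounded_operator E) (sD : usa D).
Implicit Types (x y : E) (B C : borel R).

Definition spcum (x : E) (c : R) := q (sfam sD c) x.

Lemma spcum_nd x : nondecreasing (spcum x).
by move=> c d cd; exact: sfam_q_mono. Qed.

Lemma spcum_right x : right_continuous (spcum x).
move=> c; apply/cvgrPdist_le => e e0.
have := @scvg_wcvg _ _ _ _ (sfam_right sD c) x x.
move=> /cvgrPdist_le /(_ e e0) [N _ hN].
near=> d; have cd : c <= d by near: d; exact: nbhs_right_ge.
have dN : d <= c + N.+1%:R^-1.
 by near: d; apply: nbhs_right_le; rewrite ltrDl invr_gt0.
rewrite distrC ger0_norm ?subr_ge0 ?spcum_nd//.
have := hN N (leqnn N); rewrite /= distrC => /(le_trans (ler_norm _)).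
by apply: le_trans; rewrite lerD2r; exact: sfam_q_mono.
Unshelve. all: by end_near. Qed.

HB.instance Definition _ x :=
 isCumulative.Build R _ R (spcum x) (@spcum_nd x) (@spcum_right x).

Definition spmu (x : E) := lebesgue_stieltjes_measure (spcum x : cumulative R R).
HB.instance Definition _ x := Measure.on (spmu x).

Lemma spmu_itv x a b : a <= b ->
 spmu x `]a, b]%classic = (q (sfam sD b) x - q (sfam sD a) x)%:E.
move=> ab; rewrite /spmu /lebesgue_stieltjes_measure /measure_extension.
by rewrite measurable_mu_extE/=; [rewrite wlength_itv_bnd|exact: is_ocitv].
Qed.

Lemma sfam_qy x : (fun n => q (sfam sD n%:R) x) @ \oo --> nrm x ^+ 2.
by rewrite -q1; apply: wcvg_q; apply: scvg_wcvg; exact: sfam_y. Qed.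
Lemma sfam_qNy x : (fun n => q (sfam sD (- n%:R)) x) @ \oo --> (0 : R).
by rewrite -(@q0 _ E x); apply: wcvg_q; apply: scvg_wcvg; exact: sfam_Ny. Qed.

Lemma spmu_setT x : spmu x setT = (nrm x ^+ 2)%:E.
rewrite -(bigcup_itvT false false).
pose I n : set R := `]- (n%:R), n%:R]%classic.
have h1 : (spmu x \o I) n @[n --> \oo] --> (nrm x ^+ 2)%:E.
 have -> : spmu x \o I = EFin \o (fun n => q (sfam sD n%:R) x - q (sfam sD (- n%:R)) x).
  by apply/funext=> n /=; rewrite spmu_itv// ge0_cp.
 apply: cvg_EFin; first by near=> F.
 by rewrite -(subr0 (nrm x ^+ 2)); apply: cvgB; [exact: sfam_qy|exact: sfam_qNy].
have : (spmu x \o I) n @[n --> \oo] --> spmu x (\bigcup_n I n).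
 apply: nondecreasing_cvg_mu; rewrite /I//; first exact: bigcup_measurable.
 by move=> *; apply/subsetPset/subset_itv; rewrite leBSide/= ?lerN2 ler_nat.
by move=> h2; apply: (cvg_unique _ h2 h1).
Unshelve. all: end_near. Qed.

Let spmu_fin x : fin_num_fun (spmu x).
apply: lty_fin_num_fun; apply: (@le_lt_trans _ _ (nrm x ^+ 2)%:E); last exact: ltry.
by apply: eqW; exact: spmu_setT. Qed.

HB.instance Definition _ x := @Measure_isFinite.Build _ _ _ (spmu x) (spmu_fin x).

Lemma spmu_ray x c : spmu x `]c, +oo[%classic = (q (1 - sfam sD c) x)%:E.
pose I n : set R := `]c, Num.max c n%:R]%classic.
have eI : `]c, +oo[%classic = \bigcup_n I n.
 apply/seteqP; split=> z /=; rewrite in_itv /= ?andbT.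
  move=> cz; exists (Num.bound `|z|) => //; rewrite /I /= in_itv /= cz le_max; apply/orP; right.
  by apply: (le_trans (ler_norm _)); apply/ltW/archi_boundP/normr_ge0.
 by move=> [n _]; rewrite /I /= in_itv /= => /andP[].
have h1 : (spmu x \o I) n @[n --> \oo] --> (q (1 - sfam sD c) x)%:E.
 have -> : spmu x \o I = EFin \o (fun n => q (sfam sD (Num.max c n%:R)) x - q (sfam sD c) x).
  by apply/funext=> n /=; rewrite spmu_itv// le_max lexx.
 apply: cvg_EFin; first by near=> F.
 rewrite !qE; apply: cvgB; last exact: cvg_cst.
 have h := sfam_qy (x := x); apply: cvg_trans h; apply: near_eq_cvg.
 exists (Num.bound `|c|) => // n /= hn; rewrite (_ : Num.max c n%:R = n%:R)//.
 apply/max_idPr; apply: (le_trans (ler_norm c)); apply: (le_trans (ltW (archi_boundP (normr_ge0 c)))).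
 by rewrite ler_nat.
rewrite eI; have : (spmu x \o I) n @[n --> \oo] --> spmu x (\bigcup_n I n).
 apply: nondecreasing_cvg_mu; rewrite /I//; first exact: bigcup_measurable.
 move=> n m nm; apply/subsetPset/subset_itv; rewrite leBSide/= ?lexx//.
 by rewrite ge_max !le_max lexx /= ler_nat nm orbT.
by move=> h2; apply: (cvg_unique _ h2 h1).
Unshelve. all: end_near. Qed.

(** Dynkin induction: the sets whose measure is the quadratic form of such an operator include the
    rays, and complements and disjoint unions preserve this, the latter through [monotone_limit].
    That the operators are projections is only known after [F_I]. *)
Lemma spE_exists B : measurable B -> exists T : op E,
 [/\ sa T, forall x, spmu x B = (q T x)%:E & forall Z, ucomm D Z -> Z * T = T * Z].
move: B; apply: borel_induction.
- exists 1; split; [exact: sa1|by move=> x; rewrite spmu_setT q1|by move=> Z; rewrite mulr1 mul1r].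
- move=> c; exists (1 - sfam sD c); split.
 + by apply: saB; [exact: sa1|have [] := sfam_proj sD c].
 + by move=> x; exact: spmu_ray.
 + by move=> Z uZ; rewrite mulrBr mulrBl mulr1 mul1r (sfam_comm sD).
- move=> S mS [T [sT hT cT]]; exists (1 - T); split.
 + by apply: saB => //; exact: sa1.
 + move=> x; rewrite !qE EFinB; have h := measure_compl (spmu x) mS; apply: (etrans h).
  by congr (_ - _)%E; [exact: spmu_setT|exact: hT].
 + by move=> Z uZ; rewrite mulrBr mulrBl mulr1 mul1r cT.
- move=> F mF tF hF; have [T hT] := choice hF.
 pose S n := \sum_(i < n) T i.
 have qS n x : q (S n) x = \sum_(i < n) q (T i) x.
  by apply: (big_morph (fun T => q T x)) => [? ?|]; rewrite qE.
 have muS n x : (q (S n) x)%:E = (\sum_(0 <= i < n) spmu x (F i))%E.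
  by rewrite qS big_mkord -sumEFin; apply: eq_bigr => i _; have [_ -> _] := hT i.
 have Tge i x : 0 <= q (T i) x by rewrite -lee_fin; have [_ <- _] := hT i.
 have sS n : sa (S n).
  by apply: big_ind => [||i _]; [exact: sa0|move=> *; exact: saD|have [] := hT i].
 have [|n|n x|L [sL cL lL]] := @monotone_limit _ _ S 1.
 + by [].
 + apply: lop_opn => //.
   by split=> // x; rewrite qS; apply: sumr_ge0 => i _.
  rewrite scale1r; apply: lopP => //; first exact: sa1.
  move=> x; rewrite q1 -lee_fin -spmu_setT muS.
  have mU : measurable (\bigcup_k F k) by exact: bigcup_measurable.
  apply: (@le_trans _ _ (spmu x (\bigcup_k F k))); last by apply: le_measure; rewrite ?inE.
  rewrite -(cvg_lim (@ereal_hausdorff R) (measure_sigma_additive mF tF)).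
  by apply: nneseries_lim_ge.
 + by rewrite !qS big_ord_recr /= lerDl.
 exists L; split=> //.
  move=> x; have h1 : (fun n => (q (S n) x)%:E) @ \oo --> (q L x)%:E.
   by apply: cvg_EFin; [near=> F'|apply: wcvg_q; exact: scvg_wcvg].
  have h2 : (fun n => (q (S n) x)%:E) @ \oo --> spmu x (\bigcup_k F k).
   under eq_fun do rewrite muS.
   exact: (@measure_sigma_additive _ _ _ (spmu x)).
  by apply: (cvg_unique _ h2 h1).
 move=> Z uZ; apply: scvg_comm cL => n.
 rewrite /S mulr_sumr mulr_suml; apply: eq_bigr => i _; have [_ _] := hT i; exact.
Unshelve. all: end_near. Qed.

End SpectralMeasure.

Record pvm (R : realType) (E : hilbert R) := Pvm {
 pE : borel R -> op E;
 pmu : E -> {finite_measure set (mR R) -> \bar R};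
 pE_proj : forall B, measurable B -> proj (pE B);
 pE_T : pE setT = 1;
 pE_I : forall B C, measurable B -> measurable C -> pE (B `&` C) = pE B * pE C;
 pmuE : forall x B, measurable B -> pmu x B = (q (pE B) x)%:E }.

Section SpectralTheorem.
Context {R : realType} {E : hilbert R} (D : unbounded_operator E) (sD : usa D).

Let F B : op E := if pselect (measurable B) is left mB then sval (cid (spE_exists sD mB)) else 0.

Let FP B : measurable B -> [/\ sa (F B), forall x, spmu sD x B = (q (F B) x)%:E &
 forall Z, ucomm D Z -> Z * F B = F B * Z].
by move=> mB; rewrite /F; case: pselect => // mB'; case: cid. Qed.

Let FeqP B (T : op E) : measurable B -> sa T -> (forall x, spmu sD x B = (q T x)%:E) -> F B = T.
move=> mB sT h; have [sF hF _] := FP mB; apply: sa_ext => // x.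
by apply: EFin_inj; rewrite -hF h.
Qed.

Let F_T : F setT = 1.
by apply: FeqP => // [|x]; [exact: sa1|rewrite spmu_setT q1]. Qed.

Let F_ray c : F `]c, +oo[%classic = 1 - sfam sD c.
apply: FeqP => //; last by move=> x; rewrite spmu_ray.
by apply: saB; [exact: sa1|have [] := sfam_proj sD c].
Qed.

Let F_C S : measurable S -> F (~` S) = 1 - F S.
move=> mS; have [sS hS _] := FP mS; apply: FeqP; first exact: measurableC.
 by apply: saB => //; exact: sa1.
move=> x; rewrite !qE EFinB; have h := measure_compl (spmu sD x) mS; apply: (etrans h).
by congr (_ - _)%E; [exact: spmu_setT|exact: hS].
Qed.

Let F_U (G : (borel R)^nat) : (forall n, measurable (G n)) -> trivIset setT G ->
 wcvg (fun n => \sum_(i < n) F (G i)) (F (\bigcup_k G k)).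
move=> mG tG; have mU : measurable (\bigcup_k G k) by exact: bigcup_measurable.
have [sU hU _] := FP mU; apply: sa_wcvg => //.
 by move=> n; apply: big_ind => [||i _]; [exact: sa0|move=> *; exact: saD|have [] := FP (mG i)].
move=> x; have h2 : (fun n => (\sum_(0 <= i < n) spmu sD x (G i))%E) @ \oo --> spmu sD x (\bigcup_k G k).
 exact: (@measure_sigma_additive _ _ _ (spmu sD x)).
rewrite hU in h2.
rewrite (_ : (fun n => _) = (fun n => fine (\sum_(0 <= i < n) spmu sD x (G i))%E)).
 exact: (fine_cvg h2).
apply/funext => n; rewrite (big_morph (fun T => q T x) (id1 := 0) (op1 := +%R)).
- rewrite big_mkord (eq_bigr (fun i : 'I_n => (q (F (G i)) x)%:E)) ?sumEFin// => i _.
 by have [_ -> _] := FP (mG i).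
- by move=> *; rewrite qE.
- by rewrite qE.
Qed.

Let wcvgM (u : nat -> op E) T A : wcvg u T -> wcvg (fun n => u n * A) (T * A).
by move=> h x y; have := h (A x) y. Qed.

(** Two Dynkin inductions, one for each argument, starting from two rays, where the identity is the
    monotonicity of [sfam]. *)
Let F_I B C : measurable B -> measurable C -> F (B `&` C) = F B * F C.
move=> mB mC; move: C mC B mB.
have step (C : borel R) : measurable C ->
  (forall c, F (`]c, +oo[%classic `&` C) = F `]c, +oo[%classic * F C) ->
  forall B : borel R, measurable B -> F (B `&` C) = F B * F C.
 move=> mC hc; apply: borel_induction => [|//|S mS hS|G mG tG hG].
 - by rewrite setTI F_T mul1r.
 - rewrite F_C// mulrBl mul1r -hS.
  have mSC : measurable (S `&` C) by exact: measurableI.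
  have [s1 h1 _] := FP mSC; have [s2 h2 _] := FP mC.
  apply: FeqP; [by apply: measurableI => //; exact: measurableC|exact: saB|move=> x].
  rewrite !qE EFinB -h1 -h2; apply/eqP.
  have h3 : spmu sD x C = (spmu sD x (S `&` C) + spmu sD x (~` S `&` C))%E.
   rewrite -(@measureU _ _ _ (spmu sD x))//; last by rewrite setIACA setICr set0I.
    by rewrite -setIUl setUv setTI.
   by apply: measurableI => //; exact: measurableC.
  by rewrite h3 (addeC (spmu sD x (S `&` C))) addeK// h1.
 - rewrite setI_bigcupl; apply: (@wcvg_uniq _ _ (fun n => (\sum_(i < n) F (G i)) * F C)).
   rewrite (_ : (fun n => _) = (fun n => \sum_(i < n) F (G i `&` C))).
    apply: (F_U (G := fun i => G i `&` C)) => [n|]; first exact: measurableI.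
    by apply: trivIset_setIr.
   by apply/funext => n; rewrite mulr_suml; apply: eq_bigr => i _; rewrite hG.
  exact/wcvgM/F_U.
have ray c (B : borel R) : measurable B -> F (B `&` `]c, +oo[%classic) = F B * F `]c, +oo[%classic.
 move=> mB; apply: step => // d; rewrite !F_ray.
 rewrite (_ : _ `&` _ = `]Num.max d c, +oo[%classic); last first.
  apply/seteqP; split=> z /=; rewrite !in_itv /= !andbT gt_max; first by move=> [-> ->].
  by move=> /andP.
 rewrite F_ray mulrBr mulr1 mulrBl mul1r.
 have [dc|cd] := leP d c.
  by rewrite (sfam_mono sD dc); opring.
 by rewrite (sfam_mono' sD (ltW cd)); opring.
move=> C mC; apply: step => // c; rewrite setIC ray//.
have [_ _ h] := FP mC.
by rewrite F_ray mulrBr mulrBl mulr1 mul1r (h _ (ucomm_sfam sD c)).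
Qed.

Let F_proj B : measurable B -> proj (F B).
by move=> mB; split; [have [] := FP mB|rewrite -F_I// setIid]. Qed.

Definition specp : pvm E := Pvm F_proj F_T F_I (fun x B mB => let: And3 _ h _ := FP mB in h x).

Lemma specp_ray c : pE specp `]c, +oo[%classic = 1 - sfam sD c.
exact: F_ray. Qed.
Lemma specp_comm B Z : measurable B -> ucomm D Z -> Z * pE specp B = pE specp B * Z.
by move=> mB; have [_ _] := FP mB; exact. Qed.

End SpectralTheorem.
Global Opaque specp.

(** * Bounded Borel functions and their integrals *)

Section BoundedBorel.
Import HBNNSimple.
Context {R : realType}.
Implicit Types (f g : R -> R) (c C : R) (B : borel R).

Definition bm f := measurable_fun [set: mR R] (f : mR R -> R) /\
 exists C, forall l, `|f l| <= C.

Lemma bm_cst c : bm (fun=> c).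
by split; [exact: measurable_cst|exists `|c|]. Qed.

Lemma bm_ind B : measurable B -> bm (\1_B).
move=> mB; split; first exact: measurable_indic.
by exists 1 => l; rewrite indicE; case: (l \in B); rewrite ?normr1 ?normr0.
Qed.

Lemma bmD f g : bm f -> bm g -> bm (fun l => f l + g l).
move=> [mf [C hC]] [mg [C' hC']]; split; first exact: measurable_funD.
by exists (C + C') => l; rewrite (le_trans (ler_normD _ _))// lerD.
Qed.

Lemma bmM f g : bm f -> bm g -> bm (fun l => f l * g l).
move=> [mf [C hC]] [mg [C' hC']]; split; first exact: measurable_funM.
by exists (C * C') => l; rewrite normrM ler_pM.
Qed.

Lemma bmZ c f : bm f -> bm (fun l => c * f l).
by move=> h; apply: bmM => //; exact: bm_cst. Qed.
Lemma bmN f : bm f -> bm (fun l => - f l).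
by move=> /(bmZ (-1)); under eq_fun do rewrite mulN1r. Qed.
Lemma bmB f g : bm f -> bm g -> bm (fun l => f l - g l).
by move=> h1 h2; apply: bmD => //; exact: bmN. Qed.

Lemma bmX f n : bm f -> bm (fun l => f l ^+ n).
move=> h; elim: n => [|n IH]; first exact: (bm_cst 1).
by under eq_fun do rewrite exprS; exact: bmM.
Qed.

Lemma bm_ge0_ub f : bm f -> exists2 C, 0 < C & forall l, `|f l| <= C.
move=> [_ [C hC]]; exists (`|C| + 1); first by rewrite ltr_wpDl.
by move=> l; rewrite (le_trans (hC l))// (le_trans (ler_norm C))// lerDl.
Qed.

Lemma bm_sum (I : Type) (r : seq I) (F : I -> R -> R) :
 (forall i, bm (F i)) -> bm (fun l => \sum_(i <- r) F i l).
move=> h; elim: r => [|i r IH]; first by under eq_fun do rewrite big_nil; exact: bm_cst.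
by under eq_fun do rewrite big_cons; exact: bmD.
Qed.

(** Simple functions increase to a nonnegative bounded function; adding and subtracting a constant
    removes the sign condition. *)
Lemma bm_induction (Q : (R -> R) -> Prop) :
 (forall B, measurable B -> Q (\1_B)) ->
 (forall f g, bm f -> bm g -> Q f -> Q g -> Q (fun l => f l + g l)) ->
 (forall c f, bm f -> Q f -> Q (fun l => c * f l)) ->
 (forall (F : nat -> R -> R) f C, (forall n, bm (F n)) -> bm f ->
  (forall n l, `|F n l| <= C) ->
  (forall l, (fun n => F n l) @ \oo --> f l) -> (forall n, Q (F n)) -> Q f) ->
 forall f, bm f -> Q f.
move=> Qi QD QZ QL.
have Qc c : Q (fun=> c).
 have := QZ c _ (bm_ind measurableT) (Qi _ measurableT).
 by congr Q; apply/funext => l; rewrite indicT mulr1.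
have Qs (I : Type) (r : seq I) (F : I -> R -> R) : (forall i, bm (F i)) -> (forall i, Q (F i)) ->
  Q (fun l => \sum_(i <- r) F i l).
 move=> hb h; elim: r => [|i r IH]; first by under eq_fun do rewrite big_nil; exact: Qc.
 by under eq_fun do rewrite big_cons; apply: QD => //; exact: bm_sum.
have Qnn (f : {nnsfun (mR R) >-> R}) : Q f.
 rewrite (_ : (f : R -> R) = (fun l => \sum_(y <- finmap.enum_fset (fset_set (range f)))
   (y * \1_(f @^-1` [set y]) l))); last by apply/funext => l; rewrite fimfunE fsbig_finite//.
 apply: Qs => y; first by apply: bmZ; apply: bm_ind.
 by apply: QZ; [exact: bm_ind|exact: Qi].
have Q0 f : bm f -> (forall l, 0 <= f l) -> Q f.
 move=> bf f0; have [C C0 hC] := bm_ge0_ub bf.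
 have [|l _|u [nu cu]] := @approximation _ (mR R) R setT measurableT (EFin \o f).
 - by apply/measurable_EFinP; exact: bf.1.
 - by rewrite lee_fin.
 have cu' l : (fun n => u n l) @ \oo --> f l by apply: (@fine_cvg _ _ _ _ (fun n => (u n l)%:E)); exact: (cu l I).
 have ub n l : `|u n l| <= C.
  rewrite ger0_norm//; apply: le_trans (hC l); apply: le_trans (ler_norm _).
  have nd : {homo (fun n => u n l) : n m / (n <= m)%N >-> n <= m}.
   by move=> i j ij; have /lefP := nu _ _ ij; exact.
  have cc : cvgn (fun n => u n l) by apply/cvg_ex; exists (f l).
  have := nondecreasing_cvgn_le nd cc n; rewrite (cvg_lim (@Rhausdorff R) (cu' l)); exact.
 apply: (QL (fun n => u n) _ C) => //.
 by move=> n; split; [exact: measurable_funPT|exists C].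
move=> f bf; have [C C0 hC] := bm_ge0_ub bf.
have : Q (fun l => (f l + C) + (- C)).
 apply: QD; [by apply: bmD => //; exact: bm_cst|exact: bm_cst| |exact: Qc].
 apply: Q0; first by apply: bmD => //; exact: bm_cst.
 by move=> l; have := hC l; rewrite ler_norml => /andP[h _]; rewrite -lerBlDr sub0r.
by congr Q; apply/funext => l; rewrite addrK.
Qed.

Variable mu : {finite_measure set (mR R) -> \bar R}.

Lemma bm_int f : bm f -> mu.-integrable setT (EFin \o f).
move=> bf; have [C C0 hC] := bm_ge0_ub bf; apply: measurable_bounded_integrable => //.
- by rewrite -ge0_fin_numE//; exact: fin_num_measure.
- exact: bf.1.
- exists C; split; first exact: num_real.
 by move=> y Cy l _ /=; apply: (le_trans (hC l)); exact: ltW.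
Qed.

Lemma RintD f g : bm f -> bm g ->
 \int[mu]_l (f l + g l) = \int[mu]_l f l + \int[mu]_l g l.
by move=> h1 h2; rewrite RintegralD//; exact: bm_int. Qed.

Lemma RintZ c f : bm f -> \int[mu]_l (c * f l) = c * \int[mu]_l f l.
by move=> h1; rewrite RintegralZl//; exact: bm_int. Qed.
Lemma Rint_ind B : measurable B -> \int[mu]_l (\1_B l) = fine (mu B).
by move=> mB; rewrite /Rintegral integral_indic// setIT. Qed.

Lemma Rint_le f g : bm f -> bm g -> (forall l, f l <= g l) ->
 \int[mu]_l f l <= \int[mu]_l g l.
by move=> h1 h2 h; apply: le_Rintegral => //; exact: bm_int. Qed.

Lemma Rint_ge0 f : (forall l, 0 <= f l) -> 0 <= \int[mu]_l f l.
by move=> h; apply: Rintegral_ge0 => l _. Qed.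

Lemma Rint_abs f C : bm f -> (forall l, `|f l| <= C) ->
 `|\int[mu]_l f l| <= C * fine (mu setT).
move=> bf hC; rewrite ler_norml -(Rintegral_cst mu measurableT C).
rewrite lerNl -[- _]mulN1r -RintZ// !Rint_le//; try exact: bm_cst; try exact: bmZ.
 by move=> l; apply: le_trans (ler_norm _) (hC l).
by move=> l; rewrite mulN1r; apply: le_trans (hC l); rewrite -normrN ler_norm.
Qed.

Lemma Rint_cvg (F : nat -> R -> R) f C : (forall n, bm (F n)) -> bm f ->
  (forall n l, `|F n l| <= C) -> (forall l, (fun n => F n l) @ \oo --> f l) ->
 (fun n => \int[mu]_l F n l) @ \oo --> \int[mu]_l f l.
move=> bF bf hC hl; apply: fine_cvg.
rewrite /Rintegral fineK; last by apply: integrable_fin_num => //; exact: bm_int.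
apply: (@dominated_cvg _ _ _ mu setT measurableT (fun n => EFin \o F n) (EFin \o f) (EFin \o cst C)) => //.
- by move=> n; apply/measurable_EFinP; exact: (bF n).1.
- by move=> l _; apply: cvg_EFin; [exact: nearW|exact: hl].
- exact: finite_measure_integrable_cst.
- by move=> n l _; rewrite lee_fin.
Qed.

End BoundedBorel.

(** * Bounded Borel functional calculus *)

Section BorelCalculus.
Context {R : realType} {E : hilbert R} (P : pvm E).
Implicit Types (f g : R -> R) (c C : R) (B : borel R) (x y : E) (Z : op E).

Lemma pmu_T x : fine (pmu P x setT) = nrm x ^+ 2.
by rewrite pmuE// pE_T q1. Qed.

Lemma fc_exists f : bm f -> exists T : op E, [/\ sa T,
 forall x, q T x = \int[pmu P x]_l f l &
 forall Z, (forall B, measurable B -> Z * pE P B = pE P B * Z) -> Z * T = T * Z].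
move: f; apply: (@bm_induction R (fun f => exists T : op E, [/\ sa T,
 forall x, q T x = \int[pmu P x]_l f l &
 forall Z, (forall B, measurable B -> Z * pE P B = pE P B * Z) -> Z * T = T * Z])).
- move=> B mB; exists (pE P B); split.
 + by have [] := pE_proj P mB.
 + by move=> x; rewrite Rint_ind// pmuE.
 + by move=> Z h; exact: h.
- move=> f g bf bg [S [sS hS cS]] [T [sT hT cT]]; exists (S + T); split.
 + exact: saD.
 + by move=> x; rewrite qE hS hT RintD.
 + by move=> Z h; rewrite mulrDr mulrDl cS// cT.
- move=> c f bf [T [sT hT cT]]; exists (c *: T); split.
 + exact: saZ.
 + by move=> x; rewrite qE hT RintZ.
 + by move=> Z h; rewrite -opZAr -opZAl cT.
- move=> F f C bF bf hC hl hF; have [u hu] := choice hF.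
 have C0 : 0 <= C by apply: le_trans (hC 0%N 0).
 have ub n : opn (u n) <= C.
  have [su qu _] := hu n; apply: sa_opn => // x; rewrite qu -pmu_T; exact: Rint_abs.
 have cq x : (fun n => q (u n) x) @ \oo --> \int[pmu P x]_l f l.
  rewrite (_ : (fun n => _) = (fun n => \int[pmu P x]_l F n l)); first exact: Rint_cvg hl.
  by apply/funext => n; have [_ -> _] := hu n.
 have [||x|T sT wT] := @sa_weak_limit _ _ u C; [by move=> n; have [] := hu n|exact: ub| |].
  by apply/cvg_ex; exists (\int[pmu P x]_l f l).
 exists T; split=> //.
  by move=> x; apply: (@cvg_eq_lim _ _ _ _ (wT x x)); exact: cq.
 move=> Z h; apply: op_ext => x; apply: rip_ext => y.
 have h1 := wT (Z x) y; have h2 := wT x (Z^† y).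
 rewrite !opE [LHS]adjP'; apply/esym; apply: (@cvg_eq_lim _ _ _ _ h1).
 rewrite (_ : (fun n => _) = (fun n => rip (u n x) (Z^† y))) //.
 by apply/funext => n; rewrite -adjP'; have [_ _ /(_ Z h)] := hu n => hh; rewrite -opME -hh.
Qed.

Definition fc f : op E := if pselect (bm f) is left b then sval (cid (fc_exists b)) else 0.

Lemma fc_spec f : bm f -> [/\ sa (fc f),
 forall x, q (fc f) x = \int[pmu P x]_l f l &
 forall Z, (forall B, measurable B -> Z * pE P B = pE P B * Z) -> Z * fc f = fc f * Z].
by move=> b; rewrite /fc; case: pselect => // b'; case: cid. Qed.

Lemma fc_sa f : bm f -> sa (fc f).
by move=> /fc_spec []. Qed.
Lemma fc_q f x : bm f -> q (fc f) x = \int[pmu P x]_l f l.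
by move=> /fc_spec []. Qed.

Lemma fc_comm f Z : bm f -> (forall B, measurable B -> Z * pE P B = pE P B * Z) ->
 Z * fc f = fc f * Z.
by move=> /fc_spec [_ _]; exact. Qed.

Lemma fc_uniq f T : bm f -> sa T -> (forall x, q T x = \int[pmu P x]_l f l) -> fc f = T.
by move=> bf sT h; apply: sa_ext => // [|x]; [exact: fc_sa|rewrite fc_q]. Qed.

Lemma fc_ind B : measurable B -> fc (\1_B) = pE P B.
move=> mB; apply: fc_uniq; [exact: bm_ind|by have [] := pE_proj P mB|].
by move=> x; rewrite Rint_ind// pmuE.
Qed.

Lemma fc_cst c : fc (fun=> c) = c *: (1 : op E).
apply: fc_uniq; [exact: bm_cst|by apply: saZ; exact: sa1|].
by move=> x; rewrite !qE Rintegral_cst// pmu_T.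
Qed.

Lemma fcD f g : bm f -> bm g -> fc (fun l => f l + g l) = fc f + fc g.
move=> bf bg; apply: fc_uniq; [exact: bmD|by apply: saD; exact: fc_sa|].
by move=> x; rewrite qE !fc_q// RintD.
Qed.

Lemma fcZ c f : bm f -> fc (fun l => c * f l) = c *: fc f.
move=> bf; apply: fc_uniq; [exact: bmZ|by apply: saZ; exact: fc_sa|].
by move=> x; rewrite qE !fc_q// RintZ.
Qed.

Lemma fcN f : bm f -> fc (fun l => - f l) = - fc f.
by move=> bf; rewrite -scaleN1r -fcZ//; congr fc; apply/funext => l; rewrite mulN1r. Qed.
Lemma fcB f g : bm f -> bm g -> fc (fun l => f l - g l) = fc f - fc g.
by move=> bf bg; rewrite fcD ?fcN//; exact: bmN. Qed.

Lemma fc_opn f C : bm f -> (forall l, `|f l| <= C) -> opn (fc f) <= C.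
move=> bf hC; have C0 : 0 <= C by apply: le_trans (hC 0).
by apply: sa_opn => // [|x]; [exact: fc_sa|rewrite fc_q// -pmu_T; exact: Rint_abs].
Qed.

Lemma fc_wcvg (F : nat -> R -> R) f C : (forall n, bm (F n)) -> bm f ->
  (forall n l, `|F n l| <= C) -> (forall l, (fun n => F n l) @ \oo --> f l) ->
 wcvg (fun n => fc (F n)) (fc f).
move=> bF bf hC hl; apply: sa_wcvg => [n||x]; try exact: fc_sa.
rewrite fc_q//; under eq_fun do rewrite fc_q//.
exact: Rint_cvg hl.
Qed.

(** Multiplication by a fixed operator preserves weak limits, so [bm_induction] applies to one
    factor at a time: in [f] against an indicator, then in [g]. For two indicators it is [pE_I]. *)
Lemma fcM f g : bm f -> bm g -> fc (fun l => f l * g l) = fc f * fc g.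
have wl (u : nat -> op E) T A : wcvg u T -> wcvg (fun n => A * u n) (A * T).
 move=> h x y; under eq_fun do rewrite opE adjP'.
 by rewrite opE adjP'; exact: h.
have wr (u : nat -> op E) T A : wcvg u T -> wcvg (fun n => u n * A) (T * A).
 by move=> h x y; under eq_fun do rewrite opE; rewrite opE; exact: h.
have step1 B f0 : measurable B -> bm f0 -> fc (fun l => f0 l * \1_B l) = fc f0 * pE P B.
 move=> mB; have bB := bm_ind mB; move: f0.
 apply: (@bm_induction R (fun f0 => fc (fun l => f0 l * \1_B l) = fc f0 * pE P B)).
 - move=> A mA; rewrite fc_ind// -pE_I// -fc_ind; last exact: measurableI.
  by congr fc; apply/funext => l; rewrite indicI.
 - move=> f1 f2 b1 b2 h1 h2; rewrite fcD// mulrDl -h1 -h2 -fcD; try exact: bmM.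
  by congr fc; apply/funext => l; rewrite mulrDl.
 - move=> c f0 b0 h; rewrite fcZ// -opZAl -h -fcZ; last exact: bmM.
  by congr fc; apply/funext => l; rewrite mulrA.
 - move=> F f0 C bF b0 hC hl h.
  have h1 : wcvg (fun n => fc (fun l => F n l * \1_B l)) (fc (fun l => f0 l * \1_B l)).
   apply: (@fc_wcvg _ _ C) => [n||n l|l]; try exact: bmM.
    rewrite normrM -[C]mulr1 ler_pM// indicE.
    by case: (l \in B); rewrite ?normr1 ?normr0.
   by apply: cvgM => //; exact: cvg_cst.
  apply: (wcvg_uniq h1); rewrite (_ : (fun n => _) = (fun n => fc (F n) * pE P B)).
   by apply: wr; exact: fc_wcvg hl.
  by apply/funext.
move=> bf; move: g.
apply: (@bm_induction R (fun g => fc (fun l => f l * g l) = fc f * fc g)).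
- by move=> B mB; rewrite step1// fc_ind.
- move=> f1 f2 b1 b2 h1 h2; rewrite [in RHS]fcD// mulrDr -h1 -h2 -fcD; try exact: bmM.
 by congr fc; apply/funext => l; rewrite mulrDr.
- move=> c f0 b0 h; rewrite [in RHS]fcZ// -opZAr -h -fcZ; last exact: bmM.
 by congr fc; apply/funext => l; rewrite mulrCA.
- move=> F g C bF bg hC hl h; have [K K0 hK] := bm_ge0_ub bf.
 have h1 : wcvg (fun n => fc (fun l => f l * F n l)) (fc (fun l => f l * g l)).
  apply: (@fc_wcvg _ _ (K * C)) => [n||n l|l]; try exact: bmM.
   by rewrite normrM ler_pM.
  by apply: cvgM => //; exact: cvg_cst.
 apply: (wcvg_uniq h1); rewrite (_ : (fun n => _) = (fun n => fc f * fc (F n))).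
  by apply: wl; exact: fc_wcvg hl.
 by apply/funext.
Qed.

Lemma fcC f g : bm f -> bm g -> fc f * fc g = fc g * fc f.
by move=> bf bg; rewrite -!fcM//; congr fc; apply/funext => l; rewrite mulrC. Qed.

Lemma fcX f n : bm f -> fc (fun l => f l ^+ n) = fc f ^+ n.
move=> bf; elim: n => [|n IH].
 by rewrite expr0 -[RHS](scale1r) -fc_cst.
rewrite exprS -IH -fcM//; last exact: bmX.
by congr fc; apply/funext => l; rewrite exprS.
Qed.

Lemma fc_nrm f x : bm f -> nrm (fc f x) ^+ 2 = \int[pmu P x]_l (f l ^+ 2).
by move=> bf; rewrite -q_sq (fc_sa bf) -expr2 -fcX// fc_q//; exact: bmX. Qed.
Lemma fc_psd f : bm f -> (forall l, 0 <= f l) -> psd (fc f).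
by move=> bf f0; split=> [|x]; [exact: fc_sa|rewrite fc_q// Rint_ge0]. Qed.

Lemma fc_lop f g : bm f -> bm g -> (forall l, f l <= g l) -> lop (fc f) (fc g).
move=> bf bg h; rewrite /lop -fcB//; apply: fc_psd; first exact: bmB.
by move=> l; rewrite subr_ge0.
Qed.

Lemma fc_nrm_le f g x : bm f -> bm g -> (forall l, `|f l| <= `|g l|) ->
 nrm (fc f x) <= nrm (fc g x).
move=> bf bg h; rewrite -(@ler_pXn2r _ 2)// ?nnegrE ?nrm_ge0// !fc_nrm//.
apply: Rint_le; try exact: bmX.
by move=> l; rewrite -[f l ^+ 2]real_normK ?num_real// -[g l ^+ 2]real_normK ?num_real// ler_pXn2r// nnegrE.
Qed.

End BorelCalculus.
Global Opaque fc.

Lemma cvg_eventually (R : realType) (a : nat -> R) (l : R) N :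
 (forall n, (N <= n)%N -> a n = l) -> a @ \oo --> l.
by move=> h; apply/cvgrPdist_lt => e e0; exists N => // n Nn /=; rewrite h// subrr normr0.
Qed.

(** * Existence and uniqueness of the spectral resolution *)

Section PvmOperator.
Context {R : realType} {E : hilbert R} (D : unbounded_operator E) (sD : usa D).
Implicit Types (f g : R -> R) (c C : R) (B : borel R) (x y v : E) (Z : op E).

Definition pvm_of (P : pvm E) :=
 (forall x, dom D x <-> (\int[pmu P x]_l ((l ^+ 2)%:E) < +oo)%E) /\
 (forall x, dom D x -> rip (D x) x = \int[pmu P x]_l l).

Definition win n : borel R := `]- (n%:R : R), n%:R]%classic.

Lemma win_meas n : measurable (win n).
exact: measurable_itv. Qed.

Definition trunc n (l : R) : R := l * \1_(win n) l.

Lemma indic_le1 B (l : R) : `|\1_B l : R| <= 1.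
by rewrite indicE; case: (_ \in _); rewrite ?normr1 ?normr0. Qed.
Lemma indic_win n l : \1_(win n) l = ((- n%:R < l <= n%:R)%R : nat)%:R :> R.
by rewrite indicE /win mem_setE in_itv /=. Qed.

Lemma win_cvg l : (fun n => \1_(win n) l : R) @ \oo --> (1 : R).
apply: (@cvg_eventually _ _ _ (Num.bound `|l|).+1) => n hn.
rewrite indic_win; suff -> : (- n%:R < l <= n%:R)%R by [].
have h : `|l| < n%:R.
 by apply: (lt_le_trans (archi_boundP (normr_ge0 l))); rewrite ler_nat ltnW.
by move: h; rewrite ltr_norml => /andP[-> /ltW ->].
Qed.

Lemma trunc_bm n : bm (trunc n).
split; first by apply: measurable_funM => //; apply: measurable_indic; exact: win_meas.
exists n%:R => l; rewrite /trunc indic_win; case: (boolP (_ < l <= _)) => [/andP[h1 h2]|_].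
 by rewrite mulr1 ler_norml h2 ltW.
by rewrite mulr0 normr0.
Qed.

Lemma trunc_win n k l : (n <= k)%N -> trunc k l * \1_(win n) l = trunc n l.
move=> nk; rewrite /trunc -mulrA; congr (_ * _); rewrite !indic_win -natrM mulnb; congr (nat_of_bool _)%:R.
apply/idP/idP => [/andP[] //|/andP[h1 h2]]; rewrite h1 h2 !andbT.
by rewrite (le_trans h2) ?ler_nat// (le_lt_trans _ h1)// lerN2 ler_nat.
Qed.

Lemma trunc_cvg l : (fun n => trunc n l) @ \oo --> l.
rewrite -[X in _ --> X]mulr1; apply: cvgM; [exact: cvg_cst|exact: win_cvg].
Qed.

Lemma trunc_abs n l : `|trunc n l| <= `|l|.
by rewrite /trunc normrM ler_piMr// indic_le1. Qed.
Lemma trunc_mono n k l : (n <= k)%N -> `|trunc n l| <= `|trunc k l|.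
by move=> nk; rewrite -(trunc_win l nk) normrM ler_piMr// indic_le1. Qed.

Section OnePvm.
Variable P : pvm E.

Lemma fc_scvg (F : nat -> R -> R) f C : (forall n, bm (F n)) -> bm f ->
  (forall n l, `|F n l| <= C) -> (forall l, (fun n => F n l) @ \oo --> f l) ->
 scvg (fun n => fc P (F n)) (fc P f).
move=> bF bf hC hl x; have [K K0 hK] := bm_ge0_ub bf.
have bd n : bm (fun l => F n l - f l) by exact: bmB.
have h : (fun n => nrm (fc P (F n) x - fc P f x) ^+ 2) @ \oo --> (0 : R).
 rewrite (_ : (fun n => _) = (fun n => \int[pmu P x]_l ((F n l - f l) ^+ 2))); last by apply/funext => n; rewrite -fc_nrm// fcB// opE.
 rewrite -(mul0r (fine (pmu P x setT))) -(Rintegral_cst (pmu P x) measurableT 0).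
 apply: (@Rint_cvg _ _ _ _ ((C + K) ^+ 2)) => [n||n l|l]; first exact: bmX.
 - exact: (bm_cst 0).
 - have C0 : 0 <= C by apply: le_trans (hC 0%N l).
  rewrite normrX ler_pXn2r ?nnegrE ?addr_ge0 ?(ltW K0)//.
  by rewrite (le_trans (ler_normB _ _))// lerD.
 - rewrite -[X in _ --> X](mulr0 0); under eq_fun do rewrite expr2.
  by apply: cvgM; rewrite -(subrr (f l)); apply: cvgB => //; exact: cvg_cst.
apply/hcvgP => e e0; move/cvgrPdist_lt : h => /(_ (e ^+ 2)).
rewrite exprn_gt0// => /(_ isT) [N _ hN]; exists N => n Nn.
rewrite -(@ltr_pXn2r _ 2)// ?nnegrE ?nrm_ge0 ?(ltW e0)//.
by have := hN n Nn; rewrite /= sub0r normrN ger0_norm ?sqr_ge0.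
Qed.

Lemma win_scvg : scvg (fun n => pE P (win n)) 1.
have h := @fc_scvg (fun n => \1_(win n)) (fun=> 1) 1 (fun n => bm_ind (win_meas n))
 (bm_cst 1) (fun n l => indic_le1 _ _) win_cvg.
rewrite fc_cst scale1r in h; rewrite (_ : (fun n => _) = (fun n => fc P (\1_(win n))))//.
by apply/funext => n; rewrite fc_ind//; exact: win_meas.
Qed.

Lemma int_sq_cvg x : (fun n => (nrm (fc P (trunc n) x) ^+ 2)%:E) @ \oo -->
 (\int[pmu P x]_l ((l ^+ 2)%:E))%E.
rewrite (_ : (fun n => _) = (fun n => (\int[pmu P x]_l ((trunc n l ^+ 2)%:E))%E)); last first.
 apply/funext => n; have e := fc_nrm P x (trunc_bm n).
 rewrite e fineK//; apply: integrable_fin_num => //; apply: bm_int; apply: bmX.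
 exact: trunc_bm.
rewrite (_ : (fun l => (l ^+ 2)%:E) = (fun l : mR R => limn (fun n => (trunc n l ^+ 2)%:E))); last first.
 apply/funext => l; apply/esym/cvg_lim => //; apply: cvg_EFin; first exact: nearW.
 have h : (fun n => trunc n l) @ \oo --> (l : R) by exact: trunc_cvg.
 have h2 : (fun n => trunc n l ^+ 2) @ \oo --> (l ^+ 2 : R).
  by rewrite expr2; under eq_fun do rewrite expr2; exact: cvgM.
 exact: h2.
apply: (@cvg_monotone_convergence _ (mR R) R (pmu P x) setT measurableT (fun n l => (trunc n l ^+ 2)%:E)).
- by move=> n; apply/measurable_EFinP; apply: (bmX 2 (trunc_bm n)).1.
- by move=> n l _; rewrite lee_fin sqr_ge0.
- move=> l _ n k nk; rewrite lee_fin -[trunc n l ^+ 2]real_normK ?num_real//.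
 by rewrite -[trunc k l ^+ 2]real_normK ?num_real// ler_pXn2r ?nnegrE// trunc_mono.
Qed.

Lemma fc_trunc_mono n k x : (n <= k)%N -> nrm (fc P (trunc n) x) <= nrm (fc P (trunc k) x).
by move=> nk; apply: fc_nrm_le; try exact: trunc_bm; move=> l; exact: trunc_mono. Qed.

(** By monotone convergence the second moment is the supremum of [|D_n x|^2] over the truncations
    [D_n]. The domain of [D] is thereby described by bounded operators. *)
Lemma int_sq_finP x : (\int[pmu P x]_l ((l ^+ 2)%:E) < +oo)%E <->
 exists C, forall n, nrm (fc P (trunc n) x) <= C.
have nd : {homo (fun n => (nrm (fc P (trunc n) x) ^+ 2)%:E) : n m / (n <= m)%N >-> (n <= m)%E}.
 by move=> n m nm; rewrite lee_fin ler_pXn2r ?nnegrE ?nrm_ge0// fc_trunc_mono.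
have h := @int_sq_cvg x.
split=> [fin|[C hC]].
 have hsup := ereal_nondecreasing_cvgn nd.
 have e := cvg_unique (@ereal_hausdorff R) h hsup; set I := (\int[_]_l _)%E in fin e.
 have I0 : (0 <= I)%E by apply: integral_ge0 => l _; rewrite lee_fin sqr_ge0.
 exists (Num.sqrt (fine I)) => n.
 rewrite -(@ler_pXn2r _ 2)// ?nnegrE ?nrm_ge0 ?sqrtr_ge0// sqr_sqrtr ?fine_ge0//.
 rewrite -lee_fin fineK ?ge0_fin_numE// e; apply: ereal_sup_ubound; by exists n.
apply: (@le_lt_trans _ _ (C ^+ 2)%:E); last exact: ltry.
apply: (cvge_le _ h); apply: nearW => n.
by rewrite lee_fin ler_pXn2r ?nnegrE ?nrm_ge0// (le_trans _ (hC n))// nrm_ge0.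
Qed.

Lemma trunc_q_cvg x : (\int[pmu P x]_l ((l ^+ 2)%:E) < +oo)%E ->
 (fun n => q (fc P (trunc n)) x) @ \oo --> \int[pmu P x]_l l.
move=> fin.
have m2 : measurable_fun [set: mR R] (fun l : mR R => l ^+ 2).
 exact: (@measurable_funX _ _ _ _ (fun l : mR R => l)).
have i2 : (pmu P x).-integrable setT (fun l : mR R => (l ^+ 2)%:E).
 apply/integrableP; split; first exact/measurable_EFinP.
 by under eq_integral do rewrite gee0_abs ?lee_fin ?sqr_ge0//.
have i1 : (pmu P x).-integrable setT (fun l : mR R => (1 + l ^+ 2)%:E).
 rewrite (_ : (fun l => _) = (EFin \o cst 1) \+ (fun l : mR R => (l ^+ 2)%:E)).
  by apply: integrableD => //; exact: finite_measure_integrable_cst.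
 by apply/funext => l; rewrite /= EFinD.
have lb (l : R) : `|l| <= 1 + l ^+ 2.
 rewrite -(real_normK (num_real l)); have := sqr_ge0 (`|l| - 1); have := normr_ge0 l; nra.
have il : (pmu P x).-integrable setT (EFin \o (fun l : mR R => l)).
 apply: (le_integrable measurableT _ _ i1); first exact/measurable_EFinP.
 by move=> l _; rewrite /= lee_fin [leRHS]ger0_norm ?lb// addr_ge0 ?sqr_ge0.
rewrite (_ : (fun n => _) = (fun n => \int[pmu P x]_l trunc n l)); last by apply/funext => n; rewrite fc_q//; exact: trunc_bm.
apply: fine_cvg; rewrite /Rintegral fineK; last by apply: integrable_fin_num.
apply: (@dominated_cvg _ _ _ (pmu P x) setT measurableT (fun n => EFin \o trunc n)
 (EFin \o (fun l : mR R => l)) (fun l : mR R => (1 + l ^+ 2)%:E)) => //.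
- by move=> n; apply/measurable_EFinP; exact: (trunc_bm n).1.
- move=> l _; apply: cvg_EFin; first exact: nearW.
 by have h : (fun n => trunc n l) @ \oo --> (l : R) by exact: trunc_cvg.
- by move=> n l _; rewrite lee_fin (le_trans (trunc_abs _ _)).
Qed.

Lemma fc_pE f B : bm f -> measurable B -> fc P f * pE P B = fc P (fun l => f l * \1_B l).
by move=> bf mB; rewrite -fc_ind// -fcM//; exact: bm_ind. Qed.

Lemma pE_fc f B : bm f -> measurable B -> pE P B * fc P f = fc P (fun l => f l * \1_B l).
move=> bf mB; rewrite -fc_pE// -(fc_ind P mB) fcC//; exact: bm_ind.
Qed.

Lemma pE_comm B B' : measurable B -> measurable B' -> pE P B * pE P B' = pE P B' * pE P B.
by move=> mB mB'; rewrite -!pE_I// setIC. Qed.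

Hypothesis hD : pvm_of P.

Lemma domP x : dom D x <-> exists C, forall n, nrm (fc P (trunc n) x) <= C.
by rewrite hD.1 int_sq_finP. Qed.

Lemma dom_stable Z x : (forall B, measurable B -> Z * pE P B = pE P B * Z) ->
 dom D x -> dom D (Z x).
move=> hZ /domP [C hC]; apply/domP; exists (opn Z * C) => n.
rewrite -(op_comm_app (fc_comm (trunc_bm n) hZ)) (le_trans (opn_le _ _))//.
by rewrite ler_wpM2l ?opn_ge0.
Qed.

Lemma ripD_lim x : dom D x -> (fun n => q (fc P (trunc n)) x) @ \oo --> rip (D x) x.
by move=> dx; rewrite hD.2//; apply: trunc_q_cvg; apply/hD.1. Qed.

Lemma ripD_orth u v : dom D u -> dom D v -> (forall n, rip (fc P (trunc n) u) v = 0) ->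
 rip (D u) v = 0.
move=> du dv h.
have [d1 e1] := udomD sD du dv.
have l1 := ripD_lim d1; have l2 := ripD_lim du; have l3 := ripD_lim dv.
have e n : q (fc P (trunc n)) (u + v) = q (fc P (trunc n)) u + q (fc P (trunc n)) v.
 have /saP s := fc_sa P (trunc_bm n).
 have h' := h n; rewrite /q opD !ripDl !ripDr (s v u) (ripC v) h'; ring.
have l4 : (fun n => q (fc P (trunc n)) u + q (fc P (trunc n)) v) @ \oo --> rip (D u) u + rip (D v) v.
 by apply: cvgD.
have l5 : (fun n => q (fc P (trunc n)) (u + v)) @ \oo --> rip (D u) u + rip (D v) v.
 by under eq_fun do rewrite e.
have := @cvg_eq_lim _ _ _ _ l1 l5.
rewrite e1 !ripDl !ripDr -/(rip (D v) u) (usym sD dv du) (ripC v) => /eqP.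
rewrite -subr_eq0 => /eqP h2; lra.
Qed.

(** A resolution prescribes only the diagonal values [rip (D x) x]. Polarized, they show that [D]
    has no matrix entries between the range of the projection and its complement; density of the
    domain turns this into commutation. *)
Lemma ucomm_pE B : measurable B -> ucomm D (pE P B).
move=> mB x dx; have st (B1 : borel R) : measurable B1 -> forall z, dom D z -> dom D (pE P B1 z).
 by move=> mC z; apply: dom_stable => B2 mB2; exact: pE_comm.
have pB := pE_proj P mB; have /saP sB := pB.1.
have dBx := st _ mB _ dx; split=> //.
have cB z : dom D z -> dom D (z - pE P B z).
 by move=> dz; apply: (udomB sD dz (st _ mB _ dz)).1.
have orth u v : dom D u -> dom D v -> rip (D (pE P B u)) (v - pE P B v) = 0.
 move=> du dv; apply: ripD_orth; [exact: st|exact: cB|move=> n].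
 rewrite -opME fc_pE//; last exact: trunc_bm.
 rewrite -pE_fc//; last exact: trunc_bm.
 by rewrite opE sB opB proj_id// subrr rip0r.
apply: (udense_eq sD) => y dy; rewrite -(usym sD dy dBx).
rewrite -[RHS]sB -(usym sD (st _ mB _ dy) dx).
have h1 := orth x y dx dy; have h2 := orth y x dy dx.
move: h1 h2; rewrite !ripBr => /eqP; rewrite subr_eq0 => /eqP h1 /eqP; rewrite subr_eq0 => /eqP h2.
rewrite h2 (ripC (D y)) -(usym sD dBx dy) h1.
by rewrite (usym sD dBx (st _ mB _ dy)) ripC.
Qed.

Lemma win_dom n x : dom D (pE P (win n) x) /\ D (pE P (win n) x) = fc P (trunc n) x.
have mW := win_meas n; have bt k := trunc_bm k.
have dW y : dom D (pE P (win n) y).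
 apply/domP; exists (n%:R * nrm y) => k.
 rewrite -opME fc_pE// (le_trans (opn_le _ _))// ler_wpM2r ?nrm_ge0//.
 apply: fc_opn => [|l]; first by apply: bmM => //; exact: bm_ind.
 rewrite normrM indic_win; case: (boolP (_ < l <= _)) => [/andP[h1 h2]|_].
  by rewrite normr1 mulr1 (le_trans (trunc_abs _ _))// ler_norml h2 ltW.
 by rewrite normr0 mulr0.
split=> //.
have hq y : rip (D (pE P (win n) y)) (pE P (win n) y) = q (fc P (trunc n)) y.
 apply: (@cvg_eq_lim _ _ _ _ (ripD_lim (dW y))); apply: (@cvg_eventually _ _ _ n) => k nk.
 rewrite -q_conj (pE_proj P mW).1 -mulrA fc_pE// pE_fc//; last by apply: bmM => //; exact: bm_ind.
 congr (q (fc P _) _); apply/funext => l; rewrite trunc_win// /trunc -mulrA; congr (_ * _).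
 by rewrite indic_win -natrM mulnb andbb.
have sM := fc_sa P (bt n).
apply: rip_ext => y; rewrite (polar _ _ sM) -!hq.
rewrite opD opB (udomD sD (dW x) (dW y)).2 (udomB sD (dW x) (dW y)).2.
rewrite !ripDl !ripDr !ripNl !ripNr (usym sD (dW y) (dW x)) (ripC (pE P (win n) y)).
have -> : rip (D (pE P (win n) x)) y = rip (D (pE P (win n) x)) (pE P (win n) y).
 have /saP s := (pE_proj P mW).1; rewrite -s.
 by have [_ <-] := ucomm_pE mW (dW x); rewrite (proj_id _ (pE_proj P mW)).
by field.
Qed.

(** The two sides are compared after cutting by [win n], where [D] is the bounded operator of
    [win_dom]; the cuts converge strongly to 1. *)
Lemma fc_dom f x : bm f -> bm (fun l => l * f l) ->
 dom D (fc P f x) /\ D (fc P f x) = fc P (fun l => l * f l) x.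
move=> bf blf; have bt k := trunc_bm k; have [K K0 hK] := bm_ge0_ub blf.
have dx : dom D (fc P f x).
 apply/domP; exists (K * nrm x) => n; rewrite -opME -fcM//.
 rewrite (le_trans (opn_le _ _))// ler_wpM2r ?nrm_ge0//.
 apply: fc_opn => [|l]; first exact: bmM.
 by rewrite (le_trans _ (hK l))// [leRHS]normrM (normrM (trunc n l)) ler_wpM2r// trunc_abs.
split=> //.
apply: (@hcvg_unique _ _ (fun n => pE P (win n) (D (fc P f x)))); first exact: win_scvg.
rewrite (_ : (fun n => _) = (fun n => pE P (win n) (fc P (fun l => l * f l) x))); first exact: win_scvg.
apply/funext => n; have mW := win_meas n.
have [_ <-] := ucomm_pE mW dx; rewrite (win_dom n _).2 -!opME -fcM// pE_fc//.
by congr (fc P _ _); apply/funext => l; rewrite /trunc mulrAC.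
Qed.

Lemma pE_fc_app f A y : bm f -> measurable A -> pE P A y = y ->
 fc P f y = fc P (fun l => f l * \1_A l) y.
by move=> bf mA Ay; rewrite -fc_pE// opME Ay. Qed.

Lemma fc_q_le_on f g A y : bm f -> bm g -> measurable A -> pE P A y = y ->
 (forall l, A l -> f l <= g l) -> q (fc P f) y <= q (fc P g) y.
move=> bf bg mA Ay h; have bA := bm_ind mA.
have e k : bm k -> q (fc P k) y = q (fc P (fun l => k l * \1_A l)) y.
 by move=> bk; rewrite /q (pE_fc_app bk mA Ay).
rewrite (e f)// (e g)// !fc_q; try exact: bmM.
apply: Rint_le; try exact: bmM.
move=> l; rewrite indicE; case: (boolP (l \in A)) => [|_]; last by rewrite !mulr0.
by rewrite inE !mulr1; exact: h.
Qed.

Lemma q_win_cvg c y : (fun n => q (fc P (fun l => c * \1_(win n) l)) y) @ \oo --> c * nrm y ^+ 2.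
have h := cvg_scale c (@wcvg_q _ _ _ _ y (scvg_wcvg win_scvg)).
rewrite (_ : (fun n => _) = (fun n => c * q (pE P (win n)) y)).
 by rewrite -q1.
apply/funext => n; rewrite fcZ; last exact: (bm_ind (win_meas n)).
by rewrite fc_ind ?qZ//; exact: win_meas.
Qed.

Lemma ripD_le y A c : measurable A -> dom D y -> pE P A y = y -> (forall l, A l -> l <= c) ->
 rip (D y) y <= c * nrm y ^+ 2.
move=> mA dy Ay hA; apply: (cvg_le _ (ripD_lim dy) (@q_win_cvg c y)) => n.
apply: (fc_q_le_on _ _ mA Ay); [exact: trunc_bm|exact: (bmZ _ (bm_ind (win_meas n)))|].
by move=> l Al; rewrite /trunc ler_wpM2r ?hA// indicE.
Qed.

Lemma ripD_ge y A c : measurable A -> dom D y -> pE P A y = y -> (forall l, A l -> c <= l) ->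
 c * nrm y ^+ 2 <= rip (D y) y.
move=> mA dy Ay hA; apply: (cvg_le _ (@q_win_cvg c y) (ripD_lim dy)) => n.
apply: (fc_q_le_on _ _ mA Ay); [exact: (bmZ _ (bm_ind (win_meas n)))|exact: trunc_bm|].
by move=> l Al; rewrite /trunc ler_wpM2r ?hA// indicE.
Qed.

End OnePvm.

(** A vector of both ranges satisfies [d |y|^2 <= rip (D y) y <= c |y|^2]. Cutting by [win n] brings
    it into the domain without leaving the ranges. *)
Lemma pvm_sep P P' c d : pvm_of P -> pvm_of P' -> c < d ->
 (forall B B', measurable B -> measurable B' -> pE P B * pE P' B' = pE P' B' * pE P B) ->
 pE P `]-oo, c]%classic * pE P' `]d, +oo[%classic = 0.
move=> hP hP' cd com; set A : borel R := `]-oo, c]%classic.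
set A' : borel R := `]d, +oo[%classic.
have mA : measurable A by exact: measurable_itv.
have mA' : measurable A' by exact: measurable_itv.
apply: op_ext => x; have h := win_scvg P (((pE P A : op E) * pE P' A') x).
apply: (hcvg_unique h); rewrite (_ : (fun n => _) = (fun=> 0)); first exact: hcvg_cst.
apply/funext => n; have mW := win_meas n; set y := pE P (win n) _.
have dy : dom D y by case: (win_dom hP n (((pE P A : op E) * pE P' A') x)).
have Ay : pE P A y = y.
 by rewrite /y (op_comm_app (pE_comm P mA mW)) opME proj_id//; exact: pE_proj.
have A'y : pE P' A' y = y.
 rewrite /y -(op_comm_app (com _ _ mW mA')) opME -(op_comm_app (com _ _ mA mA')) proj_id//.
 exact: pE_proj.
have h1 := ripD_le hP (c := c) mA dy Ay.
have h2 := ripD_ge hP' (c := d) mA' dy A'y.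
apply/eqP; rewrite -nrm_eq0 -sqrf_eq0 eq_le sqr_ge0 andbT.
have /h1 {}h1 : forall l, A l -> l <= c by move=> l; rewrite /A /= in_itv.
have /h2 {}h2 : forall l, A' l -> d <= l by move=> l; rewrite /A' /= in_itv /= andbT => /ltW.
nra.
Qed.

Lemma pvm_le P P' c : pvm_of P -> pvm_of P' ->
 (forall B B', measurable B -> measurable B' -> pE P B * pE P' B' = pE P' B' * pE P B) ->
 pE P `]-oo, c]%classic * pE P' `]-oo, c]%classic = pE P `]-oo, c]%classic.
move=> hP hP' com; pose B' n : borel R := `]-oo, c + n.+1%:R^-1]%classic.
have mB n : measurable (B' n) by exact: measurable_itv.
have e n : pE P `]-oo, c]%classic * pE P' (B' n) = pE P `]-oo, c]%classic.
 have := @pvm_sep P P' c (c + n.+1%:R^-1) hP hP'; rewrite ltrDl invr_gt0 ltr0Sn => /(_ isT com).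
 rewrite (_ : pE P' `]_, +oo[%classic = 1 - pE P' (B' n)).
  by rewrite mulrBr mulr1 => /eqP; rewrite subr_eq0 => /eqP.
 have bB := bm_ind (mB n).
 rewrite -(fc_ind P' (mB n)) -(scale1r (1 : op E)) -(fc_cst P') -fcB//; last exact: bm_cst.
 rewrite -fc_ind; last exact: measurable_itv.
 congr (fc _ _); apply/funext => l; rewrite !indicE !mem_setE !in_itv /= andbT leNgt.
 by case: (_ < l); rewrite ?subr0 ?subrr.
have h : scvg (fun n => pE P' (B' n)) (pE P' `]-oo, c]%classic).
 rewrite -fc_ind; last exact: measurable_itv.
 rewrite (_ : (fun n => _) = (fun n => fc P' (\1_(B' n)))); last by apply/funext => n; rewrite fc_ind.
 apply: (@fc_scvg P' _ _ 1) => [n||n l|l]; [exact: bm_ind|apply: bm_ind; exact: measurable_itv|exact: indic_le1|].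
 have [lc|cl] := lerP l c.
  apply: (@cvg_eventually _ _ _ 0%N) => n _; rewrite !indicE !mem_setE !in_itv /= lc.
  by rewrite (le_trans lc)// lerDl.
 apply: (@cvg_eventually _ _ _ (Num.bound ((l - c)^-1))) => n hn.
 rewrite !indicE !mem_setE !in_itv /= (leNgt l c) cl leNgt -ltrBrDl.
 suff -> : n.+1%:R^-1 < l - c by [].
 have lc0 : 0 < l - c by rewrite subr_gt0.
 rewrite invf_plt ?posrE//; apply: (lt_le_trans (archi_boundP (ltW _))); first by rewrite invr_gt0.
 by rewrite ler_nat ltnW.
have h2 := scvgMl (pE P `]-oo, c]%classic) h.
rewrite (_ : (fun n => _) = (fun=> pE P `]-oo, c]%classic)) in h2; last exact/funext.
exact: (scvg_uniq h2 (scvg_cst _)).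
Qed.

(** The mutual commutation assumed here is supplied in [fc_pvm_of]: the projections of any
    resolution commute with [D], hence with those of [specp]. *)
Lemma pvm_uniq P P' : pvm_of P -> pvm_of P' ->
 (forall B B', measurable B -> measurable B' -> pE P B * pE P' B' = pE P' B' * pE P B) ->
 forall B, measurable B -> pE P B = pE P' B.
move=> hP hP' com; have com' B B' : measurable B -> measurable B' -> pE P' B * pE P B' = pE P B' * pE P' B.
 by move=> mB mB'; rewrite com.
have C (Q : pvm E) B : measurable B -> pE Q (~` B) = 1 - pE Q B.
 move=> mB; rewrite -(fc_ind Q (measurableC mB)) -(fc_ind Q mB) -(scale1r (1 : op E)) -(fc_cst Q).
 rewrite -fcB//; [|exact: bm_cst|exact: bm_ind].
 congr (fc _ _); apply/funext => l; rewrite !indicE in_setC.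
 by case: (_ \in _); rewrite ?subr0 ?subrr.
apply: borel_induction => [|c|B mB h|F mF tF h].
- by rewrite !pE_T.
- rewrite -setCitvl !C; [|exact: measurable_itv|exact: measurable_itv].
 have mI := @mitv R `]-oo, c].
 congr (_ - _); rewrite -(@pvm_le P P' c hP hP' com).
 by rewrite com// (@pvm_le P' P c hP' hP com').
- by rewrite !C// h.
- have mU : measurable (\bigcup_k F k) by exact: bigcup_measurable.
 apply: sa_ext => [||x]; [exact: (pE_proj P mU).1|exact: (pE_proj P' mU).1|].
 apply/EFin_inj; rewrite -!pmuE// !measure_semi_bigcup//.
 by apply: eq_eseriesr => n _; apply: (etrans (pmuE P x (mF n))); rewrite h; apply/esym/pmuE.
Qed.

Lemma fc_pE_eq (P P' : pvm E) f : (forall B, measurable B -> pE P B = pE P' B) -> bm f -> fc P f = fc P' f.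
move=> h bf; apply: fc_uniq => // [|x]; first exact: fc_sa.
rewrite fc_q//; congr fine; apply: eq_measure_integral => B mB _.
by apply: (etrans (pmuE P' x mB)); rewrite -h//; apply/esym/pmuE.
Qed.

Let S := specp sD.

Lemma specp_ucomm B : measurable B -> ucomm D (pE S B).
move=> mB; apply/(ucommP sD); split; apply/esym; apply: specp_comm => //.
- exact: ucomm_resY.
- exact: ucomm_resZ.
Qed.

Lemma specp_itv a b : a <= b -> pE S `]a, b]%classic = sfam sD b - sfam sD a.
move=> ab; have m1 := @mitv R `]a, +oo[.
have m2 := @mitv R `]b, +oo[.
have -> : sfam sD b - sfam sD a = pE S `]a, +oo[%classic - pE S `]b, +oo[%classic.
 by rewrite !specp_ray opprB [RHS]addrC addrA subrK.
rewrite -(fc_ind S m1) -(fc_ind S m2) -fcB; try exact: bm_ind.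
rewrite -fc_ind; last exact: measurable_itv.
congr (fc _ _); apply/funext => l; rewrite !indicE !mem_setE !in_itv /= !andbT.
have [lb|bl] := lerP l b; first by rewrite andbT subr0.
by rewrite andbF (le_lt_trans ab bl) subrr.
Qed.

Lemma bm_lind a b : bm (fun l : R => l * \1_(`]a, b]%classic : set R) l).
split; first by apply: measurable_funM => //; apply: measurable_indic; exact: measurable_itv.
exists (`|a| + `|b|) => l; rewrite indicE mem_setE in_itv /=.
case: (boolP (_ < l <= _)) => [/andP[h1 h2]|_]; last by rewrite mulr0 normr0 addr_ge0.
rewrite mulr1 ler_norml; have := ler_norm b; have := ler_norm (- a).
rewrite normrN; have := normr_ge0 a; have := normr_ge0 b; move=> *; apply/andP; split; lra.
Qed.

Lemma specp_split a m b : a <= m -> m <= b ->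
 pE S `]a, b]%classic = pE S `]a, m]%classic + pE S `]m, b]%classic.
move=> am mb; rewrite !specp_itv// ?(le_trans am)//.
by rewrite [RHS]addrC addrA subrK.
Qed.

(** The errors on the two halves of an interval are orthogonal, so each bisection halves the bound;
    with [k] arbitrary the error vanishes in [specp_win]. The factor 2 comes from the base case,
    where [D] and the integral both differ from [a] by at most [b - a]. *)
Lemma specp_slice k a b x : a < b -> dom D (pE S `]a, b]%classic x) /\
 nrm (D (pE S `]a, b]%classic x) - fc S (fun l => l * \1_(`]a, b]%classic : set R) l) x) <=
  2 * (b - a) / 2 ^+ k * nrm (pE S `]a, b]%classic x).
elim: k a b => [|k IH] a b ab.
 have [d1 h1] := sfam_slice x ab (specp_itv (ltW ab)); split=> //.
 rewrite expr0 divr1; set y := pE S _ x in d1 h1 *.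
 have mI := @mitv R `]a, b].
 have yy : pE S `]a, b]%classic y = y by rewrite /y proj_id//; exact: pE_proj.
 have bla : bm (fun l => (l - a) * \1_(`]a, b]%classic : set R) l).
  have := bmB (bm_lind a b) (bmZ a (bm_ind mI)).
  by under eq_fun do rewrite -mulrBl.
 have e1 : fc S (fun l => l * \1_(`]a, b]%classic : set R) l) x =
   sv a y + fc S (fun l => (l - a) * \1_(`]a, b]%classic : set R) l) y.
  have -> : fc S (fun l => (l - a) * \1_(`]a, b]%classic : set R) l) y =
    fc S (fun l => (l - a) * \1_(`]a, b]%classic : set R) l) x.
   rewrite /y -(fc_ind S mI) -opME -fcM//; last exact: bm_ind.
   congr (fc _ _ _); apply/funext => l; rewrite -mulrA indicE -natrM mulnb andbb//.
  transitivity ((a *: fc S (\1_(`]a, b]%classic)) +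
    fc S (fun l => (l - a) * \1_(`]a, b]%classic : set R) l)) x); last by rewrite opDE opZE (fc_ind S mI).
  rewrite -fcZ; last exact: bm_ind.
  rewrite -fcD //; last exact: (bmZ _ (bm_ind mI)).
  by congr (fc _ _ _); apply/funext => l; ring.
 rewrite e1 opprD addrA (le_trans (nrmB _ _))//.
 rewrite (_ : 2 * (b - a) * nrm y = (b - a) * nrm y + (b - a) * nrm y); last by ring.
 apply: lerD => //; rewrite (le_trans (opn_le _ _))// ler_wpM2r ?nrm_ge0//.
 apply: fc_opn => [//|l].
 rewrite normrM indicE mem_setE in_itv /=; case: (boolP (_ < l <= _)) => [/andP[h3 h4]|_].
  rewrite normr1 mulr1 ger0_norm; lra.
 by rewrite normr0 mulr0 subr_ge0 ltW.
pose m := (a + b) / 2; have am : a < m by rewrite /m; lra.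
have mb : m < b by rewrite /m; lra.
have [d1 h1] := IH _ _ am; have [d2 h2] := IH _ _ mb.
have mI1 := @mitv R `]a, m].
have mI2 := @mitv R `]m, b].
have e := specp_split (ltW am) (ltW mb).
rewrite e opDE (udomD sD d1 d2).2; split; first exact: (udomD sD d1 d2).1.
set g1 := pE S `]a, m]%classic in d1 h1 e *; set g2 := pE S `]m, b]%classic in d2 h2 e *.
have p1 : proj g1 by exact: pE_proj. have p2 : proj g2 by exact: pE_proj.
have g12 : g1 * g2 = 0.
 rewrite /g1 /g2 -pE_I// (_ : _ `&` _ = set0); last first.
  apply/seteqP; split=> // l [] /=; rewrite !in_itv /= => /andP[_ h3] /andP[h4 _].
  by move: (lt_le_trans h4 h3); rewrite ltxx.
 apply/(scvg_uniq _ (scvg_cst _)); rewrite -(fc_ind S measurable0).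
 rewrite (_ : \1_set0 = fun=> 0); last by apply/funext => l; rewrite indicE in_set0.
 by rewrite fc_cst scale0r; exact: scvg_cst.
pose F1 := fc S (fun l => l * \1_(`]a, m]%classic : set R) l).
pose F2 := fc S (fun l => l * \1_(`]m, b]%classic : set R) l).
have eF : fc S (fun l => l * \1_(`]a, b]%classic : set R) l) = F1 + F2.
 rewrite -fcD; try exact: bm_lind.
 congr (fc _ _); apply/funext => l; rewrite -mulrDr; congr (_ * _).
 rewrite !indicE !mem_setE !in_itv /=; have [lm|ml] := lerP l m.
  by rewrite (le_trans lm (ltW mb)) addr0.
 by rewrite andbF add0r (lt_trans am ml).
rewrite eF opDE opprD addrACA.
set u1 := D (g1 x) - F1 x; set u2 := D (g2 x) - F2 x.
have gF (B : borel R) c d : measurable B -> B = `]c, d]%classic ->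
  pE S B * fc S (fun l => l * \1_(`]c, d]%classic : set R) l) = fc S (fun l => l * \1_(`]c, d]%classic : set R) l).
 move=> mB eB; rewrite pE_fc ?eB//; last exact: bm_lind.
 by congr (fc _ _); apply/funext => l; rewrite -mulrA indicE -natrM mulnb andbb.
have gu1 : g1 u1 = u1.
 rewrite /u1 opB -opME /F1 gF// -(specp_ucomm mI1 d1).2 -/g1 proj_id//.
have gu2 : g2 u2 = u2.
 rewrite /u2 opB -opME /F2 gF// -(specp_ucomm mI2 d2).2 -/g2 proj_id//.
have orth y z : rip (g1 y) (g2 z) = 0.
 by have /saP s := p1.1; rewrite s -opME g12 opE rip0r.
rewrite -(@ler_pXn2r _ 2)// ?nnegrE ?nrm_ge0//; last by rewrite !mulr_ge0 ?nrm_ge0 ?invr_ge0 ?exprn_ge0// subr_ge0 ltW// (lt_trans am).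
have ou : rip u1 u2 = 0 by rewrite -gu1 -gu2 orth.
rewrite exprMn (nrm_sqD u1) (nrm_sqD (g1 x)) ou orth !mulr0 !addr0 mulrDr.
have em : 2 * (m - a) / 2 ^+ k = 2 * (b - a) / 2 ^+ k.+1.
 by rewrite exprS /m; field; rewrite expf_neq0.
have em2 : 2 * (b - m) / 2 ^+ k = 2 * (b - a) / 2 ^+ k.+1.
 by rewrite exprS /m; field; rewrite expf_neq0.
rewrite em in h1; rewrite em2 in h2.
have h1' : nrm u1 <= 2 * (b - a) / 2 ^+ k.+1 * nrm (g1 x) := h1.
have h2' : nrm u2 <= 2 * (b - a) / 2 ^+ k.+1 * nrm (g2 x) := h2.
have := le_trans (nrm_ge0 _) h1'; have := le_trans (nrm_ge0 _) h2' => p3 p4.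
by apply: lerD; rewrite -exprMn ler_pXn2r ?nnegrE ?nrm_ge0.
Qed.

Lemma specp_win n x : dom D (pE S (win n) x) /\ D (pE S (win n) x) = fc S (trunc n) x.
case: n => [|n].
 have w0 : win 0 = set0 by rewrite /win; apply/seteqP; split=> // l /=; rewrite in_itv /= oppr0 => /andP[h1 h2]; move: (lt_le_trans h1 h2); rewrite ltxx.
 have -> : pE S (win 0) = 0.
  rewrite w0 -(fc_ind S measurable0) (_ : \1_set0 = fun=> 0); last by apply/funext => l; rewrite indicE in_set0.
  by rewrite fc_cst scale0r.
 have -> : fc S (trunc 0) = 0.
  rewrite (_ : trunc 0 = fun=> 0); last by apply/funext => l; rewrite /trunc w0 indicE in_set0 mulr0.
  by rewrite fc_cst scale0r.
 by rewrite opE; split; [exact: udom0|exact: uD0].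
have nn : - n.+1%:R < n.+1%:R :> R by apply: (@lt_trans _ _ 0); rewrite ?oppr_lt0.
have [d _] := specp_slice 0 x nn; split=> //.
apply/eqP; rewrite -subr_eq0 -nrm_eq0 eq_le nrm_ge0 andbT.
set C := 2 * (n.+1%:R - - n.+1%:R) * nrm (pE S (win n.+1) x).
have h : (fun k => C * (2 ^+ k)^-1) @ \oo --> (0 : R).
 apply: cvg_scale0; rewrite (_ : (fun k => _) = (fun k => 2^-1 ^+ k)); last by apply/funext => k; rewrite exprVn.
 by apply: cvg_expr; rewrite ger0_norm// invf_lt1// ltr1n.
apply: (@cvg_ge_cst _ _ _ _ _ h) => k; have [_] := specp_slice k x nn.
by move=> /le_trans; apply; rewrite /C mulrAC.
Qed.

(** If the truncations at [x] stay bounded they are Cauchy, because [|D_m x - D_n x|^2 = |D_m x|^2 -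
    |D_n x|^2]; as [D] is closed, [x] lies in its domain. *)
Lemma specp_pvm_of : pvm_of S.
have wc x : dom D x -> (forall n, fc S (trunc n) x = pE S (win n) (D x)).
 by move=> dx n; rewrite -(specp_win n x).2 (specp_ucomm (win_meas n) dx).2.
have hdom x : dom D x <-> exists C, forall n, nrm (fc S (trunc n) x) <= C.
 split=> [dx|[C hC]].
  exists (nrm (D x)) => n; rewrite wc// (le_trans (opn_le _ _))// ler_piMl ?nrm_ge0//.
  exact: (proj_opn (pE_proj S (win_meas n))).
 have diff n m : (n <= m)%N -> nrm (fc S (trunc m) x - fc S (trunc n) x) ^+ 2 =
   nrm (fc S (trunc m) x) ^+ 2 - nrm (fc S (trunc n) x) ^+ 2.
  move=> nm; have bt k := trunc_bm k.
  have -> : fc S (trunc n) x = pE S (win n) (fc S (trunc m) x).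
   rewrite -opME pE_fc//; last exact: win_meas.
   by congr (fc _ _ _); apply/funext => l; rewrite trunc_win.
  rewrite nrm_sqB ripC -/(q _ _) proj_q; last exact: (pE_proj S (win_meas n)).
  ring.
 have nd : nondecreasing_seq (fun n => nrm (fc S (trunc n) x) ^+ 2).
  move=> n m nm; rewrite ler_pXn2r ?nnegrE ?nrm_ge0//; exact: fc_trunc_mono.
 have cv : cvgn (fun n => nrm (fc S (trunc n) x) ^+ 2).
  apply: nondecreasing_is_cvgn => //; exists (C ^+ 2) => _ [n _ <-].
  by rewrite ler_pXn2r ?nnegrE ?nrm_ge0// (le_trans (nrm_ge0 _) (hC n)).
 have [z hz] : exists z, hcvg (fun n => fc S (trunc n) x) z.
  apply: hcomplete => e e0; move/cvg_cauchy/cauchyP : cv => hc.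
  have [l hl] : exists l, forall n, (l <= n)%N ->
    nrm (fc S (trunc n) x) ^+ 2 - nrm (fc S (trunc l) x) ^+ 2 < (e / 2) ^+ 2.
   have cv2 : cvgn (fun n => nrm (fc S (trunc n) x) ^+ 2).
    apply: nondecreasing_is_cvgn => //; exists (C ^+ 2) => _ [n _ <-].
    by rewrite ler_pXn2r ?nnegrE ?nrm_ge0// (le_trans (nrm_ge0 _) (hC n)).
   have e2 : 0 < (e / 2) ^+ 2 by rewrite exprn_gt0// divr_gt0.
   have /cvgrPdist_lt /(_ _ e2) [N _ hN] := cv2; exists N => n Nn.
   have h1 := hN N (leqnn N); have h2 := nondecreasing_cvgn_le nd cv2 n.
   rewrite /= ltr_norml in h1; move/andP: h1 => [_ h1].
   by apply: le_lt_trans h1; rewrite lerD2r.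
  exists l => n m ln lm; have k0 : forall k, (l <= k)%N -> nrm (fc S (trunc k) x - fc S (trunc l) x) < e / 2.
   move=> k lk; rewrite -(@ltr_pXn2r _ 2)// ?nnegrE ?nrm_ge0 ?divr_ge0 ?(ltW e0)//.
   by rewrite diff// hl.
  have -> : fc S (trunc n) x - fc S (trunc m) x =
    (fc S (trunc n) x - fc S (trunc l) x) - (fc S (trunc m) x - fc S (trunc l) x).
   by rewrite opprB addrA subrK.
  rewrite (le_lt_trans (nrmB _ _))//; have := k0 n ln; have := k0 m lm; lra.
 have [] // := @uclosed _ _ _ sD (fun n => pE S (win n) x) x z.
 - by move=> n; case: (specp_win n x).
 - by have := win_scvg S x.
 - by under eq_fun do rewrite (specp_win _ x).2.
split=> [x|x dx]; first by rewrite hdom int_sq_finP.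
have fin : (\int[pmu S x]_l ((l ^+ 2)%:E) < +oo)%E by apply/int_sq_finP/hdom.
apply: (@cvg_eq_lim _ _ _ _ _ (trunc_q_cvg fin)).
under eq_fun do rewrite /q wc//.
have h := @scvg_wcvg _ _ _ _ (win_scvg S) (D x) x; rewrite op1E in h; exact: h.
Qed.

End PvmOperator.

(** * Translation of the definitions into the operator ring *)

Section Glue.
Context {R : realType} {E : hilbert R}.
Implicit Types (S T : op E) (x y : E).

Lemma adjoint_ofP S T : adjoint_of (hdot E) T S <-> T^† = S.
split=> [h|<- x y]; last by rewrite !hdotE -adjP' -opiv -adjP'.
by apply: adj_uniq => x y; rewrite /rip h.
Qed.

Lemma self_adjointP T : self_adjoint (hdot E) T <-> sa T.
by split=> [[_ /adjoint_ofP]|h] //; split; [exact: op_bounded|exact/adjoint_ofP]. Qed.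

Lemma projectionP T : projection (hdot E) T <-> proj T.
split=> [[/self_adjointP sT TT]|[sT TT]]; split=> //.
- by apply: op_ext => x; rewrite opME; have := congr1 (fun f => f x) TT.
- exact/self_adjointP.
- by apply/funext => x /=; rewrite -opME TT.
Qed.

Lemma sa_im T : (forall x, rip (T x) (iv x) = 0) -> sa T.
move=> h; apply/saP => x y.
have h1 u v : rip (T u) (iv v) + rip (T v) (iv u) = 0.
 by have := h (u + v); rewrite opD ivD !ripDl !ripDr !h add0r addr0.
have := h1 x (iv y); rewrite iv_iv opiv ripi iv_iv !ripNr opprK => /eqP.
by rewrite addrC subr_eq0 => /eqP <-; rewrite ripC.
Qed.

Lemma positiveP T : positive_operator (hdot E) T <-> psd T.
split=> [[_ h]|[sT h]].
 split=> [|x]; last by have := h x; rewrite hdotE lecE /= => /andP[].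
 by apply: sa_im => x; have := h x; rewrite hdotE lecE /= => /andP[/eqP].
split=> [|x]; first exact: op_bounded.
rewrite hdotE lecE /= h andbT; apply/eqP; move/saP: sT => s.
have := s x (iv x); rewrite opiv (ripC x) ripi => h2; lra.
Qed.

End Glue.

(** * The functional calculus selected by [fcalc] *)

Section FcalcE.
Context {R : realType} {E : hilbert R} (D : unbounded_operator E) (sD : usa D).
Implicit Types (f : R -> R).

Lemma pvm_resolution P : pvm_of D P ->
 spectral_resolution (hdot E) D (fun B => pE P B) (pmu P).
move=> hP; split=> [B mB||x B mB|x|x dx].
- exact/projectionP/pE_proj.
- split=> [|B B' mB mB']; first by rewrite pE_T.
 by rewrite pE_I.
- exact: pmuE.
- exact: hP.1.
- rewrite -hP.2// hdotE; congr (_ +i* _).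
 have := usym sD dx (udomiv sD dx).1; rewrite (udomiv sD dx).2 (ripC x) ripi => h; lra.
Qed.

Lemma resolution_pvm F mu : spectral_resolution (hdot E) D F mu ->
 exists P : pvm E, pvm_of D P /\ pmu P = mu.
move=> [hp [hT hI] hm hd hq].
pose G B : op E := if pselect (measurable B) is left mB then Op (hp B mB).1.1 else 0.
have GE B : measurable B -> forall x, G B x = F B x.
 by move=> mB x; rewrite /G; case: pselect.
have gp B : measurable B -> proj (G B).
 move=> mB; apply/projectionP; rewrite (_ : opf (G B) = F B); last by apply/funext => x; rewrite GE.
 exact: (hp B mB).
have gT : G setT = 1 by apply: op_ext => x; rewrite GE// hT.
have gI B C : measurable B -> measurable C -> G (B `&` C) = G B * G C.
 by move=> mB mC; apply: op_ext => x; rewrite opME !GE ?hI//; exact: measurableI.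
have gm x B : measurable B -> mu x B = (q (G B) x)%:E.
 by move=> mB; rewrite hm// /q GE.
exists (Pvm gp gT gI gm); split=> //; split=> [x|x dx]; first exact: hd.
by have := hq x dx; rewrite hdotE => -[].
Qed.

Lemma fc_pvm_of P f : pvm_of D P -> bm f -> fc P f = fc (specp sD) f.
move=> hP bf; apply: fc_pE_eq => //; apply: (pvm_uniq sD hP (specp_pvm_of sD)) => B B' mB mB'.
by apply: specp_comm => //; exact: ucomm_pE.
Qed.

(** [fcalc] is a choice among operators attached to some resolution of [D]; uniqueness of the
    resolution ([fc_pvm_of]) determines the choice. *)
Lemma fcalcE f : bm f -> fcalc (hdot E) D f = fc (specp sD) f.
move=> bf; have hS := specp_pvm_of sD.
apply: get_unique => [|T [bT [F [mu [hF hT]]]]].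
 split; first exact: op_bounded.
 exists (fun B => pE (specp sD) B), (pmu (specp sD)); split; first exact: pvm_resolution.
 move=> x; have /saP s := fc_sa (specp sD) bf; rewrite hdotE -fc_q//; congr (_ +i* _).
 have := s x (iv x); rewrite opiv (ripC x) ripi => h2; lra.
have [P [hP mP]] := resolution_pvm hF.
rewrite -(fc_pvm_of hP bf) (_ : T = opf (Op bT))//; congr opf; apply/esym.
apply: fc_uniq => // [|x]; last by rewrite /q /rip /= hT mP.
by apply: sa_im => x; have := hT x; rewrite hdotE => -[_].
Qed.

End FcalcE.

(** * Von Neumann algebras and affiliated operators *)

Record tracial (R : realType) (E : hilbert R) := Tracial {
 tN : set (E -> E);
 ttau : (E -> E) -> \bar R;
 tN_vN : von_neumann_algebra (hdot E) tN;
 ttauP : faithful_normal_semifinite_trace (hdot E) tN ttau }.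

Lemma half_op (R : realType) (E : hilbert R) (S : op E) : 2^-1 *: (S + S) = S.
by rewrite scalerDr -scalerDl (_ : 2^-1 + 2^-1 = 1) ?scale1r//; field. Qed.

Section VonNeumann.
Context {R : realType} {E : hilbert R} (A : tracial E).
Implicit Types (S T U X : op E) (D : unbounded_operator E).

Definition inN T := tN A (opf T).
Definition inC S := commutant (tN A) (opf S).

Lemma tN_op f : tN A f -> exists T : op E, opf T = f.
by rewrite -(tN_vN A).2 => -[bf _]; exists (Op bf). Qed.

Lemma inCP S : inC S <-> forall T, inN T -> S * T = T * S.
split=> [[_ h] T hT|h].
 by apply: op_ext => x; have := congr1 (fun f => f x) (h _ hT).
split; first exact: op_bounded.
move=> f hf; have [T eT] := tN_op hf; subst f; apply/funext => x /=.
by rewrite -!opME h.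
Qed.

Lemma inNP T : inN T <-> forall S, inC S -> T * S = S * T.
split=> [hT S /inCP h|h]; first by rewrite h.
rewrite /inN -(tN_vN A).2; split; first exact: op_bounded.
move=> f hf; apply/funext => x /=; have -> : f = opf (Op hf.1) by [].
by rewrite -!opME h.
Qed.

Lemma inN_adj T : inN T -> inN T^†.
move=> hT; apply: (tN_vN A).1 hT (op_bounded _) _; exact/adjoint_ofP.
Qed.

Lemma inN0 : inN 0. by apply/inNP => S _; rewrite mul0r mulr0. Qed.
Lemma inN1 : inN 1. by apply/inNP => S _; rewrite mul1r mulr1. Qed.
Lemma inNJ : inN opJ. by apply/inNP => S _; rewrite opJC. Qed.
Lemma inND S T : inN S -> inN T -> inN (S + T).
by move=> /inNP hS /inNP hT; apply/inNP => X hX; rewrite mulrDl mulrDr hS// hT. Qed.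
Lemma inNN S : inN S -> inN (- S).
by move=> /inNP hS; apply/inNP => X hX; rewrite mulNr mulrN hS. Qed.
Lemma inNB S T : inN S -> inN T -> inN (S - T).
by move=> hS hT; apply: inND => //; exact: inNN. Qed.
Lemma inNM S T : inN S -> inN T -> inN (S * T).
by move=> /inNP hS /inNP hT; apply/inNP => X hX; rewrite -mulrA hT// mulrA hS// mulrA.
Qed.
Lemma inNZ c S : inN S -> inN (c *: S).
by move=> /inNP hS; apply/inNP => X hX; rewrite -opZAl hS// opZAr. Qed.
Lemma inNX S n : inN S -> inN (S ^+ n).
move=> hS; elim: n => [|n IH]; first by rewrite expr0; exact: inN1.
by rewrite exprS; exact: inNM.
Qed.
Lemma inN_sum (I : Type) (r : seq I) (F : I -> op E) :
 (forall i, inN (F i)) -> inN (\sum_(i <- r) F i).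
move=> h; elim: r => [|i r IH]; first by rewrite big_nil; exact: inN0.
by rewrite big_cons; exact: inND.
Qed.

Lemma inN_wcvg u T : (forall n, inN (u n)) -> wcvg u T -> inN T.
move=> hu h; apply/inNP => S hS; apply: op_ext => x; apply: rip_ext => y.
rewrite !opME (adjP' S); have h1 := h (S x) y; have h2 := h x (S^† y).
apply: (@cvg_eq_lim _ _ _ _ _ h2); rewrite (_ : (fun n => _) = (fun n => rip (u n (S x)) y)) //.
apply/funext => n; rewrite -adjP'; congr rip.
by apply: op_comm_app; move/inNP : (hu n) => ->.
Qed.

(** The algebra is its own bicommutant. In this form the fact places square roots, kernel
    projections and the like in the algebra. *)
Lemma inN_comm S T : inN T -> (forall Z, Z * T = T * Z -> Z * S = S * Z) -> inN S.
by move=> /inNP hT h; apply/inNP => Z hZ; rewrite h// hT. Qed.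

Lemma inC_adj S : inC S -> inC S^†.
move=> /inCP h; apply/inCP => T hT; apply/esym.
by have := congr1 (@adj R E) (h _ (inN_adj hT)); rewrite !adjM adjK.
Qed.

(* A bounded operator is a combination of the two self-adjoint operators
  [S + S^*] and [iS - iS^*], and a self-adjoint contraction S is the half-sum
  of the unitaries [S + i (1 - S^2)^(1/2)] and [S - i (1 - S^2)^(1/2)]. *)
Lemma inN_unitary T :
 (forall U, inC U -> U^† * U = 1 -> U * U^† = 1 -> T * U = U * T) -> inN T.
move=> h.
have h1 S : inC S -> sa S -> opn S <= 1 -> T * S = S * T.
 move=> cS sS nS; have p : psd (1 - S * S).
  split=> [|x]; first by apply: saB; [exact: sa1|rewrite -{1}sS; exact: sa_sq].
  rewrite !qE -{1}sS q_sq subr_ge0 ler_pXn2r ?nnegrE ?nrm_ge0//.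
  by rewrite (le_trans (opn_le _ _))// ler_piMl ?nrm_ge0.
 have [B [pB BB cB]] := sqrt_exists p.
 have SB : S * B = B * S by apply: cB; rewrite mulrBr mulrBl mulr1 mul1r mulrA.
 have JS : opJ * S = S * opJ by rewrite opJC.
 have JB : opJ * B = B * opJ by rewrite opJC.
 have aB : B^† = B by case: pB.
 have iB : inC B.
  apply/inCP => X hX; apply/esym/cB; rewrite mulrBr mulrBl mulr1 mul1r.
  by move/inCP : cS => /(_ _ hX) eS; rewrite mulrA -eS -mulrA -eS mulrA.
 have iU : inC (S + opJ * B).
  apply/inCP => X hX; move/inCP : cS => /(_ _ hX) eS; move/inCP : iB => /(_ _ hX) eB.
  by rewrite mulrDl mulrDr eS -mulrA eB mulrA opJC mulrA.
 have aU : (S + opJ * B)^† = S - opJ * B by rewrite adjD adjM adjJ sS aB mulrN JB.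
 have U1 : (S - opJ * B) * (S + opJ * B) = 1.
  rewrite mulrBl !mulrDr [_ * B * (_ * B)]mulrA -[_ * B * _]mulrA -JB mulrA opJJ mulN1r mulNr BB.
  rewrite -[_ * B * S]mulrA -SB [opJ * (_ * _)]mulrA JS -mulrA opprD opprK addrACA.
  by rewrite addrA subrK addrC subrK.
 have U2 : (S + opJ * B) * (S - opJ * B) = 1.
  rewrite mulrDl !mulrBr [_ * B * (_ * B)]mulrA -[_ * B * _]mulrA -JB mulrA opJJ mulN1r mulNr BB opprK.
  rewrite -[_ * B * S]mulrA -SB [opJ * (_ * _)]mulrA JS -mulrA addrACA [- _ + _]addrC addrA.
  by rewrite addrAC addrK addrC subrK.
 have e1 := h _ iU; rewrite aU in e1; have {}e1 := e1 U1 U2.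
 have iU' : inC (S - opJ * B) by rewrite -aU; exact: inC_adj.
 have e2 : T * (S - opJ * B) = (S - opJ * B) * T by apply: (h _ iU'); rewrite -aU adjK aU.
 have : T * (S + opJ * B) + T * (S - opJ * B) = (S + opJ * B) * T + (S - opJ * B) * T.
  by rewrite e1 e2.
 rewrite -mulrDr -mulrDl addrACA addrN addr0 => e3.
 rewrite -(half_op S).
 by rewrite -opZAr -opZAl e3.
have h2 S : inC S -> sa S -> T * S = S * T.
 move=> cS sS; pose c := opn S + 1; have c0 : 0 < c by rewrite ltr_wpDl ?opn_ge0.
 have cS' : inC (c^-1 *: S).
  by apply/inCP => X hX; move/inCP : cS => /(_ _ hX) eS; rewrite -opZAl eS opZAr.
 have := h1 _ cS' (saZ _ sS).
 have hn : opn (c^-1 *: S) <= 1.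
  rewrite (le_trans (opnZ _ _))// gtr0_norm ?invr_gt0// ler_pdivrMl// mulr1 /c lerDl ler01//.
 move=> /(_ hn) e.
 have -> : S = c *: (c^-1 *: S) by rewrite scalerA divff ?scale1r// gt_eqF.
 by rewrite -opZAr -opZAl e.
have inCD X Y : inC X -> inC Y -> inC (X + Y).
 move=> /inCP hX /inCP hY; apply/inCP => Z hZ; by rewrite mulrDl mulrDr hX// hY.
have inCJ X : inC X -> inC (opJ * X).
 move=> /inCP hX; apply/inCP => Z hZ; by rewrite -mulrA hX// mulrA opJC mulrA.
apply/inNP => S cS.
have e1 : T * (S + S^†) = (S + S^†) * T.
 by apply: h2; [apply: inCD => //; exact: inC_adj|rewrite /sa adjD adjK addrC].
have e2 : T * (opJ * (S - S^†)) = (opJ * (S - S^†)) * T.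
 apply: h2; last by rewrite /sa adjM adjB adjK adjJ mulrN -opJC -mulrN opprB.
 apply: (inCJ (_ - _)); apply: inCD => //.
 have /inCP hS := inC_adj cS; apply/inCP => Z hZ; by rewrite mulNr mulrN hS.
have e3 : T * (S - S^†) = (S - S^†) * T.
 have e := congr1 (fun Z => - (opJ * Z)) e2; set Y := S - S^† in e *.
 have l1 : opJ * (T * (opJ * Y)) = - (T * Y).
  by rewrite mulrA opJC -mulrA (mulrA opJ opJ) opJJ mulN1r mulrN.
 have l2 : opJ * (opJ * Y * T) = - (Y * T) by rewrite -(mulrA opJ) mulrA opJJ mulN1r.
 by rewrite l1 l2 !opprK in e.
have e4 : T * (S + S) = (S + S) * T.
 have := congr2 (fun X Y => X + Y) e1 e3.
 by rewrite -mulrDr -mulrDl addrACA subrr addr0.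
rewrite -(half_op S).
by rewrite -opZAr -opZAl e4.
Qed.

Lemma unitaryP U : U^† * U = 1 -> U * U^† = 1 -> unitary (hdot E) (opf U).
move=> U1 U2; split; first exact: op_bounded.
- move=> x y; rewrite !hdotE -opiv; congr (_ +i* _); by rewrite adjP' -opME U1 op1E.
- apply/seteqP; split=> // x _; exists (U^† x) => //; by rewrite -opME U2.
Qed.

Lemma fc_inN D (sD : usa D) f : affiliated (hdot E) (tN A) D -> bm f ->
 inN (fc (specp sD) f).
move=> aD bf; apply: inN_unitary => U cU U1 U2; apply/esym/fc_comm => // B mB.
by apply: specp_comm => // x dx; apply: aD => //; exact: unitaryP.
Qed.

Lemma of_bounded_usa T : sa T -> usa (of_bounded T).
move=> sT; split=> // [c x y _ _||y z].
- by split=> //; exact: (op_bounded T).1.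
- by move=> O [x Ox] _; exists x; split.
- split=> [h|[_ ->] x _ /=]; last by rewrite !hdotE -{1 2}sT !adjP opiv.
 split=> //; apply: rip_ext => v; rewrite ripC (ripC (T y)).
 by have := h v I; rewrite !hdotE => -[<- _]; rewrite -{1}sT adjP.
Qed.

Lemma of_bounded_aff T : inN T -> affiliated (hdot E) (tN A) (of_bounded T).
move=> hT u cu _ x _; split=> //=; have e := cu.2 _ hT.
by have := congr1 (fun f => f x) e.
Qed.

End VonNeumann.

(** * The trace, trace class and Hilbert-Schmidt operators *)

Section Trace.
Context {R : realType} {E : hilbert R} (A : tracial E).
Implicit Types (S T U X P Q : op E) (c : R).

Definition tau T : \bar R := ttau A (opf T).
Definition pos T := inN A T /\ psd T.
Definition fp T := pos T /\ (tau T < +oo)%E.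
Definition tr T : R := fine (tau T).

Lemma posP T : positive_part (hdot E) (tN A) (opf T) <-> pos T.
by split=> -[hN /positiveP]. Qed.

Lemma posP_op f : positive_part (hdot E) (tN A) f -> exists2 T, pos T & opf T = f.
by move=> h; have [T eT] := tN_op h.1; exists T => //; apply/posP; rewrite eT.
Qed.

Lemma le_opP S T : le_operator (hdot E) (opf S) (opf T) <-> lop S T.
rewrite /le_operator /lop -positiveP; suff -> : opf T \- opf S = opf (T - S) by [].
by apply/funext => x; rewrite opDE opNE.
Qed.

Lemma pos0 : pos 0. by split; [exact: inN0|exact: psd0]. Qed.
Lemma posD S T : pos S -> pos T -> pos (S + T).
by move=> [h1 h2] [h3 h4]; split; [exact: inND|exact: psdD]. Qed.
Lemma posZ c T : 0 <= c -> pos T -> pos (c *: T).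
by move=> c0 [h1 h2]; split; [exact: inNZ|exact: psdZ]. Qed.
Lemma pos_sq T : inN A T -> pos (T^† * T).
by move=> h; split; [apply: inNM => //; exact: inN_adj|exact: psd_sq]. Qed.
Lemma tau_ge0 T : pos T -> (0 <= tau T)%E.
by move/posP; exact: (trace_ge0 (ttauP A)). Qed.

Lemma tauD S T : pos S -> pos T -> tau (S + T) = (tau S + tau T)%E.
move=> /posP hS /posP hT; rewrite /tau -(traceD (ttauP A) hS hT); congr (ttau A _).
Qed.

Lemma tauZ c T : 0 <= c -> pos T -> tau (c *: T) = (c%:E * tau T)%E.
move=> c0 /posP hT; rewrite /tau -(traceZ (ttauP A) c0 hT); congr (ttau A _).
Qed.

Lemma tau0 : tau 0 = 0%E.
by rewrite -(scale0r (0 : op E)) tauZ// ?mul0e//; exact: pos0. Qed.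

Lemma tau_adj T : inN A T -> tau (T^† * T) = tau (T * T^†).
move=> hT; have := trace_adjoint (ttauP A) hT (op_bounded T^†).
have /adjoint_ofP h : T^† = T^† by []. move=> /(_ h) e.
rewrite /tau; have -> : opf (T^† * T) = opf T^† \o opf T by apply/funext => x; rewrite opME.
by rewrite e; congr (ttau A _); apply/funext => x; rewrite opME.
Qed.

Lemma tau_le S T : pos S -> pos T -> lop S T -> (tau S <= tau T)%E.
move=> hS hT h; have hd : pos (T - S) by split=> //; apply: inNB; [case: hT|case: hS].
by rewrite -(subrK S T) tauD// leeDr// tau_ge0.
Qed.

(** The range of the sequence is a directed set and its weak limit is the least upper bound, so
    normality applies. *)
Lemma tau_normal u T : (forall n, pos (u n)) -> (forall n, lop (u n) (u n.+1)) ->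
 pos T -> wcvg u T -> (fun n => tau (u n)) @ \oo --> tau T.
move=> hu hm hT hw.
have mono n m : (n <= m)%N -> lop (u n) (u m).
 move=> /subnK <-; elim: (m - n)%N => [|k IH]; last by rewrite addSn; exact: lop_trans IH (hm _).
 by rewrite /lop subrr; exact: psd0.
have nd : nondecreasing_seq (fun n => tau (u n)) by move=> n m nm; apply: tau_le => //; exact: mono.
have ub n : lop (u n) T.
 apply: lopP; [by case: (hu n) => _ []|by case: hT => _ []|move=> x].
 apply: (ler_cvg_to (cvg_cst (q (u n) x)) (wcvg_q hw)); exists n => // m /= nm; exact: lop_q (mono _ _ nm).
rewrite {2}/tau (trace_normal (ttauP A) (F := range (fun n => opf (u n)))).
- rewrite (_ : _ @` _ = range (fun n => tau (u n))); first exact: ereal_nondecreasing_cvgn.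
 by rewrite image_comp.
- by move=> _ [n _ <-]; exact/posP.
- by exists (opf (u 0%N)); exists 0%N.
- move=> _ _ [n _ <-] [m _ <-]; exists (opf (u (maxn n m))); split; first by exists (maxn n m).
  by apply/le_opP/mono; exact: leq_maxl.
 by apply/le_opP/mono; exact: leq_maxr.
- exact/posP.
- by move=> _ [n _ <-]; exact/le_opP.
move=> T' /posP_op [Q hQ <-] h; apply/le_opP; apply: lopP; [by case: hT => _ []|by case: hQ => _ []|move=> x].
apply: (cvg_le_cst _ (wcvg_q hw)) => n; apply: lop_q; apply/le_opP/h; by exists n.
Qed.

Lemma fpN T : fp T -> inN A T. by case=> -[]. Qed.
Lemma fp_psd T : fp T -> psd T. by case=> -[]. Qed.
Lemma fp_sa T : fp T -> sa T. by move/fp_psd => -[]. Qed.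
Lemma trE T : fp T -> tau T = (tr T)%:E.
by move=> [pT fT]; rewrite /tr fineK// ge0_fin_numE// tau_ge0. Qed.
Lemma tr_ge0 T : fp T -> 0 <= tr T.
by move=> h; rewrite -lee_fin -trE// tau_ge0//; case: h. Qed.
Lemma fp0 : fp 0. by split; [exact: pos0|rewrite tau0]. Qed.
Lemma tr0 : tr 0 = 0. by rewrite /tr tau0. Qed.
Lemma fpD S T : fp S -> fp T -> fp (S + T).
by move=> [pS fS] [pT fT]; split; [exact: posD|rewrite tauD// lte_add_pinfty]. Qed.
Lemma trD S T : fp S -> fp T -> tr (S + T) = tr S + tr T.
by move=> hS hT; apply: EFin_inj; rewrite EFinD -!trE ?tauD//; [case: hS|case: hT|exact: fpD]. Qed.
Lemma fpZ c T : 0 <= c -> fp T -> fp (c *: T).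
by move=> c0 h; have [pT fT] := h; split; [exact: posZ|rewrite tauZ// trE// -EFinM ltry].
Qed.
Lemma trZ c T : 0 <= c -> fp T -> tr (c *: T) = c * tr T.
by move=> c0 hT; apply: EFin_inj; rewrite EFinM -!trE ?tauZ//; [case: hT|exact: fpZ]. Qed.
Lemma fp_le S T : pos S -> lop S T -> fp T -> fp S.
by move=> pS h [pT fT]; split=> //; apply: le_lt_trans fT; exact: tau_le. Qed.
Lemma tr_le S T : fp S -> fp T -> lop S T -> tr S <= tr T.
by move=> hS hT h; rewrite -lee_fin -!trE// tau_le//; [case: hS|case: hT]. Qed.

Definition L1 T := exists P1 P2 P3 P4,
 [/\ fp P1 /\ fp P2, fp P3 /\ fp P4 & T = P1 - P2 + opJ * (P3 - P4)].

Lemma opJ_combE P1 P2 P3 P4 :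
 opf (P1 - P2 + opJ * (P3 - P4)) = opf P1 \- opf P2 \+ 'i%C *: (opf P3 \- opf P4).
by apply/funext => x; rewrite opDE opME !(opDE, opNE). Qed.

Lemma fpP T : finite_positive (hdot E) (tN A) (ttau A) (opf T) <-> fp T.
by split=> -[/posP]. Qed.

Lemma fpP_op f : finite_positive (hdot E) (tN A) (ttau A) f -> exists2 T, fp T & opf T = f.
by move=> h; have [T pT eT] := posP_op h.1; exists T => //; apply/fpP; rewrite eT.
Qed.

Lemma L1P T : trace_class (hdot E) (tN A) (ttau A) (opf T) <-> L1 T.
split=> [[z [f1 [f2 [f3 [f4 [[h1 h2] [h3 h4] eT _]]]]]]|[P1 [P2 [P3 [P4 [[h1 h2] [h3 h4] ->]]]]]].
 have [P1 p1 e1] := fpP_op h1; have [P2 p2 e2] := fpP_op h2.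
 have [P3 p3 e3] := fpP_op h3; have [P4 p4 e4] := fpP_op h4; subst.
 exists P1, P2, P3, P4; split=> //; apply: op_ext => x.
 by rewrite eT -opJ_combE.
exists ((tr P1 - tr P2) +i* (tr P3 - tr P4)), P1, P2, P3, P4.
by split; [split; exact/fpP|split; exact/fpP|exact: opJ_combE|].
Qed.

Lemma J_sa_inj S T : sa S -> sa T -> S + opJ * T = 0 -> S = 0 /\ T = 0.
move=> sS sT e; have := congr1 (@adj R E) e.
rewrite adjD adjM adjJ sS sT adj0 mulrN -opJC => /eqP; rewrite subr_eq0 => /eqP eS.
have {}e : opJ * T = 0 by rewrite -(half_op (opJ * T)) -{1}eS e scaler0.
rewrite eS; split=> //.
have := congr1 (fun Z => opJ * Z) e.
by rewrite mulrA opJJ mulN1r mulr0 => /eqP; rewrite oppr_eq0 => /eqP.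
Qed.

(** Self-adjoint and skew parts agree separately ([J_sa_inj]); in each, moving negative terms across
    leaves an identity of sums of positive operators, where the trace is additive. *)
Lemma L1_val_uniq P1 P2 P3 P4 Q1 Q2 Q3 Q4 :
 fp P1 -> fp P2 -> fp P3 -> fp P4 -> fp Q1 -> fp Q2 -> fp Q3 -> fp Q4 ->
 P1 - P2 + opJ * (P3 - P4) = Q1 - Q2 + opJ * (Q3 - Q4) ->
 tr P1 - tr P2 = tr Q1 - tr Q2 /\ tr P3 - tr P4 = tr Q3 - tr Q4.
move=> p1 p2 p3 p4 q1 q2 q3 q4 e.
have aux S1 S2 T1 T2 : fp S1 -> fp S2 -> fp T1 -> fp T2 -> (S1 - S2) - (T1 - T2) = 0 ->
  tr S1 - tr S2 = tr T1 - tr T2.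
 move=> s1 s2 t1 t2 h; have h' : S1 + T2 = T1 + S2.
  move/eqP : h; rewrite subr_eq0 => /eqP h.
  have -> : S1 = T1 - T2 + S2 by rewrite -h subrK.
  by rewrite addrAC subrK.
 have := congr1 tr h'; rewrite !trD// => h2; lra.
have sB S T : fp S -> fp T -> sa (S - T) by move=> /fp_sa sS /fp_sa sT; exact: saB.
have [|||h1 h2] := @J_sa_inj ((P1 - P2) - (Q1 - Q2)) ((P3 - P4) - (Q3 - Q4)).
- by apply: saB; exact: sB.
- by apply: saB; exact: sB.
- by rewrite mulrBr addrACA -opprD e subrr.
by split; exact: aux.
Qed.

Definition ctr T : R[i] := trace (hdot E) (tN A) (ttau A) (opf T).
Definition rtr T : R := complex.Re (ctr T).

Lemma ctrE P1 P2 P3 P4 : fp P1 -> fp P2 -> fp P3 -> fp P4 ->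
 ctr (P1 - P2 + opJ * (P3 - P4)) = (tr P1 - tr P2) +i* (tr P3 - tr P4).
move=> p1 p2 p3 p4; rewrite /ctr /trace.
have ex : trace_class (hdot E) (tN A) (ttau A) (opf (P1 - P2 + opJ * (P3 - P4))).
 by apply/L1P; exists P1, P2, P3, P4.
have [f1 [f2 [f3 [f4 [[h1 h2] [h3 h4] eT ->]]]]] := xgetPex 0 ex.
have [Q1 q1 e1] := fpP_op h1; have [Q2 q2 e2] := fpP_op h2.
have [Q3 q3 e3] := fpP_op h3; have [Q4 q4 e4] := fpP_op h4; subst.
have e : P1 - P2 + opJ * (P3 - P4) = Q1 - Q2 + opJ * (Q3 - Q4).
 by apply: op_ext => x; rewrite eT -opJ_combE.
by have [-> ->] := L1_val_uniq p1 p2 p3 p4 q1 q2 q3 q4 e.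
Qed.

Lemma rtrE P1 P2 P3 P4 : fp P1 -> fp P2 -> fp P3 -> fp P4 ->
 rtr (P1 - P2 + opJ * (P3 - P4)) = tr P1 - tr P2.
by move=> *; rewrite /rtr ctrE. Qed.

Lemma fp_L1 P : fp P -> L1 P.
move=> h; exists P, 0, 0, 0; split; [split=> //; exact: fp0|split; exact: fp0|].
by rewrite !subr0 mulr0 addr0.
Qed.

Lemma rtr_fp P : fp P -> rtr P = tr P.
move=> h; have := rtrE h fp0 fp0 fp0; by rewrite !subr0 mulr0 addr0 tr0 subr0.
Qed.

Lemma L1_inN T : L1 T -> inN A T.
move=> [P1 [P2 [P3 [P4 [[h1 h2] [h3 h4] ->]]]]].
by apply: inND; [|apply: inNM; [exact: inNJ|]]; apply: inNB; exact: fpN.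
Qed.

Lemma L1_0 : L1 0. exact/fp_L1/fp0. Qed.

Lemma L1D_aux S T : L1 S -> L1 T -> L1 (S + T) /\ rtr (S + T) = rtr S + rtr T.
move=> [P1 [P2 [P3 [P4 [[h1 h2] [h3 h4] ->]]]]] [Q1 [Q2 [Q3 [Q4 [[g1 g2] [g3 g4] ->]]]]].
have -> : P1 - P2 + opJ * (P3 - P4) + (Q1 - Q2 + opJ * (Q3 - Q4)) =
  (P1 + Q1) - (P2 + Q2) + opJ * ((P3 + Q3) - (P4 + Q4)) by opring.
split; first by exists (P1 + Q1), (P2 + Q2), (P3 + Q3), (P4 + Q4); split=> //; split; exact: fpD.
by rewrite !rtrE ?trD//; try exact: fpD; ring.
Qed.

Lemma L1D S T : L1 S -> L1 T -> L1 (S + T).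
by move=> h1 h2; case: (L1D_aux h1 h2). Qed.
Lemma rtrD S T : L1 S -> L1 T -> rtr (S + T) = rtr S + rtr T.
by move=> h1 h2; case: (L1D_aux h1 h2). Qed.

Lemma L1N_aux S : L1 S -> L1 (- S) /\ rtr (- S) = - rtr S.
move=> [P1 [P2 [P3 [P4 [[h1 h2] [h3 h4] ->]]]]].
have -> : - (P1 - P2 + opJ * (P3 - P4)) = P2 - P1 + opJ * (P4 - P3) by opring.
by split; [exists P2, P1, P4, P3|rewrite !rtrE// opprB].
Qed.

Lemma L1N S : L1 S -> L1 (- S). by case/L1N_aux. Qed.
Lemma rtrN S : L1 S -> rtr (- S) = - rtr S. by case/L1N_aux. Qed.
Lemma L1B S T : L1 S -> L1 T -> L1 (S - T).
by move=> h1 h2; apply: L1D => //; exact: L1N. Qed.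
Lemma rtrB S T : L1 S -> L1 T -> rtr (S - T) = rtr S - rtr T.
by move=> h1 h2; rewrite rtrD ?rtrN//; exact: L1N. Qed.

Lemma L1Z_aux c S : L1 S -> L1 (c *: S) /\ rtr (c *: S) = c * rtr S.
wlog c0 : c S / 0 <= c => [hw h|].
 have [c0|c0] := leP 0 c; first exact: hw.
 have nc : 0 <= - c by rewrite oppr_ge0 ltW.
 have -> : c *: S = (- c) *: (- S) by rewrite scaleNr scalerN opprK.
 by have [h1 ->] := hw _ _ nc (L1N h); split=> //; rewrite rtrN// mulrNN.
move=> [P1 [P2 [P3 [P4 [[h1 h2] [h3 h4] ->]]]]].
have -> : c *: (P1 - P2 + opJ * (P3 - P4)) =
  (c *: P1 - c *: P2) + opJ * (c *: P3 - c *: P4).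
 by rewrite scalerDr opZAr !scalerBr.
split; first by exists (c *: P1), (c *: P2), (c *: P3), (c *: P4); split=> //; split; exact: fpZ.
by rewrite !rtrE ?trZ//; try exact: fpZ; ring.
Qed.

Lemma L1Z c S : L1 S -> L1 (c *: S). by move=> /(L1Z_aux c) []. Qed.
Lemma rtrZ c S : L1 S -> rtr (c *: S) = c * rtr S. by move=> /(L1Z_aux c) []. Qed.

Lemma L1J S : L1 S -> L1 (opJ * S).
move=> [P1 [P2 [P3 [P4 [[h1 h2] [h3 h4] ->]]]]]; exists P4, P3, P1, P2; split=> //.
by rewrite mulrDr mulrA opJJ mulN1r opprB addrC.
Qed.

Lemma adj_L1_aux S : L1 S -> L1 S^† /\ rtr S^† = rtr S.
move=> [P1 [P2 [P3 [P4 [[h1 h2] [h3 h4] ->]]]]].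
have -> : (P1 - P2 + opJ * (P3 - P4))^† = P1 - P2 + opJ * (P4 - P3).
 rewrite adjD adjM !adjB adjJ (fp_sa h1) (fp_sa h2) (fp_sa h3) (fp_sa h4) mulrN -opJC -mulrN opprB //.
by split; [exists P1, P2, P4, P3|rewrite !rtrE].
Qed.
Lemma L1_adj S : L1 S -> L1 S^†. by case/adj_L1_aux. Qed.
Lemma rtr_adj S : L1 S -> rtr S^† = rtr S. by case/adj_L1_aux. Qed.

Lemma L1_sa T : L1 T -> sa T -> exists P1 P2, [/\ fp P1, fp P2 & T = P1 - P2].
move=> [P1 [P2 [P3 [P4 [[h1 h2] [h3 h4] eT]]]]] sT; exists P1, P2; split=> //.
have [|||e _] := @J_sa_inj (P1 - P2 - T) (P3 - P4).
- by apply: saB => //; apply: saB; exact: fp_sa.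
- by apply: saB; exact: fp_sa.
- by rewrite addrAC -eT subrr.
by apply/eqP; rewrite eq_sym -subr_eq0 e.
Qed.

Lemma L1_psd T : L1 T -> psd T -> fp T.
move=> h pT; have [P1 [P2 [h1 h2 eT]]] := L1_sa h pT.1.
apply: (fp_le _ _ h1); first by split=> //; exact: L1_inN.
by rewrite /lop eT opprB addrC subrK; exact: fp_psd.
Qed.

Lemma rtr_ge0 T : L1 T -> psd T -> 0 <= rtr T.
by move=> h p; have f := L1_psd h p; rewrite rtr_fp// tr_ge0. Qed.
Lemma rtr_le S T : L1 S -> L1 T -> lop S T -> rtr S <= rtr T.
by move=> hS hT h; rewrite -subr_ge0 -rtrB// rtr_ge0//; exact: L1B. Qed.

Definition L2 T := inN A T /\ fp (T^† * T).

Lemma L2_adj T : L2 T -> L2 T^†.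
move=> [hT [pT fT]]; split; first exact: inN_adj.
rewrite adjK; split; last by rewrite -tau_adj.
by have := pos_sq (inN_adj hT); rewrite adjK.
Qed.

Lemma sq_lopD S T : lop ((S + T)^† * (S + T)) (2 *: (S^† * S) + 2 *: (T^† * T)).
rewrite /lop (_ : _ - _ = (S - T)^† * (S - T)); first exact: psd_sq.
rewrite adjD adjB !scaler_nat !mulr2n !mulrDl !mulrDr !mulNr !mulrN.
move: (S^† * S) (T^† * T) (S^† * T) (T^† * S) => a b c d; opring.
Qed.

Lemma L2D S T : L2 S -> L2 T -> L2 (S + T).
move=> [hS fS] [hT fT]; have h : inN A (S + T) by exact: inND.
split=> //; apply: (fp_le (pos_sq h) (sq_lopD S T)).
by apply: fpD; apply: fpZ.
Qed.

Lemma L2_mull X T : inN A X -> L2 T -> L2 (X * T).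
move=> hX [hT fT]; have h : inN A (X * T) by exact: inNM.
split=> //; apply: (fp_le (pos_sq h) (T := (opn X ^+ 2) *: (T^† * T))); last by apply: fpZ => //; exact: sqr_ge0.
apply: lopP; [exact: sa_sq|by apply: saZ; exact: sa_sq|move=> x].
rewrite qE !q_sq -exprMn ler_pXn2r ?nnegrE ?nrm_ge0 ?mulr_ge0 ?opn_ge0 ?nrm_ge0//.
by rewrite opME opn_le.
Qed.

Lemma L2N T : L2 T -> L2 (- T).
by move=> [hT fT]; split; [exact: inNN|rewrite adjN mulrNN]. Qed.

Lemma L2_mulr X T : inN A X -> L2 T -> L2 (T * X).
by move=> hX /L2_adj /(L2_mull (inN_adj hX)) /L2_adj; rewrite adjM !adjK.
Qed.

Lemma L2_sqrt P : fp P -> exists B, [/\ L2 B, psd B, B * B = P & forall Z, Z * P = P * Z -> Z * B = B * Z].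
move=> h; have [B [pB BB cB]] := sqrt_exists (fp_psd h); exists B; split=> //.
by split; [exact: inN_comm (fpN h) cB|rewrite pB.1 BB].
Qed.

(** Polarization writes [S * T] with four operators of the form [Z^* Z]. The formula for [T * S]
    contains the same squares in reversed order, so [trace_adjoint] gives cyclicity in [rtrC2]. *)
Lemma L2M_aux S T : L2 S -> L2 T -> L1 (S * T) /\
 rtr (S * T) = 4^-1 * (tr ((T + S^†)^† * (T + S^†)) - tr ((T - S^†)^† * (T - S^†))).
move=> hS hT; set B := S^†.
have hB : L2 B by exact: L2_adj.
have hJB : L2 (opJ * B) by apply: L2_mull => //; exact: inNJ.
have q0 : 0 <= 4^-1 :> R by [].
pose F (Z : op E) : op E := 4^-1 *: (Z^† * Z).
have fF Z : L2 Z -> fp (F Z) by move=> [_ h]; apply: fpZ.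
have e : S * T = F (T + B) - F (T - B) + opJ * (F (T + opJ * B) - F (T - opJ * B)).
 have -> : S = B^† by rewrite /B adjK.
 rewrite /F -!scalerBr -opZAr -scalerDr.
 apply: (@scalerI _ _ (4 : R)); first by [].
 have aJB : (opJ * B)^† = - (opJ * B^†) by rewrite adjM adjJ mulrN -opJC.
 rewrite scalerA divff// scale1r !adjD !adjN aJB.
 have e1 (a a' b b' : op E) : (a' + b') * (a + b) - (a' - b') * (a - b) =
  (a' * b + b' * a) + (a' * b + b' * a) by opring.
 rewrite (e1 T T^† B B^†) opprK.
 have e2 (a a' b b' : op E) : (a' - b') * (a + b) - (a' + b') * (a - b) =
  (a' * b - b' * a) + (a' * b - b' * a) by opring.
 rewrite (e2 T T^† (opJ * B) (opJ * B^†)).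
 have e3 : opJ * (T^† * (opJ * B) - opJ * B^† * T) = B^† * T - T^† * B.
  rewrite mulrBr !mulrA opJJ opJC -(mulrA T^†) opJJ mulrN1 mulN1r !mulNr opprK.
  by rewrite addrC.
 rewrite (mulrDr opJ) e3 scaler_nat; move: (B^† * T) (T^† * B) => x y.
 by rewrite !mulrS mulr0n addr0; opring.
split; first exists (F (T + B)), (F (T - B)), (F (T + opJ * B)), (F (T - opJ * B)).
 by split; [split; apply: fF; [exact: L2D|apply: L2D => //; exact: L2N]|
   split; apply: fF; [exact: L2D|apply: L2D => //; exact: L2N]|].
rewrite e rtrE; try (by apply: fF; apply: L2D => //; exact: L2N); try (by apply: fF; exact: L2D).
by rewrite /F (trZ q0 (L2D hT hB).2) (trZ q0 (L2D hT (L2N hB)).2) [RHS]mulrBr.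
Qed.

Lemma L2M S T : L2 S -> L2 T -> L1 (S * T).
by move=> h1 h2; case: (L2M_aux h1 h2). Qed.

Lemma rtrC2 S T : L2 S -> L2 T -> rtr (S * T) = rtr (T * S).
move=> h1 h2; rewrite (L2M_aux h1 h2).2 (L2M_aux h2 h1).2; congr (_ * (_ - _)).
 have h := L2D h2 (L2_adj h1).
 by rewrite /tr (tau_adj h.1) adjD adjK !adjD adjK [S + _]addrC [T + _]addrC.
have h := L2D h2 (L2N (L2_adj h1)).
rewrite /tr (tau_adj h.1) !adjB !adjK; congr (fine (tau _)).
by rewrite -[T - S^†]opprB -[T^† - S]opprB mulrNN.
Qed.

Lemma L1_fp_aux X P : inN A X -> fp P -> [/\ L1 (X * P), L1 (P * X) & rtr (X * P) = rtr (P * X)].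
move=> hX hP; have [B [hB pB BB _]] := L2_sqrt hP.
have h1 : L2 (X * B) by exact: L2_mull. have h2 : L2 (B * X) by exact: L2_mulr.
rewrite -BB mulrA -[B * B * X]mulrA; split; [exact: L2M|exact: L2M|].
rewrite (rtrC2 h1 hB) mulrA; have e := rtrC2 h2 hB; rewrite e //.
Qed.

Lemma L1M_aux X T : inN A X -> L1 T -> [/\ L1 (X * T), L1 (T * X) & rtr (X * T) = rtr (T * X)].
move=> hX [P1 [P2 [P3 [P4 [[h1 h2] [h3 h4] ->]]]]].
have hXJ : inN A (X * opJ) by apply: inNM => //; exact: inNJ.
have [a1 b1 c1] := L1_fp_aux hX h1; have [a2 b2 c2] := L1_fp_aux hX h2.
have [a3 b3 c3] := L1_fp_aux hXJ h3; have [a4 b4 c4] := L1_fp_aux hXJ h4.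
have -> : X * (P1 - P2 + opJ * (P3 - P4)) = (X * P1 - X * P2) + (X * opJ * P3 - X * opJ * P4).
 by rewrite mulrDr !mulrBr !mulrA.
have -> : (P1 - P2 + opJ * (P3 - P4)) * X = (P1 * X - P2 * X) + (P3 * (X * opJ) - P4 * (X * opJ)).
 have hp P : opJ * P * X = P * (X * opJ) by rewrite opJC -mulrA opJC.
 by rewrite mulrDl !mulrBl mulrBr mulrBl !hp.
split; [by apply: L1D; apply: L1B|by apply: L1D; apply: L1B|].
rewrite (rtrD (L1B a1 a2) (L1B a3 a4)) (rtrD (L1B b1 b2) (L1B b3 b4)).
by rewrite (rtrB a1 a2) (rtrB a3 a4) (rtrB b1 b2) (rtrB b3 b4) c1 c2 c3 c4.
Qed.

Lemma L1Ml X T : inN A X -> L1 T -> L1 (X * T). by move=> h1 h2; case: (L1M_aux h1 h2). Qed.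
Lemma L1Mr X T : inN A X -> L1 T -> L1 (T * X). by move=> h1 h2; case: (L1M_aux h1 h2). Qed.
Lemma rtrC X T : inN A X -> L1 T -> rtr (X * T) = rtr (T * X).
by move=> h1 h2; case: (L1M_aux h1 h2). Qed.

(** With [P = B^2], cyclicity gives [rtr (B X B)], which only sees the self-adjoint part [Y] of [X];
    and [B Y B] lies between [- |X| P] and [|X| P]. *)
Lemma rtr_bound X P : inN A X -> fp P -> `|rtr (X * P)| <= opn X * tr P.
move=> hX hP; have [B [hB pB BB _]] := L2_sqrt hP.
have hBXB Z : inN A Z -> L1 (B * Z * B) by move=> hZ; apply: L2M => //; exact: L2_mulr.
have -> : rtr (X * P) = rtr (B * X * B).
 by rewrite -BB mulrA (rtrC2 (L2_mull hX hB) hB) mulrA.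
pose Y := 2^-1 *: (X + X^†).
have hY : inN A Y by apply: inNZ; apply: inND => //; exact: inN_adj.
have -> : rtr (B * X * B) = rtr (B * Y * B).
 have -> : B * Y * B = 2^-1 *: (B * X * B + (B * X * B)^†).
  by rewrite /Y -opZAr -opZAl !adjM pB.1 mulrDr mulrDl mulrA.
 have h := hBXB _ hX; rewrite rtrZ ?rtrD ?rtr_adj//; first by field.
 - exact: L1_adj.
 - by apply: L1D => //; exact: L1_adj.
have sY : sa Y by rewrite /sa /Y adjZ adjD adjK addrC.
have nY : opn Y <= opn X.
 rewrite (le_trans (opnZ _ _))// ger0_norm// ler_pdivrMl// (le_trans (opnD _ _))// opn_adj; lra.
have L := hBXB _ hY; have LP := fp_L1 hP.
have le2 : lop (B * Y * B) (opn X *: P).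
 have := lop_conj B (opn_lop sY); rewrite pB.1 -opZAr mulr1 -opZAl BB => /lop_trans; apply.
 by rewrite /lop -scalerBl; apply: psdZ; [rewrite subr_ge0|exact: fp_psd].
have ge2 : lop (- (opn X *: P)) (B * Y * B).
 have := lop_conj B (opn_lopN sY); rewrite pB.1 mulrN mulNr -opZAr mulr1 -opZAl BB; apply: lop_trans.
 by rewrite /lop opprK addrC -scalerBl; apply: psdZ; [rewrite subr_ge0|exact: fp_psd].
rewrite -(rtr_fp hP) ler_norml -rtrZ// -rtrN; last exact: L1Z.
have LZ := L1Z (opn X) LP; by rewrite (rtr_le (L1N LZ) L ge2) (rtr_le L LZ le2).
Qed.

End Trace.

(** * Dyadic layers of a nonnegative function *)

Section LayerCake.
Context {R : realType}.
Implicit Types (f g : R -> R).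

(** Rounding of [f] down to multiples of [2^-m]. It is a finite combination of indicators of the
    sets [s <= f] ([laysets]), so a comparison of spectral projections passes to functions through
    finite sums. *)
Definition lay m f : R -> R := fun l => (2 ^+ m)^-1 * (Num.truncn (2 ^+ m * f l))%:R.

Lemma lay_le m f l : 0 <= f l -> lay m f l <= f l.
move=> f0; rewrite /lay ler_pdivrMl ?exprn_gt0//.
by rewrite Num.Theory.truncn_le mulr_ge0// exprn_ge0.
Qed.

Lemma lay_ge m f l : 0 <= f l -> f l - (2 ^+ m)^-1 <= lay m f l.
move=> f0; rewrite /lay lerBlDr -[X in _ + X]mulr1 -mulrDr ler_pdivlMl ?exprn_gt0//.
by rewrite ltW// -(natrD _ _ 1) addn1 truncnS_gt.
Qed.

Lemma lay_ge0 m f l : 0 <= lay m f l.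
by rewrite /lay mulr_ge0// invr_ge0 exprn_ge0. Qed.

Lemma lay_nd m f l : 0 <= f l -> lay m f l <= lay m.+1 f l.
move=> f0; rewrite /lay exprS invfM -mulrA ler_pdivlMl// mulrCA ler_pM2l ?invr_gt0 ?exprn_gt0//.
rewrite -natrM ler_nat truncn_ge_nat; last by rewrite !mulr_ge0// exprn_ge0.
rewrite natrM -mulrA ler_pM2l// truncn_le mulr_ge0// exprn_ge0//.
Qed.

Lemma lay_cvg f l : 0 <= f l -> (fun m => lay m f l) @ \oo --> f l.
move=> f0; apply: (@cvg_squeeze _ _ (fun m => (2^-1 : R) ^+ m)) => [m|].
 have := lay_le m f0; have := lay_ge m f0; rewrite exprVn ler_norml => h1 h2.
 by apply/andP; split; [rewrite lerBrDr addrC|rewrite lerBlDr (le_trans h2)// lerDr invr_ge0 exprn_ge0].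
by apply: cvg_expr; rewrite ger0_norm// invf_lt1// ltr1n.
Qed.

Lemma truncn_sum (y : R) K : 0 <= y -> y < K%:R ->
 (Num.truncn y)%:R = \sum_(j < K) ((j.+1%:R <= y)%R : nat)%:R :> R.
move=> y0 yK; rewrite -natr_sum; congr (_%:R).
under eq_bigr do rewrite -truncn_ge_nat//.
have tK : (Num.truncn y <= K)%N.
 by rewrite -(ler_nat R) (le_trans _ (ltW yK))// truncn_le.
rewrite -(big_mkord xpredT (fun j => (j < Num.truncn y)%N : nat)).
rewrite (big_cat_nat (leq0n _) tK)/= [X in (_ + X)%N]big_nat [X in (_ + X)%N]big1 ?addn0.
 rewrite big_nat (eq_bigr (fun=> 1%N)); last by move=> i /andP[_ ->].
 by rewrite -big_nat sum_nat_const_nat muln1 subn0.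
by move=> i /andP[h _]; rewrite ltnNge h.
Qed.

Lemma laysets m f K : (forall l, 0 <= f l) -> (forall l, 2 ^+ m * f l < K%:R) ->
 lay m f = fun l => (2 ^+ m)^-1 * \sum_(j < K) \1_[set l | (2 ^+ m)^-1 * j.+1%:R <= f l] l.
move=> f0 fK; apply/funext => l; rewrite /lay (truncn_sum _ (fK l)); last by rewrite mulr_ge0// exprn_ge0.
congr (_ * _); apply: eq_bigr => j _; rewrite indicE; congr (nat_of_bool _)%:R.
by apply/idP/idP => [h|]; [rewrite inE /=|rewrite inE /=]; rewrite ler_pdivrMl ?exprn_gt0.
Qed.

End LayerCake.

(** * Comparison of traces of spectral projections and functions *)

Section TracePvm.
Context {R : realType} {E : hilbert R} (A : tracial E).
Implicit Types (P : pvm E) (f g : R -> R).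

Definition pvmN P := forall B, measurable B -> inN A (pE P B).

Lemma fcN_pvm P f : pvmN P -> bm f -> inN A (fc P f).
move=> hP bf; apply/inNP => S hS; apply/esym/fc_comm => // B mB.
by move/inNP : (hP B mB) => ->.
Qed.

Lemma pos_fc P f : pvmN P -> bm f -> (forall l, 0 <= f l) -> pos A (fc P f).
by move=> hP bf f0; split; [exact: fcN_pvm|exact: fc_psd]. Qed.
Lemma pos_proj (Q : op E) : inN A Q -> proj Q -> pos A Q.
by move=> hQ pQ; split=> //; exact: proj_psd. Qed.

Lemma tau_sum I (r : seq I) (F : I -> op E) : (forall i, pos A (F i)) ->
 pos A (\sum_(i <- r) F i) /\ tau A (\sum_(i <- r) F i) = (\sum_(i <- r) tau A (F i))%E.
move=> h; elim: r => [|i r [IH1 IH2]]; first by rewrite !big_nil tau0; split=> //; exact: pos0.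
by rewrite !big_cons tauD// IH2; split=> //; exact: posD.
Qed.

Lemma fc_sum P I (r : seq I) (F : I -> R -> R) : (forall i, bm (F i)) ->
 fc P (fun l => \sum_(i <- r) F i l) = \sum_(i <- r) fc P (F i).
move=> h; elim: r => [|i r IH].
 by under eq_fun do rewrite big_nil; rewrite big_nil fc_cst scale0r.
by under eq_fun do rewrite big_cons; rewrite big_cons fcD ?IH//; exact: bm_sum.
Qed.

Lemma bm_lset f s : bm f -> measurable ([set l | s <= f l] : borel R).
move=> bf; have := bf.1 measurableT `[s, +oo[%classic (measurable_itv _).
by rewrite setTI; congr (measurable _); apply/seteqP; split=> l /=; rewrite in_itv /= andbT.
Qed.

Lemma bm_lay m f : bm f -> (forall l, 0 <= f l) -> bm (lay m f).
move=> bf f0; have [C C0 hC] := bm_ge0_ub bf.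
rewrite (@laysets _ m f (Num.bound (2 ^+ m * C)))//.
 apply: bmZ; apply: bm_sum => j; apply: bm_ind; exact: bm_lset.
move=> l; apply: le_lt_trans (archi_boundP _); last by rewrite mulr_ge0 ?exprn_ge0// ltW.
by rewrite ler_pM2l ?exprn_gt0// (le_trans (ler_norm _)).
Qed.

Lemma tau_lay P m f K : pvmN P -> bm f -> (forall l, 0 <= f l) -> (forall l, 2 ^+ m * f l < K%:R) ->
 tau A (fc P (lay m f)) =
 (((2 ^+ m)^-1)%:E * \sum_(j < K) tau A (pE P [set l | ((2 ^+ m)^-1 * j.+1%:R <= f l)%R]))%E.
move=> hP bf f0 fK; rewrite (laysets f0 fK) fcZ; last by apply: bm_sum => j; apply: bm_ind; exact: bm_lset.
have mB (j : 'I_K) := bm_lset ((2 ^+ m)^-1 * j.+1%:R) bf.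
rewrite fc_sum; last by move=> j; exact: bm_ind.
have hp (j : 'I_K) : pos A (fc P \1_[set l | (2 ^+ m)^-1 * j.+1%:R <= f l]).
 by rewrite fc_ind//; apply: pos_proj; [exact: hP|exact: pE_proj].
have [h1 h2] := tau_sum (index_enum 'I_K) hp.
rewrite tauZ//.
rewrite h2; congr (_ * _)%E; apply: eq_bigr => j _; by rewrite fc_ind.
Qed.

Lemma tau_lay_cvg P f : pvmN P -> bm f -> (forall l, 0 <= f l) ->
 (fun m => tau A (fc P (lay m f))) @ \oo --> tau A (fc P f).
move=> hP bf f0; have [C C0 hC] := bm_ge0_ub bf.
have bl m := bm_lay m bf f0.
apply: tau_normal => [n|n||].
- by apply: pos_fc => // l; exact: lay_ge0.
- by apply: fc_lop => // l; exact: lay_nd.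
- exact: pos_fc.
- apply: (@fc_wcvg _ _ _ _ _ C) => // [n l|l]; last exact: lay_cvg.
 by rewrite ger0_norm ?lay_ge0// (le_trans (lay_le _ (f0 l)))// (le_trans (ler_norm _)).
Qed.

(** For each rounding both traces are sums over the same dyadic levels and compare term by term;
    normality gives the limit on the left. *)
Lemma layer_cake P P' f g c : pvmN P -> pvmN P' -> bm f -> bm g ->
 (forall l, 0 <= f l) -> (forall l, 0 <= g l) -> 0 <= c ->
 (forall s, 0 < s -> (tau A (pE P [set l | (s <= f l)%R]) <=
            c%:E * tau A (pE P' [set l | (s <= g l)%R]))%E) ->
 (tau A (fc P f) <= c%:E * tau A (fc P' g))%E.
move=> hP hP' bf bg f0 g0 c0 h.
have [C C0 hC] := bm_ge0_ub bf; have [C' C'0 hC'] := bm_ge0_ub bg.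
apply: (cvge_le _ (tau_lay_cvg hP bf f0)); apply: nearW => m.
pose K := Num.bound (2 ^+ m * (C + C')).
have bK (k : R -> R) : (forall l, `|k l| <= C + C') -> forall l, 2 ^+ m * k l < K%:R.
 move=> hk l; apply: le_lt_trans (archi_boundP _); last by rewrite mulr_ge0 ?exprn_ge0// addr_ge0// ltW.
 by rewrite ler_pM2l ?exprn_gt0// (le_trans (ler_norm _)).
have fK : forall l, 2 ^+ m * f l < K%:R.
 by apply: bK => l; rewrite (le_trans (hC l))// lerDl ltW.
have gK : forall l, 2 ^+ m * g l < K%:R.
 by apply: bK => l; rewrite (le_trans (hC' l))// lerDr ltW.
apply: (@le_trans _ _ (c%:E * tau A (fc P' (lay m g)))%E); last first.
 apply: lee_wpmul2l; first by rewrite lee_fin.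
 apply: tau_le; [apply: pos_fc => //; [exact: bm_lay|move=> l; exact: lay_ge0]|exact: pos_fc|].
 by apply: fc_lop => //; [exact: bm_lay|move=> l; exact: lay_le].
rewrite (tau_lay hP bf f0 fK) (tau_lay hP' bg g0 gK) muleCA.
apply: lee_wpmul2l; first by rewrite lee_fin invr_ge0 exprn_ge0.
rewrite ge0_sume_distrr; last first.
 move=> j _; apply: tau_ge0; apply: pos_proj; [apply: hP'; exact: bm_lset|].
 by apply: pE_proj; exact: bm_lset.
apply: lee_sum => j _; apply: h; by rewrite mulr_gt0// invr_gt0 exprn_gt0.
Qed.

(* For [T = F Y Q], the sequence [1 - (1 - T^*T)^j] increases to the projection
  onto the complement of the kernel of T, which is Q, and its trace is that of
  [1 - (1 - T T^* )^j <= F]. *)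
Lemma tau_proj_le (Q F Y : op E) : inN A Q -> inN A F -> inN A Y -> proj Q -> proj F ->
 (forall x, Q x = x -> F (Y x) = 0 -> x = 0) -> (tau A Q <= tau A F)%E.
move=> nQ nF nY pQ pF.
wlog Y1 : Y nY / opn Y <= 1 => [hw h|h].
 pose c := (opn Y + 1)^-1; have c0 : 0 < c by rewrite invr_gt0 ltr_wpDl ?opn_ge0.
 apply: (hw (c *: Y)); [exact: inNZ| |].
  rewrite (le_trans (opnZ _ _))// gtr0_norm// /c mulrC ler_pdivrMr ?ltr_wpDl ?opn_ge0//.
  by rewrite mul1r lerDl.
 move=> x Qx; rewrite opZE opsv => e; apply: h => //.
 have : sv c^-1 (sv c (F (Y x))) = 0 by rewrite e sv0.
 by rewrite svA mulVf ?gt_eqF// sv1.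
pose T := F * Y * Q; have nT : inN A T by apply: inNM => //; exact: inNM.
pose S := T^† * T; pose S' := T * T^†.
have T1 : opn T <= 1.
 rewrite (le_trans (opnM _ _))// mulr_ile1 ?opn_ge0 ?(proj_opn pQ)//.
 by rewrite (le_trans (opnM _ _))// mulr_ile1 ?opn_ge0 ?(proj_opn pF).
have contr (V : op E) : opn V <= 1 -> psd (1 - V^† * V).
 move=> V1; split=> [|x]; first by apply: saB; [exact: sa1|exact: sa_sq].
 rewrite !qE q_sq subr_ge0 ler_pXn2r ?nnegrE ?nrm_ge0//.
 by rewrite (le_trans (opn_le _ _))// ler_piMl ?nrm_ge0.
have pS : psd S by exact: psd_sq.
have pS1 : psd (1 - S) by exact: contr.
have pS'1 : psd (1 - S') by have := contr T^†; rewrite adjK opn_adj; apply.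
have pS' : psd S' by have := psd_sq T^†; rewrite adjK.
have comS : S * (1 - S) = (1 - S) * S by rewrite mulrBr mulrBl mulr1 mul1r.
have comX (a b : op E) n : a * b = b * a -> a * b ^+ n = b ^+ n * a.
 move=> ab; elim: n => [|n IH]; first by rewrite expr0 mulr1 mul1r.
 by rewrite exprS mulrA ab -mulrA IH mulrA.
have decE (a : op E) n : (1 - a) ^+ n - (1 - a) ^+ n.+1 = a * (1 - a) ^+ n.
 by rewrite exprS mulrBl mul1r opprB addrC subrK.
have geom (a : op E) n : 1 - (1 - a) ^+ n = a * \sum_(i < n) (1 - a) ^+ i.
 elim: n => [|n IH]; first by rewrite expr0 subrr big_ord0 mulr0.
 by rewrite big_ord_recr /= mulrDr -IH -decE addrA subrK.
have dec (a : op E) n : psd a -> psd (1 - a) -> psd ((1 - a) ^+ n - (1 - a) ^+ n.+1).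
 move=> pa p1; rewrite decE.
 by apply: psdM => //; [exact: psdX|apply: comX; rewrite mulrBr mulrBl mulr1 mul1r].
have op1 n : opn ((1 - S) ^+ n) <= 1.
 apply: lop_opn => //; first exact: psdX.
 rewrite scale1r /lop; elim: n => [|n IH]; first by rewrite expr0 subrr; exact: psd0.
 have := psdD IH (dec S n pS pS1); by rewrite addrA subrK.
have [||n x|L [sL hL lL]] := @antitone_limit _ _ (fun n => (1 - S) ^+ n) 1.
- by move=> n; case: (psdX n pS1).
- exact: op1.
- by rewrite -subr_ge0 -qN -qD; case: (dec S n pS pS1).
have SL : S * L = 0.
 have h1 := scvgMl S hL.
 have h2 : scvg (fun n => S * (1 - S) ^+ n) (L - L).
  rewrite (_ : (fun n => _) = (fun n => (1 - S) ^+ n + - (1 - S) ^+ n.+1)).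
   apply: scvgD => //; apply: scvgN => x; apply/hcvgP => e e0.
   have /hcvgP /(_ e e0) [N hN] := hL x; exists N => n Nn; exact: hN (leqW Nn).
  by apply/funext => n; rewrite -decE.
 by rewrite subrr in h2; exact: scvg_uniq h1 h2.
have QS : Q * S = S by rewrite /S /T !adjM pQ.1 -!mulrA mulrA pQ.2.
have QL : Q * L = 0.
 apply: op_ext => x; rewrite opME op0E; apply: h; first by rewrite proj_id.
 have : nrm (T (L x)) ^+ 2 = 0 by rewrite -q_sq /q -opME SL op0E rip0l.
 by move/eqP; rewrite sqrf_eq0 nrm_eq0 => /eqP; rewrite /T !opME.
have cV : scvg (fun n => 1 - (1 - S) ^+ n) (1 - L).
 by apply: scvgD; [exact: scvg_cst|exact: scvgN].
have QV n : Q * (1 - (1 - S) ^+ n) = 1 - (1 - S) ^+ n by rewrite geom mulrA QS.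
have eL : 1 - L = Q.
 have h1 := scvgMl Q cV; rewrite (_ : (fun n => _) = (fun n => 1 - (1 - S) ^+ n)) in h1; last by apply/funext => n; rewrite QV.
 by rewrite (scvg_uniq cV h1) mulrBr QL mulr1 subr0.
rewrite eL in cV.
have posV n : pos A (1 - (1 - S) ^+ n).
 split; last first.
  elim: n => [|n IH]; first by rewrite expr0 subrr; exact: psd0.
  by have := psdD IH (dec S n pS pS1); rewrite addrA subrK.
 apply: inNB; first exact: inN1.
 by apply: inNX; apply: inNB; [exact: inN1|apply: inNM => //; exact: inN_adj].
apply: (cvge_le _ (tau_normal posV _ (pos_proj nQ pQ) (scvg_wcvg cV))); last by move=> n; rewrite /lop opprB addrC addrA subrK; have := dec S n pS pS1.
apply: nearW => n.
have TS k : T * (1 - S) ^+ k = (1 - S') ^+ k * T.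
 elim: k => [|k IH]; first by rewrite !expr0 mulr1 mul1r.
 have e : T * (1 - S) = (1 - S') * T by rewrite mulrBr mulrBl mulr1 mul1r /S /S' mulrA.
 by rewrite exprSr mulrA IH -mulrA e mulrA -exprSr.
pose G := \sum_(i < n) (1 - S') ^+ i.
have pG : psd G by rewrite /G; elim/big_ind: _ => [|a b|i _]; [exact: psd0|exact: psdD|exact: psdX].
have nS' : inN A S' by apply: inNM => //; exact: inN_adj.
have nG : inN A G by apply: inN_sum => i; apply: inNX; apply: inNB => //; exact: inN1.
have [B [pB BB cB]] := sqrt_exists pG.
have nB : inN A B by exact: inN_comm nG cB.
have e1 : 1 - (1 - S) ^+ n = (B * T)^† * (B * T).
 have TG : T * (\sum_(i < n) (1 - S) ^+ i) = G * T.
  by rewrite /G mulr_sumr mulr_suml; apply: eq_bigr => i _; rewrite TS.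
 have eS : S * (\sum_(i < n) (1 - S) ^+ i) = T^† * (T * (\sum_(i < n) (1 - S) ^+ i)).
  by rewrite mulrA.
 by rewrite geom eS TG adjM pB.1 -(mulrA T^† B) (mulrA B B) BB.
have GS' : G * S' = S' * G.
 rewrite /G mulr_sumr mulr_suml; apply: eq_bigr => i _; apply/esym/comX.
 by rewrite mulrBr mulrBl mulr1 mul1r.
have e2 : (B * T) * (B * T)^† = 1 - (1 - S') ^+ n.
 rewrite adjM pB.1 mulrA -(mulrA B T) -/S'.
 have BS : B * S' = S' * B by apply/esym/cB; rewrite GS'.
 by rewrite BS -mulrA BB -geom.
rewrite e1 tau_adj ?e2; last exact: inNM.
have FS' : F * S' = S' by rewrite /S' /T !adjM -!mulrA mulrA pF.2.
set V := 1 - (1 - S') ^+ n.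
have VE : V = S' * G by exact: geom.
have pV : pos A V.
 rewrite /V -e2; have := pos_sq (inN_adj (inNM nB nT)); by rewrite adjK.
apply: tau_le => //; first exact: pos_proj.
have FV : F * V = V by rewrite VE mulrA FS'.
have VF : V * F = V by have := congr1 (@adj R E) FV; rewrite adjM pF.1 pV.2.1.
have -> : F = F^† * 1 * F by rewrite mulr1 pF.1 pF.2.
have -> : V = F^† * V * F by rewrite pF.1 FV VF.
apply: lop_conj; rewrite /lop /V opprB addrC subrK; exact: psdX.
Qed.

(** Induction on the number of tests: [Q] splits into [Q1], the part killed by the last test, and
    [Q - Q1], on which the last test is injective, so that [tau_proj_le] bounds its trace by that of
    [F]. *)
Lemma tau_proj_list (Q F : op E) (Y : nat -> op E) m : inN A Q -> inN A F -> (forall i, inN A (Y i)) ->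
 proj Q -> proj F -> (forall x, Q x = x -> (forall i, (i < m)%N -> F (Y i x) = 0) -> x = 0) ->
 (tau A Q <= (m%:R)%:E * tau A F)%E.
move=> + nF nY + pF; elim: m Q => [|m IH] Q nQ pQ h.
 have -> : Q = 0 by apply: op_ext => x; apply: h => //; exact: proj_id.
 by rewrite tau0 mul0e.
pose K := (1 - Q) + (F * Y m)^† * (F * Y m).
have nFY : inN A (F * Y m) by exact: inNM.
have nK : inN A K by apply: inND; [apply: inNB => //; exact: inN1|apply: inNM => //; exact: inN_adj].
have pK : psd K by apply: psdD; [exact/proj_psd/projC|exact: psd_sq].
have [Q1 [pQ1 KQ1 hQ1 cQ1 wQ1]] := ker_proj pK.1.
have nQ1 : inN A Q1 by exact: inN_comm nK cQ1.
have kerK x : K x = 0 -> Q x = x /\ F (Y m x) = 0.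
 move=> Kx; have : q K x = 0 by rewrite /q Kx rip0l.
 rewrite /K qE q_sq (proj_q _ (projC pQ)) => /eqP.
 rewrite paddr_eq0 ?sqr_ge0// !sqrf_eq0 !nrm_eq0 => /andP[/eqP h1 /eqP h2].
 by move: h1; rewrite opDE opNE op1E => /eqP; rewrite subr_eq0 => /eqP <-.
have QQ1 : Q * Q1 = Q1.
 by apply: op_ext => x; rewrite opME; have [] // := kerK (Q1 x); rewrite -opME KQ1.
have Q1Q : Q1 * Q = Q1 by have := congr1 (@adj R E) QQ1; rewrite adjM pQ.1 pQ1.1.
have pQ2 : proj (Q - Q1).
 split; first by apply: saB; [exact: pQ.1|exact: pQ1.1].
 by rewrite mulrBr !mulrBl pQ.2 QQ1 Q1Q pQ1.2 subrr subr0.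
have nQ2 : inN A (Q - Q1) by exact: inNB.
rewrite -(subrK Q1 Q) tauD; [|exact: pos_proj|exact: pos_proj].
rewrite -addn1 addnC natrD EFinD ge0_muleDl//.
rewrite mul1e; apply: leeD.
 apply: (tau_proj_le nQ2 nF (nY m) pQ2 pF) => x e1 e2.
 have Qx : Q x = x by rewrite -e1 -opME mulrBr pQ.2 QQ1.
 have Q1x : Q1 x = x.
  apply: hQ1; rewrite /K !opDE opNE op1E Qx subrr add0r.
  by rewrite opME [(F * Y m) x]opME e2 op0.
 by rewrite -e1 opDE opNE Qx Q1x subrr.
apply: IH => // x Q1x hx; apply: h => [|i].
 by rewrite -Q1x -opME QQ1.
rewrite ltnS leq_eqVlt => /predU1P[->|/hx//].
have Kx : K x = 0 by have := congr1 (fun T : op E => T x) KQ1; rewrite opME op0E Q1x.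
by have [] := kerK x Kx.
Qed.

End TracePvm.

(** * Spectral resolution of a bounded self-adjoint operator *)

Section BoundedSpectral.
Context {R : realType} {E : hilbert R} (S : op E) (sS : sa S).

Let P := specp (of_bounded_usa sS).
Let hP := specp_pvm_of (of_bounded_usa sS).

(** A vector of the spectral subspace beyond [n] in absolute value would have a form of size at
    least [n |y|^2], more than [|S|] allows; the measure sits in the window. *)
Lemma bounded_fc n : opn S < n%:R -> fc P (trunc n) = S.
move=> hn; have mW := win_meas (R := R) n.
have big (B : borel R) : measurable B -> (forall l : R, B l -> n%:R <= l) -> pE P B = 0.
 move=> mB hB; apply: op_ext => x; set y := pE P B x.
 have yy : pE P B y = y by rewrite /y proj_id//; exact: pE_proj.
 have h1 := ripD_ge hP mB (I : dom (of_bounded S) y) yy hB.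
 have h2 := q_abs S y; have := ler_norm (q S y); rewrite /q /= in h2 * => h3.
 have h1' : n%:R * nrm y ^+ 2 <= rip (S y) y := h1.
 apply/eqP; rewrite op0E -nrm_eq0 -sqrf_eq0 eq_le sqr_ge0 andbT; have := sqr_ge0 (nrm y).
 have := opn_ge0 S; nra.
have small (B : borel R) : measurable B -> (forall l : R, B l -> l <= - n%:R) -> pE P B = 0.
 move=> mB hB; apply: op_ext => x; set y := pE P B x.
 have yy : pE P B y = y by rewrite /y proj_id//; exact: pE_proj.
 have h1 := ripD_le hP mB (I : dom (of_bounded S) y) yy hB.
 have h2 := q_abs S y; have := ler_norm (- q S y); rewrite normrN /q /= in h2 * => h3.
 have h1' : rip (S y) y <= - n%:R * nrm y ^+ 2 := h1.
 apply/eqP; rewrite op0E -nrm_eq0 -sqrf_eq0 eq_le sqr_ge0 andbT; have := sqr_ge0 (nrm y).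
 have := opn_ge0 S; nra.
have m1 : measurable (`]n%:R, +oo[%classic : borel R) by exact: measurable_itv.
have m2 : measurable (`]-oo, - n%:R]%classic : borel R) by exact: measurable_itv.
have W1 : pE P (win n) = 1.
 rewrite -(pE_T P) -(fc_ind P measurableT).
 have -> : (\1_setT : R -> R) = fun l : R => \1_(win n) l + (\1_(`]n%:R, +oo[%classic : set R) l + \1_(`]-oo, - n%:R]%classic : set R) l).
  apply/funext => l; rewrite indic_win !indicE !mem_setE in_setT !in_itv /= andbT.
  have [h1|h1] := lerP l (- n%:R).
   have h2 : l <= n%:R by apply: (le_trans h1); apply: (@le_trans _ _ 0); rewrite ?oppr_le0.
   by rewrite /= add0r (le_gtF h2) add0r.
  by have [h2|h2] := lerP l n%:R; rewrite ?addr0 ?add0r.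
 have b1 := bm_ind m1; have b2 := bm_ind m2.
 rewrite fcD; [|exact: bm_ind|exact: bmD].
 rewrite fcD// !fc_ind// (big _ m1) ?(small _ m2) ?addr0// => l /=; rewrite in_itv /= ?andbT//.
 by move/ltW.
apply: op_ext => x; have [_ h] := win_dom (of_bounded_usa sS) hP n x.
by rewrite -h W1.
Qed.

(* The negative part of the spectral resolution does not contribute to [S]. *)
Lemma psd_bounded_fc n : psd S -> opn S < n%:R ->
 fc P (fun l => trunc n l * \1_(`[0, +oo[%classic : set R) l) = S.
move=> pS hn; have eS := bounded_fc hn.
have mI := @mitv R `[0, +oo[.
have bI := bm_ind mI; have bt := trunc_bm (R := R) n.
have b2 : bm (fun l => trunc n l * \1_(`[0, +oo[%classic : set R) l) by exact: bmM.
apply/eqP; rewrite eq_sym -subr_eq0; apply/eqP/psd_anti.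
 have pC := projC (pE_proj P mI); set C := 1 - _ in pC.
 have -> : S - fc P (fun l => trunc n l * \1_(`[0, +oo[%classic : set R) l) = C^† * S * C.
  rewrite pC.1 -fc_pE// eS.
  have com : S * pE P `[0, +oo[%classic = pE P `[0, +oo[%classic * S.
   by rewrite -eS -(fc_ind P mI) fcC.
  have -> : S - S * pE P `[0, +oo[%classic = S * C by rewrite /C mulrBr mulr1.
  have cC : C * S = S * C by rewrite /C mulrBr mulrBl mulr1 mul1r com.
  by rewrite cC -mulrA pC.2.
 exact: psd_conj.
rewrite opprB; have := @fc_lop _ _ P _ _ bt b2; rewrite /lop eS; apply=> l.
rewrite /trunc indic_win indicE mem_setE in_itv /= andbT.
by case: (_ < l <= _); case: (lerP 0 l); rewrite ?mulr1 ?mulr0// => /ltW.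
Qed.

End BoundedSpectral.

Section L2More.
Context {R : realType} {E : hilbert R} (A : tracial E).
Implicit Types (S T : op E).

Lemma L2Z c T : L2 A T -> L2 A (c *: T).
have -> : c *: T = (c *: (1 : op E)) * T by rewrite -opZAl mul1r.
by apply: L2_mull; apply: inNZ; exact: inN1.
Qed.

(** Cauchy-Schwarz in additive form; the free parameter [c] is there to be optimized in [pw_tr]. *)
Lemma rtr_amgm S T c : L2 A S -> L2 A T -> 0 < c ->
 `|rtr A (S * T)| <= 2^-1 * (c ^+ 2 * tr A (S^† * S) + (c ^+ 2)^-1 * tr A (T^† * T)).
have aux S' T' : L2 A S' -> L2 A T' ->
  `|rtr A (S' * T')| <= 2^-1 * (tr A (S'^† * S') + tr A (T'^† * T')).
 move=> h1 h2; rewrite (L2M_aux h1 h2).2.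
 have h3 := L2_adj h1; have h4 := (L2D h2 h3).2; have h5 := (L2D h2 (L2N h3)).2.
 have e : tr A ((T' + S'^†)^† * (T' + S'^†)) + tr A ((T' - S'^†)^† * (T' - S'^†)) =
   2 * tr A (T'^† * T') + 2 * tr A (S'^† * S').
  rewrite -trD// [in RHS]/tr (tau_adj h1.1) -/(tr A _).
  have h6 := h3.2; rewrite adjK in h6.
  have h7 := h2.2; rewrite -/(tr A (T'^† * T')) -!trZ// -trD//; [|exact: fpZ|exact: fpZ].
  congr tr; rewrite !adjD !adjN adjK.
  move: (T'^†) (S'^†) => a b.
  rewrite !scaler_nat !mulr2n; opring.
 have := tr_ge0 h4; have := tr_ge0 h5; rewrite normrM [`|4^-1|]ger0_norm// => p1 p2.
 set a := tr A _ in e p2 *; set b := tr A _ in e p1 *.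
 have : `|a - b| <= a + b by rewrite ler_norml; apply/andP; split; lra.
 move=> h; rewrite -/(a - b); lra.
move=> hS hT c0; have -> : S * T = (c *: S) * (c^-1 *: T).
 by rewrite -opZAl -opZAr scalerA divff ?gt_eqF// scale1r.
rewrite (le_trans (aux _ _ (L2Z c hS) (L2Z c^-1 hT)))//.
rewrite !adjZ -!opZAl -!opZAr !scalerA.
by rewrite (trZ _ hS.2) ?(trZ _ hT.2) -?expr2 ?exprVn ?sqr_ge0// -exprVn sqr_ge0.
Qed.

End L2More.

(** * Products of operators dominated by [hop] *)

Section Words.
Context {R : realType} {E : hilbert R} (A : tracial E) (D0 : unbounded_operator E) (sD0 : usa D0).
Hypothesis aD0 : affiliated (hdot E) (tN A) D0.
Implicit Types (T W X Z V : op E) (c C : R).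

Definition hfun (l : R) : R := (1 + l ^+ 2) `^ (- 4^-1).

Lemma sq1_ge1 (l : R) : 1 <= 1 + l ^+ 2.
by rewrite lerDl sqr_ge0. Qed.
Lemma sq1_gt0 (l : R) : 0 < 1 + l ^+ 2.
exact: lt_le_trans (sq1_ge1 l). Qed.
Lemma hfun_gt0 l : 0 < hfun l.
by rewrite powR_gt0// sq1_gt0. Qed.
Lemma hfunX l n : hfun l ^+ n = (1 + l ^+ 2) `^ (- (n%:R / 4)).
by rewrite /hfun -powR_mulrn ?powR_ge0// -powRrM mulNr mulrC. Qed.
Lemma hfun4 l : hfun l ^+ 4 = (1 + l ^+ 2)^-1.
by rewrite hfunX divff// powR_inv1 // ltW // sq1_gt0. Qed.

Lemma hfun_le1 l : hfun l <= 1.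
rewrite -(@ler_pXn2r _ 4)// ?nnegrE ?(ltW (hfun_gt0 _))// hfun4 expr1n.
by rewrite invf_le1 ?sq1_gt0// sq1_ge1.
Qed.

Lemma meas_sq1 : measurable_fun [set: mR R] (fun l : mR R => 1 + l ^+ 2).
exact: measurable_funD.
Qed.

Lemma bm_powR (r : R) : 0 <= r -> bm (fun l => (1 + l ^+ 2) `^ (- r)).
move=> r0; split; first by apply: (measurableT_comp (measurable_powR (- r)) meas_sq1).
exists 1 => l; rewrite ger0_norm ?powR_ge0//.
by have := @ler_powR _ _ (sq1_ge1 l) (- r) 0; rewrite powRr0; apply; rewrite oppr_le0.
Qed.

Lemma bm_hfun : bm hfun. exact: bm_powR. Qed.

Let P0 := specp sD0.
Definition hop : op E := fc P0 hfun.

Lemma P0N : pvmN A P0.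
by move=> B mB; rewrite -fc_ind//; apply: fc_inN => //; exact: bm_ind. Qed.

Lemma hop1 : opn hop <= 1.
apply: fc_opn; first exact: bm_hfun.
by move=> l; rewrite ger0_norm ?hfun_le1// ltW// hfun_gt0.
Qed.
Lemma hop_le x : nrm (hop x) <= nrm x.
by rewrite (le_trans (opn_le _ _))// ler_piMl ?nrm_ge0// hop1. Qed.

(** The domination is one-sided. Bounded factors on the left preserve [Kc]; on the right the factor
    must be bounded for the norm [|hop x|], which is the class [Bc]. *)
Definition Kc c T := inN A T /\ forall x, nrm (T x) <= c * nrm (hop x).
Definition Bc c T := inN A T /\ forall x, nrm (hop (T x)) <= c * nrm (hop x).

Lemma Kc_le c c' T : c <= c' -> Kc c T -> Kc c' T.
by move=> cc [hT h]; split=> // x; rewrite (le_trans (h x))// ler_wpM2r ?nrm_ge0. Qed.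
Lemma KcD c c' T T' : Kc c T -> Kc c' T' -> Kc (c + c') (T + T').
move=> [hT h] [hT' h']; split=> [|x]; first exact: inND.
by rewrite mulrDl (le_trans (nrmD _ _))// lerD.
Qed.
Lemma KcZ c k T : Kc c T -> Kc (`|k| * c) (k *: T).
move=> [hT h]; split=> [|x]; first exact: inNZ.
by rewrite opZE nrm_sv -mulrA ler_wpM2l.
Qed.
Lemma KcN c T : Kc c T -> Kc c (- T).
by move=> [hT h]; split=> [|x]; [exact: inNN|rewrite opNE nrmN]. Qed.
Lemma KcB c c' T T' : Kc c T -> Kc c' T' -> Kc (c + c') (T - T').
by move=> h h'; apply: KcD => //; exact: KcN. Qed.
Lemma Kc_mull c k X T : inN A X -> opn X <= k -> Kc c T -> Kc (k * c) (X * T).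
move=> hX Xk [hT h]; split=> [|x]; first exact: inNM.
have k0 : 0 <= k by apply: le_trans Xk; exact: opn_ge0.
rewrite opME (le_trans (opn_le _ _))// -mulrA.
by apply: (le_trans (ler_wpM2r (nrm_ge0 _) Xk)); rewrite ler_wpM2l.
Qed.
Lemma Kc_mulr c k T Z : 0 <= c -> Kc c T -> Bc k Z -> Kc (c * k) (T * Z).
move=> c0 [hT h] [hZ h']; split=> [|x]; first exact: inNM.
by rewrite (le_trans (h _))// -mulrA ler_wpM2l.
Qed.
Lemma Kc_Bc c T : Kc c T -> Bc c T.
by move=> [hT h]; split=> // x; rewrite (le_trans (hop_le _)). Qed.
Lemma BcD c c' T T' : Bc c T -> Bc c' T' -> Bc (c + c') (T + T').
move=> [hT h] [hT' h']; split=> [|x]; first exact: inND.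
by rewrite mulrDl opDE opD (le_trans (nrmD _ _))// lerD.
Qed.
Lemma Bc_fc f C : bm f -> (forall l, `|f l| <= C) -> Bc C (fc P0 f).
move=> bf hf; split=> [|x]; first exact: fc_inN.
rewrite (op_comm_app (fcC P0 bm_hfun bf)) (le_trans (opn_le _ _))//.
by rewrite ler_wpM2r ?nrm_ge0// fc_opn.
Qed.
Lemma Kc0 : Kc 0 0.
by split=> [|x]; [exact: inN0|rewrite op0E nrm0 mul0r]. Qed.
Lemma Kc_opn c T : 0 <= c -> Kc c T -> opn T <= c.
move=> c0 [hT h]; apply: opn_lub => // x; by rewrite (le_trans (h x))// ler_wpM2l// hop_le.
Qed.

Inductive pw : nat -> R -> op E -> Prop :=
| pw0 : pw 0 1 1
| pwS i c c' V T : pw i c V -> 0 < c' -> Kc c' T -> pw i.+1 (c * c') (V * T).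

Lemma pw_gt0 i c V : pw i c V -> 0 < c.
by elim=> // *; exact: mulr_gt0. Qed.
Lemma pwN i c V : pw i c V -> inN A V.
by elim=> [|j k k' V' T _ IH _ [hT _]]; [exact: inN1|exact: inNM]. Qed.

(** [Y k] is the product of the last [k] letters. If [hop] contracts each [Y k x] by the factor [e],
    the letters contract one after the other. *)
Lemma pw_test i c V : pw i c V -> exists Y : nat -> op E, (forall k, inN A (Y k)) /\
 forall (e : R) x, 0 <= e -> (forall k, (k < i)%N -> nrm (hop (Y k x)) <= e * nrm (Y k x)) ->
 nrm (V x) <= c * e ^+ i * nrm x.
elim=> [|j k k' V' T hV [Y [hY IH]] k0 [hT h]].
 exists (fun=> 1); split=> [_|e x _ _]; first exact: inN1.
 by rewrite expr0 !mul1r.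
exists (fun n => if n is n'.+1 then Y n' * T else 1); split=> [[|n]|e x e0 he].
- exact: inN1.
- exact: inNM.
have /(le_trans (h x)) h1 : k' * nrm (hop x) <= k' * (e * nrm x).
 by rewrite ler_wpM2l ?(ltW k0)//; exact: (he 0%N).
rewrite opME (le_trans (IH e (T x) e0 _))//; first by move=> n nj; apply: (he n.+1).
have kj : 0 <= k * e ^+ j by rewrite mulr_ge0 ?exprn_ge0// ltW// (pw_gt0 hV).
apply: (le_trans (ler_wpM2l kj h1)); rewrite le_eqVlt exprSr; apply/orP; left; apply/eqP; ring.
Qed.

(** On the spectral subspace of [V^* V] above [s] one has [|V x|^2 >= s |x|^2]. If the projection
    for [2 c^2 h^(2 i) >= s] kills all tests [Y k x], [pw_test] yields [|V x|^2 <= s / 2 |x|^2], so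
    [x = 0]; the factor 2 creates the gap. [tau_proj_list] compares the projections, [layer_cake]
    the functions. *)
Lemma pw_tau i c V : (0 < i)%N -> pw i c V ->
 (tau A (V^† * V)%R <= i%:R%:E * tau A (fc P0 (fun l => ((2 * c ^+ 2) * hfun l ^+ (2 * i))%R)))%E.
move=> i0 hV; have c0 := pw_gt0 hV; have nV := pwN hV; set S := V^† * V.
have pS : psd S by exact: psd_sq.
pose n := Num.bound (opn S); have hn : opn S < n%:R by apply: archi_boundP; exact: opn_ge0.
have nS : inN A S by apply: inNM => //; exact: inN_adj.
pose P := specp (of_bounded_usa pS.1).
have PN : pvmN A P.
 by move=> B mB; rewrite -fc_ind//; apply: fc_inN; [exact: of_bounded_aff|exact: bm_ind].
have mI := @mitv R `[0, +oo[.
pose f := fun l : R => trunc n l * \1_(`[0, +oo[%classic : set R) l.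
have bf : bm f by apply: bmM; [exact: trunc_bm|exact: bm_ind].
have f0 l : 0 <= f l.
 rewrite /f /trunc indic_win indicE mem_setE in_itv /= andbT.
 by case: (_ < l <= _); case: (lerP 0 l); rewrite ?mulr1 ?mulr0.
have eS : fc P f = S by exact: (psd_bounded_fc pS.1 pS hn).
rewrite -eS; set g := fun l => _.
have bg : bm g by apply: bmZ; apply: bmX; exact: bm_hfun.
have g0 l : 0 <= g l by rewrite mulr_ge0 ?exprn_ge0 ?mulr_ge0 ?sqr_ge0// ltW// hfun_gt0.
apply: (layer_cake PN P0N bf bg f0 g0) => // s s0.
have mf := bm_lset s bf; have mg := bm_lset s bg.
have [Y [hY hYV]] := pw_test hV.
apply: (tau_proj_list (Y := Y)); [exact: PN|exact: P0N|exact: hY|exact: pE_proj|exact: pE_proj|].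
move=> x Qx hx.
pose t := (s / (2 * c ^+ 2)) `^ (2 * i)%:R^-1.
have d0 : 0 < s / (2 * c ^+ 2) by rewrite divr_gt0// mulr_gt0// exprn_gt0.
have t0 : 0 < t by exact: powR_gt0.
have tX : t ^+ (2 * i) = s / (2 * c ^+ 2).
 rewrite -powR_mulrn ?ltW// /t -powRrM mulVf ?powRr1 ?ltW// pnatr_eq0 muln_eq0 /=.
 by rewrite -lt0n.
have test k : (k < i)%N -> nrm (hop (Y k x)) <= t * nrm (Y k x).
 move=> ki; set y := Y k x.
 have Fy : pE P0 (~` [set l | s <= g l]) y = y.
  have mC := measurableC mg.
  rewrite -(fc_ind P0 mC) (_ : \1_(~` _) = fun l => 1 - \1_[set l | s <= g l] l); last first.
   apply/funext => l; rewrite !indicE in_setC; by case: (_ \in _); rewrite ?subr0 ?subrr.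
  rewrite fcB; [|exact: bm_cst|exact: bm_ind].
  by rewrite fc_cst scale1r fc_ind// opDE opNE hx// subr0.
 rewrite -(@ler_pXn2r _ 2)// ?nnegrE ?nrm_ge0 ?mulr_ge0 ?nrm_ge0 ?(ltW t0)//.
 have bh2 := bmX 2 bm_hfun.
 have -> : nrm (hop y) ^+ 2 = q (fc P0 (fun l => hfun l ^+ 2)) y.
  by rewrite fc_q// -fc_nrm//; exact: bm_hfun.
 have := fc_q_le_on bh2 (bm_cst (t ^+ 2)) (measurableC mg) Fy.
 rewrite fc_cst qZ q1 exprMn; apply=> l /negP; rewrite -ltNge /g.
 rewrite -ltr_pdivlMl ?mulr_gt0 ?exprn_gt0// mulrC -tX => hl.
 rewrite ler_pXn2r ?nnegrE ?(ltW t0) ?(ltW (hfun_gt0 _))// ltW//.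
 by rewrite -(@ltr_pXn2r _ (2 * i))// ?nnegrE ?(ltW t0) ?(ltW (hfun_gt0 _))// muln_gt0.
have h1 := hYV t x (ltW t0) test.
have h2 : s * nrm x ^+ 2 <= nrm (V x) ^+ 2.
 rewrite -q_sq -/S -eS; have := fc_q_le_on (bm_cst s) bf mf Qx.
 by rewrite fc_cst qZ q1; apply.
have h3 : nrm (V x) ^+ 2 <= s / 2 * nrm x ^+ 2.
 have : nrm (V x) ^+ 2 <= (c * t ^+ i * nrm x) ^+ 2.
  by rewrite ler_pXn2r ?nnegrE ?nrm_ge0// (le_trans (nrm_ge0 _) h1).
 rewrite !exprMn -exprM mulnC tX; move/le_trans; apply.
 apply: eqW; field; by rewrite gt_eqF.
apply/eqP; rewrite -nrm_eq0 -sqrf_eq0 eq_le sqr_ge0 andbT; have := sqr_ge0 (nrm x); nra.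
Qed.

Variables (p : R) (p0 : 0 < p).
Hypothesis hp : (tau A (fc P0 (fun l => ((1 + l ^+ 2) `^ (- (p / 2)))%R)) < +oo)%E.

(** [hfun ^ (2 m0)] is [(1 + l^2)^(- m0 / 2)], so [m0 >= p] puts it below the function whose trace
    is finite by hypothesis; the successor keeps [m0] positive. *)
Definition m0 : nat := (Num.bound p).+1.
Definition wop := fc P0 (fun l => (1 + l ^+ 2) `^ (- (p / 2))).
Definition theta := tr A (fc P0 (fun l => hfun l ^+ (2 * m0))).
Definition Kth := 2 * m0%:R * theta.

Lemma m0_gt0 : (0 < m0)%N. by []. Qed.
Lemma p_m0 : p <= m0%:R.
by rewrite ltW// (lt_le_trans (archi_boundP (ltW p0)))// ler_nat. Qed.

Lemma fp_wop : fp A wop.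
split=> //; apply: pos_fc; [exact: P0N|by apply: bm_powR; rewrite divr_ge0// ltW|].
by move=> l; exact: powR_ge0.
Qed.

Lemma fp_hop : fp A (fc P0 (fun l => hfun l ^+ (2 * m0))).
have bh := bmX (2 * m0) bm_hfun; apply: (fp_le _ _ fp_wop).
 by apply: pos_fc => // [|l]; [exact: P0N|rewrite exprn_ge0// ltW// hfun_gt0].
apply: fc_lop => // [|l]; first by apply: bm_powR; rewrite divr_ge0// ltW.
rewrite hfunX; apply: ler_powR; first exact: sq1_ge1.
rewrite lerN2 natrM; have := p_m0; lra.
Qed.

Lemma theta_ge0 : 0 <= theta. exact: tr_ge0 fp_hop. Qed.
Lemma Kth_ge0 : 0 <= Kth. by rewrite !mulr_ge0// theta_ge0. Qed.

Lemma pw_L2 c V : pw m0 c V -> L2 A V /\ tr A (V^† * V) <= c ^+ 2 * Kth.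
move=> hV; have nV := pwN hV; have := pw_tau m0_gt0 hV.
have bh := bmX (2 * m0) bm_hfun; rewrite fcZ// tauZ; last 2 first.
- by rewrite mulr_ge0// sqr_ge0.
- by case: fp_hop.
rewrite (trE fp_hop) -/theta -!EFinM => h.
have fV : fp A (V^† * V) by split; [exact: pos_sq|exact: le_lt_trans h (ltry _)].
split; first by split.
by rewrite -lee_fin -trE//; apply: le_trans h _; rewrite lee_fin /Kth; apply: eqW; ring.
Qed.

Opaque Kth m0.

Lemma pw_split i j c V : pw (i + j) c V ->
 exists c1 c2 V1 V2, [/\ pw i c1 V1, pw j c2 V2, c = c1 * c2 & V = V1 * V2].
elim: j c V => [|j IH] c V.
 by rewrite addn0 => h; exists c, 1, V, 1; split=> //; [exact: pw0|rewrite mulr1|rewrite mulr1].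
rewrite addnS => h; inversion h as [|a k k' V' T hV k0 hT]; subst.
have [c1 [c2 [V1 [V2 [h1 h2 -> ->]]]]] := IH _ _ hV.
exists c1, (c2 * k'), V1, (V2 * T); split; [by []|exact: pwS|ring|by rewrite mulrA].
Qed.

Lemma pw_tr c V X : pw (m0 + m0) c V -> inN A X -> L1 A (X * V) /\ `|rtr A (X * V)| <= Kth * opn X * c.
move=> /pw_split[c1 [c2 [V1 [V2 [h1 h2 -> ->]]]]] hX.
have [L1v t1] := pw_L2 h1; have [L2v t2] := pw_L2 h2.
have LX := L2_mull hX L1v; rewrite mulrA; split; first exact: L2M.
have c10 := pw_gt0 h1; have c20 := pw_gt0 h2.
have [X0|X0] := leP (opn X) 0.
 have -> : X = 0 by exact: opn_eq0.
 rewrite !mul0r (rtr_fp (fp0 A)) tr0 normr0.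
 apply: mulr_ge0; last by rewrite mulr_ge0 ?ltW.
 by apply: mulr_ge0; [exact: Kth_ge0|exact: opn_ge0].
have tX : tr A ((X * V1)^† * (X * V1)) <= opn X ^+ 2 * tr A (V1^† * V1).
 rewrite -trZ ?sqr_ge0//; last exact: L1v.2.
 apply: tr_le; [exact: LX.2|by apply: fpZ; [exact: sqr_ge0|exact: L1v.2]|].
 apply: lopP; [exact: sa_sq|by apply: saZ; exact: sa_sq|move=> x].
 rewrite qE !q_sq -exprMn ler_pXn2r ?nnegrE ?nrm_ge0 ?mulr_ge0 ?opn_ge0 ?nrm_ge0//.
 by rewrite opME opn_le.
(* This [k] balances the two terms of [rtr_amgm]. *)
pose k := Num.sqrt (c2 / (opn X * c1)).
have k2 : k ^+ 2 = c2 / (opn X * c1) by rewrite sqr_sqrtr// ltW// divr_gt0// mulr_gt0.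
have k0 : 0 < k by rewrite sqrtr_gt0 divr_gt0// mulr_gt0.
apply: (le_trans (rtr_amgm LX L2v k0)).
apply: (@le_trans _ _ (2^-1 * (k ^+ 2 * (opn X ^+ 2 * (c1 ^+ 2 * Kth)) + (k ^+ 2)^-1 * (c2 ^+ 2 * Kth)))).
 rewrite ler_pM2l ?invr_gt0//; apply: lerD.
  rewrite ler_pM2l ?exprn_gt0//; apply: (le_trans tX); rewrite ler_pM2l ?exprn_gt0//.
 by rewrite ler_pM2l// invr_gt0 exprn_gt0.
rewrite k2; apply: eqW; field.
by rewrite !gt_eqF.
Qed.

(* [wd j C T]: T is a sum of products of j elements of the classes [Kc] and a bounded
  factor, C bounding the sum of the products of the constants. *)
Inductive wd : nat -> R -> op E -> Prop :=
| wd0 c T : inN A T -> opn T <= c -> wd 0 c T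
| wdS j c C T W : 0 < c -> Kc c T -> wd j C W -> wd j.+1 (c * C) (T * W)
| wdD j C C' W W' : wd j C W -> wd j C' W' -> wd j (C + C') (W + W')
| wdL j C C' W : wd j C W -> C <= C' -> wd j C' W.

Lemma wd_ge0 j C T : wd j C T -> 0 <= C.
elim=> [c T' _|i c c' T' W c0 _ _|i c c' W W' _ h _|i c c' W _ h].
- exact/le_trans/opn_ge0.
- by apply: mulr_ge0; exact: ltW.
- exact: addr_ge0.
- exact: le_trans.
Qed.

Lemma wdN j C T : wd j C T -> inN A T.
elim=> // [i c c' T' W c0 [hT _] _ h|i c c' W W' _ h _ h'].
- exact: inNM.
- exact: inND.
Qed.

(** Letters of [T] move one by one into the word [V]. Once [m0 + m0] are gathered, the bounded
    remainder joins [X] by cyclicity and [pw_tr] applies. *)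
Lemma wd_trV j C T : wd j C T -> forall i c V X, (i + j = m0 + m0)%N -> pw i c V -> inN A X ->
 L1 A (X * V * T) /\ `|rtr A (X * V * T)| <= Kth * opn X * c * C.
elim=> {j C T} [k T hT Tk|j k C T W k0 hT hW IH|j C C' W W' hW IH hW' IH'|j C C' W hW IH CC'] i c V X ij hV hX.
- rewrite addn0 in ij; subst i; have [l1 _] := pw_tr hV hX.
 have [lT hTV] := pw_tr hV (inNM hT hX).
 split; first exact: L1Mr.
 rewrite -rtrC// mulrA; apply: (le_trans hTV); have c0 := pw_gt0 hV.
 have h3 : opn (T * X) <= k * opn X.
  by rewrite (le_trans (opnM _ _))// ler_wpM2r ?opn_ge0.
 apply: (@le_trans _ _ (Kth * (k * opn X) * c)).
  by rewrite ler_pM2r// ler_wpM2l// Kth_ge0.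
 by apply: eqW; ring.
- have ij' : (i.+1 + j = m0 + m0)%N by rewrite -ij addnS addSn.
 by have := IH _ _ _ _ ij' (pwS hV k0 hT) hX; rewrite !mulrA.
- have [l1 h1] := IH _ _ _ _ ij hV hX; have [l2 h2] := IH' _ _ _ _ ij hV hX.
 rewrite !mulrDr rtrD//; split; first exact: L1D.
 by rewrite (le_trans (ler_normD _ _))// lerD.
- have [l1 h1] := IH _ _ _ _ ij hV hX; split=> //.
 by rewrite (le_trans h1)// ler_wpM2l// mulr_ge0 ?(ltW (pw_gt0 hV))// mulr_ge0 ?Kth_ge0 ?opn_ge0.
Qed.

Lemma wd_tr C T X : wd (m0 + m0) C T -> inN A X -> L1 A T /\ `|rtr A (X * T)| <= Kth * opn X * C.
move=> hT hX; split.
 by have [] := wd_trV hT (add0n _) pw0 (inN1 A); rewrite !mul1r.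
by have [_] := wd_trV hT (add0n _) pw0 hX; rewrite !mulr1.
Qed.

Lemma wd_zero j : wd j 0 0.
elim: j => [|j IH]; first by apply: wd0; [exact: inN0|rewrite opn0].
rewrite -(mulr0 1) -(mul0r (0 : op E)); apply: wdS => //.
by apply: Kc_le Kc0.
Qed.

Lemma wd_mull j C T b X : 0 < b -> inN A X -> opn X <= b -> wd j C T -> wd j (b * C) (X * T).
move=> b0 hX Xb; elim=> {j C T} [c T hT Tc|j c C T W c0 hT hW _|j C C' W W' _ h _ h'|j C C' W _ h CC'].
- apply: wd0; first exact: inNM.
 by rewrite (le_trans (opnM _ _))// ler_pM ?opn_ge0.
- by rewrite !mulrA; apply: wdS => //; [exact: mulr_gt0|exact: Kc_mull].
- by rewrite !mulrDr; exact: wdD.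
- by apply: (wdL h); rewrite ler_pM2l.
Qed.

Lemma wdM i j C C' S T : wd i C S -> wd j C' T -> wd (i + j) (C * C') (S * T).
move=> hS hT; elim: hS => {i C S} [c S hS Sc|i c C S W c0 hS hW IH|i C C1 W W' hW h hW' h'|i C C1 W _ h CC'].
- have [S0|S0] := leP (opn S) 0.
  have -> : S = 0 by exact: opn_eq0.
  rewrite mul0r add0n; apply: (wdL (wd_zero j)).
  by rewrite mulr_ge0 ?(wd_ge0 hT)// (le_trans _ Sc)// opn_ge0.
 by apply: wd_mull => //; exact: lt_le_trans Sc.
- by rewrite -!mulrA addSn; apply: wdS.
- by rewrite !mulrDl; exact: wdD.
- by apply: (wdL h); rewrite ler_wpM2r// (wd_ge0 hT).
Qed.

Lemma wd1 c T : 0 <= c -> Kc c T -> wd 1 c T.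
rewrite le_eqVlt => /predU1P[<- [hT h]|c0 hT].
 have -> : T = 0.
  apply: op_ext => x; apply/eqP; rewrite op0E -nrm_eq0 eq_le nrm_ge0 andbT.
  by have := h x; rewrite mul0r.
 exact: wd_zero.
by rewrite -(mulr1 c) -(mulr1 T); apply: wdS => //; apply: wd0; [exact: inN1|exact: opn1].
Qed.

Lemma wdZ j C T c : wd j C T -> wd j (`|c| * C) (c *: T).
have [->|c0] := eqVneq c 0; first by rewrite scale0r normr0 mul0r => _; exact: wd_zero.
have -> : c *: T = (c *: (1 : op E)) * T by rewrite -opZAl mul1r.
apply: wd_mull; [by rewrite normr_gt0|by apply: inNZ; exact: inN1|].
by rewrite (le_trans (opnZ _ _))// ler_piMr// opn1.
Qed.

Lemma wdN' j C T : wd j C T -> wd j C (- T).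
by move/(wdZ (-1)); rewrite normrN1 mul1r scaleN1r. Qed.

Lemma wdX j C T n : wd j C T -> wd (n * j) (C ^+ n) (T ^+ n).
move=> h; elim: n => [|n IH]; first by rewrite !expr0; apply: wd0; [exact: inN1|exact: opn1].
by rewrite !exprS mulSn; exact: wdM.
Qed.

Lemma wd_drop k C T : wd k C T -> forall j, (j <= k)%N -> wd j C T.
elim=> {k C T} [c T hT Tc|k c C T W c0 hT hW IH|k C C' W W' _ h _ h'|k C C' W _ h CC'] j.
- by rewrite leqn0 => /eqP ->; exact: wd0.
- case: j => [|j] jk; last by apply: wdS => //; exact: IH.
 by apply: wd_mull => //; [case: hT|exact: Kc_opn (ltW c0) hT|exact: IH].
- by move=> jk; apply: wdD; [exact: h|exact: h'].
- by move=> jk; exact: (wdL (h _ jk)).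
Qed.

(** * Calculus with explicit remainders *)

Lemma cvg_dist_lin (f : R -> R) (F : set_system R) (l x K : R) {FF : Filter F} :
 0 <= K -> (forall e : R, 0 < e -> \forall y \near F, `|y - x| < e) ->
 (\forall y \near F, `|f y - l| <= K * `|y - x|) -> f @ F --> l.
move=> K0 hF hf; apply/cvgrPdist_lt => e e0.
have d0 : 0 < e / (K + 1) by rewrite divr_gt0// ltr_wpDl.
apply: filterS2 (hF _ d0) hf => y h1 h2; rewrite distrC (le_lt_trans h2)//.
rewrite ltr_pdivlMr ?ltr_wpDl// in h1; apply: le_lt_trans h1.
by rewrite mulrC ler_wpM2l// lerDl.
Qed.

Lemma near_dist (x e : R) : 0 < e -> \forall y \near x, `|y - x| < e.
by move=> e0; near do rewrite distrC; exact: cvgr_dist_lt. Unshelve. all: by end_near. Qed.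

Lemma is_derive_lin (f : R -> R) x L :
 (forall e, 0 < e -> exists2 d, 0 < d & forall h, `|h| < d -> `|f (h + x) - f x - h * L| <= e * `|h|) ->
 is_derive x 1 f L.
move=> hf; have cv : (fun h => h^-1 *: (f (h + x) - f x)) @ 0^' --> L.
 apply/cvgrPdist_le => e e0; have [d d0 hd] := hf e e0.
 near=> h; have h0 : h != 0 by near: h; exact: nbhs_dnbhs_neq.
 have hh : `|h - 0| < d by near: h; apply: cvg_within; exact: near_dist.
 rewrite subr0 in hh; have ph : 0 < `|h| by rewrite normr_gt0.
 have -> : L - h^-1 *: (f (h + x) - f x) = - (h^-1 * (f (h + x) - f x - h * L)).
  by rewrite [h^-1 * _]mulrBr (mulrA _ h) mulVf// mul1r opprB.
 by rewrite normrN normrM normfV ler_pdivrMl// [leRHS]mulrC; exact: hd.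
apply: DeriveDef.
 apply/cvg_ex; exists L; rewrite (_ : (fun h => _) = (fun h => h^-1 *: (f (h + x) - f x)))//.
 by apply/funext => h /=; rewrite /GRing.scale /= mulr1.
apply/cvg_lim => //; rewrite (_ : (fun h => _) = (fun h => h^-1 *: (f (h + x) - f x)))//.
by apply/funext => h /=; rewrite /GRing.scale /= mulr1.
Unshelve. all: by end_near. Qed.

Lemma ftc_lin (f d : R -> R) a b : a < b -> {within `[a, b], continuous d} ->
 (forall x e, a <= x <= b -> 0 < e -> exists2 dl, 0 < dl & forall y, a <= y <= b -> `|y - x| < dl ->
   `|f y - f x - (y - x) * d x| <= e * `|y - x|) ->
 \int[leb]_(x in `[a, b]) d x = f b - f a.
move=> ab cd hf.
have lip x : a <= x <= b -> exists2 dl, 0 < dl & forall y, a <= y <= b -> `|y - x| < dl ->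
  `|f y - f x| <= (1 + `|d x|) * `|y - x|.
 move=> hx; have [dl dl0 h] := hf x 1 hx ltr01; exists dl => // y hy yx.
 have -> : f y - f x = (f y - f x - (y - x) * d x) + (y - x) * d x by rewrite subrK.
 rewrite (le_trans (ler_normD _ _))// [leRHS]mulrDl; apply: lerD; first exact: h.
 by rewrite normrM mulrC.
have dd x : x \in `]a, b[ -> is_derive x 1 f (d x).
 rewrite in_itv /= => /andP[ax xb]; have hx : a <= x <= b by rewrite !ltW.
 apply: is_derive_lin => e e0; have [dl dl0 h] := hf x e hx e0.
 exists (Num.min dl (Num.min (x - a) (b - x))); first by rewrite !lt_min dl0 !subr_gt0 ax.
 move=> k; rewrite !lt_min !ltr_norml => /andP[/andP[k0 k1] /andP[/andP[k2 k3] /andP[k4 k5]]].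
 have := h (k + x); rewrite addrK; apply; last by rewrite ltr_norml k0.
 by apply/andP; split; lra.
rewrite /Rintegral (@continuous_FTC2 _ d f a b ab cd) //; last by move=> x /dd h; rewrite derive1E; exact: derive_val.
split.
- by move=> x /dd h; exact: ex_derive.
- have [|dl dl0 h] := lip a; first by rewrite lexx ltW.
 apply: (@cvg_dist_lin _ _ _ a (1 + `|d a|)) => [|e e0|].
 + by rewrite addr_ge0.
 + by apply: cvg_within; exact: near_dist.
 + near=> y; have ya : a < y by near: y; exact: nbhs_right_gt.
  have yb : y < b by near: y; exact: nbhs_right_lt.
  have yd : y < a + dl by near: y; apply: nbhs_right_lt; rewrite ltrDl.
  by apply: h; [rewrite !ltW|rewrite ger0_norm; lra].
- have [|dl dl0 h] := lip b; first by rewrite lexx ltW.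
 apply: (@cvg_dist_lin _ _ _ b (1 + `|d b|)) => [|e e0|].
 + by rewrite addr_ge0.
 + by apply: cvg_within; exact: near_dist.
 + near=> y; have ya : a < y by near: y; exact: nbhs_left_gt.
  have yb : y < b by near: y; exact: nbhs_left_lt.
  have yd : b - dl < y by near: y; apply: nbhs_left_gt; rewrite ltrBlDr ltrDl.
  by apply: h; [rewrite !ltW|rewrite ler0_norm; lra].
Unshelve. all: by end_near. Qed.

(** Adding the estimate from [r] to [s] and the one from [s] to [r] shows that [d] is Lipschitz with
    constant [2 K], so continuity is a consequence of the bound. *)
Lemma ftc_quad (f d : R -> R) a b K : a < b ->
 (forall r s, a <= r <= b -> a <= s <= b -> `|f s - f r - (s - r) * d r| <= K * (s - r) ^+ 2) ->
 [/\ {within `[a, b], continuous f}, {within `[a, b], continuous d} &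
   \int[leb]_(x in `[a, b]) d x = f b - f a].
move=> ab hf.
have K0 : 0 <= K.
 have : 0 <= K * (b - a) ^+ 2 by apply: le_trans (normr_ge0 _) (hf a b _ _); rewrite lexx ltW.
 by rewrite pmulr_lge0// exprn_gt0// subr_gt0.
have lipd r s : a <= r <= b -> a <= s <= b -> `|d s - d r| <= 2 * K * `|s - r|.
 move=> hr hs; have [->|rs] := eqVneq r s; first by rewrite !subrr normr0 mulr0.
 have h1 := hf _ _ hr hs; have h2 := hf _ _ hs hr.
 have h3 : `|s - r| * `|d s - d r| <= 2 * K * (s - r) ^+ 2.
  rewrite -normrM (_ : (s - r) * (d s - d r) = (f s - f r - (s - r) * d r) + (f r - f s - (r - s) * d s)); last by ring.
  rewrite (le_trans (ler_normD _ _))//; rewrite -(sqrrN (r - s)) opprB in h2; lra.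
 have sr0 : 0 < `|s - r| by rewrite normr_gt0 subr_eq0 eq_sym.
 rewrite -(ler_pM2l sr0) (le_trans h3)// -(real_normK (num_real (s - r)));
 apply: eqW; ring.
have K2 : 0 <= 2 * K by rewrite mulr_ge0.
have cd : {within `[a, b], continuous d}.
 apply/subspace_continuousP => x; rewrite /= in_itv /= => hx.
 apply: (@cvg_dist_lin _ _ _ x (2 * K)) => // [e e0|].
  by apply: cvg_within; exact: near_dist.
 by rewrite near_withinE; near=> y => /=; rewrite in_itv /=; exact: lipd.
have dist r s : a <= r <= b -> a <= s <= b -> `|f s - f r| <= (`|d r| + K * (b - a)) * `|s - r|.
 move=> hr hs; have h1 := hf _ _ hr hs.
 have h2 : `|s - r| <= b - a.
  by move/andP: hr => [r1 r2]; move/andP: hs => [s1 s2]; rewrite ler_norml; apply/andP; split; lra.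
 have -> : f s - f r = (f s - f r - (s - r) * d r) + (s - r) * d r by ring.
 apply: (le_trans (ler_normD _ _)); rewrite [leRHS]mulrDl [leRHS]addrC.
 apply: lerD; last by rewrite normrM mulrC.
 rewrite (le_trans h1)//.
 have -> : K * (s - r) ^+ 2 = K * `|s - r| * `|s - r| by rewrite -mulrA -expr2 real_normK ?num_real.
 by rewrite ler_wpM2r// ler_wpM2l.
have ba0 : 0 <= b - a by rewrite subr_ge0 ltW.
have cf : {within `[a, b], continuous f}.
 apply/subspace_continuousP => x; rewrite /= in_itv /= => hx.
 apply: (@cvg_dist_lin _ _ _ x (`|d x| + K * (b - a))) => [|e e0|].
 - by rewrite addr_ge0// mulr_ge0.
 - by apply: cvg_within; exact: near_dist.
 - by rewrite near_withinE; near=> y => /=; rewrite in_itv /=; exact: dist.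
split=> //; apply: ftc_lin => // x e hx e0.
have K1 : 0 < K + 1 by rewrite ltr_wpDl.
exists (e / (K + 1)); first by rewrite divr_gt0.
move=> y hy; rewrite ltr_pdivlMr// => yx; apply: (le_trans (hf _ _ hx hy)).
rewrite -(real_normK (num_real (y - x))) expr2 mulrA ler_wpM2r// mulrC.
by apply: le_trans (ltW yx); rewrite ler_wpM2l// lerDl.
Unshelve. all: by end_near. Qed.

(** * Powers of a perturbed operator *)

Fixpoint Lp (a b : op E) n : op E := if n is n'.+1 then a * Lp a b n' + b * a ^+ n' else 0.

(** [Lp a b n] is the part of [(a + b) ^ n] linear in [b]. The recursion peels off the leftmost
    factor and suits estimates; the sum suits cyclicity. *)
Lemma LpE a b n : Lp a b n = \sum_(i < n) a ^+ (n.-1 - i) * b * a ^+ i.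
elim: n => [|n IH]; first by rewrite big_ord0.
rewrite /= big_ord_recr /= subnn expr0 mul1r IH mulr_sumr; congr (_ + _).
apply: eq_bigr => i _; rewrite !mulrA -exprS; congr (_ ^+ _ * _ * _).
by case: n i {IH} => [[]//|n] i /=; rewrite subSn// -ltnS.
Qed.

Lemma LpD a b b' n : Lp a (b + b') n = Lp a b n + Lp a b' n.
by rewrite !LpE -big_split; apply: eq_bigr => i _; rewrite mulrDr mulrDl. Qed.
Lemma LpZ a b c n : Lp a (c *: b) n = c *: Lp a b n.
by rewrite !LpE scaler_sumr; apply: eq_bigr => i _; rewrite -opZAr -opZAl. Qed.

(** Every factor [a] or [b] in the expansion is a letter, so all terms, the quadratic remainder
    included, are words of [n] letters. [K] serves all [a] and [b] within the bounds [al] and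
    [e0]. *)
Lemma pert_exp (al e0 : R) n : 0 <= al -> 0 <= e0 -> exists2 K, 0 <= K &
 forall a b e, 0 <= e <= e0 -> wd 1 al a -> wd 1 e b ->
 [/\ wd n (K * e) ((a + b) ^+ n - a ^+ n), wd n (K * e) (Lp a b n) &
   wd n (K * e ^+ 2) ((a + b) ^+ n - a ^+ n - Lp a b n)].
move=> al0 e00; elim: n => [|n [K K0 IH]].
 exists 0 => // a b e _ _ _; rewrite !mul0r /= !expr0 subrr subr0; split; exact: wd_zero.
have aln : 0 <= al ^+ n by rewrite exprn_ge0.
exists (al * K + e0 * K + K + al ^+ n); first by rewrite !addr_ge0 ?mulr_ge0.
move=> a b e he wa wb; have [h1 h2 h3] := IH _ _ _ he wa wb; case/andP: he => e1 e2.
have wan : wd n (al ^+ n) (a ^+ n) by have := wdX n wa; rewrite muln1.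
have p1 : 0 <= al * K * e by rewrite !mulr_ge0.
have p2 : 0 <= e0 * K * e by rewrite !mulr_ge0.
have p3 : 0 <= K * e by rewrite mulr_ge0.
have p4 : 0 <= al ^+ n * e by rewrite mulr_ge0.
have p5 : e * (K * e) <= e0 * K * e by rewrite mulrA ler_wpM2r// ler_wpM2r.
have p6 : 0 <= e ^+ 2 by exact: sqr_ge0.
split; rewrite -[n.+1]add1n.
- have -> : (a + b) ^+ (1 + n) - a ^+ (1 + n) =
   a * ((a + b) ^+ n - a ^+ n) + b * ((a + b) ^+ n - a ^+ n) + b * a ^+ n.
  rewrite !add1n !exprS; move: ((a + b) ^+ n) (a ^+ n) => x y; opring.
 apply: (wdL (wdD (wdD (wdM wa h1) (wdM wb h1)) (wdM wb wan))); lra.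
- apply: (wdL (wdD (wdM wa h2) (wdM wb wan))); lra.
- have -> : (a + b) ^+ (1 + n) - a ^+ (1 + n) - Lp a b (1 + n) =
   a * ((a + b) ^+ n - a ^+ n - Lp a b n) + b * ((a + b) ^+ n - a ^+ n).
  rewrite !add1n !exprS /=; move: ((a + b) ^+ n) (a ^+ n) (Lp a b n) => x y z; opring.
 apply: (wdL (wdD (wdM wa h3) (wdM wb h1))).
 have -> : al * (K * e ^+ 2) + e * (K * e) = (al * K + K) * e ^+ 2 by ring.
 have p7 : 0 <= e0 * K by rewrite mulr_ge0.
 by rewrite ler_wpM2r//; lra.
Qed.

(** Among [4 m0] letters one of the two factors has [2 m0] and is trace class alone, as cyclicity
    requires; this is the origin of the bound on [n]. *)
Lemma rtr_swap i j C C' S T : wd i C S -> wd j C' T -> ((m0 + m0) + (m0 + m0) <= i + j)%N ->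
 rtr A (S * T) = rtr A (T * S).
move=> hS hT ij; have [h|h] := leqP (m0 + m0) j.
 have [lT _] := wd_tr (wd_drop hT h) (inN1 A); exact: rtrC (wdN hS) lT.
have h' : (m0 + m0 <= i)%N.
 by rewrite -(leq_add2r (m0 + m0)) (leq_trans ij)// leq_add2l ltnW.
have [lS _] := wd_tr (wd_drop hS h') (inN1 A); exact/esym/(rtrC (wdN hT) lS).
Qed.

(** * The affine space around the bounded transform of [D0] *)

Definition Ffun (l : R) : R := l * (1 + l ^+ 2) `^ (- 2^-1).
Definition ufun (l : R) : R := (1 + l ^+ 2)^-1.

Lemma ufun_gt0 l : 0 < ufun l. by rewrite invr_gt0 sq1_gt0. Qed.
Lemma ufun_le1 l : ufun l <= 1.
by rewrite /ufun invf_le1 ?sq1_gt0// sq1_ge1. Qed.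

Lemma powR_half2 (l : R) : ((1 + l ^+ 2) `^ (- 2^-1)) ^+ 2 = ufun l.
rewrite -powR_mulrn ?powR_ge0// -powRrM mulNr mulVf// powRN powRr1//.
exact: ltW (sq1_gt0 l).
Qed.

Lemma Ffun_sq l : Ffun l ^+ 2 = 1 - ufun l.
rewrite /Ffun exprMn powR_half2 /ufun; field.
by rewrite gt_eqF// sq1_gt0.
Qed.

Lemma Ffun_le1 l : `|Ffun l| <= 1.
rewrite -(@ler_pXn2r _ 2)// ?nnegrE// real_normK ?num_real// Ffun_sq expr1n.
by rewrite gerDl oppr_le0 ltW// ufun_gt0.
Qed.

Lemma bm_Ffun : bm Ffun.
split; last by exists 1; exact: Ffun_le1.
by apply: measurable_funM => //; apply: (measurableT_comp (measurable_powR _) meas_sq1).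
Qed.

Lemma bm_ufun : bm ufun.
have -> : ufun = fun l => 1 - Ffun l ^+ 2 by apply/funext => l; rewrite Ffun_sq opprB addrC subrK.
apply: bmB; [exact: bm_cst|exact: bmX bm_Ffun].
Qed.

Lemma ufun_hfun l : ufun l <= hfun l.
by rewrite /ufun -hfun4 -[leRHS]expr1 ler_wiXn2l ?(ltW (hfun_gt0 l)) ?hfun_le1. Qed.

Definition F0 := fc P0 Ffun.
Definition uo (F : op E) : op E := 1 - F * F.
(** The space on which the form [tau (X (1 - F^2)^n)] is studied. It contains the transforms of
    [D0 + A] ([aff_FA]) and the symmetries [2 P - 1] ([aff_Q]), and segments stay inside with the
    same [M] ([aff_line]). *)
Definition aff M F := [/\ sa F, inN A F & Kc M (F - F0)].

Lemma uo_fc (P : pvm E) : uo (fc P Ffun) = fc P ufun.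
have -> : ufun = fun l => 1 - Ffun l * Ffun l.
 by apply/funext => l; rewrite -expr2 Ffun_sq opprB addrC subrK.
have bF := bm_Ffun.
by rewrite fcB; [rewrite fc_cst scale1r fcM|exact: bm_cst|exact: bmM].
Qed.

Lemma aff_F0 : aff 0 F0.
split; [exact: fc_sa bm_Ffun|exact: fc_inN bm_Ffun|rewrite subrr; exact: Kc0].
Qed.

Lemma aff_le M M' F : M <= M' -> aff M F -> aff M' F.
by move=> h [h1 h2 h3]; split=> //; exact: Kc_le h3. Qed.

Lemma aff_Bc M F : 0 <= M -> aff M F -> Bc (1 + M) F /\ opn F <= 1 + M.
move=> M0 [sF nF kF]; have e : F = F0 + (F - F0) by rewrite addrC subrK.
split; rewrite e.
 apply: BcD; last exact: Kc_Bc.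
 by apply: Bc_fc; [exact: bm_Ffun|exact: Ffun_le1].
rewrite (le_trans (opnD _ _))// lerD//; last exact: Kc_opn.
by apply: fc_opn; [exact: bm_Ffun|exact: Ffun_le1].
Qed.

(** [uo F] is [uo F0], dominated with constant 1, minus [F (F - F0) + (F - F0) F0], dominated with
    [(1 + M) M + M]. *)
Definition cu M : R := 1 + ((1 + M) * M + M).

Lemma cu_ge0 M : 0 <= M -> 0 <= cu M.
by move=> M0; rewrite /cu; nra. Qed.

Lemma uo_wd M F : 0 <= M -> aff M F -> wd 1 (cu M) (uo F).
move=> M0 hF; have [bF oF] := aff_Bc M0 hF; have [sF nF kF] := hF.
apply: wd1; first exact: cu_ge0.
have -> : uo F = uo F0 - (F * (F - F0) + (F - F0) * F0) by rewrite /uo; opring.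
apply: KcB; last apply: KcD.
- rewrite uo_fc; split=> [|x]; first exact: fc_inN bm_ufun.
 rewrite mul1r; apply: fc_nrm_le; [exact: bm_ufun|exact: bm_hfun|move=> l].
 by rewrite !ger0_norm ?ufun_hfun// ltW ?ufun_gt0 ?hfun_gt0.
- exact: Kc_mull.
- rewrite -[X in Kc X _]mulr1; apply: Kc_mulr => //.
 by apply: Bc_fc; [exact: bm_Ffun|exact: Ffun_le1].
Qed.

Lemma sym_wd M e F Y : 0 <= M -> aff M F -> 0 <= e -> Kc e Y ->
 wd 1 (2 * (1 + M) * e) (- (F * Y + Y * F)).
move=> M0 hF e0 kY; have [bF oF] := aff_Bc M0 hF; have [sF nF kF] := hF.
apply: wdN'; apply: (wdL (C := (1 + M) * e + e * (1 + M))); last by apply: eqW; ring.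
apply: wd1; first by rewrite addr_ge0 ?mulr_ge0 ?addr_ge0.
by apply: KcD; [exact: Kc_mull|exact: Kc_mulr].
Qed.

Lemma aff_line M F G r : 0 <= M -> aff M F -> aff M G -> 0 <= r <= 1 -> aff M (F + r *: (G - F)).
move=> M0 [sF nF kF] [sG nG kG] /andP[r0 r1]; split.
- by apply: saD => //; apply: saZ; exact: saB.
- by apply: inND => //; apply: inNZ; exact: inNB.
have -> : F + r *: (G - F) - F0 = (1 - r) *: (F - F0) + r *: (G - F0).
 rewrite scalerBl scale1r !scalerBr; move: (r *: F) (r *: G) (r *: F0) => x y z; opring.
have -> : M = `|1 - r| * M + `|r| * M by rewrite !ger0_norm ?subr_ge0//; ring.
by apply: KcD; exact: KcZ.
Qed.

Lemma affB M F G : aff M F -> aff M G -> Kc (M + M) (G - F).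
move=> [sF nF kF] [sG nG kG]; have -> : G - F = (G - F0) - (F - F0) by opring.
exact: KcB.
Qed.

(** * The form [tau (X (1 - F^2)^n)] and its integral along segments *)

Section Psi.
Variable n : nat.
Hypothesis n_ge : ((m0 + m0) + (m0 + m0) <= n)%N.

Let n_ge2 : (m0 + m0 <= n)%N.
by apply: leq_trans n_ge; exact: leq_addr. Qed.

Definition kk F := uo F ^+ n.
(** The derivative of [kk] at [F] along [Y], as [uo (F + Y) = uo F - (F Y + Y F) - Y^2]. *)
Definition Dk F Y := Lp (uo F) (- (F * Y + Y * F)) n.

Lemma wdn_tr C T X : wd n C T -> inN A X -> L1 A T /\ `|rtr A (X * T)| <= Kth * opn X * C.
by move=> /wd_drop /(_ _ n_ge2); exact: wd_tr. Qed.
Lemma kk_wd M F : 0 <= M -> aff M F -> wd n (cu M ^+ n) (kk F).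
by move=> M0 /(uo_wd M0) /(wdX n); rewrite muln1. Qed.

(** [pert_exp] with increment [- (F Y + Y F) - Y^2]; in the last clause the contribution of [- Y^2]
    to the linear part is moved into the remainder. *)
Lemma k_exp M : 0 <= M -> exists2 K, 0 <= K & forall F Y e, aff M F -> Kc e Y -> 0 <= e <= M ->
 [/\ wd n (K * e) (kk (F + Y) - kk F), wd n (K * e) (Dk F Y) &
   wd n (K * e ^+ 2) (kk (F + Y) - kk F - Dk F Y)].
move=> M0; have [be beE] : {be : R | be = 2 * (1 + M) + M} by eexists.
have be0 : 0 <= be by rewrite beE; lra.
have e00 : 0 <= be * M + M * M by rewrite addr_ge0 ?mulr_ge0.
have [K K0 hK] := pert_exp n (cu_ge0 M0) e00.
exists (K * (be + be ^+ 2 + 1)); first by have := sqr_ge0 be => ?; apply: mulr_ge0 => //; lra.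
move=> F Y e hF kY /andP[e0 eM]; have wu := uo_wd M0 hF.
have w1 := sym_wd M0 hF e0 kY.
have w2 : wd 1 (e * e) (- (Y * Y)).
 apply: wdN'; apply: wd1; first exact: mulr_ge0.
 by apply: Kc_mull => //; [case: kY|exact: Kc_opn].
have ee : e * e <= M * e by rewrite ler_wpM2r.
have MM : 0 <= M * M by rewrite mulr_ge0.
have wb : wd 1 (be * e) (- (F * Y + Y * F) + - (Y * Y)).
 by apply: (wdL (wdD w1 w2)); rewrite beE; lra.
have bM : be * e <= be * M by rewrite ler_wpM2l.
have [|a1 a2 a3] := hK (uo F) _ (be * e) _ wu wb; first by rewrite mulr_ge0//=; lra.
have h5 : e * e <= be * M + M * M.
 by have := mulr_ge0 be0 M0; have : M * e <= M * M by [rewrite ler_wpM2l]; move=> *; lra.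
have [|b1 b2 b3] := hK (uo F) _ (e * e) _ wu w2; first by rewrite mulr_ge0.
have [|c1 c2 c3] := hK (uo F) _ (2 * (1 + M) * e) _ wu w1.
 have h : 2 * (1 + M) * e <= be * e by rewrite ler_wpM2r// beE; lra.
 by rewrite !mulr_ge0//= ?addr_ge0//; lra.
have eu : uo (F + Y) = uo F + (- (F * Y + Y * F) + - (Y * Y)) by rewrite /uo; opring.
have q1 : 0 <= K * e by rewrite mulr_ge0.
have q2 : 0 <= K * (be ^+ 2) * e by rewrite !mulr_ge0// sqr_ge0.
have q3 : 0 <= K * e ^+ 2 by rewrite mulr_ge0// sqr_ge0.
have q4 : 0 <= K * be * e ^+ 2 by rewrite !mulr_ge0// sqr_ge0.
have q5 : 0 <= K * be * e by rewrite !mulr_ge0.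
split.
- by rewrite /kk eu; apply: (wdL a1); lra.
- apply: (wdL c2); have : K * (2 * (1 + M) * e) <= K * be * e.
  by rewrite -[K * be * e]mulrA ler_wpM2l// ler_wpM2r// beE; lra.
 lra.
- rewrite /kk eu; have -> : (uo F + (- (F * Y + Y * F) + - (Y * Y))) ^+ n - uo F ^+ n - Dk F Y =
  ((uo F + (- (F * Y + Y * F) + - (Y * Y))) ^+ n - uo F ^+ n
    - Lp (uo F) (- (F * Y + Y * F) + - (Y * Y)) n) + Lp (uo F) (- (Y * Y)) n.
  have gen (x y z : op E) : x - y = x - (y + z) + z by rewrite opprD addrA subrK.
  by rewrite LpD; exact: gen.
 apply: (wdL (wdD a3 b2)).
 have -> : K * (be * e) ^+ 2 + K * (e * e) = K * be ^+ 2 * e ^+ 2 + K * e ^+ 2 by ring.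
 lra.
Qed.

(** Write [u = 1 - F^2], which commutes with [F]. Cyclicity turns [Z u^j F Y u^i] into
    [Y u^i Z F u^j]: [Y] and [Z] change places along with [i] and [j], and the sum is symmetric.
    This symmetry is the closedness of the form. *)
Lemma Dk_sym M F Y Z e e' : 0 <= M -> aff M F -> 0 <= e -> 0 <= e' -> Kc e Y -> Kc e' Z ->
 rtr A (Z * Dk F Y) = rtr A (Y * Dk F Z).
move=> M0 hF e0 e0' kY kZ; have [bF oF] := aff_Bc M0 hF; have [sF nF kF] := hF.
have wu := uo_wd M0 hF; have wY := wd1 e0 kY; have wZ := wd1 e0' kZ.
have wF : wd 0 (1 + M) F by exact: wd0.
have wX j : wd j (cu M ^+ j) (uo F ^+ j) by have := wdX j wu; rewrite muln1.
have uF j : uo F ^+ j * F = F * uo F ^+ j.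
 have c1 : uo F * F = F * uo F by rewrite /uo mulrBl mulrBr mul1r mulr1 mulrA.
 elim: j => [|j IH]; first by rewrite expr0 mul1r mulr1.
 by rewrite exprSr -mulrA c1 mulrA IH mulrA.
pose T1 (V W : op E) j i := V * (uo F ^+ j * (F * W) * uo F ^+ i).
pose T2 (V W : op E) j i := V * (uo F ^+ j * (W * F) * uo F ^+ i).
have DkE V W : V * Dk F W = - \sum_(i < n) (T1 V W (n.-1 - i)%N i + T2 V W (n.-1 - i)%N i).
 rewrite /Dk LpE mulr_sumr -sumrN; apply: eq_bigr => i _.
 by rewrite /T1 /T2 -mulrDr -mulrDl -mulrDr !mulrN mulNr mulrN.
have wT1 V W c c' j i : wd 1 c V -> wd 1 c' W -> exists C, wd (1 + (j + (0 + 1) + i)) C (T1 V W j i).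
 by move=> hV hW; eexists; exact: (wdM hV (wdM (wdM (wX j) (wdM wF hW)) (wX i))).
have wT2 V W c c' j i : wd 1 c V -> wd 1 c' W -> exists C, wd (1 + (j + (1 + 0) + i)) C (T2 V W j i).
 by move=> hV hW; eexists; exact: (wdM hV (wdM (wdM (wX j) (wdM hW wF)) (wX i))).
have size_ok (i : 'I_n) : ((n.-1 - i) + i = n.-1)%N.
 by rewrite subnK// -ltnS (leq_trans (ltn_ord i))// leqSpred.
have n0 : (0 < n)%N by apply: leq_trans n_ge; rewrite addn_gt0 addn_gt0 m0_gt0.
have L1T V W c c' (i : 'I_n) : wd 1 c V -> wd 1 c' W ->
  L1 A (T1 V W (n.-1 - i)%N i) /\ L1 A (T2 V W (n.-1 - i)%N i).
 move=> hV hW; have [C1 h1] := wT1 _ _ _ _ (n.-1 - i)%N i hV hW.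
 have [C2 h2] := wT2 _ _ _ _ (n.-1 - i)%N i hV hW; split.
  apply: (wd_tr (wd_drop h1 _) (inN1 A)).1; rewrite add0n addnAC size_ok !addn1 add1n prednK//.
  exact: leqW.
 apply: (wd_tr (wd_drop h2 _) (inN1 A)).1; rewrite addn0 addnAC size_ok !addn1 add1n prednK//.
 exact: leqW.
have rsum V W c c' : wd 1 c V -> wd 1 c' W -> rtr A (V * Dk F W) =
  - \sum_(i < n) (rtr A (T1 V W (n.-1 - i)%N i) + rtr A (T2 V W (n.-1 - i)%N i)).
 move=> hV hW; rewrite DkE.
 have aux (r : seq 'I_n) : L1 A (\sum_(i <- r) (T1 V W (n.-1 - i)%N i + T2 V W (n.-1 - i)%N i)) /\
   rtr A (\sum_(i <- r) (T1 V W (n.-1 - i)%N i + T2 V W (n.-1 - i)%N i)) =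
   \sum_(i <- r) (rtr A (T1 V W (n.-1 - i)%N i) + rtr A (T2 V W (n.-1 - i)%N i)).
  elim: r => [|i r [IH1 IH2]].
   by rewrite !big_nil (rtr_fp (fp0 A)) tr0; split=> //; exact: L1_0.
  have [l1 l2] := L1T _ _ _ _ i hV hW; rewrite !big_cons rtrD// ?IH2 ?(rtrD l1 l2)//.
   by split=> //; apply: L1D => //; exact: L1D.
  exact: L1D.
 by have [h1 h2] := aux (index_enum 'I_n); rewrite rtrN// h2.
have swap1 V W c c' (i : 'I_n) j : (j + i = n.-1)%N -> wd 1 c V -> wd 1 c' W ->
  rtr A (T1 V W j i) = rtr A (T2 W V i j).
 move=> ji hV hW; have -> : T1 V W j i = (V * uo F ^+ j * F) * (W * uo F ^+ i) by rewrite /T1 !mulrA.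
 rewrite (@rtr_swap (1 + j + 0) (1 + i) _ _ _ _ (wdM (wdM hV (wX j)) wF) (wdM hW (wX i))).
  by congr rtr; rewrite /T2 -!mulrA; congr (_ * (_ * (_ * _))); rewrite uF.
 by rewrite addn0 addnACA ji (leq_trans n_ge)// (_ : (1 + 1 + n.-1)%N = n.-1.+2)// prednK// leqW.
have swap2 V W c c' (i : 'I_n) j : (j + i = n.-1)%N -> wd 1 c V -> wd 1 c' W ->
  rtr A (T2 V W j i) = rtr A (T1 W V i j).
 move=> ji hV hW; have -> : T2 V W j i = (V * uo F ^+ j) * (W * F * uo F ^+ i) by rewrite /T2 !mulrA.
 rewrite (@rtr_swap (1 + j) (1 + 0 + i) _ _ _ _ (wdM hV (wX j)) (wdM (wdM hW wF) (wX i))).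
  by congr rtr; rewrite /T1 -!mulrA; congr (_ * _); rewrite !mulrA uF.
 by rewrite addn0 addnACA ji (leq_trans n_ge)// (_ : (1 + 1 + n.-1)%N = n.-1.+2)// prednK// leqW.
apply: (etrans (rsum _ _ _ _ wZ wY)); apply: etrans (esym (rsum _ _ _ _ wY wZ)); congr (- _).
rewrite [RHS](reindex_inj rev_ord_inj) /=; apply: eq_bigr => i _.
have e1 : (n.-1 - (n - i.+1) = i)%N.
 by rewrite -subn1 -subnDA add1n subnSK ?subKn// ltnW.
have e2 : (n - i.+1 = n.-1 - i)%N by rewrite -subn1 -subnDA add1n.
rewrite e1 e2 addrC; congr (_ + _).
 exact: swap2 (size_ok i) wZ wY.
exact: swap1 (size_ok i) wZ wY.
Qed.

Lemma g_exp M : 0 <= M -> exists2 K, 0 <= K & forall F G X r s, aff M F -> aff M G -> inN A X ->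
 0 <= r <= 1 -> 0 <= s <= 1 ->
 `|rtr A (X * kk (F + s *: (G - F))) - rtr A (X * kk (F + r *: (G - F))) -
  (s - r) * rtr A (X * Dk (F + r *: (G - F)) (G - F))| <= opn X * K * (s - r) ^+ 2.
move=> M0; have M20 : 0 <= M + M by rewrite addr_ge0.
have MM : M <= M + M by rewrite lerDl.
have [K K0 hK] := k_exp M20; exists (Kth * (K * (M + M) ^+ 2)).
 by apply: mulr_ge0; [exact: Kth_ge0|apply: mulr_ge0 => //; exact: sqr_ge0].
move=> F G X r s hF hG hX hr hs.
have hFr := aff_line M0 hF hG hr; have hFs := aff_line M0 hF hG hs.
have kY := affB hF hG; move: (G - F) hFr hFs kY => Y hFr hFs kY.
have e : F + s *: Y = F + r *: Y + (s - r) *: Y by rewrite -addrA -scalerDl (_ : r + (s - r) = s)//; ring.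
have kY' : Kc (`|s - r| * (M + M)) ((s - r) *: Y) by exact: KcZ.
have sr1 : `|s - r| <= 1.
 by case/andP: hr hs => ? ? /andP[? ?]; rewrite ler_norml; apply/andP; split; lra.
have [|w1 w2 w3] := hK _ _ _ (aff_le MM hFr) kY'.
 by rewrite mulr_ge0//= ler_piMl.
rewrite -e in w1 w2 w3.
have [l1 _] := wdn_tr w1 hX; have [l2 _] := wdn_tr w2 hX; have [l3 h3] := wdn_tr w3 hX.
have lk := (wdn_tr (kk_wd M0 hFr) hX).1.
have lk' := (wdn_tr (kk_wd M0 hFs) hX).1.
have eD : Dk (F + r *: Y) ((s - r) *: Y) = (s - r) *: Dk (F + r *: Y) Y.
 by rewrite /Dk -opZAr -opZAl -scalerDr -scalerN LpZ.
have l4 : L1 A (Dk (F + r *: Y) Y).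
 have [|_ w4 _] := hK _ _ _ (aff_le MM hFr) kY; first by rewrite M20 lexx.
 exact: (wdn_tr w4 hX).1.
have X1 T : L1 A T -> L1 A (X * T) by exact: L1Ml.
have eq : rtr A (X * (kk (F + s *: Y) - kk (F + r *: Y) - Dk (F + r *: Y) ((s - r) *: Y))) =
  rtr A (X * kk (F + s *: Y)) - rtr A (X * kk (F + r *: Y)) - (s - r) * rtr A (X * Dk (F + r *: Y) Y).
 rewrite eD !mulrBr rtrB; last 2 first.
 - by apply: L1B; exact: X1.
 - by rewrite -opZAr; apply: L1Z; exact: X1.
 rewrite rtrB; [|exact: X1|exact: X1].
 by rewrite -opZAr rtrZ; last exact: X1.
rewrite -eq (le_trans h3)// exprMn real_normK ?num_real//.
apply: eqW; ring.
Qed.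
Lemma opaque (T : Type) (x : T) : {y | y = x}. by exists x. Qed.

Definition Psi (F G : op E) : R := \int[leb]_(r in `[0, 1]) rtr A ((G - F) * kk (F + r *: (G - F))).

Lemma int01_abs (f : R -> R) C : {within `[0, 1], continuous f} ->
 (forall r, 0 <= r <= 1 -> `|f r| <= C) -> `|\int[leb]_(r in `[0, 1]) f r| <= C.
move=> cf hC; have i1 := continuous_compact_integrable (@segment_compact _ 0 1) cf.
have m01 := @mitv R `[0, 1].
apply: (le_trans (le_normr_Rintegral m01 i1)).
have -> : C = \int[leb]_(r in `[0, 1]) C.
 have e : fine (@leb R `[0, 1]%classic) = 1.
  by rewrite lebesgue_measure_itv /= lte01 oppr0 adde0.
 by rewrite Rintegral_cst// [X in C * X]e mulr1.
have cC : {within `[0 : R, 1]%classic, continuous (cst C : R -> R)}.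
 by apply: continuous_subspaceT => x; exact: cvg_cst.
apply: le_Rintegral => //.
- have := integrable_norm i1; exact.
- exact: (continuous_compact_integrable (@segment_compact _ 0 1) cC).
Qed.

Lemma g_cont M F G X : 0 <= M -> aff M F -> aff M G -> inN A X ->
 [/\ {within `[0, 1], continuous (fun r : R => rtr A (X * kk (F + r *: (G - F))))},
   {within `[0, 1], continuous (fun r : R => rtr A (X * Dk (F + r *: (G - F)) (G - F)))} &
   \int[leb]_(r in `[0, 1]) rtr A (X * Dk (F + r *: (G - F)) (G - F)) =
   rtr A (X * kk G) - rtr A (X * kk F)].
move=> M0 hF hG hX; have [K K0 hK] := g_exp M0.
have [h1 h2 h3] := @ftc_quad (fun r : R => rtr A (X * kk (F + r *: (G - F))))
 (fun r : R => rtr A (X * Dk (F + r *: (G - F)) (G - F))) 0 1 _ ltr01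
 (fun r s hr hs => hK F G X r s hF hG hX hr hs).
have eG : F + (G - F) = G by rewrite addrC subrK.
rewrite (scale1r (G - F)) in h3.
rewrite (scale0r (G - F)) addr0 eG in h3.
split.
- exact: h1.
- exact: h2.
- exact: h3.
Qed.

(** The product rule for [r * g r] at the level of quadratic remainders, as [ftc_quad] expects
    it. *)
Lemma mul_id_quad (gs gr dr r s a b : R) : `|s| <= 1 -> `|dr| <= b ->
 `|gs - gr - (s - r) * dr| <= a * (s - r) ^+ 2 ->
 `|s * gs - r * gr - (s - r) * (gr + r * dr)| <= (a + b) * (s - r) ^+ 2.
move=> s1 hd h.
have -> : s * gs - r * gr - (s - r) * (gr + r * dr) = s * (gs - gr - (s - r) * dr) + (s - r) ^+ 2 * dr by ring.
rewrite (le_trans (ler_normD _ _))// [leRHS]mulrDl; apply: lerD.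
 by apply: le_trans h; rewrite normrM ler_piMl.
by rewrite normrM mulrC [`|_ ^+ 2|]ger0_norm ?sqr_ge0// ler_wpM2r ?sqr_ge0.
Qed.

Lemma mul4_le (k o m c u v : R) : 0 <= k -> 0 <= o -> 0 <= c -> 0 <= u -> o <= m -> u <= v ->
 k * o * (c * u) <= k * m * c * v.
move=> k0 o0 c0 u0 om uv; rewrite -(mulrA _ c v); apply: ler_pM; rewrite ?mulr_ge0//.
 exact: ler_wpM2l.
exact: ler_wpM2l.
Qed.

(* The integrand is, up to a second-order term, the derivative of [r * rtr (Z k(F_r))],
  by the symmetry of [rtr (Z Dk F Y)] in Y and Z. *)
Lemma Psi_exp M : 0 <= M -> exists2 K, 0 <= K & forall F G Z e,
 aff M F -> aff M G -> aff M (G + Z) -> Kc e Z -> 0 <= e <= M ->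
 `|Psi F (G + Z) - Psi F G - rtr A (Z * kk G)| <= K * e ^+ 2.
move=> M0; have [K K0 hK] := k_exp M0.
exists (Kth * (M + M) * K + Kth * K).
 have k0 := Kth_ge0; apply: addr_ge0; last exact: mulr_ge0.
 by apply: mulr_ge0 => //; apply: mulr_ge0 => //; exact: addr_ge0.
move=> F G Z e hF hG hGZ kZ he; have /andP[e0 eM] := he.
have [Y YE] : {Y : op E | Y = G - F} by eexists.
have nF : inN A F by case: hF. have nG : inN A G by case: hG.
have nY : inN A Y by rewrite YE; exact: inNB.
have nZ : inN A Z by case: kZ.
have eY : G + Z - F = Y + Z by rewrite YE addrAC.
have eG : F + Y = G by rewrite YE addrC subrK.
have [ch1 _ _] := g_cont M0 hF hGZ (inND nY nZ); rewrite eY in ch1.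
have [ch2 _ _] := g_cont M0 hF hG nY; rewrite -YE in ch2.
have [K1 K10 hK1] := g_exp M0.
have kY := affB hF hG; rewrite -YE in kY.
have hline r : 0 <= r <= 1 -> aff M (F + r *: Y) by move=> hr; rewrite YE; exact: aff_line.
have M20 : 0 <= M + M by rewrite addr_ge0.
have oY : opn Y <= M + M by exact: Kc_opn.
have oZ : opn Z <= e by exact: Kc_opn.
have [g gE] : {g : R -> R | forall r, g r = rtr A (Z * kk (F + r *: Y))} by eexists.
have [g' g'E] : {g : R -> R | forall r, g r = rtr A (Z * Dk (F + r *: Y) Y)} by eexists.
have [K2 K20 hK2] := k_exp M20.
have MM : M <= M + M by rewrite lerDl.
have bg' r : 0 <= r <= 1 -> `|g' r| <= Kth * opn Z * (K2 * (M + M)).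
 move=> hr; have [|_ w _] := hK2 _ _ _ (aff_le MM (hline r hr)) kY; first by rewrite M20 lexx.
 by rewrite g'E; exact: (wdn_tr w nZ).2.
have [C CE] : {C : R | C = opn Z * K1 + Kth * opn Z * (K2 * (M + M))} by eexists.
have hq (r s : R) : 0 <= r <= 1 -> 0 <= s <= 1 ->
  `|s * g s - r * g r - (s - r) * (g r + r * g' r)| <= C * (s - r) ^+ 2.
 move=> hr hs; rewrite CE; apply: mul_id_quad; last by rewrite !gE g'E YE; exact: hK1.
  by case/andP: hs => ? ?; rewrite ger0_norm.
 exact: bg'.
have [cH cd iH] := @ftc_quad (fun r : R => r * g r) (fun r : R => g r + r * g' r) 0 1 C ltr01 hq.
rewrite mul1r mul0r subr0 gE scale1r eG in iH.
have m01 := @mitv R `[0, 1].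
have itg (f : R -> R) : {within `[0, 1], continuous f} ->
  leb.-integrable `[0, 1] (EFin \o f).
 by move=> cf; exact: (continuous_compact_integrable (@segment_compact _ 0 1) cf).
have [h1 h1E] := opaque (fun r : R => rtr A ((Y + Z) * kk (F + r *: (Y + Z)))).
have [h2 h2E] := opaque (fun r : R => rtr A (Y * kk (F + r *: Y))).
rewrite -h1E in ch1; rewrite -h2E in ch2.
have -> : Psi F (G + Z) - Psi F G - rtr A (Z * kk G) =
  \int[leb]_(r in `[0, 1]) (h1 r - h2 r - (g r + r * g' r)).
 have c12 : {within `[0, 1], continuous (fun r : R => h1 r - h2 r)}.
  by move=> x; apply: (@continuousB _ _ _ _ _ x); [exact: ch1|exact: ch2].
 rewrite RintegralB//; [|exact: itg c12|exact: itg cd].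
 rewrite RintegralB//; [|exact: itg ch1|exact: itg ch2].
 by rewrite /Psi eY -YE iH h1E h2E.
apply: int01_abs.
 move=> x; apply: (@continuousB _ _ _ _ _ x); last exact: cd.
 by apply: (@continuousB _ _ _ _ _ x); [exact: ch1|exact: ch2].
move=> r hr; have hFr := hline r hr; have /andP[r0 r1] := hr.
have kr : Kc (r * e) (r *: Z) by have := KcZ r kZ; rewrite (ger0_norm r0).
have re : r * e <= e by rewrite ler_piMl.
have [|w1 w2 w3] := hK _ _ _ hFr kr.
 by rewrite mulr_ge0//= (le_trans re).
have eF : F + r *: (Y + Z) = F + r *: Y + r *: Z by rewrite scalerDr addrA.
have lk : L1 A (kk (F + r *: Y)) by exact: (wdn_tr (kk_wd M0 hFr) nZ).1.
have [lD1 b1] := wdn_tr w1 nZ; have [lD2 _] := wdn_tr w2 nZ; have [lD3 b3] := wdn_tr w3 nY.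
have lk' : L1 A (kk (F + r *: Y + r *: Z)).
 by rewrite -[X in L1 _ X](subrK (kk (F + r *: Y))); exact: L1D.
have eD : r * g' r = rtr A (Y * Dk (F + r *: Y) (r *: Z)).
 rewrite (Dk_sym M0 hFr (mulr_ge0 r0 e0) M20 kr kY) g'E -opZAl rtrZ//; apply: L1Ml => //.
 have [|_ w _] := hK2 _ _ _ (aff_le MM hFr) kY; first by rewrite M20 lexx.
 exact: (wdn_tr w nZ).1.
have -> : h1 r - h2 r - (g r + r * g' r) =
  rtr A (Y * (kk (F + r *: Y + r *: Z) - kk (F + r *: Y) - Dk (F + r *: Y) (r *: Z))) +
  rtr A (Z * (kk (F + r *: Y + r *: Z) - kk (F + r *: Y))).
 have Ml X T : inN A X -> L1 A T -> L1 A (X * T) by exact: L1Ml.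
 rewrite eD h1E h2E gE eF mulrDl !mulrBr; rewrite rtrD; [|exact: Ml|exact: Ml].
 rewrite rtrB; [|by apply: L1B; apply: Ml|exact: Ml].
 rewrite rtrB; [|exact: Ml|exact: Ml].
 rewrite rtrB; [|exact: Ml|exact: Ml].
 have gen (a b c d f : R) : a + b - c - (d + f) = a - c - f + (b - d) by ring.
 exact: gen.
rewrite (le_trans (ler_normD _ _))// mulrDl; apply: lerD.
 by apply: (le_trans b3); apply: mul4_le; rewrite ?Kth_ge0 ?opn_ge0 ?sqr_ge0// ler_pXn2r ?nnegrE ?mulr_ge0.
apply: (le_trans b1); have -> : Kth * K * e ^+ 2 = Kth * e * K * e by rewrite expr2 !mulrA [Kth * K * e]mulrAC.
by apply: mul4_le; rewrite ?Kth_ge0 ?opn_ge0 ?mulr_ge0.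
Qed.

(** By [Psi_exp] the function [t |-> Psi F1 (F2 + t Z)], with [Z = F3 - F2], has derivative
    [rtr (Z kk (F2 + t Z))], whose integral over [[0, 1]] is [Psi F2 F3]. *)
Lemma Psi_cocycle M F1 F2 F3 : 0 <= M -> aff M F1 -> aff M F2 -> aff M F3 ->
 Psi F1 F2 + Psi F2 F3 = Psi F1 F3.
move=> M0 h1 h2 h3; have M20 : 0 <= M + M by rewrite addr_ge0.
have MM : M <= M + M by rewrite lerDl.
have [K K0 hK] := Psi_exp M20; have [Z ZE] : {Z : op E | Z = F3 - F2} by eexists.
have hq (r s : R) : 0 <= r <= 1 -> 0 <= s <= 1 ->
  `|Psi F1 (F2 + s *: Z) - Psi F1 (F2 + r *: Z) - (s - r) * rtr A (Z * kk (F2 + r *: Z))| <=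
  K * (M + M) ^+ 2 * (s - r) ^+ 2.
 move=> hr hs; have hr' := aff_line M0 h2 h3 hr; have hs' := aff_line M0 h2 h3 hs.
 rewrite -ZE in hr' hs'.
 have e : F2 + s *: Z = F2 + r *: Z + (s - r) *: Z.
  by rewrite -addrA -scalerDl (_ : r + (s - r) = s)//; ring.
 have kZ : Kc (`|s - r| * (M + M)) ((s - r) *: Z) by apply: KcZ; rewrite ZE; exact: affB.
 have sr1 : `|s - r| <= 1.
  by case/andP: hr hs => ? ? /andP[? ?]; rewrite ler_norml; apply/andP; split; lra.
 have := hK F1 (F2 + r *: Z) ((s - r) *: Z) _ (aff_le MM h1) (aff_le MM hr') _ kZ.
 rewrite -e => /(_ (aff_le MM hs')) hh.
 have {}hh := hh _; rewrite mulr_ge0//= ler_piMl// in hh; have {}hh := hh isT.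
 have lk : L1 A (kk (F2 + r *: Z)) by exact: (wdn_tr (kk_wd M0 hr') (inN1 A)).1.
 have nZ : inN A Z by rewrite ZE; apply: inNB; [case: h3|case: h2].
 rewrite -opZAl rtrZ in hh; last exact: L1Ml.
 by rewrite (le_trans hh)// exprMn real_normK ?num_real// mulrA mulrAC.
have [_ _ h] := @ftc_quad (fun t : R => Psi F1 (F2 + t *: Z)) (fun t : R => rtr A (Z * kk (F2 + t *: Z)))
 0 1 (K * (M + M) ^+ 2) ltr01 hq.
have e3 : F2 + 1 *: Z = F3 by rewrite scale1r ZE addrC subrK.
by rewrite e3 scale0r addr0 in h; rewrite [Psi F2 F3]/Psi -ZE h addrC subrK.
Qed.

(** * Differences of two projections and their index *)

Section ProjectionPair.
Variables (P P' B : op E) (M : R).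
Hypotheses (M0 : 0 <= M) (pP : proj P) (pP' : proj P') (nP : inN A P) (nP' : inN A P').
Hypothesis BE : B = P' - P.
Hypothesis kB : Kc M B.

Let sB : sa B. by rewrite BE; apply: saB; [case: pP'|case: pP]. Qed.
Let nB : inN A B. by case: kB. Qed.

Let pB1 : psd (1 + B).
have -> : 1 + B = P' + (1 - P) by rewrite BE addrCA.
by apply: psdD; [exact: proj_psd|exact/proj_psd/projC].
Qed.
Let pB2 : psd (1 - B).
have -> : 1 - B = P + (1 - P') by rewrite BE opprB addrCA.
by apply: psdD; [exact: proj_psd|exact/proj_psd/projC].
Qed.

Let sq_psd j : psd (B ^+ j.*2).
rewrite -addnn exprD; have := psdX j.*2 psd1 => _.
by have := psd_sq (B ^+ j); rewrite adjX sB.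
Qed.

Let commB S j : S * B = B * S -> S * B ^+ j = B ^+ j * S.
move=> h; elim: j => [|j IH]; first by rewrite expr0 mulr1 mul1r.
by rewrite exprS mulrA h -mulrA IH mulrA.
Qed.

Let com1 : (1 + B) * B = B * (1 + B). by rewrite mulrDl mulrDr mul1r mulr1. Qed.
Let com2 : (1 - B) * B = B * (1 - B). by rewrite mulrBl mulrBr mul1r mulr1. Qed.
Let com12 : (1 - B) * (1 + B) = (1 + B) * (1 - B).
by rewrite mulrBl mulrDl !mulrBr !mulrDr !mul1r !mulr1; opring. Qed.
Let cmul (a b c : op E) : a * c = c * a -> b * c = c * b -> a * b * c = c * (a * b).
by move=> ha hb; rewrite -mulrA hb mulrA ha -mulrA. Qed.

Let dec S j : psd S -> S * B = B * S -> psd (B ^+ j.*2 * S - B ^+ j.+1.*2 * S).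
move=> pS cS; have -> : B ^+ j.*2 * S - B ^+ j.+1.*2 * S = B ^+ j.*2 * ((1 - B) * (1 + B) * S).
 rewrite -mulrBl mulrA; congr (_ * _).
 have -> : (1 - B) * (1 + B) = 1 - B * B by rewrite mulrBl !mulrDr !mul1r !mulr1 opprD addrA addrK.
 by rewrite mulrBr mulr1 doubleS !exprSr mulrA.
have c1 : (1 - B) * S = S * (1 - B) by rewrite mulrBl mulrBr mul1r mulr1 cS.
have c2 : (1 + B) * S = S * (1 + B) by rewrite mulrDl mulrDr mul1r mulr1 cS.
have c3 : (1 - B) * (1 + B) * S = S * ((1 - B) * (1 + B)) by rewrite -mulrA c2 mulrA c1 -mulrA.
apply: psdM => //; first by apply: psdM => //; exact: psdM.
apply/esym/commB; exact: cmul (cmul com2 com1) cS.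
Qed.

Let opB j : opn (B ^+ j.*2) <= 1.
apply: lop_opn => //; rewrite scale1r /lop; elim: j => [|j IH].
 by rewrite double0 expr0 subrr; exact: psd0.
have := psdD IH (dec j psd1 _); rewrite !mulr1 mul1r addrA subrK; exact.
Qed.

(** As [- 1 <= B <= 1], the even powers of [B] decrease; their limit is the projection onto the
    vectors fixed by [B^2]. *)
Let limS : {S : op E | [/\ sa S, scvg (fun j => B ^+ j.*2) S & S * B = B * S]}.
apply: cid; have [||j x|S [sS cS lS]] := @antitone_limit _ _ (fun j => B ^+ j.*2) 1.
- by move=> j; case: (sq_psd j).
- exact: opB.
- rewrite -subr_ge0 -qN -qD; have := dec j psd1; rewrite !mulr1 mul1r => /(_ erefl) [_]; exact.
exists S; split=> //; apply/esym/(scvg_comm _ cS) => j.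
exact: commB.
Qed.

Let S := sval limS.
Let sS : sa S. by rewrite /S; case: limS => ? []. Qed.
Let cS : scvg (fun j => B ^+ j.*2) S. by rewrite /S; case: limS => ? []. Qed.
Let SB : S * B = B * S. by rewrite /S; case: limS => ? []. Qed.

Let BBS : B * B * S = S.
have h1 := scvgMl (B * B) cS.
apply: (scvg_uniq h1) => x; apply/hcvgP => e e0; have /hcvgP /(_ e e0) [N hN] := cS x.
exists N => j Nj; have := hN j.+1 (leqW Nj); by rewrite doubleS !exprS mulrA.
Qed.

Let SS : S * S = S.
have h1 := scvgMr S cS; apply: (scvg_uniq h1).
rewrite (_ : (fun j => _) = fun=> S); first exact: scvg_cst.
apply/funext => j; elim: j => [|j IH]; first by rewrite double0 expr0 mul1r.
by rewrite doubleS !exprSr -!mulrA (mulrA B B) BBS.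
Qed.

(** The projections onto the eigenspaces of [B] for 1 and -1: on the range of [S], where [B^2 = 1],
    these are [(1 + B) / 2] and [(1 - B) / 2]. *)
Definition eig_p : op E := 2^-1 *: ((1 + B) * S).
Definition eig_n : op E := 2^-1 *: ((1 - B) * S).

Let eig_gen (C : op E) : sa C -> C * C = B * B -> C * B = B * C -> C * S = S * C ->
 let Ep := 2^-1 *: ((1 + C) * S) in
 [/\ proj Ep, C * Ep = Ep & forall x, C x = x -> Ep x = x].
move=> sC CC CB CS Ep; have c1S : (1 + C) * S = S * (1 + C) by rewrite mulrDl mulrDr mul1r mulr1 CS.
have CE : C * ((1 + C) * S) = (1 + C) * S.
 by rewrite mulrA mulrDr mulr1 CC mulrDl BBS mulrDl mul1r addrC.
split.
- split.
  by rewrite /sa /Ep adjZ adjM adjD adj1 sC sS c1S.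
 have ST : S * ((1 + C) * S) = (1 + C) * S by rewrite mulrA -c1S -mulrA SS.
 have TT : (1 + C) * S * ((1 + C) * S) = (1 + C) * S + (1 + C) * S.
  by rewrite -(mulrA (1 + C) S) ST (mulrDl 1 C) mul1r CE.
 by rewrite /Ep -opZAl -opZAr TT half_op.
- by rewrite /Ep -opZAr CE.
- move=> x Cx; have Sx : S x = x.
  apply: (hcvg_unique (cS x)); rewrite (_ : (fun j => _) = fun=> x); first exact: hcvg_cst.
  apply/funext => j; elim: j => [|j IH]; first by rewrite double0 expr0.
  rewrite doubleS !exprSr -mulrA opME -CC !opME Cx Cx; exact: IH.
 rewrite /Ep opZE opME Sx opDE op1E Cx.
 have := half_op (1 : op E) => /(congr1 (fun T : op E => T x)); by rewrite opZE opDE !op1E.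
Qed.

Lemma eig_pP : [/\ proj eig_p, B * eig_p = eig_p & forall x, B x = x -> eig_p x = x].
by apply: eig_gen => //; rewrite SB. Qed.

Lemma eig_nP : [/\ proj eig_n, B * eig_n = - eig_n & forall x, B x = - x -> eig_n x = x].
have [] := @eig_gen (- B); rewrite ?mulrNN ?mulNr ?mulrN ?SB//.
 exact: saN.
move=> h1 h2 h3; split=> //; first by rewrite -[LHS]opprK h2.
by move=> x Bx; apply: h3; rewrite opNE Bx opprK.
Qed.

Let wB : wd 1 M B. exact: wd1. Qed.

Let L1B' j : (m0 + m0 <= j)%N -> L1 A (B ^+ j).
move=> h; have := wdX j wB; rewrite muln1 => /wd_drop /(_ _ h) w.
exact: (wd_tr w (inN1 A)).1.
Qed.

Let tr_lim (C : op E) : psd C -> inN A C -> C * B = B * C -> C * S = S * C ->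
 fp A (C * S) /\ (fun j => rtr A (B ^+ (j + m0).*2 * C)) @ \oo --> tr A (C * S).
move=> pC nC CB CS.
have L1T j : L1 A (B ^+ (j + m0).*2 * C).
 by apply: L1Mr => //; apply: L1B'; rewrite -addnn leq_add// leq_addl.
have pT j : psd (B ^+ j.*2 * C) by apply: psdM => //; apply/esym/commB.
have fT j : fp A (B ^+ (j + m0).*2 * C) by exact: L1_psd.
have cT : scvg (fun j => B ^+ j.*2 * C) (C * S) by rewrite CS; exact: scvgMr.
have nS : inN A S by apply: (inN_wcvg _ (scvg_wcvg cS)) => j; exact: inNX.
have pCS : psd (C * S).
 split=> [|x]; first by apply: saM => //; case: pC.
 by apply: (cvg_ge_cst _ (wcvg_q (scvg_wcvg cT))) => j; case: (pT j).
have mono j k : (j <= k)%N -> lop (B ^+ k.*2 * C) (B ^+ j.*2 * C).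
 move=> /subnK <-; elim: (k - j)%N => [|i IH]; first by rewrite /lop subrr; exact: psd0.
 by apply: lop_trans IH; rewrite addSn; exact: dec.
have le j : lop (C * S) (B ^+ j.*2 * C).
 apply: lopP; [by case: pCS|by case: (pT j)|move=> x].
 apply: (ler_cvg_to (wcvg_q (scvg_wcvg cT)) (cvg_cst (q (B ^+ j.*2 * C) x))).
 by exists j => // k /= jk; exact: lop_q (mono _ _ jk).
have fCS : fp A (C * S) by apply: (fp_le _ (le (0 + m0)%N) (fT 0%N)); split=> //; exact: inNM.
split=> //.
(* Normality concerns increasing sequences, so it is applied to the first term minus the others. The
   shift by [m0] makes every term trace class. *)
have := @tau_normal _ _ A (fun j => B ^+ (0 + m0).*2 * C - B ^+ (j + m0).*2 * C)
  (B ^+ (0 + m0).*2 * C - C * S).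
have pD j : pos A (B ^+ (0 + m0).*2 * C - B ^+ (j + m0).*2 * C).
 split; first by apply: inNB; exact: fpN.
 by have := mono (0 + m0)%N (j + m0)%N; rewrite leq_add2r => /(_ (leq0n _)).
have fD j : fp A (B ^+ (0 + m0).*2 * C - B ^+ (j + m0).*2 * C).
 by apply: (fp_le (pD j) _ (fT 0%N)); rewrite /lop opprB addrC subrK; case: (fT j) => -[].
have pD' : pos A (B ^+ (0 + m0).*2 * C - C * S).
 by split; [apply: inNB; exact: fpN|exact: le].
have fD' : fp A (B ^+ (0 + m0).*2 * C - C * S).
 by apply: (fp_le pD' _ (fT 0%N)); rewrite /lop opprB addrC subrK; case: fCS => -[].
move=> /(_ pD _ pD') h.
have {}h : (fun j => tau A (B ^+ (0 + m0).*2 * C - B ^+ (j + m0).*2 * C)) @ \oo -->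
  tau A (B ^+ (0 + m0).*2 * C - C * S).
 apply: h => [j|]; first by rewrite /lop opprB addrC addrA subrK; exact: dec.
 apply: scvg_wcvg; apply: scvgD; first exact: scvg_cst.
 apply: scvgN => x; apply/hcvgP => e e0; have /hcvgP /(_ e e0) [N hN] := cT x.
 by exists N => j Nj; apply: hN; rewrite (leq_trans Nj)// leq_addr.
have trD' (U V : op E) : fp A U -> fp A V -> fp A (U - V) -> tr A (U - V) = tr A U - tr A V.
 by move=> fU fV fUV; have := trD fUV fV; rewrite subrK => ->; rewrite addrK.
have h2 : (fun j => tr A (B ^+ (0 + m0).*2 * C) - tr A (B ^+ (j + m0).*2 * C)) @ \oo -->
  tr A (B ^+ (0 + m0).*2 * C) - tr A (C * S).
 rewrite -trD'//; under eq_fun do rewrite -trD'//.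
 by apply: (@fine_cvg _ _ _ _ (fun j => tau A (B ^+ (0 + m0).*2 * C - B ^+ (j + m0).*2 * C))); rewrite -trE.
have h3 : (fun j => tr A (B ^+ (0 + m0).*2 * C) -
  (tr A (B ^+ (0 + m0).*2 * C) - tr A (B ^+ (j + m0).*2 * C))) @ \oo -->
  tr A (B ^+ (0 + m0).*2 * C) - (tr A (B ^+ (0 + m0).*2 * C) - tr A (C * S)).
 by apply: cvgB h2; exact: cvg_cst.
rewrite opprB addrC subrK in h3.
rewrite (_ : (fun j => _) = (fun j => tr A (B ^+ (0 + m0).*2 * C) -
  (tr A (B ^+ (0 + m0).*2 * C) - tr A (B ^+ (j + m0).*2 * C)))); first exact: h3.
by apply/funext => j; rewrite rtr_fp// opprB addrC subrK.
Qed.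

(** [U = 1 - P - P'] anticommutes with [B], and [U^2 = 1 - B^2]. For odd [k] cyclicity gives
    [rtr (B^k U^2) = - rtr (B^k U^2)], so this number, [rtr (B^k) - rtr (B^(k + 2))], is zero. *)
Let odd_const j : (m0 + m0 <= j)%N -> rtr A (B ^+ j.*2.+1) = rtr A (B ^+ j.+1.*2.+1).
move=> h; have [U UE] : {U : op E | U = 1 - P - P'} by eexists.
have PP : P * P = P by case: pP. have PP' : P' * P' = P' by case: pP'.
have UU : U * U = 1 - B * B.
 have -> : U * U = 1 - P - P' - P - P' + (P * P + P * P' + P' * P + P' * P') by rewrite UE; opring.
 have -> : B * B = P' * P' - P' * P - P * P' + P * P by rewrite BE; opring.
 by rewrite PP PP'; move: (P * P') (P' * P) => x y; opring.
have UB : U * B = - (B * U).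
 have -> : U * B = P' - P - P * P' + P * P - P' * P' + P' * P by rewrite UE BE; opring.
 have -> : B * U = P' - P - P' * P - P' * P' + P * P + P * P' by rewrite UE BE; opring.
 by rewrite PP PP'; move: (P * P') (P' * P) => x y; opring.
have nU : inN A U by rewrite UE; apply: inNB => //; apply: inNB => //; exact: inN1.
have UBo : U * B ^+ j.*2.+1 = - (B ^+ j.*2.+1 * U).
 have ev i : U * B ^+ i.*2 = B ^+ i.*2 * U.
  elim: i => [|i IH]; first by rewrite double0 expr0 mulr1 mul1r.
  by rewrite doubleS !exprS (mulrA U) UB mulNr -(mulrA B U) (mulrA U) UB mulNr mulrN opprK -!mulrA IH.
 by rewrite exprSr mulrA ev -mulrA UB mulrN mulrA.
have hj : (m0 + m0 <= j.*2.+1)%N by rewrite (leq_trans h)// -addnn leqW// leq_addr.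
have hj' : (m0 + m0 <= j.+1.*2.+1)%N by rewrite doubleS (leq_trans hj)// leqW.
have l1 := L1B' hj; have l2 := L1B' hj'.
have lU : L1 A (B ^+ j.*2.+1 * U) by exact: L1Mr.
have e : rtr A (B ^+ j.*2.+1 * U * U) = - rtr A (B ^+ j.*2.+1 * U * U).
 rewrite -{1}(rtrC nU lU) mulrA UBo mulNr rtrN//; exact: L1Mr.
have e2 : B ^+ j.*2.+1 * U * U = B ^+ j.*2.+1 - B ^+ j.+1.*2.+1.
 by rewrite -mulrA UU mulrBr mulr1 doubleS !exprSr !mulrA.
rewrite e2 rtrB// in e; lra.
Qed.

(** [2 B^(2 j + 1)] is [B^(2 j) (1 + B) - B^(2 j) (1 - B)]. Its trace does not depend on [j] once
    [j >= n], and in the limit only the eigenvalues 1 and -1 contribute. *)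
Lemma rtr_odd_power : rtr A (B ^+ n.*2.+1) = tr A eig_p - tr A eig_n.
have c1 : (1 + B) * S = S * (1 + B) by rewrite mulrDl mulrDr mul1r mulr1 SB.
have c2 : (1 - B) * S = S * (1 - B) by rewrite mulrBl mulrBr mul1r mulr1 SB.
have [f1 h1] := tr_lim pB1 (inND (inN1 A) nB) com1 c1.
have [f2 h2] := tr_lim pB2 (inNB (inN1 A) nB) com2 c2.
have h4 : (fun j => rtr A (B ^+ (j + m0).*2 * (1 + B)) - rtr A (B ^+ (j + m0).*2 * (1 - B))) @ \oo -->
 tr A ((1 + B) * S) - tr A ((1 - B) * S) by apply: cvgB.
have h3 := cvg_scale 2^-1 h4.
rewrite mulrBr -!trZ// in h3; rewrite -/eig_p -/eig_n in h3.
apply: (@cvg_eq_lim _ _ _ _ _ h3); apply: (@cvg_eventually _ _ _ n) => j nj /=.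
have hm : (m0 + m0 <= (j + m0).*2)%N by rewrite -addnn leq_add// leq_addl.
have l1 := L1B' hm; have l2 := L1B' (leqW hm).
have -> : B ^+ (j + m0).*2 * (1 + B) = B ^+ (j + m0).*2 + B ^+ (j + m0).*2.+1 by rewrite mulrDr mulr1 exprSr.
have -> : B ^+ (j + m0).*2 * (1 - B) = B ^+ (j + m0).*2 - B ^+ (j + m0).*2.+1 by rewrite mulrBr mulr1 exprSr.
rewrite rtrD// rtrB//.
have cst k : rtr A (B ^+ (n + k).*2.+1) = rtr A (B ^+ n.*2.+1).
 elim: k => [|k IH]; first by rewrite addn0.
 rewrite addnS -odd_const// (leq_trans _ (leq_addr _ _))// (leq_trans _ n_ge)//; exact: leq_addr.
rewrite -(cst (j + m0 - n)%N) subnKC; last by rewrite (leq_trans nj)// leq_addr.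
by field.
Qed.

(** The factor 2 is the direction [Q' - Q = 2 B] of the segment between the symmetries, the 4 comes
    from [(Q' - Q)^2 = 4 B^2]. *)
Definition vfun (r : R) : R := 2 * (r * (1 - r) * 4) ^+ n.
Definition cn : R := \int[leb]_(r in `[0, 1]) vfun r.

Lemma vfun_cont : continuous vfun.
move=> r; apply: cvgM; first exact: cvg_cst.
apply: (@continuous_comp _ _ _ (fun r : R => r * (1 - r) * 4) (fun y => y ^+ n)); last exact: exprn_continuous.
apply: cvgM; last exact: cvg_cst.
by apply: cvgM; [exact: cvg_id|apply: cvgB; [exact: cvg_cst|exact: cvg_id]].
Qed.

Lemma op_exprZ (c : R) (T : op E) k : (c *: T) ^+ k = c ^+ k *: T ^+ k.
elim: k => [|k IH]; first by rewrite !expr0 scale1r.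
by rewrite !exprS IH -opZAl -opZAr scalerA.
Qed.

(* On the segment the curvature [1 - F^2] is [r (1 - r) (Q' - Q)^2]. *)
Lemma Psi_proj : Psi (2 *: P - 1) (2 *: P' - 1) = cn * (tr A eig_p - tr A eig_n).
rewrite -rtr_odd_power /Psi.
have eY : 2 *: P' - 1 - (2 *: P - 1) = 2 *: B by rewrite BE scalerBr opprB addrA subrK.
rewrite eY.
have PP : P * P = P by case: pP. have PP' : P' * P' = P' by case: pP'.
have two (T : op E) : 2 *: T = T + T by rewrite scaler_nat mulr2n.
have [Q QE] : {Q : op E | Q = P + P - 1} by eexists.
have [Y YE] : {Y : op E | Y = B + B} by eexists.
have QQ : Q * Q = 1.
 have -> : Q * Q = 1 + (P * P - P) + (P * P - P) + (P * P - P) + (P * P - P) by rewrite QE; opring.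
 by rewrite PP subrr !addr0.
have QY : Q * Y + Y * Q = - (Y * Y).
 apply/eqP; rewrite -subr_eq0 opprK; apply/eqP.
 have -> : Q * Y + Y * Q + Y * Y =
  (P' * P' - P') - (P * P - P) + ((P' * P' - P') - (P * P - P)) +
  (P' * P' - P') - (P * P - P) + ((P' * P' - P') - (P * P - P)) by rewrite QE YE BE; opring.
 by rewrite PP PP' !subrr !subr0 !addr0.
have eu (r : R) : kk (2 *: P - 1 + r *: (2 *: B)) = ((r * (1 - r) * 4) ^+ n) *: B ^+ n.*2.
 rewrite (two P) (two B) -QE -YE /kk.
 have -> : uo (Q + r *: Y) = (r * (1 - r) * 4) *: (B * B).
  have -> : uo (Q + r *: Y) = 1 - Q * Q - r *: (Q * Y + Y * Q) - (r * r) *: (Y * Y).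
   have e1 : Q * (r *: Y) = r *: (Q * Y) by rewrite -opZAr.
   have e2 : (r *: Y) * Q = r *: (Y * Q) by rewrite -opZAl.
   have e3 : (r *: Y) * (r *: Y) = (r * r) *: (Y * Y) by rewrite -opZAl -opZAr scalerA.
   have e4 : (Q + r *: Y) * (Q + r *: Y) = Q * Q + Q * (r *: Y) + ((r *: Y) * Q + (r *: Y) * (r *: Y)).
    by rewrite mulrDl !mulrDr.
   rewrite /uo e4 e1 e2 e3 scalerDr.
   move: (Q * Q) (r *: (Q * Y)) (r *: (Y * Q)) ((r * r) *: (Y * Y)) => a b c d; opring.
  rewrite QQ subrr sub0r QY scalerN opprK -scalerBl.
  have -> : Y * Y = 4 *: (B * B).
   by rewrite YE -two -opZAl -opZAr scalerA; congr (_ *: _); ring.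
  by rewrite scalerA; congr (_ *: _); ring.
 by rewrite op_exprZ -expr2 -exprM mul2n.
have lB : L1 A (B ^+ n.*2.+1).
 apply: L1B'; rewrite (leq_trans _ (leqnSn _))// (leq_trans n_ge2)// -addnn leq_addr//.
rewrite (_ : (fun r => _) = (fun r => vfun r * rtr A (B ^+ n.*2.+1))); last first.
 apply/funext => r; rewrite eu -opZAr -opZAl -exprS scalerA rtrZ// /vfun [2 * _]mulrC; congr (_ * _).
have m01 := @mitv R `[0, 1].
have iv : leb.-integrable `[0, 1]%classic (EFin \o vfun).
 apply: (continuous_compact_integrable (@segment_compact _ 0 1)).
 by apply: continuous_subspaceT; exact: vfun_cont.
exact: (RintegralZr _ m01 iv).
Qed.

End ProjectionPair.

Lemma projection_ontoE (V : set E) (Q : op E) : proj Q -> range Q = V -> projection_onto (hdot E) V = opf Q.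
move=> pQ rQ; apply: get_unique => [|f [pf rf]]; first by split=> //; exact/projectionP.
have bf : bounded_operator f by case: pf => -[].
have [T TE] : {T : op E | opf T = f} by exists (Op bf).
rewrite -TE in pf rf *; have pT : proj T by exact/projectionP.
congr opf; have QT : Q * T = T.
 apply: op_ext => x; have : V (T x) by rewrite -rf; exists x.
 by rewrite -rQ => -[z _ ez]; rewrite opME -ez proj_id.
have TQ : T * Q = Q.
 apply: op_ext => x; have : V (Q x) by rewrite -rQ; exists x.
 by rewrite -rf => -[z _ ez]; rewrite opME -ez proj_id.
by rewrite -[LHS](pT.1) -QT adjM pT.1 pQ.1.
Qed.

(** If [P' x - P x = x], then [|x|^2 >= |P' x|^2 = |x|^2 + 3 |P x|^2], so [P x = 0] and [P' x = x]:
    the eigenspaces of [B] for 1 and -1 are the two intersections in the definition of the index. *)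
Lemma index_eig (P P' B : op E) (pP : proj P) (pP' : proj P') (BE : B = P' - P) :
 Defs.index (hdot E) (ttau A) P P' = tr A (eig_p pP pP' BE) - tr A (eig_n pP pP' BE).
have [h1 h2 h3] := eig_pP pP pP' BE; have [g1 g2 g3] := eig_nP pP pP' BE.
have key (Q Q' : op E) x : proj Q -> proj Q' -> Q' x - Q x = x -> Q' x = x /\ Q x = 0.
 move=> pQ pQ' e; have e1 : Q' x = x + Q x by rewrite -{2}e subrK.
 have le := proj_le1 pQ'; have := lop_q x le; rewrite proj_q// q1 e1 nrm_sqD.
 have -> : rip x (Q x) = nrm (Q x) ^+ 2 by rewrite -proj_q// /q ripC.
 move=> h; have /nrm0P z : nrm (Q x) <= 0.
  by have := sqr_ge0 (nrm (Q x)); have := nrm_ge0 (Q x); nra.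
 by rewrite z addr0.
have [e1 e1E] := opaque (eig_p pP pP' BE); have [e2 e2E] := opaque (eig_n pP pP' BE).
rewrite -e1E -e2E in h1 h2 h3 g1 g2 g3 *.
rewrite /Defs.index (projection_ontoE h1) ?(projection_ontoE g1)//; apply/seteqP; split=> x /=.
- move=> [z _ <-]; have := congr1 (fun T : op E => T z) g2.
 rewrite opME BE !opE => e.
 have e' : P (e2 z) - P' (e2 z) = e2 z.
  by rewrite -[RHS]opprK -e opprB.
 have [a b] := key _ _ _ pP' pP e'.
 by split=> //; exists (e2 z).
- move=> [[z _ <-]] Pz; exists (P z) => //; apply: g3.
 by rewrite BE !opE (proj_id _ pP) Pz sub0r.
- move=> [z _ <-]; have := congr1 (fun T : op E => T z) h2.
 rewrite opME BE !opE => e; have [a b] := key _ _ _ pP pP' e.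
 by split=> //; exists (e1 z).
- move=> [[z _ <-]] Pz; exists (P' z) => //; apply: h3.
 by rewrite BE !opE (proj_id _ pP') Pz subr0.
Qed.

Lemma rtr_unitary (U T : op E) : inN A U -> U^† * U = 1 -> L1 A T -> rtr A (U * T * U^†) = rtr A T.
move=> nU UU lT; rewrite -(rtrC (inN_adj nU)); last exact: L1Ml.
by rewrite mulrA UU mul1r.
Qed.

Lemma kk_unitary (U F : op E) : U^† * U = 1 -> U * U^† = 1 -> kk (U * F * U^†) = U * kk F * U^†.
move=> UU UU'; have uE : uo (U * F * U^†) = U * uo F * U^†.
 rewrite /uo mulrBr mulr1 mulrBl UU'; congr (_ - _).
 by rewrite !mulrA -(mulrA _ U^† U) UU mulr1.
rewrite /kk uE; elim: n => [|k IH]; first by rewrite !expr0 mulr1 UU'.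
by rewrite !exprS IH !mulrA -(mulrA _ U^† U) UU mulr1.
Qed.

Lemma Psi_unitary M (U F G : op E) : 0 <= M -> aff M F -> aff M G ->
 inN A U -> U^† * U = 1 -> U * U^† = 1 -> Psi (U * F * U^†) (U * G * U^†) = Psi F G.
move=> M0 hF hG nU UU UU'; rewrite /Psi; apply: eq_Rintegral => r.
rewrite inE /= in_itv /= => hr.
have e1 : U * G * U^† - U * F * U^† = U * (G - F) * U^† by rewrite mulrBr mulrBl.
have e2 : U * F * U^† + r *: (U * (G - F) * U^†) = U * (F + r *: (G - F)) * U^†.
 by move: (G - F) => Y; rewrite (mulrDr U) (mulrDl _ _ U^†) -opZAr -opZAl.
rewrite e1 e2 kk_unitary// !mulrA -(mulrA _ U^† U) UU mulr1 -(mulrA U).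
have hl := aff_line M0 hF hG hr.
have nY : inN A (G - F) by apply: inNB; [case: hG|case: hF].
apply: rtr_unitary => //; exact: L1Ml nY (wdn_tr (kk_wd M0 hl) (inN1 A)).1.
Qed.

Lemma Psi_rev M F G : 0 <= M -> aff M F -> aff M G -> Psi F G = - Psi G F.
move=> M0 hF hG; apply/eqP; rewrite -subr_eq0 opprK; apply/eqP.
rewrite (Psi_cocycle M0 hF hG hF) /Psi subrr.
rewrite (_ : (fun r => _) = fun=> 0); first by rewrite Rintegral_cst// mul0r.
by apply/funext => r; rewrite mul0r (rtr_fp (fp0 A)) tr0.
Qed.

(** * Perturbation of resolvents *)

Section Perturbation.
Implicit Types (x y z : E) (s l : R).

Lemma perturb_usa (D : unbounded_operator E) (T : op E) : usa D -> sa T -> usa (perturb D (opf T)).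
move=> sD /self_adjointP [_ sT]; case: (sD) => d0 dl dd ds; split=> //=.
 move=> c x y dx dy; have [h1 h2] := dl c x y dx dy; split=> //.
 by rewrite h2 opD opZ scalerDr addrACA.
move=> y z; have [h1 h2] := ds y (z - T y).
have bD u v w : hdot E (u + v) w = hdot E u w + hdot E v w by exact: linearDl.
have bB u v w : hdot E w (u - v) = hdot E w u - hdot E w v by exact: linearBr.
split=> [h|[dy ->] x dx].
 case: h1 => [x dx|dy e]; last by split=> //; rewrite -e subrK.
 by rewrite bB -h//= bD sT addrK.
have [_ h3] := ds y (D y); rewrite bD sT h3//.
exact/esym/linearDr.
Qed.

Lemma perturb_aff (D : unbounded_operator E) (T : op E) :
 affiliated (hdot E) (tN A) D -> inN A T -> affiliated (hdot E) (tN A) (perturb D (opf T)).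
move=> aD nT u cu uu x dx; have [h1 h2] := aD u cu uu x dx; split=> //=.
by have e := congr1 (fun f => f x) (cu.2 _ nT); rewrite h2 /= in e *; rewrite -e; apply/esym; exact: (opD (Op (cu.1))).
Qed.

(** [cfun s] and [sqrt s * bfun s] are the real and imaginary parts of [1 / (l - i sqrt s)].
    Splitting the resolvent in this way keeps the calculus to real functions. *)
Definition cfun s l : R := l / (l ^+ 2 + s).
Definition bfun s l : R := (l ^+ 2 + s)^-1.

Lemma sqs_gt0 s l : 0 < s -> 0 < l ^+ 2 + s.
by move=> s0; rewrite ltr_wpDl// sqr_ge0. Qed.
Lemma bfun_gt0 s l : 0 < s -> 0 < bfun s l. by move=> s0; rewrite invr_gt0 sqs_gt0. Qed.
Lemma bfun_le s l : 0 < s -> bfun s l <= s^-1.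
by move=> s0; rewrite lef_pV2 ?posrE ?sqs_gt0// lerDr sqr_ge0. Qed.

Lemma cfun_le s l : 0 < s -> `|cfun s l| <= (Num.sqrt s)^-1.
move=> s0; have q0 : 0 < Num.sqrt s by rewrite sqrtr_gt0.
rewrite /cfun normrM normfV (gtr0_norm (sqs_gt0 l s0)) ler_pdivrMr ?sqs_gt0// ler_pdivlMl//.
have e := sqr_sqrtr (ltW s0); rewrite -{2}e -[l ^+ 2]real_normK ?num_real//.
have := sqr_ge0 (`|l| - Num.sqrt s); have := normr_ge0 l; nra.
Qed.

Lemma bm_bfun s : 0 < s -> bm (bfun s).
move=> s0; split; last by exists s^-1 => l; rewrite ger0_norm ?bfun_le// ltW// bfun_gt0.
apply: continuous_measurable_fun => l; apply: cvgV; first by rewrite gt_eqF// sqs_gt0.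
by apply: cvgD; [exact: exprn_continuous|exact: cvg_cst].
Qed.

Lemma bm_cfun s : 0 < s -> bm (cfun s).
move=> s0; split; last by exists (Num.sqrt s)^-1 => l; exact: cfun_le.
by apply: measurable_funM => //; have [] := bm_bfun s0.
Qed.

Section Resolvents.
Variables (D : unbounded_operator E) (sD : usa D) (P : pvm E) (hP : pvm_of D P) (s : R) (s0 : 0 < s).

Lemma bfun_dom x : dom D (fc P (bfun s) x) /\ D (fc P (bfun s) x) = fc P (cfun s) x.
exact: (fc_dom sD hP x (bm_bfun s0) (bm_cfun s0 : bm (fun l => l * bfun s l))). Qed.

Lemma cfun_dom x : dom D (fc P (cfun s) x) /\ D (fc P (cfun s) x) = x - sv s (fc P (bfun s) x).
have e : (fun l => l * cfun s l) = (fun l => 1 - s * bfun s l).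
 apply/funext => l; rewrite /cfun /bfun; field; by rewrite gt_eqF// sqs_gt0.
have b1 := bm_cst (1 : R); have b2 := bmZ s (bm_bfun s0).
have [|h1 h2] := fc_dom sD hP x (bm_cfun s0); first by rewrite e; exact: bmB.
split=> //; rewrite h2 e fcB// fc_cst scale1r fcZ//; exact: bm_bfun.
Qed.

Lemma cfun_D y : dom D y -> fc P (cfun s) (D y) = y - sv s (fc P (bfun s) y).
move=> dy; apply: rip_ext => z; have [dz ez] := cfun_dom z.
have /saP sc := fc_sa P (bm_cfun s0); have /saP sb := fc_sa P (bm_bfun s0).
by rewrite sc usym// ez ripBl ripBr ripZl ripZr sb.
Qed.

Lemma bfun_D y : dom D y -> fc P (bfun s) (D y) = fc P (cfun s) y.
move=> dy; apply: rip_ext => z; have [dz ez] := bfun_dom z.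
have /saP sc := fc_sa P (bm_cfun s0); have /saP sb := fc_sa P (bm_bfun s0).
by rewrite sb usym// ez sc.
Qed.

End Resolvents.

Section Pair.
Variables (D D' : unbounded_operator E) (sD : usa D) (sD' : usa D') (P P' : pvm E).
Hypotheses (hP : pvm_of D P) (hP' : pvm_of D' P').
Variable X : op E.
Hypotheses (dE : forall x, dom D' x <-> dom D x) (DE : forall x, dom D x -> D' x = D x + X x).
Variables (s : R) (s0 : 0 < s).

Local Notation b := (fc P (bfun s)).
Local Notation c := (fc P (cfun s)).
Local Notation b' := (fc P' (bfun s)).
Local Notation c' := (fc P' (cfun s)).

Let c'D y : dom D y -> c' (D y) = y - sv s (b' y) - c' (X y).
by move=> dy; have := cfun_D sD' hP' s0 ((dE y).2 dy); rewrite DE// opD => <-; rewrite addrK.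
Qed.

Let b'D y : dom D y -> b' (D y) = c' y - b' (X y).
by move=> dy; have := bfun_D sD' hP' s0 ((dE y).2 dy); rewrite DE// opD => <-; rewrite addrK.
Qed.

Let xE x : x = D (c x) + sv s (b x).
by have [_ ->] := cfun_dom sD hP s0 x; rewrite subrK. Qed.

(** Real part of the resolvent identity [R' - R = - R' X R] with [R = c + i sqrt s b]; [resolvent_b]
    is its imaginary part. The proof decomposes [x] as [D (c x) + s b x] and lets the primed
    operators absorb [D = D' - X]. *)
Lemma resolvent_c : c' - c = s *: (b' * X * b) - c' * X * c.
apply: op_ext => x; have [dc _] := cfun_dom sD hP s0 x; have [db eb] := bfun_dom sD hP s0 x.
have h1 : sv s (c' (b x)) = sv s (b' (c x)) + sv s (b' (X (b x))).
 by have := b'D db; rewrite eb => ->; rewrite -svD subrK.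
rewrite !opE {1}(xE x) opD (c'D dc) opsv h1.
move: (c x) (sv s (b' (c x))) (c' (X (c x))) (sv s _) => u v w t.
by apply: rip_ext => z; rewrite !(ripDl, ripNl); ring.
Qed.

Lemma resolvent_b : b' - b = - (c' * X * b + b' * X * c).
apply: op_ext => x; have [dc _] := cfun_dom sD hP s0 x; have [db eb] := bfun_dom sD hP s0 x.
have h1 : sv s (b' (b x)) = b x - c' (c x) - c' (X (b x)).
 have := c'D db; rewrite eb => ->; move: (c' (X _)) (sv s _) => u v.
 by apply: rip_ext => z; rewrite !(ripDl, ripNl); ring.
rewrite !opE {1}(xE x) opD (b'D dc) opsv h1.
move: (c' (c x)) (b' (X (c x))) (c' _) (b x) => u v w t.
by apply: rip_ext => z; rewrite !(ripDl, ripNl); ring.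
Qed.

End Pair.
End Perturbation.

(** * Riemann sums for the inverse square root *)

Lemma atan_step (q a b : R) : 0 < q -> 0 <= a -> a < b ->
 (b - a) / (q ^+ 2 + b ^+ 2) <= q^-1 * (atan (b / q) - atan (a / q)) <= (b - a) / (q ^+ 2 + a ^+ 2).
move=> q0 a0 ab; have qi : 0 < q^-1 by rewrite invr_gt0.
have h : a / q < b / q by rewrite ltr_pM2r.
have hd (x : R) : x \in `]a / q, b / q[ -> is_derive x 1 atan (1 + x ^+ 2)^-1.
 by move=> _; exact: is_derive1_atan.
have hc : {within `[a / q, b / q], continuous atan}.
 by apply: continuous_subspaceT => x; exact: continuous_atan.
have [c] := MVT h hd hc; rewrite in_itv /= => /andP[c1 c2] ->.
have [d dE] : {d | d = c * q} by eexists.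
have cE : c = d / q by rewrite dE mulfK// gt_eqF.
rewrite cE !ltr_pM2r// in c1 c2.
have qn : q != 0 by rewrite gt_eqF.
have pos (x : R) : 0 < q ^+ 2 + x ^+ 2 by rewrite ltr_pwDl// ?sqr_ge0// exprn_gt0.
have -> : q^-1 * ((1 + c ^+ 2)^-1 * (b / q - a / q)) = (b - a) / (q ^+ 2 + d ^+ 2).
 by rewrite cE; field; have := pos d => /lt0r_neq0 ->; rewrite qn.
have ba : 0 <= b - a by rewrite subr_ge0 ltW.
have d0 : 0 <= d by exact: le_trans a0 (ltW c1).
have b0 : 0 <= b by exact: le_trans a0 (ltW ab).
by apply/andP; split; rewrite ler_wpM2l// lef_pV2 ?posrE ?pos// lerD2l ler_pXn2r ?nnegrE// ?(ltW c1) ?(ltW c2).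
Qed.

(** Riemann sums for the integral over [t >= 0] of [(2 / pi) / (1 + t^2 + l^2)], which is
    [(1 + l^2)^(-1/2)]: mesh [1 / (m + 1)], nodes up to [m + 1]. With finite sums the resolvent
    identities apply term by term and no operator-valued integral is formed. *)
Definition node m i : R := i.+1%:R / m.+1%:R.
Definition level m i : R := 1 + node m i ^+ 2.
Definition wgt m : R := 2 / pi / m.+1%:R.
Definition nterm m : nat := (m.+1 ^ 2)%N.
Definition kfun (l : R) : R := (1 + l ^+ 2) `^ (- 2^-1).
Definition bsum m l : R := \sum_(i < nterm m) wgt m * bfun (level m i) l.
Definition csum m l : R := \sum_(i < nterm m) wgt m * cfun (level m i) l.

Lemma wgt_ge0 m : 0 <= wgt m.
by rewrite /wgt !mulr_ge0 ?invr_ge0 ?pi_ge0. Qed.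
Lemma level_gt0 m i : 0 < level m i. by rewrite /level sq1_gt0. Qed.
Lemma kfun_gt0 l : 0 < kfun l. by rewrite powR_gt0 ?sq1_gt0. Qed.
Lemma kfun_sqrt l : kfun l = (Num.sqrt (1 + l ^+ 2))^-1.
by rewrite /kfun powRN powR12_sqrt// ltW// sq1_gt0. Qed.

(** The integrand decreases and has the antiderivative [atan (t / q) / q]. Sums over right end
    points lie below the integral from 0 and above the one shifted by a step, which starts at
    [1 / (m + 1)]. *)
Lemma mesh_sum m N q : 0 < q ->
 q^-1 * (atan ((N.+1%:R / m.+1%:R) / q) - atan ((m.+1%:R)^-1 / q)) <=
  \sum_(i < N) (m.+1%:R)^-1 / (q ^+ 2 + node m i ^+ 2) <= q^-1 * atan ((N%:R / m.+1%:R) / q).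
move=> q0; have mp : 0 < (m.+1%:R : R)^-1 by rewrite invr_gt0.
elim: N => [|N IH].
 by rewrite big_ord0 !mul0r atan0 mulr0 mul1r subrr mulr0 lexx.
have st (k : nat) : (k.+1%:R / m.+1%:R : R) - k%:R / m.+1%:R = (m.+1%:R)^-1.
 by rewrite -mulrBl -(natrB _ (leqnSn k)) subSnn mul1r.
have lt (k : nat) : (k%:R / m.+1%:R : R) < k.+1%:R / m.+1%:R by rewrite ltr_pM2r// ltr_nat.
have ge (k : nat) : 0 <= (k%:R / m.+1%:R : R) by rewrite divr_ge0.
have /andP[a1 a2] := atan_step q0 (ge N) (lt N).
have /andP[b1 b2] := atan_step q0 (ge N.+1) (lt N.+1).
rewrite st in a1 a2; rewrite st in b1 b2; have /andP[i1 i2] := IH.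
rewrite big_ord_recr /=; apply/andP; split.
 apply: le_trans (lerD i1 b2); rewrite -mulrDr ler_wpM2l ?invr_ge0 ?(ltW q0)//.
 by rewrite [leRHS]addrC addrA subrK.
by apply: (le_trans (lerD i2 a1)); rewrite -mulrDr addrC subrK.
Qed.

Lemma bsumE m l : bsum m l = 2 / pi * \sum_(i < nterm m) (m.+1%:R)^-1 / (Num.sqrt (1 + l ^+ 2) ^+ 2 + node m i ^+ 2).
rewrite mulr_sumr; apply: eq_bigr => i _.
rewrite sqr_sqrtr ?ltW ?sq1_gt0// /wgt /bfun /level (addrCA (l ^+ 2)) addrA [1 + l ^+ 2 + _]addrAC.
by rewrite !mulrA.
Qed.

Lemma two_pi_ge0 : 0 <= 2 / pi :> R. by rewrite divr_ge0 ?pi_ge0. Qed.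
Lemma nterm_mesh m : (nterm m)%:R / m.+1%:R = m.+1%:R :> R.
by rewrite /nterm natrX expr2 mulfK. Qed.
Lemma bsum_ge0 m l : 0 <= bsum m l.
by apply: sumr_ge0 => i _; rewrite mulr_ge0 ?wgt_ge0// ltW// bfun_gt0// level_gt0. Qed.

Lemma bsum_le m l : bsum m l <= kfun l.
have q0 : 0 < Num.sqrt (1 + l ^+ 2) :> R by rewrite sqrtr_gt0 sq1_gt0.
have /andP[_ h] := mesh_sum m (nterm m) q0.
rewrite bsumE kfun_sqrt; apply: (le_trans (ler_wpM2l two_pi_ge0 h)).
rewrite mulrCA ler_piMr ?invr_ge0 ?(ltW q0)//.
rewrite mulrC -ler_pdivlMr ?divr_gt0 ?pi_gt0// div1r invf_div ltW//; exact: atan_ltpi2.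
Qed.

Lemma bsum_cvg l : (fun m => bsum m l) @ \oo --> kfun l.
have [q qE] := opaque (Num.sqrt (1 + l ^+ 2)).
have q0 : 0 < q by rewrite qE sqrtr_gt0 sq1_gt0.
have c1 : (fun m : nat => m.+1%:R / q : R) @ \oo --> +oo.
 apply/cvgryPge => B; exists (Num.bound `|B * q|) => // m /= hm.
 rewrite ler_pdivlMr// (le_trans (ler_norm _))// (le_trans (ltW (archi_boundP (normr_ge0 _))))//.
 by rewrite ler_nat (leq_trans hm).
have c2 : (fun m : nat => atan (m.+1%:R / q) : R) @ \oo --> (pi / 2 : R).
 by apply: cvg_comp c1 _; exact: cvgy_atan.
have c3 : (fun m : nat => atan ((m.+1%:R)^-1 / q) : R) @ \oo --> (0 : R).
 rewrite -[X in _ --> X](@atan0 R) -[X in atan X](mul0r q^-1).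
 apply: (@cvg_comp _ _ _ (fun m : nat => (m.+1%:R)^-1 / q) atan _ _ _ _ (@continuous_atan R (0 / q))).
 by apply: cvgM; [exact: cvg_harmonic|exact: cvg_cst].
have c4 : (fun m : nat => (2 / pi) * (q^-1 * (atan (m.+1%:R / q) - atan ((m.+1%:R)^-1 / q)))) @ \oo -->
  ((2 / pi) * (q^-1 * (pi / 2 - 0)) : R).
 by apply: cvgM; [exact: cvg_cst|apply: cvgM; [exact: cvg_cst|exact: cvgB]].
have eK : (2 / pi) * (q^-1 * (pi / 2 - 0)) = kfun l.
 have pn : pi != 0 :> R by rewrite gt_eqF ?pi_gt0.
 rewrite kfun_sqrt -qE subr0; move: (pi : R) pn => w w0; field; by rewrite w0 gt_eqF.
rewrite eK in c4.
have c5 : (fun m : nat => kfun l - (2 / pi) * (q^-1 * (atan (m.+1%:R / q) - atan ((m.+1%:R)^-1 / q)))) @ \oo -->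
  (0 : R).
 by rewrite -(subrr (kfun l)); apply: cvgB => //; exact: cvg_cst.
apply: (cvg_squeeze _ c5) => m; rewrite distrC ger0_norm ?subr_ge0 ?bsum_le//.
rewrite lerB// bsumE ler_wpM2l ?two_pi_ge0//.
rewrite -qE; have /andP[h _] := mesh_sum m (nterm m) q0.
apply: le_trans h; rewrite ler_wpM2l ?invr_ge0 ?(ltW q0)// lerD2r le_atan//.
by rewrite ler_pM2r ?invr_gt0// -[leLHS](nterm_mesh m) ler_pM2r ?invr_gt0// ler_nat.
Qed.

Lemma hfun_mono x y : y ^+ 2 <= x ^+ 2 -> hfun x <= hfun y.
move=> h; rewrite /hfun !powRN lef_pV2 ?posrE ?powR_gt0 ?sq1_gt0//.
by rewrite ge0_ler_powR ?nnegrE ?(ltW (sq1_gt0 _))// lerD2l.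
Qed.

(** All four bounds come from [z = hfun (sqrt (l^2 + t^2))], which is at most [hfun l] and [hfun t]:
    [bfun] equals [z^4] and [cfun] is at most [z^2] in absolute value. *)
Lemma bcfun_hfun t l : [/\ bfun (1 + t ^+ 2) l <= hfun t ^+ 3 * hfun l,
 `|cfun (1 + t ^+ 2) l| <= hfun t * hfun l, bfun (1 + t ^+ 2) l <= hfun t ^+ 4 &
 `|cfun (1 + t ^+ 2) l| <= hfun t ^+ 2].
have e0 : 0 <= l ^+ 2 + t ^+ 2 by rewrite addr_ge0 ?sqr_ge0.
have [z zE] := opaque (hfun (Num.sqrt (l ^+ 2 + t ^+ 2))).
have zl : z <= hfun l by rewrite zE hfun_mono// sqr_sqrtr// lerDl sqr_ge0.
have zt : z <= hfun t by rewrite zE hfun_mono// sqr_sqrtr// lerDr sqr_ge0.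
have z0 : 0 < z by rewrite zE hfun_gt0.
have bz : bfun (1 + t ^+ 2) l = z ^+ 4 by rewrite zE hfun4 sqr_sqrtr// /bfun addrCA.
have cz : `|cfun (1 + t ^+ 2) l| <= z ^+ 2.
 rewrite -(@ler_pXn2r _ 2)// ?nnegrE ?sqr_ge0// real_normK ?num_real// /cfun -/(bfun _ _) bz.
 have h : l ^+ 2 * z ^+ 4 <= 1.
  rewrite -bz -ler_pdivlMr ?bfun_gt0 ?sq1_gt0// /bfun invrK mul1r.
  by have := sqr_ge0 t; lra.
 by rewrite exprMn -!exprM -[leRHS]mul1r (_ : (4 * 2 = 4 + 4)%N)// exprD mulrA ler_wpM2r// exprn_ge0// ltW.
have zz := ltW z0; have ht := ltW (hfun_gt0 t); have hl := ltW (hfun_gt0 l).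
have pw k : z ^+ k <= hfun t ^+ k by case: k => // k; rewrite ler_pXn2r ?nnegrE.
split.
- by rewrite bz exprSr ler_pM// exprn_ge0.
- by apply: (le_trans cz); rewrite expr2 ler_pM.
- by rewrite bz.
- exact: le_trans cz (pw 2).
Qed.

(** A telescoping majorant: [(1 + t^2)^(-3/4)] is at most [2 (1 + t)^(-3/2)], whose antiderivative
    is [- 4 (1 + t)^(-1/2)]. *)
Lemma hfun3_step (a b : R) : 0 <= a -> a < b ->
 (b - a) * hfun b ^+ 3 <= 4 * ((Num.sqrt (1 + a))^-1 - (Num.sqrt (1 + b))^-1).
move=> a0 ab; have b0 : 0 < b by exact: le_lt_trans ab.
have [x xE] := opaque (Num.sqrt (1 + a)); have [y yE] := opaque (Num.sqrt (1 + b)).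
have x0 : 0 < x by rewrite xE sqrtr_gt0; lra.
have y0 : 0 < y by rewrite yE sqrtr_gt0; lra.
have xx : x ^+ 2 = 1 + a by rewrite xE sqr_sqrtr//; lra.
have yy : y ^+ 2 = 1 + b by rewrite yE sqr_sqrtr//; lra.
have xy : x <= y by rewrite xE yE ler_sqrt; lra.
rewrite -xE -yE.
have h3 : hfun b ^+ 3 <= 2 * y ^- 3.
 have n1 : 0 <= 2 * y ^- 3 by rewrite mulr_ge0// invr_ge0 exprn_ge0// ltW.
 rewrite -(@ler_pXn2r _ 4)// ?nnegrE ?exprn_ge0 ?(ltW (hfun_gt0 _))//.
 have h4 : hfun b ^+ 4 <= 2 * y ^- 4.
  rewrite hfun4 -[leLHS]mul1r ler_pdivrMr ?sq1_gt0// mulrAC -ler_pdivrMr ?invr_gt0 ?exprn_gt0// invrK mul1r.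
  have -> : y ^+ 4 = (1 + b) ^+ 2 by rewrite -yy -exprM.
  by have := sqr_ge0 (b - 1); nra.
 rewrite -exprM mulnC exprM; apply: (@le_trans _ _ ((2 * y ^- 4) ^+ 3)).
  by rewrite ler_pXn2r ?nnegrE ?exprn_ge0 ?(ltW (hfun_gt0 b))// mulr_ge0// invr_ge0 exprn_ge0// ltW.
 rewrite !exprMn !exprVn -!exprM ler_wpM2r// ?invr_ge0 ?exprn_ge0 ?(ltW y0)//; lra.
have e : b - a = y ^+ 2 - x ^+ 2 by rewrite xx yy; ring.
apply: (le_trans (ler_wpM2l _ h3)); first by lra.
have -> : x^-1 - y^-1 = (y - x) / (x * y) by field; rewrite !gt_eqF.
have -> : (b - a) * (2 * y ^- 3) = (y - x) * (2 * (y + x) / y ^+ 3) by rewrite e; field; rewrite gt_eqF.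
rewrite [leRHS]mulrCA; apply: ler_wpM2l; first by lra.
rewrite ler_pdivrMr ?exprn_gt0// mulrAC ler_pdivlMr ?mulr_gt0//.
have -> : 4 * y ^+ 3 = 4 * y ^+ 2 * y by rewrite -mulrA -exprSr.
rewrite mulrA; apply: ler_wpM2r; first exact: ltW.
nra.
Qed.

Lemma wgt_hfun3 m N : \sum_(i < N) wgt m * hfun (node m i) ^+ 3 <= 4.
have mp : 0 < (m.+1%:R : R)^-1 by rewrite invr_gt0.
have h : \sum_(i < N) (m.+1%:R)^-1 * hfun (node m i) ^+ 3 <= 4 * (1 - (Num.sqrt (1 + N%:R / m.+1%:R))^-1).
 elim: N => [|N IH]; first by rewrite big_ord0 mul0r addr0 sqrtr1 invr1 subrr mulr0.
 have lt : (N%:R / m.+1%:R : R) < N.+1%:R / m.+1%:R by rewrite ltr_pM2r// ltr_nat.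
 have := @hfun3_step (N%:R / m.+1%:R) (N.+1%:R / m.+1%:R) _ lt.
 rewrite -mulrBl -(natrB _ (leqnSn N)) subSnn mul1r => /(_ (divr_ge0 _ _)) hh.
 rewrite big_ord_recr /=; have := lerD IH (hh _ _); rewrite !ler0n => /(_ isT isT) /le_trans; apply.
 by rewrite -mulrDr addrA subrK.
have -> : \sum_(i < N) wgt m * hfun (node m i) ^+ 3 = 2 / pi * \sum_(i < N) (m.+1%:R)^-1 * hfun (node m i) ^+ 3.
 by rewrite mulr_sumr; apply: eq_bigr => i _; rewrite /wgt !mulrA.
apply: (le_trans (ler_wpM2l two_pi_ge0 h)).
have h4 : 4 * (1 - (Num.sqrt (1 + N%:R / m.+1%:R))^-1) <= 4 :> R.
 by rewrite ler_piMr// gerDl oppr_le0 invr_ge0 sqrtr_ge0.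
apply: (le_trans (ler_wpM2l two_pi_ge0 h4)); rewrite ler_piMl//.
by rewrite ler_pdivrMr ?pi_gt0// mul1r pi_ge2.
Qed.

Lemma bm_kfun : bm kfun.
by apply: bm_powR; rewrite invr_ge0. Qed.
Lemma bm_csum m : bm (csum m).
by apply: bm_sum => i; apply: bmZ; apply: bm_cfun; exact: level_gt0. Qed.
Lemma bm_bsum m : bm (bsum m).
by apply: bm_sum => i; apply: bmZ; apply: bm_bfun; exact: level_gt0. Qed.
Lemma csumE m l : csum m l = l * bsum m l.
by rewrite mulr_sumr; apply: eq_bigr => i _; rewrite /cfun /bfun mulrCA. Qed.

Lemma csum_cvg l : (fun m => csum m l) @ \oo --> Ffun l.
have e : (fun m => csum m l) = (fun m => l * bsum m l) by apply/funext => m; rewrite csumE.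
have -> : Ffun l = l * kfun l by [].
by rewrite e; apply: (cvg_scale l); exact: bsum_cvg.
Qed.

Lemma csum_le1 m l : `|csum m l| <= 1.
apply: le_trans (Ffun_le1 l); rewrite csumE /Ffun !normrM ler_wpM2l//.
by rewrite !ger0_norm ?bsum_ge0 ?powR_ge0//; exact: bsum_le.
Qed.

Lemma kfun_le1 l : kfun l <= 1.
rewrite kfun_sqrt invf_le1 ?sqrtr_gt0 ?sq1_gt0// -[leLHS]sqrtr1 ler_sqrt ?sq1_ge1//; exact: ltW (sq1_gt0 l).
Qed.

Lemma bsum_le1 m l : `|bsum m l| <= 1.
by rewrite ger0_norm ?bsum_ge0//; apply: le_trans (bsum_le m l) (kfun_le1 l). Qed.
Lemma hfun2 l : hfun l ^+ 2 = kfun l.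
by rewrite hfunX /kfun; congr (_ `^ - _); field. Qed.

(** * Perturbation estimates for the bounded transform *)

Section PairEstimates.
Variables (D D' : unbounded_operator E) (sD : usa D) (sD' : usa D') (P P' : pvm E).
Hypotheses (hP : pvm_of D P) (hP' : pvm_of D' P').
Variable X : op E.
Hypotheses (dE : forall x, dom D' x <-> dom D x) (DE : forall x, dom D x -> D' x = D x + X x).

Let h := fc P hfun.
Let h' := fc P' hfun.

Local Notation bt Q t := (fc Q (bfun (1 + t ^+ 2))).
Local Notation ct Q t := (fc Q (cfun (1 + t ^+ 2))).

Let bfun_nrm (Q : pvm E) t x : nrm (bt Q t x) <= hfun t ^+ 3 * nrm (fc Q hfun x).
have ht := exprn_ge0 3 (ltW (hfun_gt0 t)).
apply: (@le_trans _ _ (nrm (fc Q (fun l => hfun t ^+ 3 * hfun l) x))).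
 apply: fc_nrm_le => [||l]; [exact: bm_bfun (sq1_gt0 t)|exact: bmZ bm_hfun|].
 have [a _ _ _] := bcfun_hfun t l.
 by rewrite (ger0_norm (ltW (bfun_gt0 l (sq1_gt0 t)))) (ger0_norm (mulr_ge0 ht (ltW (hfun_gt0 l)))).
by rewrite fcZ ?opZE ?nrm_sv ?ger0_norm//; exact: bm_hfun.
Qed.

Let cfun_nrm (Q : pvm E) t x : nrm (ct Q t x) <= hfun t * nrm (fc Q hfun x).
have ht := ltW (hfun_gt0 t).
apply: (@le_trans _ _ (nrm (fc Q (fun l => hfun t * hfun l) x))).
 apply: fc_nrm_le => [||l]; [exact: bm_cfun (sq1_gt0 t)|exact: bmZ bm_hfun|].
 have [_ a _ _] := bcfun_hfun t l.
 by rewrite [leRHS]ger0_norm ?mulr_ge0 ?(ltW (hfun_gt0 l)).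
by rewrite fcZ ?opZE ?nrm_sv ?ger0_norm//; exact: bm_hfun.
Qed.

Let bfun_opn (Q : pvm E) t : opn (bt Q t) <= hfun t ^+ 4.
apply: fc_opn => [|l]; first exact: bm_bfun (sq1_gt0 t).
by have [_ _ a _] := bcfun_hfun t l; rewrite ger0_norm ?(ltW (bfun_gt0 l (sq1_gt0 t))).
Qed.

Let cfun_opn (Q : pvm E) t : opn (ct Q t) <= hfun t ^+ 2.
by apply: fc_opn => [|l]; [exact: bm_cfun (sq1_gt0 t)|have [_ _ _ a] := bcfun_hfun t l].
Qed.

Let three (S T : op E) x a b y : opn S <= a -> nrm (T x) <= b * y -> 0 <= b -> 0 <= y ->
 nrm ((S * X * T) x) <= a * b * opn X * y.
move=> Sa Tb b0 y0; rewrite !opME (le_trans (opn_le _ _))// -!mulrA; apply: ler_pM; rewrite ?opn_ge0 ?nrm_ge0//.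
rewrite (le_trans (opn_le _ _))// mulrCA ler_wpM2l ?opn_ge0//.
Qed.

Let hle1 t k : hfun t ^+ k <= 1.
by rewrite exprn_ile1 ?hfun_le1 ?(ltW (hfun_gt0 t)). Qed.

Lemma bdiff_nrm t x : nrm ((bt P' t - bt P t) x) <=
 2 * hfun t ^+ 3 * opn X * nrm (h x).
have ht := ltW (hfun_gt0 t); have n0 := nrm_ge0 (h x); have X0 := opn_ge0 X.
rewrite (resolvent_b sD sD' hP hP' dE DE (sq1_gt0 t)) opNE nrmN opDE (le_trans (nrmD _ _))//.
have a1 := three (cfun_opn P' t) (bfun_nrm P t x) (exprn_ge0 3 ht) n0.
have a2 := three (bfun_opn P' t) (cfun_nrm P t x) ht n0.
apply: (le_trans (lerD a1 a2)).
have e : hfun t ^+ 2 * hfun t ^+ 3 * opn X * nrm (h x) + hfun t ^+ 4 * hfun t * opn X * nrm (h x) =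
 hfun t ^+ 2 * (2 * hfun t ^+ 3 * opn X * nrm (h x)) by ring.
by rewrite e ler_piMl ?hle1// !mulr_ge0// exprn_ge0.
Qed.

Lemma cdiff_nrm t x : nrm ((ct P' t - ct P t) x) <=
 2 * hfun t ^+ 3 * opn X * nrm (h x).
have ht := ltW (hfun_gt0 t); have n0 := nrm_ge0 (h x); have X0 := opn_ge0 X.
rewrite (resolvent_c sD sD' hP hP' dE DE (sq1_gt0 t)) opDE opNE (le_trans (nrmB _ _))//.
have a1 := three (bfun_opn P' t) (bfun_nrm P t x) (exprn_ge0 3 ht) n0.
have a2 := three (cfun_opn P' t) (cfun_nrm P t x) ht n0.
have e4 : (1 + t ^+ 2) * hfun t ^+ 4 = 1 by rewrite hfun4 mulfV// gt_eqF// sq1_gt0.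
rewrite opZE nrm_sv (ger0_norm (ltW (sq1_gt0 t))).
apply: (le_trans (lerD (ler_wpM2l (ltW (sq1_gt0 t)) a1) a2)).
rewrite -/h; move: (nrm (h x)) => y; move: (hfun t) e4 (opn X) => z e4 w.
have -> : (1 + t ^+ 2) * (z ^+ 4 * z ^+ 3 * w * y) = (1 + t ^+ 2) * z ^+ 4 * (z ^+ 3 * w * y) by ring.
rewrite e4; apply: eqW; ring.
Qed.

(** In the quadratic form one resolvent acts on each copy of [x], so one side carries [h] and the
    other [h']. This symmetric bound is what [hop_pair] starts from. *)
Lemma bdiff_q t x : `|q (bt P' t - bt P t) x| <=
 2 * hfun t ^+ 3 * opn X * (nrm (h x) * nrm (h' x)).
have ht := ltW (hfun_gt0 t); have n0 := nrm_ge0 (h x); have n0' := nrm_ge0 (h' x); have X0 := opn_ge0 X.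
rewrite (resolvent_b sD sD' hP hP' dE DE (sq1_gt0 t)) qN normrN qD.
have /saP sc := fc_sa P' (bm_cfun (sq1_gt0 t)); have /saP sb := fc_sa P' (bm_bfun (sq1_gt0 t)).
have key (u v : E) a b : nrm u <= a * nrm (h x) -> nrm v <= b * nrm (h' x) -> 0 <= a ->
  `|rip (X u) v| <= a * b * opn X * (nrm (h x) * nrm (h' x)).
 move=> hu hv a0; rewrite (le_trans (rip_abs _ _))//.
 have -> : a * b * opn X * (nrm (h x) * nrm (h' x)) = opn X * (a * nrm (h x)) * (b * nrm (h' x)) by ring.
 apply: ler_pM; rewrite ?nrm_ge0//; by rewrite (le_trans (opn_le _ _))// ler_wpM2l.
have a1 := key _ _ _ _ (bfun_nrm P t x) (cfun_nrm P' t x) (exprn_ge0 3 ht).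
have a2 := key _ _ _ _ (cfun_nrm P t x) (bfun_nrm P' t x) ht.
rewrite (le_trans (ler_normD _ _))// /q !opME sc sb; apply: (le_trans (lerD a1 a2)).
have e : hfun t ^+ 3 * hfun t * opn X * (nrm (h x) * nrm (h' x)) + hfun t * hfun t ^+ 3 * opn X * (nrm (h x) * nrm (h' x))
 = hfun t * (2 * hfun t ^+ 3 * opn X * (nrm (h x) * nrm (h' x))) by ring.
rewrite e ler_piMl ?hfun_le1//; apply: mulr_ge0; last exact: mulr_ge0.
by apply: mulr_ge0 => //; apply: mulr_ge0 => //; exact: exprn_ge0.
Qed.

Let fcsum (Q : pvm E) (g : R -> R -> R) m : (forall s, 0 < s -> bm (g s)) ->
 fc Q (fun l => \sum_(i < nterm m) wgt m * g (level m i) l) =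
 \sum_(i < nterm m) wgt m *: fc Q (g (level m i)).
move=> bg; have bgi i := bg _ (level_gt0 m i).
rewrite fc_sum => [|i]; last exact: bmZ.
by apply: eq_bigr => i _; rewrite fcZ.
Qed.

Let sum_app (I : Type) (r : seq I) (F : I -> op E) x : (\sum_(i <- r) F i) x = \sum_(i <- r) F i x.
by elim: r => [|i r IH]; rewrite ?big_nil// !big_cons opDE IH. Qed.

Let nrm_sum (I : Type) (r : seq I) (F : I -> E) : nrm (\sum_(i <- r) F i) <= \sum_(i <- r) nrm (F i).
elim: r => [|i r IH]; first by rewrite !big_nil nrm0.
by rewrite !big_cons (le_trans (nrmD _ _))// lerD2l.
Qed.

Let q_sum (I : Type) (r : seq I) (F : I -> op E) x : q (\sum_(i <- r) F i) x = \sum_(i <- r) q (F i) x.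
by elim: r => [|i r IH]; rewrite ?big_nil ?q0// !big_cons qD IH. Qed.

(** The 2 of the bound at each node times the 4 of [wgt_hfun3]: the source of the constant 8 in the
    perturbation estimates. *)
Let sum_bound (a : R -> R) m C : (forall t, a t <= 2 * hfun t ^+ 3 * C) -> 0 <= C ->
 \sum_(i < nterm m) wgt m * a (node m i) <= 8 * C.
move=> ha C0; apply: (@le_trans _ _ (\sum_(i < nterm m) (wgt m * hfun (node m i) ^+ 3) * (2 * C))).
 apply: ler_sum => i _; rewrite -mulrA ler_wpM2l ?wgt_ge0// (le_trans (ha _))//.
 by apply: eqW; ring.
rewrite -mulr_suml; have := wgt_hfun3 m (nterm m) => w.
have -> : 8 * C = 4 * (2 * C) by ring.
by apply: ler_wpM2r => //; exact: mulr_ge0.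
Qed.

Let sums_nrm (g : R -> R -> R) m x : (forall s, 0 < s -> bm (g s)) ->
 (forall t, nrm ((fc P' (g (1 + t ^+ 2)) - fc P (g (1 + t ^+ 2))) x) <= 2 * hfun t ^+ 3 * opn X * nrm (h x)) ->
 nrm (fc P' (fun l => \sum_(i < nterm m) wgt m * g (level m i) l) x -
    fc P (fun l => \sum_(i < nterm m) wgt m * g (level m i) l) x) <= 8 * opn X * nrm (h x).
move=> bg hg; rewrite !fcsum// -opNE -opDE -sumrN -big_split /= sum_app (le_trans (nrm_sum _ _))//.
rewrite -[leRHS]mulrA.
apply: le_trans (@sum_bound (fun t => nrm ((fc P' (g (1 + t ^+ 2)) - fc P (g (1 + t ^+ 2))) x)) m (opn X * nrm (h x)) _ _).
- apply: ler_sum => i _; rewrite -scalerN -scalerDr opZE nrm_sv ger0_norm ?wgt_ge0//.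
- by move=> t; rewrite mulrA.
- by rewrite mulr_ge0 ?opn_ge0 ?nrm_ge0.
Qed.

Let scvg_c (Q : pvm E) : scvg (fun m => fc Q (csum m)) (fc Q Ffun).
exact: fc_scvg bm_csum bm_Ffun csum_le1 csum_cvg. Qed.
Let scvg_b (Q : pvm E) : scvg (fun m => fc Q (bsum m)) (fc Q kfun).
exact: fc_scvg bm_bsum bm_kfun bsum_le1 bsum_cvg. Qed.

Lemma Fdiff_nrm x : nrm ((fc P' Ffun - fc P Ffun) x) <= 8 * opn X * nrm (h x).
rewrite opDE opNE; apply: (hcvg_nrm_le (hcvgB (scvg_c P' x) (scvg_c P x))) => m.
by apply: sums_nrm => [s s0|t]; [exact: bm_cfun|exact: cdiff_nrm].
Qed.

Lemma kdiff_nrm x : nrm ((fc P' kfun - fc P kfun) x) <= 8 * opn X * nrm (h x).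
rewrite opDE opNE; apply: (hcvg_nrm_le (hcvgB (scvg_b P' x) (scvg_b P x))) => m.
by apply: sums_nrm => [s s0|t]; [exact: bm_bfun|exact: bdiff_nrm].
Qed.

Let q_k (Q : pvm E) x : q (fc Q kfun) x = nrm (fc Q hfun x) ^+ 2.
have bh := bm_hfun.
have -> : kfun = fun l => hfun l ^+ 2 by apply/funext => l; rewrite hfun2.
by rewrite fc_nrm// fc_q//; exact: bmX.
Qed.

Lemma kdiff_q x : q (fc P' kfun) x - q (fc P kfun) x <= 8 * opn X * (nrm (h x) * nrm (h' x)).
have c : (fun m => q (fc P' (bsum m)) x - q (fc P (bsum m)) x) @ \oo --> q (fc P' kfun) x - q (fc P kfun) x.
 by apply: cvgB; apply: wcvg_q; apply: scvg_wcvg.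
apply: (cvg_le_cst _ c) => m; rewrite -qN -qD.
have bb s : 0 < s -> bm (bfun s) by exact: bm_bfun.
rewrite /bsum !fcsum// -sumrN -big_split /= q_sum.
rewrite -[leRHS]mulrA.
apply: le_trans (@sum_bound (fun t => `|q (bt P' t - bt P t) x|) m _ _ _).
- apply: ler_sum => i _; rewrite -scalerN -scalerDr qZ ler_wpM2l ?wgt_ge0// ler_norm//.
- by move=> t; rewrite mulrA; exact: bdiff_q.
- by rewrite !mulr_ge0 ?opn_ge0 ?nrm_ge0.
Qed.

(** For [u = |h x|] and [v = |h' x|], [kdiff_q] reads [v^2 - u^2 <= 8 a u v] with [a = |X|], a
    quadratic inequality that forces [v <= (1 + 8 a) u]. *)
Lemma hop_pair x : nrm (h' x) <= (1 + 8 * opn X) * nrm (h x).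
have := kdiff_q x; rewrite !q_k; have := nrm_ge0 (h x); have := nrm_ge0 (h' x); have := opn_ge0 X.
rewrite -/h -/h'; move: (nrm (h x)) (nrm (h' x)) (opn X) => u v a a0 v0 u0 e.
rewrite leNgt; apply/negP => lt.
have h0 : 0 <= 8 * a * u by apply: mulr_ge0 => //; exact: mulr_ge0.
have h1 : 0 < v * (v - (1 + 8 * a) * u) by apply: mulr_gt0; lra.
have h2 : 0 <= u * (v - u) by apply: mulr_ge0 => //; lra.
nra.
Qed.

End PairEstimates.

Lemma opn_mul1 (S T : op E) a : opn S <= a -> opn T <= 1 -> opn (S * T) <= a.
move=> Sa T1; apply: (le_trans (opnM _ _)); rewrite -[leRHS]mulr1.
by apply: ler_pM; rewrite ?opn_ge0.
Qed.

Lemma opn_mul2 (S T : op E) a b : opn S <= a -> opn T <= b -> opn (S * T) <= a * b.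
by move=> Sa Tb; apply: (le_trans (opnM _ _)); apply: ler_pM; rewrite ?opn_ge0. Qed.
Lemma opnD_le (S T : op E) a b : opn S <= a -> opn T <= b -> opn (S + T) <= a + b.
by move=> Sa Tb; apply: (le_trans (opnD _ _)); exact: lerD. Qed.
Lemma opnB_le (S T : op E) a b : opn S <= a -> opn T <= b -> opn (S - T) <= a + b.
by move=> Sa Tb; apply: (le_trans (opnB _ _)); exact: lerD. Qed.

(* With [d = F' - F] and [e = K' - K], the relations [F K = Z] and [K K = Y] give
  [d K = (Z' - Z) - F e - d e] and [e K + K e = (Y' - Y) - e e]; the resolvent differences
  are explicit and, by cyclicity, [F e] contributes half of [e K + K e]. *)
Lemma transform_exp (F K Y Z F' K' Y' Z' X S : op E) x :
 inN A F -> inN A K -> inN A F' -> inN A K' -> inN A X -> fp A S ->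
 opn F <= 1 -> opn K <= 1 -> opn Y <= 1 -> opn Z <= 1 -> opn Y' <= 1 -> opn Z' <= 1 -> opn X <= x ->
 F * K = Z -> K * K = Y -> F' * K' = Z' -> K' * K' = Y' ->
 F * K = K * F -> F * S = S * F -> K * S = S * K ->
 Z' - Z = Y' * X * Y - Z' * X * Z -> Y' - Y = - (Z' * X * Y + Y' * X * Z) ->
 opn (F' - F) <= 8 * x -> opn (K' - K) <= 8 * x ->
 `|rtr A ((F' - F) * (Y * S)) - rtr A (X * ((Y * Y * K - Z * Z * K + Y * Z * F) * S))| <=
  102 * x ^+ 2 * tr A S.
move=> nF nK nF' nK' nX fS F1 K1 Y1 Z1 Y1' Z1' Xx ZE YE ZE' YE' FK FS KS dZ dY dF dK.
have nY : inN A Y by rewrite -YE; exact: inNM.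
have nZ : inN A Z by rewrite -ZE; exact: inNM.
have nY' : inN A Y' by rewrite -YE'; exact: inNM.
have nZ' : inN A Z' by rewrite -ZE'; exact: inNM.
have x0 : 0 <= x by apply: le_trans Xx; exact: opn_ge0.
have YS : Y * S = S * Y by rewrite -YE -mulrA KS mulrA KS -mulrA.
have ZS : Z * S = S * Z by rewrite -ZE -mulrA KS mulrA FS -mulrA.
have lS W : inN A W -> L1 A (W * S) by move=> nW; apply: L1Ml => //; exact: fp_L1.
have cyc U W : inN A U -> inN A W -> U * S = S * U -> rtr A (U * W * S) = rtr A (W * U * S).
 by move=> nU nW US; rewrite -mulrA rtrC//; [rewrite -!mulrA US|exact: lS].
have tS : 0 <= tr A S by exact: tr_ge0.
have bS W c : inN A W -> opn W <= c -> `|rtr A (W * S)| <= c * tr A S.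
 by move=> nW Wc; apply: (le_trans (rtr_bound nW fS)); exact: ler_wpM2r.
have [d d_E] := opaque (F' - F : op E); have [e e_E] := opaque (K' - K : op E).
have nd : inN A d by rewrite d_E; exact: inNB.
have ne : inN A e by rewrite e_E; exact: inNB.
have [G1 G1E] := opaque (Z' - Z : op E); have [G2 G2E] := opaque (Y' - Y : op E).
rewrite -d_E in dF *; rewrite -e_E in dK; rewrite -G1E in dZ; rewrite -G2E in dY.
have nG1 : inN A G1 by rewrite G1E; exact: inNB.
have nG2 : inN A G2 by rewrite G2E; exact: inNB.
have bXYZ U V : opn U <= 1 -> opn V <= 1 -> opn (U * X * V) <= x.
 by move=> U1 V1; apply: opn_mul1 => //; rewrite -[leRHS]mul1r; exact: opn_mul2.
have bG1 : opn G1 <= x + x by rewrite dZ; apply: opnB_le; exact: bXYZ.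
have bG2 : opn G2 <= x + x by rewrite dY opnN; apply: opnD_le; exact: bXYZ.
have rel1 : d * K = G1 - F * e - d * e.
 by rewrite G1E -ZE -ZE' d_E e_E; opring.
have rel2 : e * K + K * e = G2 - e * e.
 by rewrite G2E -YE -YE' e_E; opring.
have [r1 r1E] := opaque (G2 * X * Y - G1 * X * Z : op E).
have [r2 r2E] := opaque (- (G1 * X * Y + G2 * X * Z) : op E).
have nr1 : inN A r1 by rewrite r1E; apply: inNB; do 2![apply: inNM => //].
have nr2 : inN A r2 by rewrite r2E; apply/inNN/inND; do 2![apply: inNM => //].
have bGX G U : opn G <= x + x -> opn U <= 1 -> opn (G * X * U) <= (x + x) * x.
 by move=> hG hU; apply: opn_mul1 => //; exact: opn_mul2.
have br1 : opn r1 <= (x + x) * x + (x + x) * x by rewrite r1E; apply: opnB_le; exact: bGX.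
have br2 : opn r2 <= (x + x) * x + (x + x) * x by rewrite r2E opnN; apply: opnD_le; exact: bGX.
have e1 : G1 = Y * X * Y - Z * X * Z + r1 by rewrite {1}dZ r1E G1E G2E; opring.
have e2 : G2 = - (Z * X * Y + Y * X * Z) + r2 by rewrite {1}dY r2E G1E G2E; opring.
have ZK : Z * K = K * Z by rewrite -ZE mulrA -FK.
have YF : Y * F = F * Y by rewrite -YE -mulrA -FK mulrA -FK -mulrA.
have YZ : Y * Z = Z * Y by rewrite -ZE mulrA YF -!mulrA; congr (_ * _); rewrite -YE -mulrA.
have ZF : Z * F = F * Z by rewrite -ZE -mulrA -FK.
have N3 U V W : inN A U -> inN A V -> inN A W -> inN A (U * V * W).
 by move=> h1 h2 h3; apply: inNM => //; exact: inNM.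
have cyc4 U W V T : inN A U -> inN A W -> inN A V -> inN A T -> U * S = S * U ->
  rtr A (U * W * V * T * S) = rtr A (W * (V * T * U * S)).
 move=> nU nW nV nT US; have -> : U * W * V * T * S = U * (W * V * T) * S by rewrite !mulrA.
 by rewrite (cyc _ _ nU (N3 _ _ _ nW nV nT) US) !mulrA.
have hF : rtr A (F * e * K * S) = 2^-1 * rtr A ((G2 - e * e) * F * S).
 rewrite -rel2 mulrDl mulrDl rtrD; try exact/lS/N3.
 have -> : rtr A (K * e * F * S) = rtr A (e * K * F * S).
  by rewrite -(mulrA K) cyc//; [rewrite -(mulrA e F K) FK mulrA|exact: inNM].
 rewrite -(mulrA F e K) cyc//; last exact: inNM.
 by move: (rtr A _) => t; field.
have E1 : rtr A (d * (Y * S)) = rtr A (G1 * K * S) - rtr A (F * e * K * S) - rtr A (d * e * K * S).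
 have -> : d * (Y * S) = d * K * (K * S) by rewrite -YE !mulrA.
 rewrite rel1 mulrA !mulrBl rtrB; [|by apply: L1B; apply: lS; [exact: inNM|exact: N3]|exact/lS/N3].
 rewrite rtrB; [reflexivity|exact/lS/inNM|exact/lS/N3].
have E2 : rtr A (G1 * K * S) = rtr A (X * (Y * Y * K * S)) - rtr A (X * (Z * Z * K * S)) + rtr A (r1 * K * S).
 rewrite {1}e1 mulrDl mulrBl mulrDl mulrBl rtrD; [|by apply: L1B; apply: lS; apply: inNM => //; exact: N3|exact/lS/inNM].
 rewrite rtrB; [|by apply: lS; apply: inNM => //; exact: N3|by apply: lS; apply: inNM => //; exact: N3].
 rewrite !cyc4//; congr (rtr A (X * (_ * S)) - rtr A (X * (_ * S)) + _).
  by rewrite -YE !mulrA.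
 by rewrite -mulrA -ZK mulrA.
have E3 : rtr A ((G2 - e * e) * F * S) =
  - (2 * rtr A (X * (Y * Z * F * S))) + rtr A (r2 * F * S) - rtr A (e * e * F * S).
 rewrite mulrBl mulrBl rtrB; [|exact/lS/inNM|exact/lS/N3].
 congr (_ - _); rewrite {1}e2 mulrDl mulrDl rtrD; [|by apply: lS; apply: inNM => //; apply/inNN/inND; exact: N3|exact/lS/inNM].
 congr (_ + _); rewrite !mulNr rtrN; last by apply: lS; apply: inNM => //; apply: inND; exact: N3.
 congr (- _); rewrite mulrDl mulrDl rtrD; [|by apply: lS; apply: inNM => //; exact: N3|by apply: lS; apply: inNM => //; exact: N3].
 have -> : rtr A (Z * X * Y * F * S) = rtr A (X * (Y * Z * F * S)).
  by rewrite cyc4//; congr (rtr A (X * (_ * S))); rewrite -mulrA -ZF mulrA.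
 have -> : rtr A (Y * X * Z * F * S) = rtr A (X * (Y * Z * F * S)).
  by rewrite cyc4//; congr (rtr A (X * (_ * S))); rewrite -mulrA -YF mulrA YZ.
 by move: (rtr A _) => t; ring.
have E4 : rtr A (X * ((Y * Y * K - Z * Z * K + Y * Z * F) * S)) =
  rtr A (X * (Y * Y * K * S)) - rtr A (X * (Z * Z * K * S)) + rtr A (X * (Y * Z * F * S)).
 rewrite mulrDl mulrBl mulrDr mulrBr rtrD; [|by apply: L1B; apply: L1Ml => //; apply: lS; exact: N3|by apply: L1Ml => //; apply: lS; exact: N3].
 rewrite rtrB; [reflexivity|apply: (L1Ml nX); apply: lS; exact: N3|apply: (L1Ml nX); apply: lS; exact: N3].
rewrite E1 hF E2 E3 E4.
have b1 : `|rtr A (r1 * K * S)| <= ((x + x) * x + (x + x) * x) * tr A S.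
 by apply: bS; [exact: inNM|exact: opn_mul1].
have b2 : `|rtr A (r2 * F * S)| <= ((x + x) * x + (x + x) * x) * tr A S.
 by apply: bS; [exact: inNM|exact: opn_mul1].
have b3 : `|rtr A (e * e * F * S)| <= (8 * x) * (8 * x) * tr A S.
 apply: bS; [exact: N3|exact: (opn_mul1 (opn_mul2 dK dK) F1)].
have b4 : `|rtr A (d * e * K * S)| <= (8 * x) * (8 * x) * tr A S.
 apply: bS; [exact: N3|exact: (opn_mul1 (opn_mul2 dF dK) K1)].
(* Used with [a = 4 x^2 tr S] and [b = 64 x^2 tr S]; the sum [3 / 2 (a + b)] is the 102 of the
   statement. *)
have fin (t1 t2 t3 s1 s2 s3 s4 y a b : R) : `|s1| <= a -> `|s2| <= a -> `|s3| <= b -> `|s4| <= b ->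
  a + 2^-1 * a + 2^-1 * b + b = y ->
  `|t1 - t2 + s1 - 2^-1 * (- (2 * t3) + s2 - s3) - s4 - (t1 - t2 + t3)| <= y.
 move=> /ler_normlP [h1 h1'] /ler_normlP [h2 h2'] /ler_normlP [h3 h3'] /ler_normlP [h4 h4'] <-.
 by apply/ler_normlP; split; lra.
by apply: (fin _ _ _ _ _ _ _ _ _ _ b1 b2 b3 b4); move: (tr A S) => t; field.
Qed.

(** * Functions of [D0 + T] for self-adjoint [T] in the algebra *)

Definition aN (T : op E) := sa T /\ inN A T.

Lemma aN0 : aN 0. by split; [exact: sa0|exact: inN0]. Qed.
Lemma aND S T : aN S -> aN T -> aN (S + T).
by move=> [? ?] [? ?]; split; [exact: saD|exact: inND]. Qed.
Lemma aNB S T : aN S -> aN T -> aN (S - T).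
by move=> [? ?] [? ?]; split; [exact: saB|exact: inNB]. Qed.
Lemma aNZ c T : aN T -> aN (c *: T).
by move=> [? ?]; split; [exact: saZ|exact: inNZ]. Qed.

Definition DA (T : op E) := perturb D0 (opf T).

(** The spectral measure of [D0 + T], so that [fA T f] below is [f (D0 + T)]; [P0] is a default
    value for [T] not self-adjoint. *)
Definition PA (T : op E) : pvm E :=
 if pselect (sa T) is left h then specp (perturb_usa sD0 h) else P0.

Lemma PA_specp T (h : usa (DA T)) : sa T -> PA T = specp h.
move=> sT; rewrite /PA; case: pselect => [k|/(_ sT) []].
by rewrite (Prop_irrelevance h (perturb_usa sD0 k)).
Qed.

Lemma PA_of T : sa T -> pvm_of (DA T) (PA T).
by move=> sT; rewrite (PA_specp (perturb_usa sD0 sT))//; exact: specp_pvm_of. Qed.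

Definition fA (T : op E) (f : R -> R) : op E := fc (PA T) f.

Lemma fA_N T f : aN T -> bm f -> inN A (fA T f).
move=> [sT nT] bf; rewrite /fA (PA_specp (perturb_usa sD0 sT))//; apply: fc_inN => //.
exact: perturb_aff.
Qed.

Lemma PA_N T : aN T -> pvmN A (PA T).
by move=> aT B mB; rewrite -fc_ind//; apply: (fA_N aT); exact: bm_ind. Qed.

Lemma DA_step (T X : op E) : (forall x, dom (DA (T + X)) x <-> dom (DA T) x) /\
 (forall x, dom (DA T) x -> DA (T + X) x = DA T x + X x).
by split=> // x _; rewrite /DA /= opDE addrA. Qed.

Lemma DA_base (T : op E) : (forall x, dom (DA T) x <-> dom D0 x) /\
 (forall x, dom D0 x -> DA T x = D0 x + T x).
by []. Qed.

Lemma P0_of : pvm_of D0 P0. exact: specp_pvm_of. Qed.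

Lemma hop_A T x : sa T -> nrm (fA T hfun x) <= (1 + 8 * opn T) * nrm (hop x).
move=> sT; have [d1 d2] := DA_base T.
exact: (hop_pair sD0 (perturb_usa sD0 sT) P0_of (PA_of sT) d1 d2).
Qed.

Section Step.
Variables (T X : op E) (aT : aN T) (aX : aN X).
Let sT : sa T. by case: aT. Qed.
Let sTX : sa (T + X). by apply: saD => //; case: aX. Qed.

Lemma FA_nrm x : nrm ((fA (T + X) Ffun - fA T Ffun) x) <= 8 * opn X * nrm (fA T hfun x).
have [d1 d2] := DA_step T X.
exact: (Fdiff_nrm (perturb_usa sD0 sT) (perturb_usa sD0 sTX) (PA_of sT) (PA_of sTX) d1 d2).
Qed.

Lemma fA_hfun_le Y x : nrm (fA Y hfun x) <= nrm x.
have h : opn (fA Y hfun) <= 1.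
 apply: fc_opn => [|l]; first exact: bm_hfun.
 by rewrite ger0_norm ?hfun_le1// ltW// hfun_gt0.
by apply: (le_trans (opn_le _ _)); rewrite ler_piMl ?nrm_ge0.
Qed.

Lemma FA_opn : opn (fA (T + X) Ffun - fA T Ffun) <= 8 * opn X.
apply: opn_lub => [|x]; first by rewrite mulr_ge0 ?opn_ge0.
by apply: (le_trans (FA_nrm x)); rewrite ler_wpM2l ?mulr_ge0 ?opn_ge0// fA_hfun_le.
Qed.

Lemma kA_opn : opn (fA (T + X) kfun - fA T kfun) <= 8 * opn X.
apply: opn_lub => [|x]; first by rewrite mulr_ge0 ?opn_ge0.
have [d1 d2] := DA_step T X.
have := kdiff_nrm (perturb_usa sD0 sT) (perturb_usa sD0 sTX) (PA_of sT) (PA_of sTX) d1 d2 x.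
by move=> /le_trans; apply; rewrite ler_wpM2l ?mulr_ge0 ?opn_ge0//; exact: fA_hfun_le.
Qed.

Lemma FA_Kc : Kc (8 * opn X * (1 + 8 * opn T)) (fA (T + X) Ffun - fA T Ffun).
have aTX : aN (T + X) by exact: aND.
split=> [|x]; first by apply: inNB; apply: fA_N => //; exact: bm_Ffun.
apply: (le_trans (FA_nrm x)); rewrite -[leRHS]mulrA ler_wpM2l ?mulr_ge0 ?opn_ge0//; exact: hop_A.
Qed.

Lemma ZA_step : fA (T + X) (cfun 1) - fA T (cfun 1) =
 fA (T + X) (bfun 1) * X * fA T (bfun 1) - fA (T + X) (cfun 1) * X * fA T (cfun 1).
have [d1 d2] := DA_step T X.
have := resolvent_c (perturb_usa sD0 sT) (perturb_usa sD0 sTX) (PA_of sT) (PA_of sTX) d1 d2 ltr01.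
by rewrite scale1r.
Qed.

Lemma YA_step : fA (T + X) (bfun 1) - fA T (bfun 1) =
 - (fA (T + X) (cfun 1) * X * fA T (bfun 1) + fA (T + X) (bfun 1) * X * fA T (cfun 1)).
have [d1 d2] := DA_step T X.
exact: (resolvent_b (perturb_usa sD0 sT) (perturb_usa sD0 sTX) (PA_of sT) (PA_of sTX) d1 d2 ltr01).
Qed.

End Step.

Lemma aff_FA T M : aN T -> opn T <= M -> aff (8 * M) (fA T Ffun).
move=> aT TM; have [sT nT] := aT; have bF := bm_Ffun; split; first exact: fc_sa.
 exact: fA_N.
split=> [|x]; first by apply: inNB; [exact: fA_N|exact: fc_inN].
have [d1 d2] := DA_base T.
apply: (le_trans (Fdiff_nrm sD0 (perturb_usa sD0 sT) P0_of (PA_of sT) d1 d2 x)).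
by rewrite ler_wpM2r ?nrm_ge0// ler_wpM2l.
Qed.

Lemma bfun1 : bfun 1 = ufun. by apply/funext => l; rewrite /bfun addrC. Qed.
Lemma kfun_sq l : kfun l ^+ 2 = ufun l. by rewrite -hfun2 -exprM hfun4. Qed.
Lemma cfun1 l : cfun 1 l = Ffun l * kfun l.
by rewrite /Ffun -/(kfun l) -mulrA -expr2 kfun_sq /cfun /ufun addrC. Qed.
Lemma n_gt1 : (1 < n)%N.
by apply: leq_trans n_ge; rewrite (@leq_add 1 1)// addn_gt0 m0_gt0. Qed.

Lemma m0_pred : (m0 + m0 <= n.-1)%N.
rewrite -ltnS prednK ?(ltnW n_gt1)//; apply: leq_trans n_ge.
by rewrite -[X in (X < _)%N]addn0 ltn_add2l addn_gt0 m0_gt0.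
Qed.

(** In [kk = uo * uo ^ (n - 1)] the second factor is still trace class, uniformly for [opn T <= M].
    It is the [S] of [transform_exp], the first factor being left for the expansion. *)
Lemma psi_bound M : 0 <= M -> exists2 C, 0 <= C & forall T, aN T -> opn T <= M ->
 fp A (fA T (fun l => ufun l ^+ n.-1)) /\ tr A (fA T (fun l => ufun l ^+ n.-1)) <= C.
move=> M0; have M80 : 0 <= 8 * M by rewrite mulr_ge0.
have [C CE] := opaque (Kth * opn (1 : op E) * (cu (8 * M) ^+ n.-1)).
exists C.
 rewrite CE; apply: mulr_ge0; first by apply: mulr_ge0; [exact: Kth_ge0|exact: opn_ge0].
 by apply: exprn_ge0; exact: cu_ge0.
move=> T aT TM; have hF := aff_FA aT TM; have bu := bm_ufun.
have e : fA T (fun l => ufun l ^+ n.-1) = uo (fA T Ffun) ^+ n.-1 by rewrite uo_fc /fA fcX.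
have w : wd (m0 + m0) (cu (8 * M) ^+ n.-1) (fA T (fun l => ufun l ^+ n.-1)).
 rewrite e; have := wdX n.-1 (uo_wd M80 hF); rewrite muln1 => /wd_drop; apply; exact: m0_pred.
have [l1 b1] := wd_tr w (inN1 A).
have pT : psd (fA T (fun l => ufun l ^+ n.-1)).
 apply: fc_psd => [|l]; first exact: bmX.
 by rewrite exprn_ge0// ltW// ufun_gt0.
have f1 := L1_psd l1 pT; split=> //.
by move: b1; rewrite mul1r rtr_fp// -CE => /(le_trans (ler_norm _)).
Qed.

(** [kfun ^ 3] is the derivative of [Ffun], so [gfun] is the density of [(1 - F^2)^n dF] with
    [F = Ffun l]. *)
Definition gfun (l : R) : R := ufun l ^+ n * kfun l ^+ 3.

Lemma bm_gfun : bm gfun.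
by apply: bmM; apply: bmX; [exact: bm_ufun|exact: bm_kfun]. Qed.

(** [transform_exp] with [Y = u], [Z = F k] and [S = u^(n - 1)]. In its linear term the two
    contributions containing [F^2] cancel, and [u^(n + 1) k = gfun] remains. *)
Lemma FA_exp M : 0 <= M -> exists2 K, 0 <= K & forall T X, aN T -> aN X -> opn T <= M ->
 `|rtr A ((fA (T + X) Ffun - fA T Ffun) * kk (fA T Ffun)) - rtr A (X * fA T gfun)| <= K * opn X ^+ 2.
move=> M0; have [C C0 hC] := psi_bound M0; exists (102 * C); first exact: mulr_ge0.
move=> T X aT aX TM; have aTX : aN (T + X) by exact: aND.
have [fS tS] := hC T aT TM; have bF := bm_Ffun; have bk := bm_kfun; have bu := bm_ufun.
have bc : bm (cfun 1) by exact: bm_cfun ltr01.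
have bS := bmX n.-1 bu.
have FK (Q : pvm E) : fc Q Ffun * fc Q kfun = fc Q (cfun 1).
 by rewrite -fcM//; congr fc; apply/funext => l; rewrite cfun1.
have KK (Q : pvm E) : fc Q kfun * fc Q kfun = fc Q ufun.
 by rewrite -fcM//; congr fc; apply/funext => l; rewrite -expr2 kfun_sq.
have o1 (Q : pvm E) (f : R -> R) : bm f -> (forall l, `|f l| <= 1) -> opn (fc Q f) <= 1 by move=> bf hf; exact: fc_opn.
have k1 l : `|kfun l| <= 1 by rewrite ger0_norm ?kfun_le1// ltW// kfun_gt0.
have u1 l : `|ufun l| <= 1 by rewrite ger0_norm ?ufun_le1// ltW// ufun_gt0.
have c1 l : `|cfun 1 l| <= 1.
 by rewrite cfun1 normrM (le_trans (ler_pM _ _ (Ffun_le1 l) (k1 l)))// mulr1.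
have h := @transform_exp (fA T Ffun) (fA T kfun) (fA T ufun) (fA T (cfun 1))
 (fA (T + X) Ffun) (fA (T + X) kfun) (fA (T + X) ufun) (fA (T + X) (cfun 1)) X
 (fA T (fun l => ufun l ^+ n.-1)) (opn X)
 (fA_N aT bF) (fA_N aT bk) (fA_N aTX bF) (fA_N aTX bk) aX.2 fS
 (o1 _ _ bF Ffun_le1) (o1 _ _ bk k1) (o1 _ _ bu u1) (o1 _ _ bc c1) (o1 _ _ bu u1) (o1 _ _ bc c1)
 (lexx _) (FK _) (KK _) (FK _) (KK _) (fcC _ bF bk) (fcC _ bF bS) (fcC _ bk bS).
have hZ := ZA_step aT aX; have hY := YA_step aT aX; rewrite bfun1 in hZ hY.
have {}h := h hZ hY (FA_opn aT aX) (kA_opn aT aX).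
have e1 : fA T ufun * fA T (fun l => ufun l ^+ n.-1) = kk (fA T Ffun).
 rewrite /kk uo_fc /fA -fcX// -fcM//; congr fc; apply/funext => l.
 by rewrite -exprS prednK// (ltnW n_gt1).
have e2 : (fA T ufun * fA T ufun * fA T kfun - fA T (cfun 1) * fA T (cfun 1) * fA T kfun +
   fA T ufun * fA T (cfun 1) * fA T Ffun) * fA T (fun l => ufun l ^+ n.-1) = fA T gfun.
 have b1 := bmM bu bu; have b2 := bmM b1 bk; have b3 := bmM bc bc; have b4 := bmM b3 bk.
 have b5 := bmM bu bc; have b6 := bmM b5 bF; have b7 := bmB b2 b4; have b8 := bmD b7 b6.
 rewrite /fA -!fcM// -fcB// -fcD// -fcM//; congr fc; apply/funext => l.
 have -> : gfun l = ufun l * ufun l ^+ n.-1 * kfun l ^+ 3.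
  by rewrite /gfun -exprS prednK// (ltnW n_gt1).
 rewrite cfun1; move: (ufun l ^+ n.-1) => w; rewrite -(kfun_sq l).
 by move: (Ffun l) (kfun l) => x y; ring.
rewrite e1 e2 in h; apply: (le_trans h).
rewrite mulrAC ler_wpM2r ?sqr_ge0// ler_wpM2l//.
Qed.

(** * Potentials of the forms [tau (X g(D0 + T))] *)

Lemma real_complete (u : nat -> R) :
 (forall e : R, 0 < e -> exists N, forall n m, (N <= n)%N -> (N <= m)%N -> `|u n - u m| < e) ->
 exists l : R, u @ \oo --> l.
move=> h; have /cvg_ex[l ul] : cvgn u.
 apply/cauchy_cvgP/cauchy_ballP => e e0; have [N hN] := h e e0.
 exists (u @` [set n | (N <= n)%N], u @` [set n | (N <= n)%N]) => /=.
  by split; exists N => // i Ni /=; exists i.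
 by move=> [_ _] [/= [i Ni <-] [m Nm <-]]; rewrite -ball_normE /= hN.
by exists l.
Qed.

(* [tc g]: every [g(D0 + T)] is trace class; [pot f g]: [f] is a potential of the one-form
  [lA g], uniformly differentiable on bounded sets. *)
Definition tc (g : R -> R) := bm g /\ forall T, aN T -> L1 A (fA T g).
Definition lA (g : R -> R) (T X : op E) : R := rtr A (X * fA T g).
Definition pot (f : op E -> R) (g : R -> R) := forall M e, 0 < e -> exists2 d, 0 < d &
 forall T X, aN T -> aN X -> opn T <= M -> opn X <= d -> `|f (T + X) - f T - lA g T X| <= e * opn X.

Lemma lA_D g T X Y : tc g -> aN T -> aN X -> aN Y -> lA g T (X + Y) = lA g T X + lA g T Y.
move=> [_ hg] aT aX aY; rewrite /lA mulrDl rtrD//; apply: L1Ml; [exact: aX.2|exact: hg|exact: aY.2|exact: hg].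
Qed.

Lemma lA_Z g T X c : tc g -> aN T -> aN X -> lA g T (c *: X) = c * lA g T X.
by move=> [_ hg] aT aX; rewrite /lA -opZAl rtrZ//; apply: L1Ml; [exact: aX.2|exact: hg]. Qed.

Lemma L1_bound T : L1 A T -> exists2 C, 0 <= C & forall X, inN A X -> `|rtr A (X * T)| <= C * opn X.
move=> [P1 [P2 [P3 [P4 [[h1 h2] [h3 h4] ->]]]]].
have tp P : fp A P -> 0 <= tr A P by exact: tr_ge0.
exists (tr A P1 + tr A P2 + (tr A P3 + tr A P4)).
 by apply: addr_ge0; apply: addr_ge0; exact: tp.
move=> X nX; have l1 Q : fp A Q -> L1 A (X * Q) by move=> fQ; apply: L1Ml => //; exact: fp_L1.
have nXJ : inN A (X * opJ) by apply: inNM => //; exact: inNJ.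
have l2 Q : fp A Q -> L1 A (X * opJ * Q) by move=> fQ; apply: L1Ml => //; exact: fp_L1.
have -> : X * (P1 - P2 + opJ * (P3 - P4)) = X * P1 - X * P2 + (X * opJ * P3 - X * opJ * P4).
 by rewrite mulrDr mulrBr mulrA mulrBr.
rewrite rtrD; [|exact: L1B (l1 _ h1) (l1 _ h2)|exact: L1B (l2 _ h3) (l2 _ h4)].
rewrite (rtrB (l1 _ h1) (l1 _ h2)) (rtrB (l2 _ h3) (l2 _ h4)).
have b1 Q : fp A Q -> `|rtr A (X * Q)| <= opn X * tr A Q by exact: rtr_bound.
have oJ : opn (X * opJ) <= opn X.
 apply: opn_mul1 => //; apply: opn_lub => // x; by rewrite mul1r nrm_iv.
have b2 Q : fp A Q -> `|rtr A (X * opJ * Q)| <= opn X * tr A Q.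
 by move=> fQ; apply: (le_trans (rtr_bound nXJ fQ)); rewrite ler_wpM2r ?tp.
have fin (x1 x2 x3 x4 y t1 t2 t3 t4 : R) : `|x1| <= y * t1 -> `|x2| <= y * t2 -> `|x3| <= y * t3 ->
  `|x4| <= y * t4 -> `|x1 - x2 + (x3 - x4)| <= (t1 + t2 + (t3 + t4)) * y.
 move=> /ler_normlP [? ?] /ler_normlP [? ?] /ler_normlP [? ?] /ler_normlP [? ?].
 by apply/ler_normlP; split; lra.
apply: fin; [exact: b1|exact: b1|exact: b2|exact: b2].
Qed.

Lemma lA_bound g T : tc g -> aN T -> exists2 C, 0 <= C & forall X, aN X -> `|lA g T X| <= C * opn X.
by move=> [_ hg] aT; have [C C0 hC] := L1_bound (hg T aT); exists C => // X aX; exact: hC aX.2.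
Qed.

Lemma pot_line f g T X (t : R) : tc g -> pot f g -> aN T -> aN X ->
 is_derive t 1 (fun s => f (T + s *: X)) (lA g (T + t *: X) X).
move=> tg pf aT aX; apply: is_derive_lin => e e0.
have aTt : aN (T + t *: X) by apply: aND => //; exact: aNZ.
have e0' : 0 < e / (opn X + 1) by rewrite divr_gt0// ltr_wpDl// opn_ge0.
have [d d0 hd] := pf (opn (T + t *: X)) _ e0'.
have x1 : 0 < opn X + 1 by rewrite ltr_wpDl// opn_ge0.
exists (d / (opn X + 1)); first by rewrite divr_gt0.
move=> h hh; have hX : opn (h *: X) <= d.
 apply: (le_trans (opnZ _ _)); rewrite ltr_pdivlMr// in hh; apply: le_trans (ltW hh).
 by rewrite ler_wpM2l// lerDl.
have := hd _ (h *: X) aTt (aNZ h aX) (lexx _) hX.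
have -> : T + t *: X + h *: X = T + (h + t) *: X by rewrite -addrA -scalerDl (addrC t).
rewrite lA_Z// => /le_trans; apply.
rewrite mulrAC ler_pdivrMr// -mulrA ler_wpM2l ?(ltW e0)// (le_trans (opnZ _ _))// ler_wpM2l// lerDl//.
Qed.

Lemma opn_segment (T X : op E) M t : opn T <= M -> opn (T + X) <= M -> 0 <= t <= 1 -> opn (T + t *: X) <= M.
move=> h1 h2 /andP[t0 t1].
have -> : T + t *: X = (1 - t) *: T + t *: (T + X).
 by rewrite scalerBl scale1r scalerDr addrA subrK.
have -> : M = `|1 - t| * M + `|t| * M by rewrite !ger0_norm ?subr_ge0//; ring.
by apply: (le_trans (opnD _ _)); apply: lerD; apply: (le_trans (opnZ _ _)); rewrite ler_wpM2l.
Qed.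

Lemma pot_mvt f1 f2 g1 g2 M c T X : tc g1 -> tc g2 -> pot f1 g1 -> pot f2 g2 -> aN T -> aN X ->
 opn T <= M -> opn (T + X) <= M ->
 (forall S Y, aN S -> aN Y -> opn S <= M -> `|lA g1 S Y - lA g2 S Y| <= c * opn Y) ->
 `|(f1 (T + X) - f1 T) - (f2 (T + X) - f2 T)| <= c * opn X.
move=> t1 t2 p1 p2 aT aX TM TXM hc.
have hd (t : R) : is_derive t 1 (fun s => f1 (T + s *: X) - f2 (T + s *: X))
  (lA g1 (T + t *: X) X - lA g2 (T + t *: X) X).
 by apply: is_deriveB; exact: pot_line.
have hc1 : {within `[0, 1], continuous (fun s : R => f1 (T + s *: X) - f2 (T + s *: X))}.
 by apply: derivable_within_continuous => t _; have := hd t => -[].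
have [t ht] := MVT ltr01 (fun t _ => hd t) hc1.
rewrite scale1r scale0r addr0 subr0 mulr1 => e.
have -> : f1 (T + X) - f1 T - (f2 (T + X) - f2 T) = f1 (T + X) - f2 (T + X) - (f1 T - f2 T) by ring.
rewrite e; apply: hc => //; first by apply: aND => //; exact: aNZ.
by apply: opn_segment => //; move: ht; rewrite in_itv /= => /andP[? ?]; rewrite !ltW.
Qed.

Lemma pot_quad f g : (forall M, 0 <= M -> exists2 C, 0 <= C & forall T X, aN T -> aN X -> opn T <= M ->
  opn X <= 1 -> `|f (T + X) - f T - lA g T X| <= C * opn X ^+ 2) -> pot f g.
move=> h M e e0; have M0 : 0 <= Num.max M 0 by rewrite le_max lexx orbT.
have [C C0 hC] := h _ M0.
have C1 : 0 < C + 1 by rewrite ltr_wpDl.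
exists (Num.min 1 (e / (C + 1))); first by rewrite lt_min ltr01 divr_gt0.
move=> T X aT aX TM; rewrite le_min => /andP[x1 x2].
apply: (le_trans (hC T X aT aX _ x1)); first by rewrite le_max TM.
rewrite expr2 mulrA ler_wpM2r ?opn_ge0//; rewrite ler_pdivlMr// mulrC in x2; apply: le_trans x2.
by rewrite ler_wpM2r ?opn_ge0// lerDl.
Qed.

Lemma tcD g1 g2 : tc g1 -> tc g2 -> tc (fun l => g1 l + g2 l).
move=> [b1 h1] [b2 h2]; split=> [|T aT]; first exact: bmD.
by rewrite /fA fcD//; apply: L1D; [exact: h1|exact: h2].
Qed.

Lemma tcZ c g : tc g -> tc (fun l => c * g l).
by move=> [b h]; split=> [|T aT]; [exact: bmZ|rewrite /fA fcZ//; apply: L1Z; exact: h].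
Qed.

Lemma lA_gD g1 g2 T X : tc g1 -> tc g2 -> aN T -> aN X -> lA (fun l => g1 l + g2 l) T X = lA g1 T X + lA g2 T X.
move=> [b1 h1] [b2 h2] aT aX; rewrite /lA /fA fcD// mulrDr rtrD//; apply: L1Ml; [exact: aX.2|exact: h1|exact: aX.2|exact: h2].
Qed.

Lemma lA_gZ c g T X : tc g -> aN T -> aN X -> lA (fun l => c * g l) T X = c * lA g T X.
by move=> [b h] aT aX; rewrite /lA /fA fcZ// -opZAr rtrZ//; apply: L1Ml; [exact: aX.2|exact: h].
Qed.

Lemma potD f1 f2 g1 g2 : tc g1 -> tc g2 -> pot f1 g1 -> pot f2 g2 ->
 pot (fun T => f1 T + f2 T) (fun l => g1 l + g2 l).
move=> t1 t2 p1 p2 M e e0; have e2 : 0 < e / 2 by rewrite divr_gt0.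
have [d1 d10 h1] := p1 M _ e2; have [d2 d20 h2] := p2 M _ e2.
exists (Num.min d1 d2) => [|T X aT aX TM]; first by rewrite lt_min d10.
rewrite le_min lA_gD// => /andP[x1 x2].
have := h1 T X aT aX TM x1; have := h2 T X aT aX TM x2.
move: (f1 _) (f1 T) (f2 _) (f2 T) (lA g1 T X) (lA g2 T X) (opn X) => a b c d u v w.
by move=> /ler_normlP [? ?] /ler_normlP [? ?]; apply/ler_normlP; split; lra.
Qed.

Lemma potZ c f g : tc g -> pot f g -> pot (fun T => c * f T) (fun l => c * g l).
move=> tg pf M e e0; have c1 : 0 < `|c| + 1 by rewrite ltr_wpDl.
have [d d0 h] := pf M (e / (`|c| + 1)) (divr_gt0 e0 c1).
exists d => // T X aT aX TM Xd; rewrite lA_gZ//; have := h T X aT aX TM Xd.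
move: (f _) (f T) (lA g T X) => a b u hh.
have -> : c * a - c * b - c * u = c * (a - b - u) by ring.
rewrite normrM; apply: (le_trans (ler_wpM2l (normr_ge0 c) hh)).
rewrite mulrA ler_wpM2r ?opn_ge0// mulrCA ler_piMr ?(ltW e0)//.
by rewrite ler_pdivrMr// mul1r lerDl.
Qed.

(* Polarization: the second difference of a potential is [o(|X| + |Y|)]. *)
Lemma pot_cont f g M e : tc g -> pot f g -> 0 < e -> exists2 d, 0 < d &
 forall T Y X, aN T -> aN Y -> aN X -> opn T <= M -> opn Y <= d ->
 `|lA g (T + Y) X - lA g T X| <= e * opn X.
move=> tg pf e0; have e4 : 0 < e / 4 by rewrite divr_gt0.
have [d d0 h] := pf (M + 1) _ e4.
exists (Num.min 1 (d / 2)); first by rewrite lt_min ltr01 divr_gt0.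
move=> T Y X aT aY aX TM; rewrite le_min => /andP[Y1 Yd].
have aTY : aN (T + Y) by exact: aND.
have M1 : opn T <= M + 1 by rewrite (le_trans TM)// lerDl.
have M2 : opn (T + Y) <= M + 1 by apply: opnD_le.
have [y0|y0] := leP (opn Y) 0.
 by rewrite (opn_eq0 y0) addr0 subrr normr0 mulr_ge0 ?opn_ge0// ltW.
have [x0|x0] := leP (opn X) 0.
 by rewrite (opn_eq0 x0) /lA !mul0r subrr normr0 mulr_ge0 ?opn_ge0// ltW.
have key Z : aN Z -> opn Z <= opn Y -> `|lA g (T + Y) Z - lA g T Z| <= e * opn Y.
 move=> aZ ZY; have d1 : opn Y + opn Y <= d by rewrite [leRHS]splitr; apply: lerD.
 have d2 : opn Y <= d by apply: le_trans d1; rewrite lerDl opn_ge0.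
 have Zd : opn Z <= d by exact: le_trans ZY d2.
 have YZ : opn (Y + Z) <= opn Y + opn Y by apply: opnD_le.
 have h1 := h _ Z aTY aZ M2 Zd.
 have h2 := h T (Y + Z) aT (aND aY aZ) M1 (le_trans YZ d1).
 have h3 := h T Y aT aY M1 d2.
 rewrite lA_D// addrA in h2.
 have w1 : e / 4 * opn Z <= e / 4 * opn Y by rewrite ler_wpM2l// ltW.
 have w2 : e / 4 * opn (Y + Z) <= e / 4 * (opn Y + opn Y) by rewrite ler_wpM2l// ltW.
 move: h1 h2 h3 w1 w2; move: (f (T + Y + Z)) (f (T + Y)) (f T) (lA _ _ _) (lA _ _ _) (lA _ _ _) => a b c u v w.
 move=> /ler_normlP [? ?] /ler_normlP [? ?] /ler_normlP [? ?] ? ?.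
 by apply/ler_normlP; split; lra.
(* [key] treats directions no longer than [Y]; by linearity of the form, rescaling [X] to the length
   of [Y] suffices. *)
have r0 : 0 <= opn Y / opn X by rewrite divr_ge0// ltW.
have := key ((opn Y / opn X) *: X) (aNZ _ aX) _.
rewrite !lA_Z// -mulrBr normrM (ger0_norm r0) => /(_ _) hh.
have hc : `|opn Y / opn X| * opn X <= opn Y by rewrite ger0_norm// divfK// gt_eqF.
have {hh} := hh (le_trans (opnZ _ _) hc).
rewrite mulrAC ler_pdivrMr// => hh; rewrite -(ler_pM2l y0); apply: (le_trans hh).
by rewrite -mulrA mulrCA.
Qed.

(** The limit is taken of the potentials normalized at 0. By the mean value inequality [pot_mvt],
    uniform convergence of the forms on bounded sets makes increments Cauchy relative to [opn X], so
    uniform differentiability survives. *)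
Lemma pot_lim (f : nat -> op E -> R) (gk : nat -> R -> R) g : (forall k, tc (gk k)) -> tc g ->
 (forall k, pot (f k) (gk k)) ->
 (forall M e, 0 < e -> exists K, forall k, (K <= k)%N -> forall T X, aN T -> aN X -> opn T <= M ->
   `|lA (gk k) T X - lA g T X| <= e * opn X) ->
 exists2 h, pot h g & forall T S, aN T -> aN S -> (fun k => f k T - f k S) @ \oo --> h T - h S.
move=> tk tg pk hk.
have kc M e : 0 < e -> exists K, forall k m, (K <= k)%N -> (K <= m)%N -> forall T X, aN T -> aN X ->
  opn T <= M -> opn (T + X) <= M ->
  `|(f k (T + X) - f k T) - (f m (T + X) - f m T)| <= e * opn X.
 move=> e0; have e2 : 0 < e / 2 by rewrite divr_gt0.
 have [K hK] := hk M _ e2; exists K => k m Kk Km T X aT aX TM TXM.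
 apply: (pot_mvt (tk k) (tk m) (pk k) (pk m) aT aX TM TXM) => S Y aS aY SM.
 have h1 := hK k Kk S Y aS aY SM; have h2 := hK m Km S Y aS aY SM.
 move: h1 h2; move: (lA _ _ _) (lA _ _ _) (lA _ _ _) (opn Y) => a b c y.
 by move=> /ler_normlP [? ?] /ler_normlP [? ?]; apply/ler_normlP; split; lra.
have opn0T (S : op E) : opn (0 : op E) <= opn S by rewrite opn0 opn_ge0.
have ex T : aN T -> exists l : R, (fun k => f k T - f k 0) @ \oo --> l.
 move=> aT; apply: real_complete => e e0.
 have t1 : 0 < opn T + 1 by rewrite ltr_wpDl// opn_ge0.
 have [K hK] := kc (opn T) (e / (opn T + 1)) (divr_gt0 e0 t1).
 exists K => k m Kk Km; have := hK k m Kk Km 0 T aN0 aT.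
 rewrite add0r => hh; have {}hh := hh (opn0T T) (lexx _).
 apply: (le_lt_trans hh); rewrite mulrAC ltr_pdivrMr// ltr_pM2l// ltrDl//.
pose h T := if pselect (aN T) is left aT then sval (cid (ex T aT)) else 0.
have hT T : aN T -> (fun k => f k T - f k 0) @ \oo --> h T.
 by move=> aT; rewrite /h; case: pselect => // a; exact: svalP (cid (ex T a)).
have hTS T S : aN T -> aN S -> (fun k => f k T - f k S) @ \oo --> h T - h S.
 move=> aT aS; have c := cvgB (hT T aT) (hT S aS).
 have e : (fun k => f k T - f k S) = (fun k => (f k T - f k 0) - (f k S - f k 0)).
  by apply/funext => k; ring.
 by rewrite e; apply: cvgB; exact: hT.
exists h => // M e e0; have e3 : 0 < e / 3 by rewrite divr_gt0.
have [K1 hK1] := kc (M + 1) _ e3; have [K2 hK2] := hk (M + 1) _ e3.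
pose k := maxn K1 K2; have [d d0 hd] := pk k (M + 1) _ e3.
exists (Num.min 1 d) => [|T X aT aX TM]; first by rewrite lt_min ltr01.
rewrite le_min => /andP[X1 Xd].
have TM1 : opn T <= M + 1 by rewrite (le_trans TM)// lerDl.
have TXM1 : opn (T + X) <= M + 1 by exact: opnD_le.
have h1 := hd T X aT aX TM1 Xd; have h2 := hK2 k (leq_maxr _ _) T X aT aX TM1.
have aTX := aND aT aX.
have h3 : `|(f k (T + X) - f k T) - (h (T + X) - h T)| <= e / 3 * opn X.
 have c : (fun m => `|(f k (T + X) - f k T) - (f m (T + X) - f m T)|) @ \oo -->
   `|(f k (T + X) - f k T) - (h (T + X) - h T)|.
  by apply: cvg_norm; apply: cvgB; [exact: cvg_cst|exact: hTS].
 apply: (ler_cvg_to c (cvg_cst (e / 3 * opn X))).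
 exists K1 => // m /= Km; exact: hK1 (leq_maxl _ _) Km T X aT aX TM1 TXM1.
move: h1 h2 h3; move: (f k (T + X)) (f k T) (h (T + X)) (h T) (lA _ _ _) (lA _ _ _) (opn X) => a b c' d' u v x.
move=> /ler_normlP [? ?] /ler_normlP [? ?] /ler_normlP [? ?]; apply/ler_normlP; split; lra.
Qed.

Lemma tc_gfun : tc gfun.
split=> [|T aT]; first exact: bm_gfun.
have bu := bm_ufun; have bk := bm_kfun; have bS := bmX n.-1 bu.
have b1 : bm (fun l => ufun l * kfun l ^+ 3) by apply: bmM => //; exact: bmX.
have [C _ hC] := psi_bound (opn_ge0 T); have [fS _] := hC T aT (lexx _).
have -> : fA T gfun = fA T (fun l => ufun l * kfun l ^+ 3) * fA T (fun l => ufun l ^+ n.-1).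
 rewrite /fA -fcM//; congr fc; apply/funext => l; rewrite /gfun -{1}(prednK (ltnW n_gt1)) exprS; ring.
by apply: L1Ml; [exact: fA_N|exact: fp_L1].
Qed.

(** Chain rule: [Psi_exp] in the direction [F(D0 + T + X) - F(D0 + T)], then [FA_exp] to express the
    result through [X]. *)
Lemma pot_Psi : pot (fun T => Psi F0 (fA T Ffun)) gfun.
apply: pot_quad => M M0.
have M1 : 0 <= 8 * (M + 1) * (1 + 8 * M).
 by apply: mulr_ge0; [apply: mulr_ge0 => //; exact: addr_ge0|apply: addr_ge0 => //; exact: mulr_ge0].
have [K1 K10 h1] := Psi_exp M1; have [K2 K20 h2] := FA_exp M0.
exists (K1 * (8 * (1 + 8 * M)) ^+ 2 + K2).
 by apply: addr_ge0 => //; apply: mulr_ge0 => //; exact: sqr_ge0.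
move=> T X aT aX TM X1; have aTX := aND aT aX.
have big : 8 * (M + 1) <= 8 * (M + 1) * (1 + 8 * M).
 by rewrite ler_peMr ?mulr_ge0 ?addr_ge0// lerDl mulr_ge0.
have TM1 : opn T <= M + 1 by rewrite (le_trans TM)// lerDl.
have af0 := aff_le M1 aff_F0.
have af1 := aff_le big (aff_FA aT TM1).
have af2 := aff_le big (aff_FA aTX (opnD_le TM X1)).
have [e eE] := opaque (8 * opn X * (1 + 8 * opn T)).
have eM : e <= 8 * opn X * (1 + 8 * M).
 by rewrite eE ler_wpM2l ?mulr_ge0 ?opn_ge0// lerD2l ler_wpM2l.
have e0 : 0 <= e by rewrite eE; apply: mulr_ge0; [|apply: addr_ge0 => //]; rewrite ?mulr_ge0 ?opn_ge0.
have e1 : 0 <= e <= 8 * (M + 1) * (1 + 8 * M).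
 rewrite e0/= (le_trans eM)// ler_wpM2r ?addr_ge0 ?mulr_ge0// ler_wpM2l// (le_trans X1)// lerDr//.
have kd := FA_Kc aT aX; rewrite -eE in kd.
have eq : fA T Ffun + (fA (T + X) Ffun - fA T Ffun) = fA (T + X) Ffun by rewrite addrC subrK.
have := h1 F0 (fA T Ffun) (fA (T + X) Ffun - fA T Ffun) e af0 af1.
rewrite eq => /(_ af2 kd e1) q1; have q2 := h2 T X aT aX TM.
have q3 : K1 * e ^+ 2 <= K1 * (8 * (1 + 8 * M)) ^+ 2 * opn X ^+ 2.
 have r0 : 0 <= 8 * (1 + 8 * M) * opn X.
  by apply: mulr_ge0; [apply: mulr_ge0 => //; apply: addr_ge0 => //; exact: mulr_ge0|exact: opn_ge0].
 by rewrite -mulrA ler_wpM2l// -exprMn ler_pXn2r ?nnegrE// mulrAC.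
rewrite /lA mulrDl; move: q1 q2 q3.
move: (Psi _ _) (Psi _ _) (rtr A _) (rtr A _) (K1 * _) (K2 * _) (K1 * _ * _) => a b u v k1 k2 k3.
move=> /ler_normlP [? ?] /ler_normlP [? ?] ?; apply/ler_normlP; split; lra.
Qed.

(** * Signs of [D0 + T] and the index formula *)

Definition pos1 : R -> R := \1_[set l : R | 0 <= l].
Definition Pp T := fA T pos1.

Lemma pos1_meas : measurable ([set l | 0 <= l] : borel R).
rewrite (_ : [set l | _] = `[0, +oo[%classic); first exact: measurable_itv.
by apply/seteqP; split=> l /=; rewrite in_itv /= andbT.
Qed.

Lemma bm_pos1 : bm pos1. exact: bm_ind pos1_meas. Qed.
Lemma Pp_proj T : proj (Pp T).
by rewrite /Pp /fA /pos1 fc_ind; [exact: pE_proj pos1_meas|exact: pos1_meas]. Qed.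

(** [1 - |F| <= 1 - F^2]. This puts the symmetry [2 Pp T - 1] in the same affine space as the
    transform of [D0 + T]. *)
Lemma sgn_Ffun l : `|2 * pos1 l - 1 - Ffun l| <= ufun l.
have := Ffun_sq l; have := Ffun_le1 l; have k0 := kfun_gt0 l.
have -> : pos1 l = ((0 <= l)%R : nat)%:R.
 rewrite /pos1 indicE; congr (nat_of_bool _)%:R.
 by apply/idP/idP => [/set_mem|h]; [|exact: mem_set].
case: (leP 0 l) => l0 /=.
 have F0' : 0 <= Ffun l by rewrite mulr_ge0// ltW.
 rewrite (ger0_norm F0') => F1 Fs; rewrite ger0_norm; nra.
have F0' : Ffun l <= 0 by rewrite mulr_le0_ge0// ltW.
rewrite (ler0_norm F0') => F1 Fs; rewrite ler0_norm; nra.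
Qed.

Lemma aff_Q T M : aN T -> opn T <= M -> aff (8 * M + (1 + 8 * M)) (2 *: Pp T - 1).
move=> aT TM; have [sF nF kF] := aff_FA aT TM.
have bp := bm_pos1; have bF := bm_Ffun.
have nP : inN A (Pp T) by exact: fA_N.
split.
- by apply: saB; [apply: saZ; case: (Pp_proj T)|exact: sa1].
- by apply: inNB; [exact: inNZ|exact: inN1].
have -> : 2 *: Pp T - 1 - F0 = (fA T Ffun - F0) + (2 *: Pp T - 1 - fA T Ffun) by opring.
apply: KcD => //; split=> [|x]; first by apply: inNB => //; apply: inNB; [exact: inNZ|exact: inN1].
have -> : 2 *: Pp T - 1 - fA T Ffun = fA T (fun l => 2 * pos1 l - 1 - Ffun l).
 have b1 := bmZ 2 bp; have b2 := bm_cst (1 : R); have b3 := bmB b1 b2.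
 by rewrite /fA fcB// fcB// fcZ// fc_cst scale1r.
apply: (@le_trans _ _ (nrm (fA T hfun x))).
 apply: fc_nrm_le => [||l].
 - by apply: bmB => //; apply: bmB; [exact: bmZ|exact: bm_cst].
 - exact: bm_hfun.
 - apply: (le_trans (sgn_Ffun l)); rewrite (ger0_norm (ltW (hfun_gt0 l))); exact: ufun_hfun.
apply: (le_trans (hop_A x aT.1)); rewrite ler_wpM2r ?nrm_ge0// lerD2l ler_wpM2l//.
Qed.

Lemma Pp_Kc T S M : aN T -> aN S -> opn T <= M -> opn S <= M ->
 Kc (8 * M + (1 + 8 * M)) (Pp S - Pp T).
move=> aT aS TM SM; have [_ _ k1] := aff_Q aT TM; have [_ _ k2] := aff_Q aS SM.
have := KcZ 2^-1 (KcB k2 k1); rewrite ger0_norm ?invr_ge0//.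
have -> : 2^-1 *: (2 *: Pp S - 1 - F0 - (2 *: Pp T - 1 - F0)) = Pp S - Pp T.
 have two (W : op E) : 2 *: W = W + W by rewrite scaler_nat mulr2n.
 rewrite !two -[RHS]half_op; congr (_ *: _); move: (Pp S) (Pp T) F0 => x y z; opring.
by apply: Kc_le; apply: eqW; field.
Qed.

(** The cocycle identity replaces the path by the polygon with vertices [2 Pp (T i) - 1] and two end
    segments. [Psi_proj] and [index_eig] evaluate the edges; conjugation by [U] carries one end
    segment to the other. *)
Lemma Psi_index (T : nat -> op E) k M (U : op E) : 0 <= M -> (forall i, (i <= k)%N -> aN (T i)) ->
 (forall i, (i <= k)%N -> opn (T i) <= M) -> inN A U -> U^† * U = 1 -> U * U^† = 1 ->
 fA (T k) Ffun = U * fA (T 0%N) Ffun * U^† -> Pp (T k) = U * Pp (T 0%N) * U^† ->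
 Psi F0 (fA (T k) Ffun) - Psi F0 (fA (T 0%N) Ffun) =
 cn * \sum_(i < k) Defs.index (hdot E) (ttau A) (Pp (T i)) (Pp (T i.+1)).
move=> M0 aT TM nU U1 U2 UF UP.
have [M' ME] := opaque (8 * M + (1 + 8 * M)).
have M'0 : 0 <= M' by rewrite ME; apply: addr_ge0; [|apply: addr_ge0 => //]; exact: mulr_ge0.
have MM' : 8 * M <= M' by rewrite ME lerDl; apply: addr_ge0 => //; exact: mulr_ge0.
have affF i : (i <= k)%N -> aff M' (fA (T i) Ffun).
 by move=> ik; exact: aff_le MM' (aff_FA (aT i ik) (TM i ik)).
have affQ i : (i <= k)%N -> aff M' (2 *: Pp (T i) - 1).
 by move=> ik; rewrite ME; exact: aff_Q (aT i ik) (TM i ik).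
have aff0 : aff M' F0 by exact: aff_le M'0 aff_F0.
have sum j : (j <= k)%N -> Psi (2 *: Pp (T 0%N) - 1) (2 *: Pp (T j) - 1) =
  cn * \sum_(i < j) Defs.index (hdot E) (ttau A) (Pp (T i)) (Pp (T i.+1)).
 elim: j => [|j IH] jk.
  rewrite big_ord0 mulr0; have := Psi_rev M'0 (affQ _ jk) (affQ _ jk) => e; lra.
 have jk' := ltnW jk; rewrite big_ord_recr /= mulrDr -IH//.
 rewrite -(Psi_cocycle M'0 (affQ 0%N (leq0n _)) (affQ j jk') (affQ _ jk)); congr (_ + _).
 have kB := Pp_Kc (aT _ jk') (aT _ jk) (TM _ jk') (TM _ jk); rewrite -ME in kB.
 have nP i : (i <= k)%N -> inN A (Pp (T i)) by move=> ik; apply: fA_N; [exact: aT|exact: bm_pos1].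
 rewrite (Psi_proj M'0 (Pp_proj _) (Pp_proj _) (nP _ jk') (nP _ jk) erefl kB).
 by rewrite (index_eig (Pp_proj _) (Pp_proj _) erefl).
rewrite -sum//; have l0 := leq0n k; have lk := leqnn k.
have <- := Psi_cocycle M'0 aff0 (affF _ l0) (affF _ lk).
rewrite addrAC subrr add0r.
have <- := Psi_cocycle M'0 (affQ _ l0) (affF _ l0) (affQ _ lk).
have <- := Psi_cocycle M'0 (affF _ l0) (affF _ lk) (affQ _ lk).
have -> : 2 *: Pp (T k) - 1 = U * (2 *: Pp (T 0%N) - 1) * U^†.
 by rewrite UP mulrBr mulr1 mulrBl U2 -opZAr -opZAl.
have -> : Psi (fA (T k) Ffun) (U * (2 *: Pp (T 0%N) - 1) * U^†) =
  Psi (fA (T 0%N) Ffun) (2 *: Pp (T 0%N) - 1).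
 rewrite UF; exact: (Psi_unitary M'0 (affF _ l0) (affQ _ l0) nU U1 U2).
rewrite (Psi_rev M'0 (affQ _ l0) (affF _ l0)).
by rewrite addrCA addNr addr0.
Qed.

End Psi.

(** * The normalizing constant [cn] *)

Lemma is_derive_Ffun (l : R) : is_derive l 1 Ffun (kfun l ^+ 3).
have s0 := sq1_gt0 l; have q0 : 0 < Num.sqrt (1 + l ^+ 2) by rewrite sqrtr_gt0.
have d1 : is_derive l 1 (fun x : R => 1 + x ^+ 2) (2 * l).
 apply: is_derive_lin => e e0; exists e => // h he.
 have -> : 1 + (h + l) ^+ 2 - (1 + l ^+ 2) - h * (2 * l) = h * h by ring.
 by rewrite normrM ler_wpM2r// ltW.
have d2 : is_derive l 1 (Num.sqrt \o (fun x : R => 1 + x ^+ 2)) ((2 * Num.sqrt (1 + l ^+ 2))^-1 * (2 * l)).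
 by apply: is_derive1_comp => //; exact: is_derive1_sqrt.
have d3 := @is_deriveV R (Num.sqrt \o (fun x : R => 1 + x ^+ 2)) l _ 1 (lt0r_neq0 q0) d2.
have d4 := is_deriveM (is_derive_id l 1) d3.
have -> : Ffun = (fun x => x * (Num.sqrt (1 + x ^+ 2))^-1).
 by apply/funext => x; rewrite /Ffun -/(kfun x) kfun_sqrt.
apply: (is_derive_eq d4) => /=; rewrite kfun_sqrt /GRing.scale /=.
have := sqr_sqrtr (ltW s0); move: (Num.sqrt _) q0 => q q0 e.
have -> : l * (- q ^- 2 * ((2 * q)^-1 * (2 * l))) + q^-1 * 1 = (q ^+ 2 - l ^+ 2) / q ^+ 3.
 by field; rewrite gt_eqF.
by rewrite e addrK div1r -exprVn.
Qed.

Lemma Ffun_cvg1 : (fun m => Ffun m%:R) @ \oo --> (1 : R).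
apply: (@cvg_squeeze _ _ (fun m : nat => (m.+1%:R)^-1)) => [m|]; last exact: cvg_harmonic.
have := sgn_Ffun (m%:R); rewrite /pos1 indicE mem_set//= => h.
have e : 2 * 1%:R - 1 - Ffun m%:R = 1 - Ffun m%:R by ring.
rewrite e distrC in h; apply: (le_trans h).
rewrite /ufun lef_pV2 ?posrE ?sq1_gt0// -natr1 addrC lerD2l.
by case: m {h e} => [|m]; rewrite ?expr0n// expr2 ler_peMr// ler1n.
Qed.

Lemma Ffun_odd (l : R) : Ffun (- l) = - Ffun l.
by rewrite /Ffun sqrrN mulNr. Qed.

(** The base point -1 and the bound 2 make 0 and 1 interior points, so that the antiderivative is
    differentiable on all of [[0, 1]]. *)
Lemma vfun_int_derive n (x : R) : -1 < x < 2 ->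
 is_derive x 1 (fun y : R => \int[leb]_(t in `[-1, y]) vfun n t) (vfun n x).
move=> /andP[x1 x2]; have cv := @vfun_cont n.
have iv : leb.-integrable `[-1, 2] (EFin \o vfun n).
 apply: (continuous_compact_integrable (@segment_compact _ (-1) 2)).
 exact: continuous_subspaceT.
have [h1 h2] := continuous_FTC1_closed x2 iv x1 (cv x).
rewrite derive1E in h2; exact: (DeriveDef h1 h2).
Qed.

Lemma gfun_ge0 n l : 0 <= gfun n l.
by rewrite mulr_ge0 ?exprn_ge0 ?(ltW (ufun_gt0 l)) ?(ltW (kfun_gt0 l)). Qed.

(* The substitution [r = (1 + F(l)) / 2] turns [2 (4 r (1 - r))^n dr] into [gfun n l dl]. *)
Lemma cn_integral n : (\int[leb]_l (gfun n l)%:E = (cn n)%:E)%E.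
have [V VE] := opaque (fun y : R => \int[leb]_(t in `[-1, y]) vfun n t).
have dV (x : R) : -1 < x < 2 -> is_derive x 1 V (vfun n x) by rewrite VE; exact: vfun_int_derive.
have cV (x : R) : -1 < x < 2 -> {for x, continuous V}.
 by move=> hx; have := dV x hx => -[h _]; apply: differentiable_continuous; exact/derivable1_diffP.
have cnE : cn n = V 1 - V 0.
 rewrite /cn /Rintegral (@continuous_FTC2 _ (vfun n) V 0 1)//.
 - by apply: continuous_subspaceT; exact: vfun_cont.
 - split.
  + move=> x; rewrite in_itv /= => /andP[x0 x1]; have [|h _] := dV x; first by apply/andP; split; lra.
   exact: h.
  + by apply: cvg_at_right_filter; apply: cV; apply/andP; split; lra.
  + by apply: cvg_at_left_filter; apply: cV; apply/andP; split; lra.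
 - move=> x; rewrite in_itv /= => /andP[x0 x1]; rewrite derive1E.
  have [|_ h] := dV x; first by apply/andP; split; lra.
  exact: h.
have Frange (l : R) : -1 < 2^-1 * (1 + Ffun l) < 2.
 have := Ffun_le1 l; rewrite ler_norml => /andP[? ?]; apply/andP; split; lra.
have dG (l : R) : is_derive l 1 (V \o (fun x => 2^-1 * (1 + Ffun x))) (gfun n l).
 have d1 : is_derive l 1 (fun x => 2^-1 * (1 + Ffun x)) (2^-1 * kfun l ^+ 3).
  have dA (y : R) : is_derive y 1 (fun z : R => 2^-1 * (1 + z)) 2^-1.
   apply: is_derive_lin => e e0; exists 1 => // h _.
   by rewrite (_ : _ - h / 2 = 0) ?normr0 ?mulr_ge0 ?(ltW e0)//; ring.
  exact: (is_derive1_comp (dA _) (is_derive_Ffun l)).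
 have h := @is_derive1_comp R V (fun x => 2^-1 * (1 + Ffun x)) l _ _ (dV _ (Frange l)) d1; apply: (is_derive_eq h).
 rewrite /vfun /gfun; have -> : 2^-1 * (1 + Ffun l) * (1 - 2^-1 * (1 + Ffun l)) * 4 = ufun l.
  by have := Ffun_sq l; nra.
 by field.
have cg : continuous (gfun n).
 have -> : gfun n = fun l => kfun l ^+ (2 * n + 3).
  by apply/funext => l; rewrite /gfun -kfun_sq -exprM -exprD.
 move=> l; apply: (@continuous_comp _ _ _ kfun (fun x => x ^+ (2 * n + 3))); last exact: exprn_continuous.
 rewrite (_ : kfun = fun x => (Num.sqrt (1 + x ^+ 2))^-1); last by apply/funext => x; rewrite kfun_sqrt.
 apply: cvgV; first by rewrite gt_eqF// sqrtr_gt0 sq1_gt0.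
 apply: (@continuous_comp _ _ _ (fun x : R => 1 + x ^+ 2) Num.sqrt); last exact: sqrt_continuous.
 by apply: cvgD; [exact: cvg_cst|exact: exprn_continuous].
have g0 := gfun_ge0 n.
have int_m m : (\int[leb]_(l in `[(- m.+1%:R)%R, m.+1%:R]) (gfun n l)%:E =
  (V (2^-1 * (1 + Ffun m.+1%:R)) - V (2^-1 * (1 - Ffun m.+1%:R)))%:E)%E.
 have lt : - m.+1%:R < m.+1%:R :> R by rewrite gtrN ?ltr0n.
 rewrite (@continuous_FTC2 _ (gfun n) (V \o (fun x => 2^-1 * (1 + Ffun x))) _ _ lt).
 - by rewrite /= Ffun_odd.
 - exact: continuous_subspaceT.
 - have cG (l : R) : {for l, continuous (V \o (fun x => 2^-1 * (1 + Ffun x)))}.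
   by have := dG l => -[h _]; apply: differentiable_continuous; exact/derivable1_diffP.
  split; [by move=> x _; have [h _] := dG x|by apply: cvg_at_right_filter; exact: cG|].
  by apply: cvg_at_left_filter; exact: cG.
 - by move=> x _; rewrite derive1E; have [_ h] := dG x.
have Fc : (fun m => Ffun m.+1%:R) @ \oo --> (1 : R).
 by have := Ffun_cvg1; rewrite -(cvg_shiftS (fun m => Ffun m%:R)).
have c1 : (fun m => V (2^-1 * (1 + Ffun m.+1%:R)) - V (2^-1 * (1 - Ffun m.+1%:R))) @ \oo --> cn n.
 have e1 : 2^-1 * (1 + 1) = 1 :> R by field.
 have e0 : 2^-1 * (1 - 1) = 0 :> R by field.
 have c11 : (fun m => 2^-1 * (1 + Ffun m.+1%:R)) @ \oo --> 2^-1 * (1 + 1 : R).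
  by apply: cvg_scale; apply: cvgD => //; exact: cvg_cst.
 have c10 : (fun m => 2^-1 * (1 - Ffun m.+1%:R)) @ \oo --> 2^-1 * (1 - 1 : R).
  by apply: cvg_scale; apply: cvgB => //; exact: cvg_cst.
 rewrite e1 in c11; rewrite e0 in c10; rewrite cnE; apply: cvgB.
  by apply: (cvg_comp _ _ c11); apply: cV; apply/andP; split; lra.
 by apply: (cvg_comp _ _ c10); apply: cV; apply/andP; split; lra.
have mono : {homo (fun m : nat => `[(- m.+1%:R)%R, m.+1%:R]%classic : borel R) : i j / (i <= j)%N >-> (i <= j)%O}.
 move=> i j ij; apply/subsetPset => l /=; rewrite !in_itv /= => /andP[a b].
 have ij' : (i.+1%:R <= j.+1%:R :> R) by rewrite ler_nat.
 by apply/andP; split; lra.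
have mg : measurable_fun [set: mR R] (EFin \o gfun n).
 by apply/measurable_EFinP; apply: continuous_measurable_fun.
have UT : \bigcup_m (`[(- m.+1%:R)%R, m.+1%:R]%classic : borel R) = setT.
 apply/seteqP; split=> // l _; exists (Num.bound `|l|) => //=; rewrite in_itv /= -ler_norml.
 apply: le_trans (ltW (archi_boundP (normr_ge0 l))) _; by rewrite ler_nat.
have c3 : (fun m => ((V (2^-1 * (1 + Ffun m.+1%:R)) - V (2^-1 * (1 - Ffun m.+1%:R)))%:E)%E) @ \oo --> ((cn n)%:E)%E.
 by apply: cvg_EFin => //; exact: nearW.
apply/esym; apply: (cvg_unique _ c3); first exact: ereal_hausdorff.
rewrite (_ : (fun m => _) = (fun m => \int[leb]_(l in `[(- m.+1%:R)%R, m.+1%:R]) (gfun n l)%:E)%E); last by apply/funext => m; rewrite int_m.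
rewrite -UT; apply: ge0_nondecreasing_set_cvg_integral => // [m|m l _].
- by apply: measurable_funTS.
- by rewrite lee_fin.
Qed.

(** * The binomial series with negative exponent *)

Section BinomialSeries.
Variable e : R.
Hypothesis e1 : 1 <= e.

(** The Taylor coefficients of [(1 - v)^(- e)]; accordingly [brho] is the quotient of a partial sum
    by the function it approximates. *)
Fixpoint bcoef (j : nat) : R := if j is j'.+1 then bcoef j' * (e + j'%:R) / j'.+1%:R else 1.
Definition bpoly N (v : R) : R := \sum_(j < N.+1) bcoef j * v ^+ j.
Definition brho N (v : R) : R := (1 - v) `^ e * bpoly N v.

Let e0 : 0 < e. exact: lt_le_trans ltr01 e1. Qed.
Lemma bcoef_ge0 j : 0 <= bcoef j.
by elim: j => //= j IH; rewrite divr_ge0 ?mulr_ge0 ?addr_ge0// ltW. Qed.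

Let powS (v : R) : v < 1 -> (1 - v) `^ e = (1 - v) * (1 - v) `^ (e - 1).
move=> v1; have h : 0 < 1 - v by rewrite subr_gt0.
rewrite -{2}(powRr1 (ltW h)) -powRD; last by rewrite (gt_eqF h) implybT.
by congr (_ `^ _); rewrite addrC subrK.
Qed.

Let dpow (v : R) : v < 1 -> is_derive v 1 (fun x : R => (1 - x) `^ e) (- (e * (1 - v) `^ (e - 1))).
move=> v1; have h : 0 < 1 - v by rewrite subr_gt0.
have d1 : is_derive v 1 (fun x : R => 1 - x) (-1).
 apply: is_derive_lin => r r0; exists 1 => // k _.
 by rewrite (_ : _ - k * -1 = 0) ?normr0 ?mulr_ge0 ?(ltW r0)//; ring.
have := @is_derive1_comp R (fun x : R => x `^ e) (fun x : R => 1 - x) v _ _ (is_derive1_powR e h) d1.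
by rewrite mulrN1.
Qed.

(* The recursion [j c_j = (e + j - 1) c_(j-1)] makes the derivative of the partial sums telescope. *)
Lemma brho_derive N (v : R) : v < 1 ->
 is_derive v 1 (brho N) (- ((e + N%:R) * bcoef N * v ^+ N * (1 - v) `^ (e - 1))).
move=> v1; elim: N => [|N IH].
 have -> : brho 0 = fun x => (1 - x) `^ e.
  by apply/funext => x; rewrite /brho /bpoly big_ord1 /= expr0 !mulr1.
 by apply: (is_derive_eq (dpow v1)); rewrite /= addr0 expr0 !mulr1.
have dX : is_derive v 1 (fun x : R => x ^+ N.+1) (N.+1%:R * v ^+ N).
 have := @is_deriveX R _ id N.+1 v 1 1 (is_derive_id v 1) => d.
 have e' : (id : R -> R) ^+ N.+1 = (fun x : R => x ^+ N.+1).
  by apply/funext => x; rewrite exprfctE.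
 by rewrite e' in d; apply: (is_derive_eq d); rewrite /GRing.scale /= mulr1.
have dP : is_derive v 1 (fun x : R => x ^+ N.+1 * (1 - x) `^ e)
  (v ^+ N.+1 * - (e * (1 - v) `^ (e - 1)) + (1 - v) `^ e * (N.+1%:R * v ^+ N)).
 exact: (is_derive_eq (is_deriveM dX (dpow v1))).
have dC : is_derive v 1 (fun x : R => bcoef N.+1 * (x ^+ N.+1 * (1 - x) `^ e))
  (bcoef N.+1 * (v ^+ N.+1 * - (e * (1 - v) `^ (e - 1)) + (1 - v) `^ e * (N.+1%:R * v ^+ N))).
 exact: (is_derive_eq (is_deriveZ _ dP)).
have -> : brho N.+1 = brho N + (fun x : R => bcoef N.+1 * (x ^+ N.+1 * (1 - x) `^ e)).
 apply/funext => x; rewrite /brho /bpoly /= big_ord_recr /= mulrDr [X in _ + X]mulrC -!mulrA.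
 by congr (_ + _); rewrite -!mulrA.
apply: (is_derive_eq (is_deriveD IH dC)); rewrite powS// /= exprS -natr1.
move: ((1 - v) `^ _) (bcoef N) (v ^+ N) => y b z; field.
by rewrite ?natr1 ?nat1r pnatr_eq0.
Qed.

(** Mean value theorem from [brho N 0 = 1]; the condition [1 <= e] bounds [(1 - c)^(e - 1)] by 1. *)
Lemma brho_bound N (v : R) : 0 <= v < 1 -> 0 <= 1 - brho N v <= (e + N%:R) * bcoef N * v ^+ N.
move=> /andP[v0 v1]; have a0 : 0 <= (e + N%:R) * bcoef N by rewrite mulr_ge0 ?bcoef_ge0// addr_ge0// ltW.
move: v0; rewrite le_eqVlt => /predU1P[<-|v0].
 rewrite /brho /bpoly big_ord_recl /= expr0 subr0 powR1 !mul1r big1 ?addr0 ?subrr ?lexx.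
  by rewrite mulr_ge0// exprn_ge0.
 by move=> i _; rewrite /= /bump /= add1n expr0n mulr0.
have hd (x : R) : x \in `]0, v[ -> is_derive x 1 (brho N) (- ((e + N%:R) * bcoef N * x ^+ N * (1 - x) `^ (e - 1))).
 by rewrite in_itv /= => /andP[_ xv]; apply: brho_derive; exact: lt_trans xv v1.
have hc : {within `[0, v], continuous (brho N)}.
 apply: derivable_within_continuous => x; rewrite in_itv /= => /andP[_ xv].
 by have [] := brho_derive N (le_lt_trans xv v1).
have [c] := MVT v0 hd hc; rewrite in_itv /= => /andP[c0 cv].
have -> : brho N 0 = 1.
 rewrite /brho /bpoly big_ord_recl /= expr0 subr0 powR1 !mul1r big1 ?addr0//.
 by move=> i _; rewrite /= /bump /= add1n expr0n mulr0.
rewrite subr0 => eq; have -> : 1 - brho N v = (e + N%:R) * bcoef N * c ^+ N * (1 - c) `^ (e - 1) * v.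
 by rewrite -[LHS]opprB eq mulNr opprK.
have pw0 := powR_ge0 (1 - c) (e - 1).
have pw1 : (1 - c) `^ (e - 1) <= 1.
 apply: (@le_trans _ _ (1 `^ (e - 1))); last by rewrite powR1.
 rewrite ge0_ler_powR ?nnegrE ?subr_ge0//; lra.
have cN : 0 <= c ^+ N by rewrite exprn_ge0// ltW.
have v00 := ltW v0.
apply/andP; split; first by apply: mulr_ge0 => //; apply: mulr_ge0 => //; apply: mulr_ge0.
rewrite -!(mulrA ((e + N%:R) * bcoef N)); apply: ler_wpM2l => //.
have cv' : c ^+ N <= v ^+ N by case: (N) => // k; rewrite ler_pXn2r ?nnegrE ?(ltW c0)// ltW.
by apply: le_trans cv'; rewrite -mulrA; apply: ler_piMr => //; apply: mulr_ile1 => //; exact: ltW.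
Qed.

Lemma brho_mono N (v : R) : 0 <= v < 1 -> 0 <= brho N v <= brho N.+1 v.
move=> /andP[v0 v1]; have b0 K : 0 <= bpoly K v.
 by apply: sumr_ge0 => j _; rewrite mulr_ge0 ?bcoef_ge0// exprn_ge0.
rewrite /brho mulr_ge0 ?powR_ge0//=; apply: ler_wpM2l; first exact: powR_ge0.
by rewrite /bpoly [leRHS]big_ord_recr /= lerDl mulr_ge0 ?exprn_ge0//; exact: (bcoef_ge0 N.+1).
Qed.

Lemma brho_unif (v : R) eta : 0 <= v < 1 -> 0 < eta -> exists K, forall N, (K <= N)%N ->
 forall x, 0 <= x <= v -> 1 - brho N x <= eta.
move=> /andP[v0 v1] eta0; pose a N := (e + N%:R) * bcoef N * v ^+ N.
have a0 N : 0 <= a N by rewrite /a !mulr_ge0 ?bcoef_ge0 ?exprn_ge0// addr_ge0// ltW.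
have [r rE] := opaque ((1 + v) / 2); have r0 : 0 <= r by rewrite rE; lra.
have r1 : r < 1 by rewrite rE; lra.
(* From this rank on the ratio [(e + N + 1) / (N + 1) * v] of consecutive bounds is at most
   [r = (1 + v) / 2]. *)
pose K := Num.bound (2 * e / (1 - v)).
have step N : (K <= N)%N -> a N.+1 <= r * a N.
 move=> KN; have vv : 0 < 1 - v by rewrite subr_gt0.
 have h : 2 * e / (1 - v) <= N%:R.
  have := archi_boundP (_ : 0 <= 2 * e / (1 - v)) => hh.
  apply: (le_trans (ltW (hh _))); last by rewrite ler_nat.
  by rewrite divr_ge0 ?mulr_ge0// ltW.
 rewrite ler_pdivrMr// in h.
 have -> : a N.+1 = (e + N.+1%:R) / N.+1%:R * v * a N.
  rewrite /a /= exprS; move: (bcoef N) (v ^+ N) => b z; field.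
  by rewrite ?natr1 ?nat1r pnatr_eq0.
 apply: ler_wpM2r => //; rewrite mulrAC ler_pdivrMr ?ltr0n// rE.
 have ev : e * v <= e by rewrite ler_piMr ?ltW.
 rewrite -natr1; move: (N%:R : R) h => y h; lra.
have geo j : a (K + j)%N <= a K * r ^+ j.
 elim: j => [|j IH]; first by rewrite addn0 expr0 mulr1.
 rewrite addnS; apply: (le_trans (step _ (leq_addr _ _))); rewrite (exprS r j) [leRHS]mulrCA.
 exact: ler_wpM2l.
have c : (fun j => a K * r ^+ j) @ \oo --> (0 : R).
 by apply: cvg_scale0; apply: cvg_expr; rewrite ger0_norm.
have /cvgrPdist_lt /(_ _ eta0) [J _ hJ] := c.
exists (K + J)%N => N KN x /andP[x0 xv].
have x1 : 0 <= x < 1 by rewrite x0 (le_lt_trans xv).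
have /andP[_ h] := brho_bound N x1; apply: (le_trans h).
have xN : x ^+ N <= v ^+ N by case: (N) => // k; rewrite ler_pXn2r ?nnegrE.
apply: (@le_trans _ _ (a N)).
 by rewrite ler_wpM2l// mulr_ge0 ?bcoef_ge0// addr_ge0// ltW.
have KN' : (K <= N)%N by apply: leq_trans KN; exact: leq_addr.
have := hJ (N - K)%N; rewrite /= leq_subRL// => /(_ KN).
rewrite sub0r normrN => hh; have := geo (N - K)%N; rewrite subnKC// => /le_trans; apply.
exact: le_trans (ler_norm _) (ltW hh).
Qed.

End BinomialSeries.

(** * Uniform approximation of the function with exponent [p / 2] *)

Definition wfun (l : R) : R := (1 + l ^+ 2) `^ (- (p / 2)).

Lemma wfun_gt0 l : 0 < wfun l. by rewrite powR_gt0 ?sq1_gt0. Qed.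
Lemma p2_ge0 : 0 <= p / 2. by rewrite divr_ge0// ltW. Qed.
Lemma bm_wfun : bm wfun. exact: bm_powR p2_ge0. Qed.
Lemma wfun_hfun l : wfun l = hfun l `^ (2 * p).
by rewrite /wfun /hfun -powRrM; congr (_ `^ _); field. Qed.

Lemma ufun_wfun l : ufun l = wfun l `^ (2 / p).
rewrite /wfun -powRrM mulNr (_ : p / 2 * (2 / p) = 1); last by field; rewrite gt_eqF.
by rewrite powR_inv1// ltW// sq1_gt0.
Qed.

Lemma wfun_le1 l : wfun l <= 1.
rewrite wfun_hfun; apply: (@le_trans _ _ (1 `^ (2 * p))); last by rewrite powR1.
by rewrite ge0_ler_powR ?nnegrE ?hfun_le1 ?(ltW (hfun_gt0 _)) ?mulr_ge0 ?(ltW p0).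
Qed.

Lemma wfun_level s l : 0 < s -> (s <= wfun l) = (s `^ (2 * p)^-1 <= hfun l).
move=> s0; have pp : 0 < 2 * p by rewrite mulr_gt0.
have pn : 2 * p != 0 by rewrite gt_eqF.
rewrite wfun_hfun; apply/idP/idP => h.
 have -> : hfun l = (hfun l `^ (2 * p)) `^ (2 * p)^-1 by rewrite -powRrM mulfV// powRr1// ltW// hfun_gt0.
 by rewrite ge0_ler_powR ?nnegrE ?powR_ge0 ?invr_ge0 ?(ltW pp) ?(ltW s0).
have -> : s = (s `^ (2 * p)^-1) `^ (2 * p) by rewrite -powRrM mulVf// powRr1// ltW.
by rewrite ge0_ler_powR ?nnegrE ?powR_ge0 ?(ltW pp)// ltW// hfun_gt0.
Qed.

(** Where [wfun > d] the approximation by [wN] is uniform; where [wfun <= d] the error is absorbed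
    by [wtail d], whose trace is small with [d], uniformly over bounded sets of perturbations. *)
Definition wtail (d l : R) : R := Num.min (wfun l) d.

Lemma wtail_ge0 d l : 0 <= d -> 0 <= wtail d l.
by move=> d0; rewrite le_min d0 (ltW (wfun_gt0 l)). Qed.
Lemma wtail_le d l : wtail d l <= wfun l. by rewrite ge_min lexx. Qed.

Lemma bm_wtail d : 0 <= d -> bm (wtail d).
move=> d0; split.
 by apply: measurable_minr; [have [] := bm_wfun|exact: measurable_cst].
by exists d => l; rewrite ger0_norm ?wtail_ge0// ge_min lexx orbT.
Qed.

Lemma wtail1 : wtail 1 = wfun.
by apply/funext => l; apply/min_idPl; exact: wfun_le1. Qed.
Lemma meas_hset t : measurable ([set l | t <= hfun l] : borel R).
exact: bm_lset bm_hfun. Qed.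

(** On a vector of the left subspace killed by the right projection, [hop_A] gives
    [t |x| <= (1 + 8 M) t / (2 + 8 M) |x|], hence [x = 0]; the 2 in place of 1 makes the gap.
    [tau_proj_le] with [Y = 1] concludes. *)
Lemma tau_level T M t : aN T -> opn T <= M -> 0 < t ->
 (tau A (pE (PA T) [set l | (t <= hfun l)%R]) <= tau A (pE P0 [set l | (t / (2 + 8 * M) <= hfun l)%R]))%E.
move=> aT TM t0; have M0 : 0 <= M by exact: le_trans (opn_ge0 T) TM.
have [b bE] := opaque (2 + 8 * M); have b0 : 0 < b by rewrite bE ltr_wpDr// mulr_ge0.
rewrite -bE; have tb0 : 0 < t / b by rewrite divr_gt0.
have mt := meas_hset t; have mtb := meas_hset (t / b); have bh := bm_hfun.
apply: (@tau_proj_le _ _ A _ _ 1).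
- exact: PA_N.
- exact: P0N.
- exact: inN1.
- exact: pE_proj.
- exact: pE_proj.
move=> x Qx; rewrite op1E => Fx; apply: nrm0P.
have h1 : t ^+ 2 * nrm x ^+ 2 <= nrm (fA T hfun x) ^+ 2.
 rewrite fc_nrm// -fc_q; last exact: bmX.
 have -> : t ^+ 2 * nrm x ^+ 2 = q (fc (PA T) (fun=> t ^+ 2)) x by rewrite fc_cst qZ q1.
 apply: (fc_q_le_on _ _ mt Qx) => [||l /= hl]; [exact: bm_cst|exact: bmX|].
 by rewrite ler_pXn2r ?nnegrE ?(ltW t0) ?(ltW (hfun_gt0 l)).
have h2 : nrm (hop x) ^+ 2 <= (t / b) ^+ 2 * nrm x ^+ 2.
 rewrite fc_nrm// -fc_q; last exact: bmX.
 have -> : (t / b) ^+ 2 * nrm x ^+ 2 = q (fc P0 (fun=> (t / b) ^+ 2)) x by rewrite fc_cst qZ q1.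
 have Cx : pE P0 (~` [set l | t / b <= hfun l]) x = x.
  have := pE_T P0; rewrite -(setUv [set l | t / b <= hfun l]).
  have -> : pE P0 (~` [set l | t / b <= hfun l]) = 1 - pE P0 [set l | t / b <= hfun l].
   rewrite -!fc_ind//; last exact: measurableC.
   rewrite -(scale1r (1 : op E)) -(fc_cst P0 1) -fcB; [|exact: bm_cst|exact: bm_ind].
   congr fc; apply/funext => l; rewrite !indicE in_setC.
   by case: (l \in _); rewrite /= ?subrr ?subr0.
  by rewrite opDE opNE op1E Fx subr0.
 apply: (fc_q_le_on _ _ (measurableC mtb) Cx) => [||l /= hl]; [exact: bmX|exact: bm_cst|].
 move/negP : hl; rewrite -ltNge => hl.
 by rewrite ler_pXn2r ?nnegrE ?(ltW tb0) ?(ltW (hfun_gt0 l))// ltW.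
have h3 := hop_A x aT.1.
have h4 : nrm (fA T hfun x) <= (1 + 8 * M) * nrm (hop x).
 by apply: (le_trans h3); rewrite ler_wpM2r ?nrm_ge0// lerD2l ler_wpM2l.
have h5 : nrm (hop x) <= t / b * nrm x.
 have z0 : 0 <= t / b * nrm x by apply: mulr_ge0; [exact: ltW|exact: nrm_ge0].
 by move: h2; rewrite -exprMn ler_pXn2r ?nnegrE ?nrm_ge0.
have h6 : t * nrm x <= nrm (fA T hfun x).
 have z0 : 0 <= t * nrm x by apply: mulr_ge0; [exact: ltW|exact: nrm_ge0].
 by move: h1; rewrite -exprMn ler_pXn2r ?nnegrE ?nrm_ge0.
have h7 : (1 + 8 * M) * nrm (hop x) <= (1 + 8 * M) * (t / b * nrm x).
 by rewrite ler_wpM2l// addr_ge0// mulr_ge0.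
have h8 : t * nrm x <= (1 + 8 * M) * (t / b * nrm x) by exact: le_trans h6 (le_trans h4 h7).
have e : (1 + 8 * M) * (t / b * nrm x) = t * nrm x - t / b * nrm x.
 rewrite (_ : 1 + 8 * M = b - 1); last by rewrite bE; ring.
 by field; rewrite gt_eqF.
have : t / b * nrm x <= 0 by move: h8; rewrite e; lra.
by rewrite pmulr_rle0.
Qed.

Definition tailc M : R := (2 + 8 * M) `^ (2 * p).

Lemma fp_tail0 d : 0 <= d -> fp A (fc P0 (wtail d)).
move=> d0; have bw := bm_wtail d0; apply: (fp_le _ _ fp_wop).
 by apply: pos_fc => // [|l]; [exact: P0N|exact: wtail_ge0].
by apply: fc_lop => // [|l]; [exact: bm_wfun|exact: wtail_le].
Qed.

(** [wfun] is [hfun ^ (2 p)], so dividing the level of [hfun] by [2 + 8 M] costs the factor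
    [tailc M]. The cut at [d] is compatible because this factor is at least 1 and levels above [d]
    are empty on the left. *)
Lemma tau_tail T M d : aN T -> opn T <= M -> 0 < d ->
 fp A (fA T (wtail d)) /\ tr A (fA T (wtail d)) <= tailc M * tr A (fc P0 (wtail d)).
move=> aT TM d0; have M0 : 0 <= M by exact: le_trans (opn_ge0 T) TM.
have d0' := ltW d0; have bw := bm_wtail d0'.
have [b bE] := opaque (2 + 8 * M); have b1 : 1 <= b by rewrite bE (@le_trans _ _ 2) ?ler1n// lerDl mulr_ge0.
have b0 : 0 < b by exact: lt_le_trans b1.
have cE : tailc M = b `^ (2 * p) by rewrite bE.
have pp : 0 < 2 * p by rewrite mulr_gt0.
have c1 : 1 <= b `^ (2 * p).
 apply: (@le_trans _ _ (1 `^ (2 * p))); first by rewrite powR1.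
 by rewrite ge0_ler_powR ?nnegrE ?(ltW pp)// ltW.
have c0 : 0 < b `^ (2 * p) by exact: lt_le_trans c1.
have bg : bm (fun l => b `^ (2 * p) * wtail d l) by exact: bmZ.
have f0 := fp_tail0 d0'.
have h : (tau A (fc (PA T) (wtail d)) <= 1%:E * tau A (fc P0 (fun l => (b `^ (2 * p) * wtail d l)%R)))%E.
 apply: layer_cake => // [||l|l|s s0].
 - exact: PA_N.
 - exact: P0N.
 - exact: wtail_ge0.
 - by rewrite mulr_ge0 ?wtail_ge0// ltW.
 rewrite mul1e; have [sd|sd] := leP s d.
  have t0 : 0 < s `^ (2 * p)^-1 by rewrite powR_gt0.
  have -> : [set l | s <= wtail d l] = [set l | s `^ (2 * p)^-1 <= hfun l].
   by apply/seteqP; split=> l /=; rewrite le_min sd andbT wfun_level.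
  have := tau_level aT TM t0; rewrite -bE => /le_trans; apply.
  have mb : measurable ([set l | s <= b `^ (2 * p) * wtail d l] : borel R) by exact: bm_lset.
  have mh := meas_hset (s `^ (2 * p)^-1 / b).
  apply: tau_le; try by apply: pos_proj; [exact: P0N|exact: pE_proj].
  rewrite -!fc_ind//; apply: fc_lop; [exact: bm_ind|exact: bm_ind|move=> l].
  rewrite !indicE; case: (boolP (l \in [set l | s `^ (2 * p)^-1 / b <= hfun l])) => [|_]; last exact: ler0n.
  move=> /set_mem /= hl; rewrite mem_set//= -ler_pdivrMl// le_min; apply/andP; split; last by rewrite mulrC ler_pdivrMr// (le_trans sd)// ler_peMr// ltW.
  have -> : (b `^ (2 * p))^-1 * s = (s `^ (2 * p)^-1 / b) `^ (2 * p).
   rewrite powRM ?powR_ge0 ?invr_ge0 ?(ltW b0)// -powRrM mulVf ?gt_eqF// powRr1 ?(ltW s0)//.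
   have -> : b^-1 `^ (2 * p) = (b `^ (-1)) `^ (2 * p) by rewrite powR_inv1 ?(ltW b0).
   by rewrite mulrC -powRrM mulN1r powRN.
  by rewrite wfun_hfun ge0_ler_powR ?nnegrE ?(ltW pp) ?divr_ge0 ?powR_ge0 ?(ltW b0)// ltW// hfun_gt0.
 have -> : [set l | s <= wtail d l] = set0.
  by apply/seteqP; split=> l //=; rewrite le_min => /andP[_ ds]; rewrite leNgt sd in ds.
 have -> : pE (PA T) set0 = 0.
  by rewrite -fc_ind// (_ : \1_set0 = (fun=> 0)) ?fc_cst ?scale0r//; apply/funext => l; rewrite indicE in_set0.
 rewrite tau0; apply: tau_ge0; apply: pos_proj; first by apply: P0N; exact: bm_lset.
 by apply: pE_proj; exact: bm_lset.
rewrite mul1e fcZ// tauZ ?(ltW c0)// in h; last by case: f0.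
have pT : pos A (fA T (wtail d)).
 by apply: pos_fc => // [|l]; [exact: PA_N|exact: wtail_ge0].
have fT : fp A (fA T (wtail d)).
 by split=> //; apply: (le_lt_trans h); rewrite trE// -EFinM ltry.
split=> //; rewrite cE -lee_fin EFinM -!trE//.
Qed.

(** Normality of the trace along [wfun - wtail (1 / (j + 1))], which increases to [wfun]. *)
Lemma tail_small eta : 0 < eta -> exists2 d, 0 < d <= 1 & tr A (fc P0 (wtail d)) <= eta.
move=> eta0; pose dl (j : nat) : R := j.+1%:R^-1.
have dl0 j : 0 < dl j by rewrite invr_gt0.
have dl0' j : 0 <= dl j by exact: ltW.
have bw := bm_wfun; have bt j := bm_wtail (dl0' j).
have pD j : pos A (fc P0 (fun l => wfun l - wtail (dl j) l)).
 by apply: pos_fc => [||l]; [exact: P0N|exact: bmB|rewrite subr_ge0 wtail_le].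
have dlS j : dl j.+1 <= dl j by rewrite lef_pV2 ?posrE// ler_nat.
have := @tau_normal _ _ A (fun j => fc P0 (fun l => wfun l - wtail (dl j) l)) (fc P0 wfun) pD.
have fw : fp A (fc P0 wfun) by exact: fp_wop.
move=> /(_ _ fw.1 _) h.
have {}h : (fun j => tau A (fc P0 (fun l => wfun l - wtail (dl j) l))) @ \oo --> tau A (fc P0 wfun).
 apply: h => [j|].
  apply: fc_lop => [||l]; [exact: bmB|exact: bmB|].
  by rewrite lerB// le_min ge_min lexx/= ge_min dlS orbT.
 apply: (@fc_wcvg _ _ _ _ _ 1) => [j||j l|l] //; first exact: bmB.
  rewrite ger0_norm ?subr_ge0 ?wtail_le// (le_trans _ (wfun_le1 l))// lerBlDr lerDl wtail_ge0//.
 apply: (@cvg_squeeze _ _ dl) => [j|]; last exact: cvg_harmonic.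
 have gen (x y : R) : x - y - x = - y by ring.
 by rewrite gen normrN ger0_norm ?wtail_ge0// ge_min lexx orbT.
have fD j : fp A (fc P0 (fun l => wfun l - wtail (dl j) l)).
 apply: (fp_le (pD j) _ fw); apply: fc_lop => [||l] //; first exact: bmB.
 by rewrite lerBlDr lerDl wtail_ge0.
have h2 : (fun j => tr A (fc P0 (fun l => wfun l - wtail (dl j) l))) @ \oo --> tr A (fc P0 wfun).
 by apply: (@fine_cvg _ _ _ _ (fun j => tau A (fc P0 (fun l => wfun l - wtail (dl j) l)))); rewrite -trE.
have /cvgrPdist_lt /(_ _ eta0) [J _ hJ] := h2.
have {}hJ := hJ J (leqnn J); rewrite /= in hJ.
exists (dl J); first by rewrite dl0 /dl invf_le1// ler1n.
have e : tr A (fc P0 wfun) = tr A (fc P0 (fun l => wfun l - wtail (dl J) l)) + tr A (fc P0 (wtail (dl J))).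
 rewrite -trD//; last exact: fp_tail0.
 by rewrite fcB// subrK.
by rewrite e addrAC subrr add0r in hJ; move/ltW: hJ; apply: le_trans; exact: ler_norm.
Qed.

Lemma tc_wfun : tc wfun.
split=> [|T aT]; first exact: bm_wfun.
by rewrite -wtail1; apply: fp_L1; exact: (tau_tail aT (lexx _) ltr01).1.
Qed.

Definition n0 : nat := ((m0 + m0) + (m0 + m0))%N.
(** The exponent with [gfun n0 = wfun * ufun ^ eexp]: the binomial series in [v = 1 - ufun] then
    recovers [wfun] from [gfun n0] ([wN_brho]). *)
Definition eexp : R := n0%:R + 3 / 2 - p / 2.
Definition wN N (l : R) : R := gfun n0 l * bpoly eexp N (1 - ufun l).

Lemma eexp_ge1 : 1 <= eexp.
have h1 : m0%:R <= n0%:R :> R by rewrite ler_nat /n0 -addnA leq_addr.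
have := p_m0; rewrite /eexp; have := p0; lra.
Qed.

Lemma gfun_powR n l : gfun n l = ufun l `^ (n%:R + 3 / 2).
have u0 := ufun_gt0 l; have s0 := ltW (sq1_gt0 l).
have kE : kfun l = ufun l `^ 2^-1.
 by rewrite /kfun /ufun -[X in _ = X `^ _](powR_inv1 s0) -powRrM mulN1r.
have kE3 : kfun l ^+ 3 = ufun l `^ (3 / 2).
 by rewrite -powR_mulrn ?(ltW (kfun_gt0 l))// kE -powRrM; congr (_ `^ _); field.
rewrite /gfun kE3 -powR_mulrn ?(ltW u0)// -powRD//; by rewrite (gt_eqF u0) implybT.
Qed.

Lemma wfun_powR l : wfun l = ufun l `^ (p / 2).
by rewrite /ufun -powR_inv1 ?(ltW (sq1_gt0 l))// -powRrM mulN1r. Qed.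

Lemma wN_brho N l : wN N l = wfun l * brho eexp N (1 - ufun l).
have u0 := ufun_gt0 l.
have e1 : 1 - (1 - ufun l) = ufun l by rewrite opprB addrC subrK.
rewrite /wN /brho mulrA gfun_powR wfun_powR e1 -powRD; last by rewrite (gt_eqF u0) implybT.
by congr (_ `^ _ * _); rewrite /eexp [RHS]addrC subrK.
Qed.

Lemma uv l : 0 <= 1 - ufun l < 1.
by rewrite subr_ge0 ufun_le1 gtrDl oppr_lt0 ufun_gt0. Qed.

Lemma wN_ge0 N l : 0 <= wN N l.
rewrite wN_brho mulr_ge0 ?(ltW (wfun_gt0 l))//.
by have /andP[] := brho_mono eexp_ge1 N (uv l).
Qed.

Lemma wN_le N l : wN N l <= wfun l.
rewrite wN_brho ler_piMr ?(ltW (wfun_gt0 l))//.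
by have /andP[] := brho_bound eexp_ge1 N (uv l); rewrite subr_ge0.
Qed.

Lemma wN_mono N l : wN N l <= wN N.+1 l.
rewrite !wN_brho ler_wpM2l ?(ltW (wfun_gt0 l))//.
by have /andP[] := brho_mono eexp_ge1 N (uv l).
Qed.

(** Since [ufun] is [wfun ^ (2 / p)], the condition [wfun > d] keeps [1 - ufun] below
    [1 - d ^ (2 / p) < 1], where [brho_unif] applies; otherwise [wtail d] is the whole of [wfun]. *)
Lemma wN_unif d eta : 0 < d <= 1 -> 0 < eta -> exists K, forall N, (K <= N)%N -> forall l,
 wfun l - wN N l <= eta * wfun l + wtail d l.
move=> /andP[d0 d1] eta0; have pe : 0 <= 2 / p by rewrite divr_ge0// ltW.
have u0 : 0 < d `^ (2 / p) by rewrite powR_gt0.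
have u1 : d `^ (2 / p) <= 1.
 apply: (@le_trans _ _ (1 `^ (2 / p))); last by rewrite powR1.
 by rewrite ge0_ler_powR ?nnegrE// ltW.
have hv : 0 <= 1 - d `^ (2 / p) < 1 by rewrite subr_ge0 u1 gtrDl oppr_lt0.
have [K hK] := brho_unif eexp_ge1 hv eta0; exists K => N KN l.
have w0 := ltW (wfun_gt0 l); have t0 := wtail_ge0 l (ltW d0).
have [wd|dw] := leP (wfun l) d.
 have -> : wtail d l = wfun l by apply/min_idPl.
 have := wN_ge0 N l; have := mulr_ge0 (ltW eta0) w0; lra.
have := hK N KN (1 - ufun l); rewrite (andP (uv l)).1/= => h.
have hu : 1 - ufun l <= 1 - d `^ (2 / p).
 by rewrite lerB// ufun_wfun ge0_ler_powR ?nnegrE// ltW.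
have {}h := h hu; rewrite wN_brho.
have := ler_wpM2l w0 h; rewrite mulrBr mulr1 (mulrC _ eta); lra.
Qed.

Lemma bm_wN N : bm (wN N).
apply: bmM; first exact: bm_gfun.
apply: bm_sum => j; apply: bmZ; apply: bmX; apply: bmB; [exact: bm_cst|exact: bm_ufun].
Qed.

(** [wfun - wN N] is positive, so [rtr_bound] reduces the claim to its trace at [D0 + T], which
    [wN_unif] and [tau_tail] bound by two halves of [eta]. *)
Lemma wN_approx M eta : 0 < eta -> exists K, forall N, (K <= N)%N -> forall T X, aN T -> aN X ->
 opn T <= M -> `|lA (wN N) T X - lA wfun T X| <= eta * opn X.
move=> eta0; have [M0|M0] := ltP M 0.
 by exists 0%N => N _ T X _ _ TM; have := opn_ge0 T; rewrite leNgt (le_lt_trans TM).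
have c0 : 0 < tailc M by rewrite powR_gt0// ltr_wpDr// mulr_ge0.
have [t1 t1E] := opaque (tr A (fc P0 (wtail 1))).
have t10 : 0 <= t1 by rewrite t1E; apply: tr_ge0; exact: fp_tail0.
have e1 : 0 < eta / 2 / (tailc M * (t1 + 1)) by rewrite divr_gt0 ?divr_gt0// mulr_gt0// ltr_wpDl.
have e2 : 0 < eta / 2 / tailc M by rewrite !divr_gt0.
have [d d01 hd] := tail_small e2; have /andP[d0 d1] := d01.
have [K hK] := wN_unif d01 e1; exists K => N KN T X aT aX TM.
have bw := bm_wfun; have bN := bm_wN N; have bt := bm_wtail (ltW d0).
have [fw tw] := tau_tail aT TM ltr01; rewrite wtail1 in fw tw.
have [ft tt] := tau_tail aT TM d0.
have pG : pos A (fA T (fun l => wfun l - wN N l)).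
 by apply: pos_fc => [||l]; [exact: PA_N|exact: bmB|rewrite subr_ge0 wN_le].
have [e eE] := opaque (eta / 2 / (tailc M * (t1 + 1))); rewrite -eE in e1 hK.
have le : lop (fA T (fun l => wfun l - wN N l)) (e *: fA T wfun + fA T (wtail d)).
 rewrite /fA -fcZ// -fcD//; last exact: bmZ.
 by apply: fc_lop => [||l]; [exact: bmB|by apply: bmD => //; exact: bmZ|exact: hK].
have fr : fp A (e *: fA T wfun + fA T (wtail d)) by apply: fpD => //; apply: fpZ => //; exact: ltW.
have fG : fp A (fA T (fun l => wfun l - wN N l)) by exact: fp_le pG le fr.
have trG : tr A (fA T (fun l => wfun l - wN N l)) <= eta.
 apply: (le_trans (tr_le fG fr le)); rewrite trD//; last by apply: fpZ => //; exact: ltW.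
 rewrite trZ ?(ltW e1)//.
 have h1 : e * tr A (fA T wfun) <= eta / 2.
  apply: (@le_trans _ _ (e * (tailc M * (t1 + 1)))).
   rewrite ler_wpM2l ?(ltW e1)//; apply: (le_trans tw); rewrite -wtail1 -t1E.
   by rewrite ler_wpM2l ?(ltW c0)// lerDl.
  by rewrite eE divfK// gt_eqF// mulr_gt0// ltr_wpDl.
 have h2 : tr A (fA T (wtail d)) <= eta / 2.
  apply: (le_trans tt); rewrite mulrC -ler_pdivlMr//.
 by rewrite [leRHS]splitr lerD.
have eq : lA (wN N) T X - lA wfun T X = - rtr A (X * fA T (fun l => wfun l - wN N l)).
 have lw := fp_L1 fw; have nX := aX.2; have lG := fp_L1 fG.
 have lN : L1 A (fA T (wN N)).
  have -> : fA T (wN N) = fA T wfun - fA T (fun l => wfun l - wN N l).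
   by rewrite /fA fcB// opprB addrC subrK.
  exact: L1B.
 have -> : fA T (fun l => wfun l - wN N l) = fA T wfun - fA T (wN N) by rewrite /fA fcB.
 by rewrite mulrBr rtrB ?opprB//; exact: L1Ml.
rewrite eq normrN; apply: (le_trans (rtr_bound aX.2 fG)); rewrite mulrC.
by rewrite ler_wpM2r ?opn_ge0.
Qed.

(* [chain T k s]: unitarily equivalent end points, total index [s]. *)
Definition chain (T : nat -> op E) k (s : R) := exists M U,
 [/\ 0 <= M, forall i, (i <= k)%N -> aN (T i) /\ opn (T i) <= M,
   [/\ inN A U, U^† * U = 1 & U * U^† = 1],
   fA (T k) Ffun = U * fA (T 0%N) Ffun * U^† /\ Pp (T k) = U * Pp (T 0%N) * U^† &
   s = \sum_(i < k) Defs.index (hdot E) (ttau A) (Pp (T i)) (Pp (T i.+1))].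

(** Both sides of the index identity are linear in [g], so the class is stable under linear
    combinations; this carries the formula from [gfun n] to [wN N]. *)
Definition good (g : R -> R) := tc g /\ exists f, [/\ pot f g,
 leb.-integrable [set: mR R] (EFin \o g) &
 forall (T : nat -> op E) k s, chain T k s -> f (T k) - f (T 0%N) = (\int[leb]_l g l) * s].

Lemma good_gfun n : (n0 <= n)%N -> good (gfun n).
move=> hn; split; first exact: tc_gfun.
exists (fun T => Psi n F0 (fA T Ffun)); split; first exact: pot_Psi.
 apply/integrableP; split; first by apply/measurable_EFinP; have [] := bm_gfun n.
 have -> : (\int[leb]_l `|(EFin \o gfun n) l| = \int[leb]_l (gfun n l)%:E)%E.
  by apply: eq_integral => l _; rewrite /= ger0_norm ?gfun_ge0.
 by rewrite cn_integral ltry.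
move=> T k s [M [U [M0 hT [nU U1 U2] [UF UP] ->]]].
rewrite /Rintegral cn_integral /=.
have aT' i : (i <= k)%N -> aN (T i) by move=> /hT[].
have TM' i : (i <= k)%N -> opn (T i) <= M by move=> /hT[].
exact: (Psi_index hn M0 aT' TM' nU U1 U2 UF UP).
Qed.

Lemma good_D g1 g2 : good g1 -> good g2 -> good (fun l => g1 l + g2 l).
move=> [t1 [f1 [p1 i1 c1]]] [t2 [f2 [p2 i2 c2]]]; split; first exact: tcD.
exists (fun T => f1 T + f2 T); split; first exact: potD.
 by have := integrableD measurableT i1 i2; exact.
move=> T k s h; rewrite RintegralD// mulrDl -(c1 _ _ _ h) -(c2 _ _ _ h).
move: (f1 _) (f2 _) (f1 _) (f2 _) => a b c d; ring.
Qed.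

Lemma good_Z c g : good g -> good (fun l => c * g l).
move=> [t1 [f1 [p1 i1 c1]]]; split; first exact: tcZ.
exists (fun T => c * f1 T); split; first exact: potZ.
 by have := integrableZl measurableT c i1; exact.
by move=> T k s h; rewrite RintegralZl// -mulrA -(c1 _ _ _ h) mulrBr.
Qed.

Lemma good_eq g1 g2 : (forall l, g1 l = g2 l) -> good g1 -> good g2.
by move=> h; have -> : g1 = g2 by apply/funext. Qed.

(** [gfun n * ufun] is [gfun n.+1], so each factor [1 - ufun] produces a difference of two good
    functions, the second with a larger [n]. *)
Lemma good_pow j n : (n0 <= n)%N -> good (fun l => gfun n l * (1 - ufun l) ^+ j).
elim: j n => [|j IH] n hn.
 by apply: (good_eq _ (good_gfun hn)) => l; rewrite expr0 mulr1.
apply: (good_eq _ (good_D (IH n hn) (good_Z (-1) (IH n.+1 (leqW hn))))) => l.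
rewrite /gfun !exprS; ring.
Qed.

Lemma good_wN N : good (wN N).
suff h K : good (fun l => \sum_(j < K.+1) bcoef eexp j * (gfun n0 l * (1 - ufun l) ^+ j)).
 apply: (good_eq _ (h N)) => l; rewrite /wN /bpoly mulr_sumr; apply: eq_bigr => j _.
 by rewrite mulrCA.
elim: K => [|K IH].
 by apply: (good_eq _ (good_Z (bcoef eexp 0) (good_pow 0 (leqnn _)))) => l; rewrite big_ord1.
apply: (good_eq _ (good_D IH (good_Z (bcoef eexp K.+1) (good_pow K.+1 (leqnn _))))) => l.
by rewrite [RHS]big_ord_recr.
Qed.

Lemma wN_cvg l : (fun N => wN N l) @ \oo --> wfun l.
apply/cvgrPdist_le => e e0; have [K hK] := brho_unif eexp_ge1 (uv l) e0.
exists K => // N /= KN; rewrite ger0_norm ?subr_ge0 ?wN_le//.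
have := hK N KN (1 - ufun l); rewrite lexx (andP (uv l)).1 => /(_ isT) h.
have w0 := ltW (wfun_gt0 l); have -> : wfun l - wN N l = wfun l * (1 - brho eexp N (1 - ufun l)).
 by rewrite wN_brho mulrBr mulr1.
apply: le_trans h; rewrite ler_piMl ?wfun_le1//.
by have /andP[] := brho_bound eexp_ge1 N (uv l).
Qed.

Lemma wN_integral_cvg : (fun N => \int[leb]_l (wN N l)%:E)%E @ \oo -->
 (\int[leb]_l (wfun l)%:E)%E.
have -> : (\int[leb]_l (wfun l)%:E)%E =
  (\int[leb]_l limn (fun N => (wN N l)%:E))%E.
 apply: eq_integral => l _; apply/esym/cvg_lim => //; apply: cvg_EFin; first exact: nearW.
 exact: wN_cvg.
apply: cvg_monotone_convergence => // [N|N l _|l _ i j ij].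
- by apply/measurable_EFinP; have [] := bm_wN N.
- by rewrite lee_fin wN_ge0.
- rewrite lee_fin; elim: j i ij => [|j IH] i; first by rewrite leqn0 => /eqP ->.
 by rewrite leq_eqVlt => /predU1P[->//|]; rewrite ltnS => /IH /le_trans; apply; exact: wN_mono.
Qed.

Lemma wfun_integral_gt0 : (0 < \int[leb]_l (wfun l)%:E)%E.
have m01 := @mitv R `[0, 1].
have mw : measurable_fun [set: mR R] (EFin \o wfun).
 by apply/measurable_EFinP; have [] := bm_wfun.
have w0 l : (0 <= (wfun l)%:E)%E by rewrite lee_fin ltW// wfun_gt0.
have h1 : (0 < \int[leb]_(l in `[0%R, 1%R]) (wfun 1)%:E)%E.
 have e : @leb R `[0, 1]%classic = 1%E by rewrite lebesgue_measure_itv /= lte01 oppr0 adde0.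
 by rewrite integral_cst// [X in (_ * X)%E]e mule1 lte_fin; exact: wfun_gt0.
have h2 : (\int[leb]_(l in `[0%R, 1%R]) (wfun 1)%:E <=
  \int[leb]_(l in `[0%R, 1%R]) (wfun l)%:E)%E.
 apply: ge0_le_integral => //.
 - exact: measurable_funTS.
 - move=> l /=; rewrite in_itv /= => /andP[l0 l1]; rewrite lee_fin !wfun_hfun.
  rewrite ge0_ler_powR ?nnegrE ?mulr_ge0 ?(ltW p0) ?(ltW (hfun_gt0 _))//.
  by apply: hfun_mono; rewrite ler_pXn2r ?nnegrE.
have h3 : (\int[leb]_(l in `[0%R, 1%R]) (wfun l)%:E <= \int[leb]_l (wfun l)%:E)%E.
 by apply: ge0_subset_integral.
exact: lt_le_trans h1 (le_trans h2 h3).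
Qed.

Lemma CtildeE : Ctilde p = fine (\int[leb]_l (wfun l)%:E)%E.
by []. Qed.

Lemma sf_potential : exists2 f, pot f wfun &
 forall (T : nat -> op E) k s, chain T k s -> s = (Ctilde p)^-1 * (f (T k) - f (T 0%N)).
have /choice [f hf] : forall N, exists f : op E -> R, [/\ pot f (wN N),
 leb.-integrable [set: mR R] (EFin \o wN N) &
 forall (T : nat -> op E) k s, chain T k s -> f (T k) - f (T 0%N) = (\int[leb]_l wN N l) * s].
 by move=> N; have [_ h] := good_wN N.
have tN N : tc (wN N) by have [] := good_wN N.
have pN N : pot (f N) (wN N) by have [] := hf N.
have [h ph hc] := pot_lim tN tc_wfun pN wN_approx.
exists h => // T k s hs; have [M [U [_ hT _ _ _]]] := hs.
have c1 := hc (T k) (T 0%N) (hT k (leqnn _)).1 (hT 0%N (leq0n _)).1.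
have fE N : f N (T k) - f N (T 0%N) = (\int[leb]_l wN N l) * s by have [_ _ h3] := hf N; exact: h3.
rewrite (eq_cvg _ _ fE) in c1.
have finN N : (\int[leb]_l (wN N l)%:E)%E = (\int[leb]_l wN N l)%:E.
 rewrite /Rintegral fineK//; have [_ i _] := hf N; exact: integrable_fin_num i.
have c2 := wN_integral_cvg; rewrite (eq_cvg _ _ finN) in c2.
have := wfun_integral_gt0; rewrite CtildeE; move: c2.
case: (\int[leb]_l (wfun l)%:E)%E => [c| |] //= c2.
- rewrite lte_fin => c0; have {}c2 : (fun N => \int[leb]_l wN N l) @ \oo --> c.
  exact: (@fine_cvg R nat \oo _ (fun N => (\int[leb]_l wN N l)%:E) c c2).
 have c3 : (fun N => (\int[leb]_l wN N l) * s) @ \oo --> c * s.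
  by apply: cvgM => //; exact: cvg_cst.
 by rewrite -(cvg_eq_lim c3 c1) mulKf// gt_eqF.
(* The integral of [wfun] is infinite, so [Ctilde p] and its inverse have the value 0 and the claim
   is [s = 0]. Otherwise the integrals of [wN N], convergent after multiplication by [s], would
   converge, while they tend to [+oo]. *)
- move=> _; rewrite invr0 mul0r; apply/eqP/negPn/negP => s0.
 have c3 : (fun N => (\int[leb]_l wN N l) * s * s^-1) @ \oo --> (h (T k) - h (T 0%N)) * s^-1.
  by apply: cvgM => //; exact: cvg_cst.
 have e N : (\int[leb]_l wN N l) * s * s^-1 = \int[leb]_l wN N l by rewrite mulfK.
 rewrite (eq_cvg _ _ e) in c3.
 have c4 : (fun N => (\int[leb]_l wN N l)%:E) @ \oo --> ((h (T k) - h (T 0%N)) * s^-1)%:E.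
  by apply: cvg_EFin => //; exact: nearW.
 have l4 : limn (fun N => (\int[leb]_l wN N l)%:E) = ((h (T k) - h (T 0%N)) * s^-1)%:E.
  exact/cvg_lim.
 have l5 : limn (fun N => (\int[leb]_l wN N l)%:E) = +oo%E by exact/cvg_lim.
 by move: l5; rewrite l4.
Qed.

(** * Integration of a form along a path *)

Local Notation integ D f := (leb.-integrable (D%classic : borel R) (EFin \o f)).

Definition lint (f : R -> R) (a b I : R) :=
 integ `[a, b] f /\
 \int[leb]_(t in `[a, b]) f t = I.

(** End points are null sets. This matters because the two-sided derivative of a path need not exist
    at the end points of a piece. *)
Lemma lint_open (f g : R -> R) a b I : lint g a b I -> (forall t, a < t < b -> f t = g t) -> lint f a b I.
move=> [ig gI] fg.
have fg' : {in `]a, b[%classic, EFin \o f =1 EFin \o g}.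
 by move=> t /set_mem /=; rewrite in_itv /= => /fg ->.
have moo := @mitv R `]a, b[.
have mcc := @mitv R `[a, b].
have igo : integ `]a, b[ g.
 by apply: (integrableS mcc moo _ ig); exact: subset_itv_oo_cc.
have ifo : integ `]a, b[ f.
 by apply: (eq_integrable moo (EFin \o g)) => // t ht; rewrite fg'.
have mf := measurable_int _ ifo.
have mfc : measurable_fun (`[a, b]%classic : borel R) (EFin \o f).
 by apply/emeasurable_fun_itv_obnd_cbndP/emeasurable_fun_itv_bndo_bndcP.
have eqI (h : R -> \bar R) : measurable_fun (`]a, b[%classic : borel R) h ->
  (\int[leb]_(t in `]a, b[) h t = \int[leb]_(t in `[a, b]) h t)%E.
 by move=> mh; rewrite -(integral_itv_bndoo true false mh).
split.
 apply/integrableP; split=> //; rewrite -(eqI (fun t => `|(f t)%:E|)%E).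
  by case/integrableP: ifo.
 exact: measurableT_comp.
rewrite -gI /Rintegral -(eqI (EFin \o f)) // -(eqI (EFin \o g)); last exact: measurable_int igo.
by congr fine; apply: eq_integral => t ht; exact: fg'.
Qed.

Lemma lint_glue (f : R -> R) a m b I J : a < m -> m < b -> lint f a m I -> lint f m b J -> lint f a b (I + J).
move=> am mb [if1 <-] [if2 <-].
have m1 := @mitv R `[a, m].
have m2 := @mitv R `]m, b].
have m3 := @mitv R `[m, b].
have if3 : integ `]m, b] f.
 by apply: (integrableS m3 m2 _ if2); exact: subset_itv_oc_cc.
have eab : `[a, b]%classic = `[a, m]%classic `|` `]m, b]%classic.
 by rewrite -itv_bndbnd_setU// bnd_simp ltW.
have mf : measurable_fun (`[a, b]%classic : borel R) (EFin \o f).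
 by rewrite eab; apply/measurable_funU => //; split; [exact: measurable_int if1|exact: measurable_int if3].
have iab : integ `[a, b] f.
 apply/integrableP; split=> //; rewrite eab ge0_integral_setU//.
 - by apply: lte_add_pinfty; [case/integrableP: if1|case/integrableP: if3].
 - by rewrite -eab; exact: measurableT_comp.
 - by apply/disj_set2P; rewrite -subset0 => t /= []; rewrite !in_itv /= => /andP[_ h] /andP[]; rewrite ltNge h.
split=> //.
have := @Rintegral_itvB R f (BLeft a) (BRight b) m iab.
rewrite !bnd_simp => /(_ (ltW am) (ltW mb)) h.
by rewrite -(Rintegral_itv_obnd_cbnd if3) -h addrCA subrr addr0.
Qed.

Lemma lA_B g T X Y : tc g -> aN T -> aN X -> aN Y -> lA g T (X - Y) = lA g T X - lA g T Y.
move=> tg aT aX aY; rewrite -scaleN1r lA_D//; last exact: aNZ.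
by rewrite lA_Z// mulN1r.
Qed.

Section Path.
Variables (f : op E -> R) (g : R -> R).
Hypotheses (tg : tc g) (pf : pot f g).

Lemma aN_closed (T : op E) : (forall e, 0 < e -> exists2 S, aN S & opn (S - T) <= e) -> aN T.
move=> h; split.
 apply/eqP; rewrite -subr_eq0; apply/eqP/opn_eq0; apply/ler_addgt0Pl => e e0; rewrite addr0.
 have [S [sS _] hS] := h (e / 2) (divr_gt0 e0 (ltr0n _ 2)).
 have -> : T^† - T = (S - T) - (S - T)^† by rewrite adjB sS; opring.
 by rewrite (le_trans (opnB _ _))// opn_adj [leRHS]splitr lerD.
apply/inNP => Z hZ; apply/eqP; rewrite -subr_eq0; apply/eqP/opn_eq0.
apply/ler_addgt0Pl => e e0; rewrite addr0.
have z1 : 0 < 2 * (opn Z + 1) by rewrite mulr_gt0// ltr_wpDl// opn_ge0.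
have [S [_ /inNP nS] hS] := h _ (divr_gt0 e0 z1).
have -> : T * Z - Z * T = Z * (S - T) - (S - T) * Z.
 by rewrite mulrBl mulrBr (nS _ hZ); move: (T * Z) (Z * T) (Z * S) => *; opring.
rewrite (le_trans (opnB _ _))//.
have hz : opn (S - T) * opn Z <= e / 2.
 apply: (@le_trans _ _ (e / (2 * (opn Z + 1)) * (opn Z + 1))).
  by apply: ler_pM; rewrite ?opn_ge0// lerDl.
 by rewrite invfM mulrA divfK// gt_eqF// ltr_wpDl// opn_ge0.
rewrite [leRHS]splitr; apply: lerD; apply: (le_trans (opnM _ _)) => //.
by rewrite mulrC.
Qed.

Variables (T B : R -> op E) (a b : R).
Hypotheses (ab : a < b) (aT : forall t, a <= t <= b -> aN (T t)).
Hypothesis cB : forall t e, a <= t <= b -> 0 < e -> exists2 d, 0 < d &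
 forall s, a <= s <= b -> `|s - t| < d -> opn (B s - B t) <= e.
Hypothesis dT : forall t e, a <= t <= b -> 0 < e -> exists2 d, 0 < d &
 forall s, a <= s <= b -> `|s - t| < d -> opn (T s - T t - (s - t) *: B t) <= e * `|s - t|.

(** [B t] is a norm limit of difference quotients, which lie in the closed space of self-adjoint
    elements of the algebra. The increment is taken towards the side of [t] on which at least half
    of the interval remains. *)
Lemma path_aN t : a <= t <= b -> aN (B t).
move=> ht; apply: aN_closed => e e0; have [d d0 hd] := dT ht e0.
have [s [hs sd st]] : exists s, [/\ a <= s <= b, `|s - t| < d & s != t].
 have ba : 0 < b - a by rewrite subr_gt0.
 have [r rE] := opaque (Num.min (d / 2) ((b - a) / 2)).
 have r0 : 0 < r by rewrite rE lt_min !divr_gt0.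
 have rd : r < d by rewrite rE gt_min ltr_pdivrMr// ltr_pMr// ltr1n.
 have rb : r <= (b - a) / 2 by rewrite rE ge_min lexx orbT.
 have [tm|tm] := leP t ((a + b) / 2).
  exists (t + r); split; [lra| |by rewrite gt_eqF// ltrDl].
  by rewrite addrC addKr gtr0_norm.
 exists (t - r); split; [lra| |by rewrite lt_eqF// gtrBl].
 by rewrite addrAC subrr sub0r normrN gtr0_norm.
have s0 : s - t != 0 by rewrite subr_eq0.
exists ((s - t)^-1 *: (T s - T t)); first by apply: aNZ; apply: aNB; exact: aT.
have -> : (s - t)^-1 *: (T s - T t) - B t = (s - t)^-1 *: (T s - T t - (s - t) *: B t).
 by rewrite [RHS]scalerBr scalerA mulVf// scale1r.
apply: (le_trans (opnZ _ _)); rewrite normfV mulrC ler_pdivrMr ?normr_gt0//; exact: hd.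
Qed.

Lemma path_near t e : a <= t <= b -> 0 < e -> exists2 d, 0 < d &
 forall s, a <= s <= b -> `|s - t| < d -> opn (T s - T t) <= e.
move=> ht e0; have [d d0 hd] := dT ht ltr01.
have c0 : 0 < 1 + opn (B t) by rewrite ltr_wpDr// opn_ge0.
exists (Num.min d (e / (1 + opn (B t)))); first by rewrite lt_min d0 divr_gt0.
move=> s hs; rewrite lt_min => /andP[sd se].
have -> : T s - T t = (T s - T t - (s - t) *: B t) + (s - t) *: B t by rewrite subrK.
apply: (le_trans (opnD _ _)); rewrite ltr_pdivlMr// in se; apply: le_trans (ltW se).
rewrite mulrDr mulr1; apply: lerD; last exact: opnZ.
by rewrite -[leRHS]mul1r; exact: hd.
Qed.

Definition slope t := lA g (T t) (B t).

(** Joint continuity of the form: [pot_cont] moves the base point, [lA_bound] the direction. *)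
Lemma slope_near t e : a <= t <= b -> 0 < e -> exists2 d, 0 < d &
 forall s, a <= s <= b -> `|s - t| < d -> `|slope s - slope t| <= e.
move=> ht e0; have [C C0 hC] := lA_bound tg (aT ht); have aB := path_aN ht.
have c1 : 0 < opn (B t) + 1 by rewrite ltr_wpDl// opn_ge0.
have c2 : 0 < C + 1 by rewrite ltr_wpDl.
have e1 : 0 < e / 2 / (opn (B t) + 1) by rewrite !divr_gt0.
have e2 : 0 < Num.min 1 (e / 2 / (C + 1)) by rewrite lt_min ltr01 !divr_gt0.
have [d1 d10 h1] := pot_cont (opn (T t)) tg pf e1.
have [d2 d20 h2] := path_near ht d10; have [d3 d30 h3] := cB ht e2.
exists (Num.min d2 d3); first by rewrite lt_min d20.
move=> s hs; rewrite lt_min => /andP[sd2 sd3].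
have aBs := path_aN hs; have aTs := aT hs.
have hB : opn (B s - B t) <= Num.min 1 (e / 2 / (C + 1)) by exact: h3.
have hB1 : opn (B s) <= opn (B t) + 1.
 have -> : B s = B t + (B s - B t) by rewrite addrC subrK.
 by apply: opnD_le => //; apply: (le_trans hB); rewrite ge_min lexx.
have hB2 : opn (B s - B t) <= e / 2 / (C + 1) by apply: (le_trans hB); rewrite ge_min lexx orbT.
have -> : slope s - slope t = (lA g (T t + (T s - T t)) (B s) - lA g (T t) (B s)) + lA g (T t) (B s - B t).
 have -> : T t + (T s - T t) = T s by rewrite addrC subrK.
 by rewrite (lA_B tg (aT ht) aBs aB) addrA subrK.
rewrite (le_trans (ler_normD _ _))// [leRHS]splitr; apply: lerD.
 apply: (le_trans (h1 _ _ _ (aT ht) (aNB aTs (aT ht)) aBs (lexx _) (h2 _ hs sd2))).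
 by rewrite -[leRHS](divfK (lt0r_neq0 c1)) ler_wpM2l// ltW.
apply: (le_trans (hC _ (aNB aBs aB))).
apply: (@le_trans _ _ ((C + 1) * (e / 2 / (C + 1)))).
 by apply: ler_pM; rewrite ?opn_ge0// lerDl.
by rewrite mulrC divfK// gt_eqF.
Qed.

Lemma slope_cont : {within `[a, b], continuous slope}.
apply/subspace_continuousP => t; rewrite /= in_itv /= => ht; apply/cvgrPdist_le => e e0.
have [d d0 hd] := slope_near ht e0.
near=> s; rewrite distrC; apply: hd.
 by have : s \in `[a, b] by near: s; exact: withinT.
by near: s; apply: cvg_within; apply/nbhs_ballP; exists d => // z; rewrite /ball /= distrC.
Unshelve. all: by end_near. Qed.

(** Chain rule, then the fundamental theorem of calculus. The error splits into that of [f] at the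
    increment [X] of the path and the form evaluated at [X - (s - t) B t]. *)
Lemma path_lint : lint slope a b (f (T b) - f (T a)).
split; first by apply: continuous_compact_integrable; [exact: segment_compact|exact: slope_cont].
apply: (@ftc_lin (fun t => f (T t))) => //; first exact: slope_cont.
move=> t e ht e0; have [C C0 hC] := lA_bound tg (aT ht); have aB := path_aN ht.
have c1 : 0 < opn (B t) + 1 by rewrite ltr_wpDl// opn_ge0.
have c2 : 0 < C + 1 by rewrite ltr_wpDl.
have e1 : 0 < e / 2 / (opn (B t) + 1) by rewrite !divr_gt0.
have [e2 e2E] := opaque (Num.min 1 (e / 2 / (C + 1))).
have e20 : 0 < e2 by rewrite e2E lt_min ltr01 !divr_gt0.
have [d1 d10 h1] := pf (opn (T t)) e1.
have [d2 d20 h2] := path_near ht d10; have [d3 d30 h3] := dT ht e20.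
exists (Num.min d2 d3); first by rewrite lt_min d20.
move=> s hs; rewrite lt_min => /andP[sd2 sd3]; have aTs := aT hs.
have [X XE] := opaque (T s - T t); have aX : aN X by rewrite XE; apply: aNB => //; exact: aT.
have sX : T s = T t + X by rewrite XE addrC subrK.
have hX : opn X <= d1 by rewrite XE; exact: h2.
have hY := h3 s hs sd3; rewrite -XE in hY.
have aY : aN (X - (s - t) *: B t) by apply: aNB => //; exact: aNZ.
have n0 := normr_ge0 (s - t).
have hX1 : opn X <= (opn (B t) + 1) * `|s - t|.
 have -> : X = (s - t) *: B t + (X - (s - t) *: B t) by rewrite addrC subrK.
 rewrite mulrDl; apply: opnD_le; first by rewrite mulrC; exact: opnZ.
 by apply: (le_trans hY); rewrite ler_wpM2r// e2E ge_min lexx.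
have -> : f (T s) - f (T t) - (s - t) * slope t =
  (f (T t + X) - f (T t) - lA g (T t) X) + lA g (T t) (X - (s - t) *: B t).
 rewrite sX (lA_B tg (aT ht) aX (aNZ (s - t) aB)) (lA_Z (s - t) tg (aT ht) aB) /slope; move: (f _) (f _) (lA _ _ _) (lA _ _ _) => *; ring.
rewrite (le_trans (ler_normD _ _))// {1}[e]splitr mulrDl; apply: lerD.
 apply: (le_trans (h1 _ _ (aT ht) aX (lexx _) hX)).
 by rewrite -[X in _ <= X * _](divfK (lt0r_neq0 c1)) -[leRHS]mulrA ler_wpM2l// ltW.
apply: (le_trans (hC _ aY)).
apply: (@le_trans _ _ ((C + 1) * ((e / 2 / (C + 1)) * `|s - t|))).
 apply: ler_pM; rewrite ?opn_ge0 ?lerDl//; apply: (le_trans hY).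
 by rewrite ler_wpM2r// e2E ge_min lexx orbT.
by rewrite mulrA [_ * (e / 2 / _)]mulrC divfK// gt_eqF.
Qed.

End Path.

(** * Spectral projections of the bounded transform *)

Section Composition.
Context (P : pvm E) (h : R -> R) (bh : bm h).

Let mh : measurable_fun [set: mR R] (h : mR R -> mR R) := bh.1.

Let mpre B : measurable B -> measurable (h @^-1` B : borel R).
by move=> mB; rewrite -[X in measurable X]setTI; exact: mh. Qed.

Let push_measure x : {measure set (mR R) -> \bar R} :=
 @measure_function_pushforward__canonical__measure_function_Measure _ _ (mR R) (mR R) R (pmu P x) h mh.

Let push_fin x : fin_num_fun (push_measure x).
by move=> B mB; apply: fin_num_measure; exact: mpre. Qed.

Let push_fmeasure x : {finite_measure set (mR R) -> \bar R} :=
 HB.pack (push_measure x : borel R -> \bar R)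
  (Measure.on (push_measure x)) (@Measure_isFinite.Build _ _ _ (push_measure x) (@push_fin x)).

Let pre_proj B : measurable B -> proj (pE P (h @^-1` B)).
by move=> mB; apply: pE_proj; exact: mpre. Qed.
Let pre_T : pE P (h @^-1` setT) = 1. by rewrite preimage_setT pE_T. Qed.
Let pre_I (B C : borel R) : measurable B -> measurable C -> pE P (h @^-1` (B `&` C)) = pE P (h @^-1` B) * pE P (h @^-1` C).
by move=> mB mC; rewrite preimage_setI pE_I//; exact: mpre. Qed.
Let pre_mu x B : measurable B -> push_fmeasure x B = (q (pE P (h @^-1` B)) x)%:E.
by move=> mB; rewrite -(pmuE P x (mpre mB)). Qed.

(** The spectral measure of the bounded operator [h(D)] is the image of that of [D]. It is needed
    because [nonneg_projection] applies the calculus to the transform and not to [D]. *)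
Definition push_pvm : pvm E := Pvm pre_proj pre_T pre_I pre_mu.

Lemma push_pvm_int f x : bm (fun l => f (h l)) -> measurable_fun [set: mR R] (f : mR R -> R) ->
 (\int[pmu push_pvm x]_l (f l)%:E = \int[pmu P x]_l (f (h l))%:E)%E.
move=> bf mf; have i := bm_int (pmu P x) bf.
have mf' : measurable_fun [set: mR R] (EFin \o f : mR R -> \bar R).
 exact/measurable_EFinP.
have := @integral_pushforward _ _ (mR R) (mR R) R h mh (pmu P x) setT _ mf'.
by rewrite preimage_setT => /(_ i measurableT).
Qed.

Lemma push_pvm_of : pvm_of (of_bounded (fc P h)) push_pvm.
have bs : bm (fun l => h l ^+ 2) by exact: bmX.
have ms : measurable_fun [set: mR R] (fun l : mR R => (l : R) ^+ 2) by exact: measurable_funX.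
split=> x; last by move=> _; rewrite /Rintegral push_pvm_int ?measurable_id//=; have := fc_q P x bh.
split=> // _; rewrite (push_pvm_int x bs ms).
by rewrite ltey_eq integrable_fin_num//; exact: bm_int.
Qed.
End Composition.

Lemma fcalc_of (D : unbounded_operator E) (sD : usa D) (P : pvm E) f : pvm_of D P -> bm f -> fcalc (hdot E) D f = fc P f.
by move=> hP bf; rewrite (fcalcE sD bf) (fc_pvm_of sD hP bf). Qed.

Lemma nonneg_projection_fc (P : pvm E) h : bm h ->
 nonneg_projection (hdot E) (fc P h) = fc P (fun l => pos1 (h l)).
move=> bh; rewrite /nonneg_projection (fcalc_of (of_bounded_usa (fc_sa P bh)) (push_pvm_of P bh) bm_pos1).
have mh : measurable_fun [set: mR R] (h : mR R -> mR R) := bh.1.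
have m1 : measurable (h @^-1` [set l | 0 <= l] : borel R).
 by rewrite -[X in measurable X]setTI; apply: mh => //; exact: pos1_meas.
have -> : (fun l => pos1 (h l)) = \1_(h @^-1` [set l | 0 <= l]) :> (R -> R) by [].
by rewrite (fc_ind _ pos1_meas) (fc_ind _ m1).
Qed.

Lemma nonneg_projection_Ffun T : nonneg_projection (hdot E) (fA T Ffun) = Pp T.
rewrite /fA nonneg_projection_fc; last exact: bm_Ffun.
congr (opf (fc _ _)); apply/funext => l; have k0 := kfun_gt0 l; rewrite /Ffun -/(kfun l) /pos1 !indicE.
have [l0|l0] := leP 0 l.
 by rewrite !mem_set//=; apply: mulr_ge0 => //; exact: ltW.
by rewrite !memNset//=; apply/negP; rewrite -ltNge// pmulr_llt0.
Qed.

Lemma resolvent_power_fA T : aN T -> resolvent_power (hdot E) p (DA T) = fA T wfun.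
move=> [sT _]; rewrite /resolvent_power (fcalc_of (perturb_usa sD0 sT) (PA_of sT))//.
exact: bm_wfun.
Qed.

Lemma bounded_transform_fA T : aN T -> bounded_transform (hdot E) (DA T) = fA T Ffun.
move=> [sT _]; rewrite /bounded_transform /resolvent_power.
have -> : (fun l : R => (1 + l ^+ 2) `^ (- (1 / 2))) = kfun by apply/funext => l; rewrite div1r.
have sD := perturb_usa sD0 sT.
rewrite (fcalc_of sD (PA_of sT) bm_kfun)//; apply/funext => x /=.
exact: (fc_dom sD (PA_of sT) x bm_kfun bm_Ffun).2.
Qed.

(** The imaginary part is [- rtr (opJ X w)]; taking adjoints and then permuting cyclically changes
    its sign. *)
Lemma ctr_mul_real X w : aN X -> sa w -> L1 A w -> ctr A (X * w) \is Num.real.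
move=> [sX nX] sw lw; have lS := L1Ml nX lw.
have r0 : rtr A (opJ * (X * w)) = 0.
 have nJX : inN A (opJ * X) by apply: inNM => //; exact: inNJ.
 have h : rtr A (opJ * (X * w)) = - rtr A (opJ * (X * w)).
  rewrite -{1}(rtr_adj (L1J lS)) !adjM adjJ sX sw mulrN -mulrA -opJC rtrN; last by rewrite opJC mulrA; apply: L1Mr; [|exact: L1Mr] => //; exact: inNJ.
  by rewrite -(rtrC nJX lw) mulrA.
 lra.
move: r0; move: lS => [P1 [P2 [P3 [P4 [[h1 h2] [h3 h4] ->]]]]].
have -> : opJ * (P1 - P2 + opJ * (P3 - P4)) = P4 - P3 + opJ * (P1 - P2).
 rewrite mulrDr mulrA opJJ mulN1r opprB addrC; by [].
rewrite rtrE// ctrE// => e; have -> : tr A P3 - tr A P4 = 0 by lra.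
by rewrite complex_real.
Qed.

(** Let [Q] be the spectral projection of [D0] for [hfun >= d]. It has finite trace, being dominated
    by a multiple of [wfun], so [T Q] is trace class; the rest of [T] has norm at most [c d]. *)
Lemma Kc_compact c T : 0 <= c -> Kc c T -> compact_ideal (hdot E) (tN A) (ttau A) T.
move=> c0 [nT hT] I [_ _ _ _ cI] LI; apply: cI => // e e0.
have c1 : 0 < c + 1 by rewrite ltr_wpDl.
have [d dE] := opaque (e / 2 / (c + 1)); have d0 : 0 < d by rewrite dE !divr_gt0.
have dp : 0 < d `^ (2 * p) by rewrite powR_gt0.
have [B BE] := opaque ([set l : R | d <= hfun l] : borel R).
have mB : measurable B by rewrite BE; exact: meas_hset.
have bB := bm_ind mB; have bB' : bm (fun l => 1 - \1_B l) by apply: bmB => //; exact: bm_cst.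
have fE : fp A (fc P0 (\1_B)).
 apply: (@fp_le _ _ _ _ ((d `^ (2 * p))^-1 *: fc P0 wfun)).
 - by apply: pos_fc => [||l]; [exact: P0N|exact: bB|rewrite indicE].
 - rewrite -fcZ; last exact: bm_wfun.
  apply: fc_lop => // [|l]; first by apply: bmZ; exact: bm_wfun.
  have w0 : 0 <= (d `^ (2 * p))^-1 * wfun l by rewrite mulr_ge0// ?invr_ge0 ltW// wfun_gt0.
  rewrite indicE; case: (boolP (l \in B)) => //= /set_mem; rewrite BE => hl.
  rewrite mulrC ler_pdivlMr// mul1r wfun_hfun ge0_ler_powR ?nnegrE ?mulr_ge0 ?(ltW p0)//.
   exact: ltW.
  by rewrite ltW// hfun_gt0.
 - apply: fpZ; first by rewrite invr_ge0 ltW.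
  by split=> //; apply: pos_fc => [||l]; [exact: P0N|exact: bm_wfun|rewrite ltW// wfun_gt0].
exists (opf (T * fc P0 (\1_B))); first by apply: LI; apply/L1P; apply: L1Ml => //; exact: fp_L1.
have -> : opf T \- opf (T * fc P0 (\1_B)) = opf (T * fc P0 (fun l => 1 - \1_B l)).
 apply/funext => x; rewrite fcB//; last exact: bm_cst.
 by rewrite fc_cst scale1r mulrBr mulr1.
apply: (@le_lt_trans _ _ (c * d)); last first.
 have : d * (c + 1) = e / 2 by rewrite dE divfK// gt_eqF.
 rewrite mulrDr mulr1 (mulrC d); lra.
apply: opn_lub => [|x]; first by rewrite mulr_ge0// ltW.
rewrite opME; apply: (le_trans (hT _)); rewrite -mulrA ler_wpM2l// /hop -opME.
rewrite -fcM//; last exact: bm_hfun.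
apply: (le_trans (opn_le _ _)); rewrite ler_wpM2r ?nrm_ge0//.
apply: fc_opn => [|l]; first by apply: bmM => //; exact: bm_hfun.
have h0 := hfun_gt0 l; rewrite normrM (gtr0_norm h0) indicE.
case: (boolP (l \in B)) => /= hl; first by rewrite subrr normr0 mulr0 ltW.
rewrite subr0 normr1 mulr1 leNgt; apply: contra hl => hl; apply: mem_set; rewrite BE; exact: ltW.
Qed.

(** The transform is its own parametrix: [F^2 - 1 = - ufun (D0 + T)] is dominated by [hop], hence
    compact. *)
Lemma FA_fredholm T : aN T -> breuer_fredholm (hdot E) (tN A) (ttau A) (fA T Ffun).
move=> aT; have nF := fA_N aT bm_Ffun; split; first exact: nF.
have nu := fA_N aT bm_ufun.
have h : compact_ideal (hdot E) (tN A) (ttau A) (opf (- fA T ufun)).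
 have c0 : 0 <= 1 + 8 * opn T by rewrite addr_ge0// mulr_ge0// opn_ge0.
 apply: (Kc_compact c0); apply: KcN; split=> // x; apply: le_trans (hop_A x aT.1).
 apply: fc_nrm_le => [||l]; [exact: bm_ufun|exact: bm_hfun|].
 rewrite /ufun -hfun4 normrX; have h0 := hfun_gt0 l; have := hfun_le1 l; rewrite gtr0_norm// => h1.
 by rewrite exprS ler_piMr ?(ltW h0)// exprn_ile1// ltW.
have e : fA T Ffun * fA T Ffun - 1 = - fA T ufun.
 rewrite /fA -fcM//; try exact: bm_Ffun.
 rewrite -[X in _ - X]scale1r -(fc_cst (PA T) 1) -fcB.
 rewrite -fcN; [congr (fc _ _); apply/funext => l|exact: bm_ufun].
 - by rewrite -expr2 Ffun_sq addrAC subrr sub0r.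
 - by apply: bmM; exact: bm_Ffun.
 - exact: bm_cst.
have e' : (opf (fA T Ffun) \o opf (fA T Ffun)) \- id = opf (- fA T ufun) by rewrite -e.
by exists (opf (fA T Ffun)); split; rewrite ?e'.
Qed.

Lemma calkin_compact T : compact_ideal (hdot E) (tN A) (ttau A) (opf T) ->
 calkin_norm (hdot E) (tN A) (ttau A) (opf T) < 1.
move=> kT; rewrite /calkin_norm; set S := [set _ | _ in _].
(* Without an infimum the default value 0 satisfies the bound as well. *)
have [hS|nS] := pselect (has_inf S); last by rewrite inf_out.
apply: le_lt_trans (ge_inf hS.2 _) ltr01; exists (opf T) => //.
by rewrite -[RHS](opn0 (E := E)) -(subrr T).
Qed.

(** * Unitary equivalence of perturbed operators *)

Section Conjugate.
Variables (T1 T2 U : op E).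
Hypotheses (s1 : sa T1) (s2 : sa T2) (U1 : U^† * U = 1) (U2 : U * U^† = 1).
Hypothesis dU : forall x, dom (DA T2) (U x) <-> dom (DA T1) x.
Hypothesis eU : forall x, dom (DA T1) x -> DA T2 (U x) = U (DA T1 x).

Let P := PA T1.
Let G (B : borel R) := U * pE P B * U^†.

Let G_proj B : measurable B -> proj (G B).
move=> mB; have [sP PP] := pE_proj P mB; split.
 by rewrite /sa /G !adjM adjK sP mulrA.
by rewrite /G -!mulrA (mulrA U^†) U1 mul1r (mulrA (pE P B) (pE P B)) PP.
Qed.
Let G_T : G setT = 1. by rewrite /G pE_T mulr1. Qed.
Let G_I (B C : borel R) : measurable B -> measurable C -> G (B `&` C) = G B * G C.
by move=> mB mC; rewrite /G pE_I// -!mulrA (mulrA U^†) U1 mul1r. Qed.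
Let G_mu x B : measurable B -> pmu P (U^† x) B = (q (G B) x)%:E.
by move=> mB; rewrite pmuE// /q /G !opME [in RHS]adjP'. Qed.

(** The conjugated projections form a resolution of [D0 + T2], and resolutions are unique. *)
Lemma fA_conj f : bm f -> fA T2 f = U * fA T1 f * U^†.
move=> bf; pose P' := Pvm G_proj G_T G_I G_mu.
have hP := PA_of s1; have sD := perturb_usa sD0 s2.
have UU x : U (U^† x) = x by rewrite -opME U2.
have hP' : pvm_of (DA T2) P'.
 split=> x; first by rewrite -{1}(UU x) dU; exact: hP.1.
 move=> dx; have dx' : dom (DA T1) (U^† x) by rewrite -dU UU.
 rewrite -[RHS](hP.2 _ dx') -{1}(UU x) eU// adjP' ; by [].
have [_ hq] : True /\ forall x, q (U * fA T1 f * U^†) x = \int[pmu P' x]_l f l.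
 by split=> // x; rewrite -(fc_q P (U^† x) bf) /q !opME adjP'.
have sf := fc_sa P bf.
rewrite {1}/fA (PA_specp sD s2) -(fc_pvm_of sD hP' bf); apply: fc_uniq => //.
by rewrite /sa !adjM adjK -mulrA; congr (_ * (_ * _)).
Qed.
End Conjugate.

Lemma within_epsP (g : R -> R) (J : set R) (t : R) : g s @[s --> within J (nbhs t)] --> (0 : R) <->
 forall e, 0 < e -> exists2 d, 0 < d & forall s, J s -> `|s - t| < d -> `|g s| <= e.
split=> [/cvgr0Pnorm_le h e e0|h].
 have /nbhs_ballP[d /= d0 hd] := h e e0; exists d => // s Js sd.
 by apply: hd => //; rewrite /ball /= distrC.
apply/cvgr0Pnorm_le => e e0; have [d d0 hd] := h e e0.
by apply/nbhs_ballP; exists d => // s; rewrite /ball /= distrC => sd Js; exact: hd.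
Qed.

Lemma dwithin_epsP (g : R -> R) (J : set R) (t : R) : g s @[s --> within J t^'] --> (0 : R) <->
 forall e, 0 < e -> exists2 d, 0 < d & forall s, J s -> s != t -> `|s - t| < d -> `|g s| <= e.
split=> [/cvgr0Pnorm_le h e e0|h].
 have /nbhs_ballP[d /= d0 hd] := h e e0; exists d => // s Js st sd.
 by apply: hd => //; rewrite /ball /= distrC.
apply/cvgr0Pnorm_le => e e0; have [d d0 hd] := h e e0.
by apply/nbhs_ballP; exists d => // s; rewrite /ball /= distrC => sd st Js; exact: hd.
Qed.

Lemma sa_partP T : self_adjoint_part (hdot E) (tN A) (opf T) <-> aN T.
by split=> -[] => [h /self_adjointP|/self_adjointP h h']; split. Qed.

Lemma sa_part_op f : self_adjoint_part (hdot E) (tN A) f -> exists2 T, aN T & opf T = f.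
by move=> h; have [T eT] := tN_op h.1; exists T => //; apply/sa_partP; rewrite eT.
Qed.

Lemma unitary_op u : tN A u -> unitary (hdot E) u ->
 exists U : op E, [/\ opf U = u, inN A U, U^† * U = 1 & U * U^† = 1].
move=> nu [bu iu ru]; have [U eU] := tN_op nu; subst u.
have U1 : U^† * U = 1.
 rewrite -[LHS]adjK; apply: adj_uniq => x y.
 by rewrite adjM adjK opME adjP op1E /rip iu.
exists U; split=> //; apply: op_ext => x; have [y _ <-] : range U x by rewrite ru.
by rewrite opME -(opME U^†) U1.
Qed.

(** * Spectral flow along the path *)

Section Flow.
Variables (B : R -> E -> E) (T : R -> op E) (a b : R).
Hypotheses (ab : a < b) (aT : forall t, a <= t <= b -> aN (T t))
 (BT : forall t, a <= t <= b -> B t = opf (T t)) (cB : Defs.norm_continuous a b B).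

Let F t := bounded_transform (hdot E) (perturb D0 (B t)).

Let FE t : a <= t <= b -> F t = opf (fA (T t) Ffun).
by move=> ht; rewrite /F BT// -/(DA _) bounded_transform_fA//; exact: aT. Qed.
Let PE t : a <= t <= b -> nonneg_projection (hdot E) (F t) = opf (Pp (T t)).
by move=> ht; rewrite FE// nonneg_projection_Ffun. Qed.

(** By [Pp_Kc] and [Kc_compact] all projections [Pp (T t)] agree modulo the compact ideal, so the
    partition with the single interval [[a, b]] is fine enough. *)
Lemma flow_value_exists : exists v, spectral_flow_value (hdot E) (tN A) (ttau A) a b F v.
eexists; split; last first.
 exists [:: b]; split; first exact: itv_partition1.
  move=> [|//] _ t t' /=; rewrite !in_itv /= => ht ht'.
  rewrite !PE// (_ : _ \- _ = opf (Pp (T t) - Pp (T t')))//.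
  have M1 : opn (T t) <= opn (T t) + opn (T t') by rewrite lerDl opn_ge0.
  have M2 : opn (T t') <= opn (T t) + opn (T t') by rewrite lerDr opn_ge0.
  apply: calkin_compact; apply: (Kc_compact _ (Pp_Kc (aT ht') (aT ht) M2 M1)).
  have := opn_ge0 (T t); have := opn_ge0 (T t'); lra.
 by [].
- move=> t; rewrite in_itv /= => ht; apply/within_epsP => e e0.
 have /within_epsP h : (fun s => opnorm (B s \- B t)) s @[s --> within `[a, b] (nbhs t)] --> (0 : R).
  by apply: cB; rewrite in_itv.
 have [d d0 hd] := h (e / 8) (divr_gt0 e0 (ltr0n _ 8)); exists d => // s hs sd.
 have := hd s hs sd; move: hs; rewrite /= in_itv /= => hs.
 rewrite !BT// !FE// (_ : opf (T s) \- opf (T t) = opf (T s - T t))//.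
 rewrite (_ : opf _ \- opf _ = opf (fA (T s) Ffun - fA (T t) Ffun))// -!/(opn _) !ger0_norm ?opn_ge0// => h8.
 have := FA_opn (aT ht) (aNB (aT hs) (aT ht)); rewrite (addrC (T t)) subrK; lra.
- move=> t; rewrite in_itv /= => ht; rewrite FE//; split; first exact: FA_fredholm (aT ht).
 by apply/self_adjointP; apply: fc_sa; exact: bm_Ffun.
Qed.

Hypothesis ue : unitarily_equivalent (hdot E) (tN A) (perturb D0 (B a)) (perturb D0 (B b)).

(** Every admissible partition gives a chain, so the formula holds for whichever value
    [spectral_flow] selects, and independence of the partition comes out of it. *)
Lemma flow_value_chain v : spectral_flow_value (hdot E) (tN A) (ttau A) a b F v ->
 exists (S : nat -> op E) k, [/\ S 0%N = T a, S k = T b & chain S k v].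
move=> [_ _ [s [ps _ ->]]].
have ha : a <= a <= b by rewrite lexx ltW.
have hb : a <= b <= b by rewrite lexx ltW.
have [u [nu uu du eu]] := ue; have [U [uE nU U1 U2]] := unitary_op nu uu; subst u.
rewrite !BT// in du eu.
have nthb : nth b (a :: s) (size s) = b by exact: itv_partition_nth_size.
have hn i : (i <= size s)%N -> a <= nth b (a :: s) i <= b.
 by move=> ik; rewrite (itv_partition_nth_ge _ ps)// (itv_partition_nth_le _ ps).
exists (fun i => T (nth b (a :: s) i)), (size s); split=> //; first by rewrite nthb.
exists (\sum_(j < (size s).+1) opn (T (nth b (a :: s) j))), U; split=> //.
- by rewrite sumr_ge0// => i _; exact: opn_ge0.
- move=> i ik; split; first exact: aT (hn _ ik).
 rewrite -ltnS in ik; rewrite (bigD1 (Ordinal ik))//= lerDl sumr_ge0// => j _; exact: opn_ge0.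
- have [sa1 _] := aT ha; have [sb _] := aT hb.
 by rewrite nthb /=; split; apply: (fA_conj sa1 sb U1 U2 du eu); [exact: bm_Ffun|exact: bm_pos1].
- by apply: eq_bigr => i _; rewrite !PE//; [exact: (hn i.+1)|apply: hn; exact: ltnW].
Qed.

Lemma spectral_flow_value_of : exists2 f, pot f wfun &
 spectral_flow (hdot E) (tN A) (ttau A) a b (fun t => perturb D0 (B t)) = (Ctilde p)^-1 * (f (T b) - f (T a)).
have [f pf hf] := sf_potential; exists f => //; rewrite /spectral_flow.
have [v hv] := flow_value_exists; have := xgetPex 0 (ex_intro _ v hv).
set w := xget _ _ => /flow_value_chain[S [k [S0 Sk hc]]].
by rewrite (hf S k w hc) S0 Sk.
Qed.
End Flow.

(** * The integrand along piecewise differentiable paths *)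

Section Integrand.
Variables (B : R -> E -> E) (T : R -> op E) (f : op E -> R).
Hypothesis pf : pot f wfun.

Let integrand t := complex.Re (trace (hdot E) (tN A) (ttau A)
 (op_derivative B t \o resolvent_power (hdot E) p (perturb D0 (B t)))).

(** [op_derivative] is the two-sided derivative, which is identified with the given one at interior
    points; [lint_open] takes care of the ends. *)
Lemma integrand_C1 a b : a < b -> (forall t, a <= t <= b -> aN (T t)) ->
 (forall t, a <= t <= b -> B t = opf (T t)) -> C1_path a b B -> lint integrand a b (f (T b) - f (T a)).
move=> ab aT BT [B' [cB' dB']].
pose S t : op E := if pselect (bounded_operator (B' t)) is left h then Op h else 0.
have SE t : a <= t <= b -> opf (S t) = B' t.
 by move=> ht; rewrite /S; case: pselect => // -[]; apply: (dB' t _).1; rewrite in_itv.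
have cS t e : a <= t <= b -> 0 < e -> exists2 d, 0 < d &
  forall s, a <= s <= b -> `|s - t| < d -> opn (S s - S t) <= e.
 move=> ht e0; have /within_epsP h : (fun s => opnorm (B' s \- B' t)) s @[s --> within `[a, b] (nbhs t)] --> (0 : R).
  by apply: cB'; rewrite in_itv.
 have [d d0 hd] := h e e0; exists d => // s hs sd.
 apply: le_trans (ler_norm _) _; have := hd s _ sd; rewrite /= in_itv /= => /(_ hs).
 by rewrite -!SE.
have dT t e : a <= t <= b -> 0 < e -> exists2 d, 0 < d & forall s, a <= s <= b -> `|s - t| < d ->
  opn (T s - T t - (s - t) *: S t) <= e * `|s - t|.
 move=> ht e0; have ti : t \in `[a, b] by rewrite in_itv.
 have [_ /dwithin_epsP h] := dB' t ti; have [d d0 hd] := h e e0; exists d => // s hs sd.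
 have [->|st] := eqVneq s t; first by rewrite !subrr scale0r subr0 opn0 normr0 mulr0.
 have st0 : s - t != 0 by rewrite subr_eq0.
 have := hd s _ st sd; rewrite /= in_itv /= => /(_ hs); rewrite !BT// -SE//.
 rewrite (_ : (_ *: _) \- _ = opf ((s - t)^-1 *: (T s - T t) - S t))// -/(opn _) ger0_norm ?opn_ge0// => h'.
 have -> : T s - T t - (s - t) *: S t = (s - t) *: ((s - t)^-1 *: (T s - T t) - S t).
  by rewrite scalerBr scalerA mulfV// scale1r.
 by apply: (le_trans (opnZ _ _)); rewrite mulrC ler_wpM2r.
apply: (lint_open (path_lint tc_wfun pf ab aT cS dT)) => t /andP[at' tb].
have ht : a <= t <= b by rewrite !ltW.
rewrite /integrand BT// -/(DA _) (resolvent_power_fA (aT t ht)) /slope /lA /rtr /ctr.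
suff -> : op_derivative B t = opf (S t) by [].
have ti : t \in `[a, b] by rewrite in_itv.
apply: get_unique.
 split; first exact: op_bounded.
 have [_ /dwithin_epsP h] := dB' t ti; apply/dwithin_epsP => e e0.
 have [d d0 hd] := h e e0; exists (Num.min d (Num.min (t - a) (b - t))).
  by rewrite !lt_min d0 !subr_gt0 at'.
 move=> s _ st; rewrite !lt_min => /and3P[sd sa' sb]; rewrite SE//; apply: hd => //.
 rewrite /= in_itv /=; move: sa' sb; rewrite !ltr_norml => /andP[? ?] /andP[? ?]; lra.
move=> V [bV /dwithin_epsP hV].
suff : S t = Op bV by move=> ->.
apply/eqP; rewrite -subr_eq0; apply/eqP/opn_eq0; apply/ler_addgt0Pl => e e0; rewrite addr0.
have [_ /dwithin_epsP hS] := dB' t ti; have e2 : 0 < e / 2 by rewrite divr_gt0.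
have [d1 d10 h1] := hS _ e2; have [d2 d20 h2] := hV _ e2.
(* Two candidate derivatives at [t] are compared through one difference quotient, at a step [r]
   small enough for both and staying within the interval. *)
have [r rE] := opaque (Num.min (Num.min d1 d2) (b - t) / 2).
have m0 : 0 < Num.min (Num.min d1 d2) (b - t) by rewrite !lt_min d10 d20 subr_gt0.
have r0 : 0 < r by rewrite rE divr_gt0.
have rm : r < Num.min (Num.min d1 d2) (b - t) by rewrite rE ltr_pdivrMr// ltr_pMr// ltr1n.
move: rm; rewrite !lt_min => /andP[/andP[r1 r2] rb].
have st : t + r != t by rewrite gt_eqF// ltrDl.
have sr : `|t + r - t| = r by rewrite addrC addKr gtr0_norm.
have hs : a <= t + r <= b by lra.
have := h1 (t + r); have := h2 (t + r); rewrite /= in_itv /= sr st hs -SE// !BT//.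
move=> /(_ I isT r2) g2 /(_ isT isT r1) g1.
pose Q := (t + r - t)^-1 *: (T (t + r) - T t).
have {}g1 : opn (Q - S t) <= e / 2 by exact: le_trans (ler_norm _) g1.
have {}g2 : opn (Q - Op bV) <= e / 2 by exact: le_trans (ler_norm _) g2.
have -> : S t - Op bV = (Q - Op bV) - (Q - S t) by rewrite opprB [RHS]addrC addrA subrK.
by rewrite (le_trans (opnB _ _))// [leRHS]splitr lerD.
Qed.

Lemma integrand_piecewise a b s : itv_partition a b s -> a < b -> (forall t, a <= t <= b -> aN (T t)) ->
 (forall t, a <= t <= b -> B t = opf (T t)) ->
 (forall i, (i < size s)%N -> C1_path (nth b (a :: s) i) (nth b s i) B) ->
 lint integrand a b (f (T b) - f (T a)).
elim: s a => [|c s IH] a ps ab aT BT hC; first by move: ab; rewrite (itv_partition_nil ps) ltxx.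
have ac : a < c by case: ps => /andP[].
have ps' := itv_partition_cons ps; have cb := itv_partition_le ps'.
have l1 : lint integrand a c (f (T c) - f (T a)).
 by apply: integrand_C1 => // [t /andP[h1 h2]|t /andP[h1 h2]|]; [apply: aT|apply: BT|exact: (hC 0%N)];
  rewrite h1 (le_trans h2).
move: cb; rewrite le_eqVlt => /predU1P[cb|cb]; first by rewrite -cb.
have -> : f (T b) - f (T a) = (f (T c) - f (T a)) + (f (T b) - f (T c)) by ring.
apply: (lint_glue ac cb l1); apply: IH => // [t /andP[h1 h2]|t /andP[h1 h2]|i hi].
- by apply: aT; rewrite h2 (le_trans (ltW ac)).
- by apply: BT; rewrite h2 (le_trans (ltW ac)).
- exact: (hC i.+1).
Qed.
End Integrand.

(** * The one-form on the affine space of [D0] *)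

Lemma affine_DA D : affine_space (hdot E) (tN A) D0 D -> exists2 T, aN T & D = DA T.
by move=> [f /sa_part_op[T aT <-] ->]; exists T. Qed.

(** Unbounded operators are total functions with a domain, so equality of the records yields
    [D0 x + T x = D0 x + S x] at every [x]. *)
Lemma DA_inj T S : DA T = DA S -> T = S.
move=> h; apply: op_ext => x; have := congr1 (fun D => app D x) h.
by move=> /= /addrI.
Qed.

Lemma summable_form_lA T X : aN T -> summable_form (hdot E) (tN A) (ttau A) p (DA T) X = (Ctilde p)^-1 * lA wfun T X.
by move=> aT; rewrite /summable_form (resolvent_power_fA aT). Qed.

Lemma form_trace_class D (X : E -> E) : affine_space (hdot E) (tN A) D0 D -> self_adjoint_part (hdot E) (tN A) X ->
 trace_class (hdot E) (tN A) (ttau A) (X \o resolvent_power (hdot E) p D) /\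
 trace (hdot E) (tN A) (ttau A) (X \o resolvent_power (hdot E) p D) \is Num.real.
move=> /affine_DA[T aT ->] /sa_part_op[Y aY <-]; rewrite (resolvent_power_fA aT).
have lw := tc_wfun.2 T aT; split; first exact/(L1P A (Y * fA T wfun))/(L1Ml aY.2 lw).
apply: (ctr_mul_real aY _ lw); apply: fc_sa; exact: bm_wfun.
Qed.

Lemma form_one_form : one_form (hdot E) (tN A) D0 (summable_form (hdot E) (tN A) (ttau A) p).
move=> D /affine_DA[T aT ->]; split=> [c X Y /sa_part_op[X' aX <-] /sa_part_op[Y' aY <-]|].
 rewrite (_ : _ \+ _ = opf (c *: X' + Y'))// !summable_form_lA//.
 rewrite (lA_D tc_wfun aT (aNZ c aX) aY) (lA_Z c tc_wfun aT aX) mulrDr; congr (_ + _).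
 by rewrite mulrCA.
have [C C0 hC] := lA_bound tc_wfun aT; exists (`|(Ctilde p)^-1| * C) => X /sa_part_op[X' aX <-].
by rewrite summable_form_lA// normrM -mulrA ler_wpM2l//; exact: hC.
Qed.

(** The potential is a function of the perturbation [T]; [DA_inj] allows it to be read as a function
    of [D0 + T]. *)
Lemma form_exact : exact (hdot E) (tN A) D0 (summable_form (hdot E) (tN A) (ttau A) p).
have [f pf _] := sf_potential.
exists (fun D => (Ctilde p)^-1 * f (xget 0 [set T | D = DA T])) => D X /affine_DA[T aT ->] /sa_part_op[Y aY <-].
have fE (s : R) : xget 0 [set S | perturb (DA T) (s%:C *: opf Y) = DA S] = T + s *: Y.
 have e : perturb (DA T) (s%:C *: opf Y) = DA (T + s *: Y).
  by rewrite /DA /perturb; congr UnboundedOperator; apply/funext => x; rewrite /= -addrA.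
 by apply: xget_unique => //= S; rewrite e => /DA_inj.
have -> : (fun s : R => (Ctilde p)^-1 * f (xget 0 [set S | perturb (DA T) (s%:C *: opf Y) = DA S])) =
  (Ctilde p)^-1 \*: (fun s : R => f (T + s *: Y)).
 by apply/funext => s; rewrite fE.
rewrite summable_form_lA//.
have h := pot_line 0 tc_wfun pf aT aY; rewrite scale0r addr0 in h.
exact: is_deriveZ.
Qed.

Lemma form_path a b (B : R -> E -> E) : a < b ->
 (forall t, t \in `[a, b] -> self_adjoint_part (hdot E) (tN A) (B t)) -> piecewise_C1_path a b B ->
 unitarily_equivalent (hdot E) (tN A) (perturb D0 (B a)) (perturb D0 (B b)) ->
 let integrand t := complex.Re (trace (hdot E) (tN A) (ttau A)
  (op_derivative B t \o resolvent_power (hdot E) p (perturb D0 (B t)))) in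
 leb.-integrable `[a, b] (EFin \o integrand) /\
 spectral_flow (hdot E) (tN A) (ttau A) a b (fun t => perturb D0 (B t)) =
  (Ctilde p)^-1 * \int[leb]_(t in `[a, b]) integrand t.
move=> ab hB [cB [s ps hC]] ue integrand.
have /choice[T hT] : forall t, exists S : op E, a <= t <= b -> aN S /\ B t = opf S.
 move=> t; case: (boolP (a <= t <= b)) => ht; last by exists 0.
 by have [|S aS eS] := @sa_part_op (B t); [apply: hB; rewrite in_itv|exists S].
have aT t (ht : a <= t <= b) := (hT t ht).1; have BT t (ht : a <= t <= b) := (hT t ht).2.
have [f pf ->] := spectral_flow_value_of ab aT BT cB ue.
by have [h <-] := integrand_piecewise pf ps ab aT BT hC.
Qed.

End Words.

Theorem theorem9p3 (R : realType) (H : completeNormedModType R[i])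
    (dot : {dot H for Num.conj}) (dot_norm : forall x : H, `|x| ^+ 2 = dot x x)
    (N : set (H -> H)) (N_vN : von_neumann_algebra dot N)
    (N_predual : separable_predual dot N)
    (tau : (H -> H) -> \bar R) (tau_trace : faithful_normal_semifinite_trace dot N tau)
    (p : R) (p_gt0 : 0 < p)
    (D0 : unbounded_operator H) (D0_summable : summable_module dot N tau p D0) :
  [/\ (forall (D : unbounded_operator H) (X : H -> H),
         affine_space dot N D0 D -> self_adjoint_part dot N X ->
         trace_class dot N tau (X \o resolvent_power dot p D) /\
         trace dot N tau (X \o resolvent_power dot p D) \is Num.real),
      one_form dot N D0 (summable_form dot N tau p),
      exact dot N D0 (summable_form dot N tau p) &
      forall (a b : R) (A : R -> H -> H), a < b ->
        (forall t, t \in `[a, b] -> self_adjoint_part dot N (A t)) ->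
        piecewise_C1_path a b A ->
        let D (t : R) := perturb D0 (A t) in
        let integrand (t : R) :=
          complex.Re (trace dot N tau (op_derivative A t \o resolvent_power dot p (D t))) in
        unitarily_equivalent dot N (D a) (D b) ->
        lebesgue_measure.-integrable `[a, b] (EFin \o integrand) /\
        spectral_flow dot N tau a b D =
          (Ctilde p)^-1 * \int[lebesgue_measure]_(t in `[a, b]) integrand t].
Proof.
have [sD aD fin0] := D0_summable.
pose E : hilbert R := Hilbert dot_norm; pose A : tracial E := @Tracial R E N tau N_vN tau_trace.
have hp : (ttau A (opf (fc (specp (sD : usa (E := E) D0)) (fun l : R => (1 + l ^+ 2) `^ (- (p / 2)))%R)) < +oo)%E.
  have bw : bm (fun l : R => (1 + l ^+ 2) `^ (- (p / 2))) by apply: bm_powR; rewrite divr_ge0// ltW.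
  by move: fin0; rewrite /resolvent_power (fcalcE (E := E) sD bw).
split.
- by move=> D X; exact: (form_trace_class (A := A) aD p_gt0 hp).
- exact: (form_one_form (A := A) aD p_gt0 hp).
- exact: (form_exact (A := A) aD p_gt0 hp).
- by move=> a b B ab hB cB D integrand ue; exact: (form_path (A := A) aD p_gt0 hp ab hB cB ue).
Qed.
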